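(* Let $X_1,X_2,\ldots$ be iid complex-valued random variables with distribution $\mu$. Fix $s\in\mathbb{N}$ and distinct, deterministic values $\xi_1,\ldots,\xi_s\in\mathbb{C}$ with $\xi_1,\ldots,\xi_s\notin \mathrm{M}_\mu := \{z\in\mathbb{C}: m_\mu(z)=0\}$, and suppose that in a neighborhood of each $\xi_l$, $1\le l\le s$, $\mu$ has a bounded density $f$. Then, with probability $1-o(1)$ as $n\to\infty$, the polynomial $$p_n(z)=\prod_{l=1}^s(z-\xi_l)\prod_{j=1}^{n+1-s}(z-X_j)$$ has $s$ critical points $w_1^{(n)},\ldots,w_s^{(n)}$ such that for $1\le l\le s$, $w_l^{(n)}$ is the unique critical point of $p_n$ that is within a distance of $\frac{3}{|m_\mu(\xi_l)|n}$ of $\xi_l$, and $$\left|w_l^{(n)}-\xi_l+\frac{1}{n+1}\,\frac{n}{\sum_{j\ne l}\frac{1}{\xi_l-\xi_j}+\sum_{j=1}^{n+1-s}\frac{1}{\xi_l-X_j}}\right| = O_{\mu,\vec\xi}\left(\left(\frac{\log n}{n}\right)^2\right).$$ In addition, if $f$ is continuous at $\xi_1,\ldots,\xi_s$, then $$\left(\frac{n^{3/2}}{\sqrt{\log n}}\cdot m_\mu(\xi_l)^2\cdot\left(w_l^{(n)}-\xi_l+\frac{1}{n+1}\frac{1}{m_\mu(\xi_l)}\right)\right)_{l=1}^s\longrightarrow (N_1,\ldots,N_s)$$ in distribution as $n\to\infty$, where $(N_1,\ldots,N_s)$ is a vector of complex random variables such that $(\operatorname{Re}N_1,\operatorname{Im}N_1,\ldots,\operatorname{Re}N_s,\operatorname{Im}N_s)$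 has a (possibly degenerate) multivariate normal distribution with mean zero and covariances, for all $1\le j,l\le s$, $$\operatorname{Cov}(\operatorname{Re}N_j,\operatorname{Re}N_l)=\operatorname{Cov}(\operatorname{Im}N_j,\operatorname{Im}N_l)=\begin{cases}\frac{\pi f(\xi_j)}{2}& \text{if } l=j,\\ 0&\text{else,}\end{cases}\qquad \operatorname{Cov}(\operatorname{Re}N_j,\operatorname{Im}N_l)=0.$$
   Context: The Cauchy--Stieltjes transform of a probability measure $\mu$ on $\mathbb{C}$ is $m_\mu(z) := \int_{\mathbb{C}} \frac{d\mu(x)}{z-x}$, defined for those $z$ for which the integral exists. A measure $\mu$ has a density in a neighborhood of $z_0$ if there is $\rho>0$ so that the restriction of $\mu$ to the open ball $B(z_0,\rho)$ is absolutely continuous with respect to Lebesgue measure on $B(z_0,\rho)$. The notation $O_{\mu,\vec\xi}$ means that the implied constant depends only on $\mu$ and $\vec\xi=(\xi_1,\ldots,\xi_s)$. The variables $w_l^{(n)}$ are defined on an event of probability $1-o(1)$; their values off that event are immaterial for the convergence in distribution. *)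

(* Defs.v *)
From HB Require Import structures.
From mathcomp Require Import all_boot all_order all_algebra.
From mathcomp Require Import complex.
From mathcomp Require Import all_classical all_reals all_analysis.

Set Implicit Arguments.
Unset Strict Implicit.
Unset Printing Implicit Defensive.

Import Order.TTheory GRing.Theory Num.Theory.
Import numFieldNormedType.Exports.

Local Open Scope classical_set_scope.
Local Open Scope complex_scope.
Local Open Scope ring_scope.

(* Topology: the metric of the modulus, as for any numFieldType. *)
HB.instance Definition _ (R : realType) := PseudoPointedMetric.copy R[i] R[i]^o.

(* Borel sets and Lebesgue measure of C are those of R * R, transported along
   (x, y) |-> x + iy. *)
Definition complex_of_pair (R : Type) (p : R * R) : R[i] := p.1 +i* p.2.

Definition complex_measurable (R : realType) : set (set R[i]) :=
  [set A | measurable (@complex_of_pair R @^-1` A)].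

Lemma complex_measurable0 (R : realType) : complex_measurable (@set0 R[i]).
Proof. by rewrite /complex_measurable /= preimage_set0. Qed.

Lemma complex_measurableC (R : realType) (A : set R[i]) :
  complex_measurable A -> complex_measurable (~` A).
Proof. by rewrite /complex_measurable /= preimage_setC; exact: measurableC. Qed.

Lemma complex_measurable_bigcup (R : realType) (F : (set R[i])^nat) :
  (forall k, complex_measurable (F k)) -> complex_measurable (\bigcup_k F k).
Proof.
by rewrite /complex_measurable /= preimage_bigcup => mF;
  exact: bigcup_measurable.
Qed.

HB.instance Definition _ (R : realType) :=
  @isMeasurable.Build default_measure_display R[i] (@complex_measurable R)
    (@complex_measurable0 R) (@complex_measurableC R)
    (@complex_measurable_bigcup R).

Lemma measurable_complex_of_pair (R : realType) :
  measurable_fun [set: R * R] (@complex_of_pair R).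
Proof. by move=> _ A mA; rewrite setTI. Qed.

HB.instance Definition _ (R : realType) :=
  isMeasurableFun.Build _ _ (R * R)%type R[i] (@complex_of_pair R)
    (@measurable_complex_of_pair R).

Definition lebesgue_measureC (R : realType) : set R[i] -> \bar R :=
  pushforward (@lebesgue_measure R \x @lebesgue_measure R)%E
    (@complex_of_pair R).

Lemma lebesgue_measureC0 (R : realType) :
  lebesgue_measureC (@set0 R[i]) = 0%E.
Proof. by rewrite /lebesgue_measureC /pushforward preimage_set0 measure0. Qed.

Lemma lebesgue_measureC_ge0 (R : realType) (A : set R[i]) :
  (0 <= lebesgue_measureC A)%E.
Proof. by rewrite /lebesgue_measureC /pushforward; exact: measure_ge0. Qed.

Lemma lebesgue_measureC_sigma_additive (R : realType) :
  semi_sigma_additive (@lebesgue_measureC R).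
Proof.
move=> F mF tF mUF; rewrite /lebesgue_measureC /pushforward preimage_bigcup.
apply: measure_semi_sigma_additive => [n||]; first exact: mF.
- apply/trivIsetP => /= i j _ _ ij; rewrite -preimage_setI.
  by move/trivIsetP : tF => /(_ _ _ _ _ ij) -> //; rewrite preimage_set0.
- by rewrite -preimage_bigcup; exact: mUF.
Qed.

HB.instance Definition _ (R : realType) :=
  isMeasure.Build _ _ _ (@lebesgue_measureC R)
    (lebesgue_measureC0 R) (@lebesgue_measureC_ge0 R)
    (@lebesgue_measureC_sigma_additive R).

Section CauchyStieltjes.
Context (R : realType) (mu : probability R[i] R).

Definition cauchy_stieltjes (z : R[i]) : R[i] :=
  (\int[mu]_x complex.Re (z - x)^-1) +i* (\int[mu]_x complex.Im (z - x)^-1).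

(* The inverse is that of \bar R, where 0^-1 = +oo: the integral does not exist
   at an atom of mu. *)
Definition cauchy_stieltjes_exists (z : R[i]) : Prop :=
  (\int[mu]_x ((Normc.normc (z - x))%:E)^-1 < +oo)%E.

Definition cauchy_stieltjes_zeros : set R[i] :=
  [set z | cauchy_stieltjes_exists z /\ cauchy_stieltjes z = 0].

Definition bounded_density_near (f : R[i] -> R) (z0 : R[i]) : Prop :=
  exists2 rho : R, 0 < rho &
    let B := ball z0 rho%:C in
    [/\ measurable_fun B f,
        exists M : R, forall z, B z -> 0 <= f z <= M
      & forall A, measurable A -> A `<=` B ->
          mu A = (\int[@lebesgue_measureC R]_(z in A) (f z)%:E)%E].

End CauchyStieltjes.

Section Probability.
Context (R : realType) (d : measure_display) (T : measurableType d).
Variable P : probability T R.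

Definition iid d' (S : measurableType d') (X : nat -> {RV P >-> S})
    (mu : probability S R) : Prop :=
  (forall j A, measurable A -> distribution P (X j) A = mu A) /\
  (forall (J : seq nat) (A : nat -> set S), uniq J ->
    (forall j, measurable (A j)) ->
    P (\big[setI/setT]_(j <- J) (X j @^-1` A j)) =
    (\prod_(j <- J) P (X j @^-1` A j))%E).

Definition cvg_in_distribution (S : topologicalType) (V : nat -> T -> S)
    d' (T' : measurableType d') (P' : probability T' R) (W : T' -> S) : Prop :=
  forall g : S -> R, continuous g -> (exists M : R, forall x, `|g x| <= M) ->
    ('E_P[g \o V n] @[n --> \oo] --> 'E_P'[g \o W])%E.

(* normal_prob m s is only meaningful for s != 0; variance 0 is a Dirac mass. *)
Definition gaussian_variable (Y : T -> R) : Prop :=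
  (exists m s : R, s != 0 /\
    forall A, measurable A -> P (Y @^-1` A) = normal_prob m s A) \/
  (exists m : R, forall A, measurable A -> P (Y @^-1` A) = \d_m A).

Definition gaussian_vector (I : finType) (Y : I -> T -> R) : Prop :=
  forall c : I -> R, gaussian_variable (fun t => \sum_i c i * Y i t).

(* (Re N_1, Im N_1, ..., Re N_s, Im N_s), with true indexing imaginary parts *)
Definition real_coordinates (s : nat) (N : 'I_s -> T -> R[i])
    (k : 'I_s * bool) (t : T) : R :=
  if k.2 then complex.Im (N k.1 t) else complex.Re (N k.1 t).

End Probability.

Definition rooted_poly (R : realType) (s : nat) (xi : 'I_s -> R[i])
    (x : nat -> R[i]) (n : nat) : {poly R[i]} :=
  \prod_(l < s) ('X - (xi l)%:P) * \prod_(j < n.+1 - s) ('X - (x j)%:P).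

(* Main.v *)
(* The critical points of p = (X - xi) * \prod_(a <- A) (X - a) near xi are the
   fixed points of z |-> xi - 1 / G z, where G z = \sum_(a <- A) 1 / (z - a).
   Let the other roots stay at distance of order at least
   e = 1 / (sqrt n * (log n)^(1/4)) from xi, let \sum 1 / |xi - X_j|^2 be at most
   n (log n)^2, and let G xi be n m(xi) up to sqrt n (log n)^(3/2).  Then this map
   is a contraction of the disc of radius 3 / (|m(xi)| n), and its fixed point is
   xi - 1 / G xi up to O((log n / n)^2).  By Markov's inequality these three
   conditions fail with probability O(1 / sqrt (log n)), because a bounded density
   makes mu (B(xi, e)) = O(e^2), the truncation at e changes m(xi) by O(e), and
   the truncated second moment of 1 / (xi - x) is of order log (1 / e).

   To first order the fluctuation of the critical point is the centered sum of
   the truncated 1 / (xi - X_j), divided by sqrt (n log n).  If the density f is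
   continuous at xi, the truncated second moment of Re (c / (xi - x)) is
   asymptotic to |c|^2 pi f(xi) log (1 / e), where log (1 / e) ~ (log n) / 2; the
   mixed moments at two points xi stay bounded.  As a summand is at most
   1 / e = o(sqrt (n log n)), a second order expansion of the characteristic
   function gives the normal limit, which is independent across the xi. *)

(* The obstacle is that |1 / (xi - x)|^2 just fails to be integrable against a bounded density: its
   integral truncated at level e may grow like log (1 / e). Hence the scale sqrt (n log n) and the
   need to truncate. The level e meets two opposite demands: n e^2 -> 0, so that with high
   probability truncation changes no summand, and e sqrt (n log n) -> oo, so that no single summand
   is visible in the limit.

   Distances near xi are measured in the maximum norm, so that Tonelli's theorem and a linear
   substitution replace polar coordinates. The critical points are random variables because they are
   limits of iterates that are rational in the sample. Convergence of characteristic functions is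
   turned into convergence in distribution by Bernstein polynomials in sines of the coordinates,
   whose expectations are combinations of characteristic functions. The characteristic function of
   the normal law comes from its functional equation. One constant, depending only on mu and the
   points xi, is fixed before the sample space, which makes the error bound uniform. *)
From HB Require Import structures.
From mathcomp Require Import all_boot all_order all_algebra.
From mathcomp Require Import complex.
From mathcomp Require Import all_classical all_reals all_analysis.
From mathcomp Require Import measurable_realfun ring lra.
Require Import Defs.

Set Implicit Arguments.
Unset Strict Implicit.
Unset Printing Implicit Defensive.

Import Order.TTheory GRing.Theory Num.Theory.
Import numFieldNormedType.Exports.

Local Open Scope classical_set_scope.
Local Open Scope complex_scope.
Local Open Scope ring_scope.

(** * Measurability and bounded expectations *)

Section ComplexMeasurable.
Context (R : realType) (d : measure_display) (T : measurableType d).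
Implicit Types f g : T -> R[i].

Lemma measurable_Re : measurable_fun [set: R[i]] (@complex.Re R).
Proof.
move=> _ A mA; rewrite setTI.
change (measurable ((fun p : R * R => p.1) @^-1` A)).
by rewrite -[X in measurable X]setTI; exact: measurable_fst.
Qed.

Lemma measurable_Im : measurable_fun [set: R[i]] (@complex.Im R).
Proof.
move=> _ A mA; rewrite setTI.
change (measurable ((fun p : R * R => p.2) @^-1` A)).
by rewrite -[X in measurable X]setTI; exact: measurable_snd.
Qed.

Lemma measurable_complexP f :
  measurable_fun setT f <->
  measurable_fun setT (fun t => complex.Re (f t)) /\
  measurable_fun setT (fun t => complex.Im (f t)).
Proof.
split=> [mf|[mRe mIm]].
  by split; [exact: (measurableT_comp measurable_Re) |
             exact: (measurableT_comp measurable_Im)].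
rewrite (_ : f = @complex_of_pair R \o
    (fun t => (complex.Re (f t), complex.Im (f t)))).
  apply: measurableT_comp; first exact: measurable_complex_of_pair.
  exact: measurable_fun_pair.
by apply/funext => t /=; rewrite /complex_of_pair /=; case: (f t).
Qed.

Lemma measurable_complexD f g : measurable_fun setT f -> measurable_fun setT g ->
  measurable_fun setT (fun t => f t + g t).
Proof.
move=> /measurable_complexP[fr fi] /measurable_complexP[gr gi].
apply/measurable_complexP; split.
- rewrite (_ : (fun t => _) = (fun t => complex.Re (f t)) \+ (fun t => complex.Re (g t))).
    exact: measurable_funD.
  by apply/funext => t /=; case: (f t) (g t) => ? ? [].
- rewrite (_ : (fun t => _) = (fun t => complex.Im (f t)) \+ (fun t => complex.Im (g t))).
    exact: measurable_funD.
  by apply/funext => t /=; case: (f t) (g t) => ? ? [].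
Qed.

Lemma measurable_complexN f : measurable_fun setT f ->
  measurable_fun setT (fun t => - f t).
Proof.
move=> /measurable_complexP[fr fi]; apply/measurable_complexP; split.
- rewrite (_ : (fun t => _) = \- (fun t => complex.Re (f t))).
    exact: measurable_funN.
  by apply/funext => t /=; case: (f t).
- rewrite (_ : (fun t => _) = \- (fun t => complex.Im (f t))).
    exact: measurable_funN.
  by apply/funext => t /=; case: (f t).
Qed.

Lemma measurable_complexB f g : measurable_fun setT f -> measurable_fun setT g ->
  measurable_fun setT (fun t => f t - g t).
Proof. by move=> mf mg; apply: measurable_complexD => //; exact: measurable_complexN. Qed.

(** Inversion is written as the power [-1], with which it agrees on the nonnegative reals; at 0 both
    sides are 0. *)
Lemma measurable_fun_invr_ge0 (h : T -> R) : (forall t, 0 <= h t) ->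
  measurable_fun setT h -> measurable_fun setT (fun t => (h t)^-1).
Proof.
move=> h0 mh; rewrite (_ : (fun t => _) = (@powR R ^~ (-1)) \o h).
  by apply: measurableT_comp => //; exact: measurable_powR.
by apply/funext => t /=; rewrite powR_inv1.
Qed.

Lemma measurable_complexV f : measurable_fun setT f ->
  measurable_fun setT (fun t => (f t)^-1).
Proof.
move=> /measurable_complexP[fr fi].
have m2 : measurable_fun setT
    (fun t => (complex.Re (f t) ^+ 2 + complex.Im (f t) ^+ 2)^-1).
  apply: measurable_fun_invr_ge0 => [t|]; first by rewrite addr_ge0// sqr_ge0.
  by apply: measurable_funD; exact: measurable_funX.
apply/measurable_complexP; split.
- rewrite (_ : (fun t => _) = (fun t => complex.Re (f t)) \*
      (fun t => (complex.Re (f t) ^+ 2 + complex.Im (f t) ^+ 2)^-1)).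
    exact: measurable_funM.
  by apply/funext => t /=; case: (f t).
- rewrite (_ : (fun t => _) = \- ((fun t => complex.Im (f t)) \*
      (fun t => (complex.Re (f t) ^+ 2 + complex.Im (f t) ^+ 2)^-1))).
    by apply: measurable_funN; exact: measurable_funM.
  by apply/funext => t /=; case: (f t).
Qed.

Lemma measurable_complex_sum (I : Type) (s : seq I) (F : I -> T -> R[i]) :
  (forall i, measurable_fun setT (F i)) ->
  measurable_fun setT (fun t => \sum_(i <- s) F i t).
Proof.
move=> mF; elim: s => [|i s ih].
  rewrite (_ : (fun t => _) = cst 0); first exact: measurable_cst.
  by apply/funext => t; rewrite big_nil.
rewrite (_ : (fun t => _) = (fun t => F i t + \sum_(j <- s) F j t)).
  exact: measurable_complexD.
by apply/funext => t; rewrite big_cons.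
Qed.

Lemma measurable_normc f : measurable_fun setT f ->
  measurable_fun setT (fun t => Normc.normc (f t)).
Proof.
move=> /measurable_complexP[fr fi].
rewrite (_ : (fun t => _) = Num.sqrt \o
    (fun t => complex.Re (f t) ^+ 2 + complex.Im (f t) ^+ 2)).
  apply: measurableT_comp; first by apply: continuous_measurable_fun; exact: sqrt_continuous.
  by apply: measurable_funD; exact: measurable_funX.
by apply/funext => t /=; case: (f t).
Qed.
End ComplexMeasurable.

Section BoundedMeasurable.
Context (R : realType) (d : measure_display) (T : measurableType d).
Implicit Types f g : T -> R.

(** Truncation makes the random sums of the argument bounded. Closing this class under algebraic
    operations settles the integrability conditions for linearity of expectation once and for
    all. *)
Definition bounded_mfun f :=
  measurable_fun setT f /\ exists M : R, forall t, `|f t| <= M.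

Lemma bounded_mfun_cst (c : R) : bounded_mfun (fun=> c).
Proof. by split; [exact: measurable_cst | exists `|c|]. Qed.

Lemma bounded_mfunN f : bounded_mfun f -> bounded_mfun (fun t => - f t).
Proof.
move=> [mf [M hM]]; split; first exact: measurable_funN.
by exists M => t; rewrite normrN.
Qed.

Lemma bounded_mfunD f g : bounded_mfun f -> bounded_mfun g ->
  bounded_mfun (fun t => f t + g t).
Proof.
move=> [mf [M hM]] [mg [K hK]]; split; first exact: measurable_funD.
by exists (M + K) => t; rewrite (le_trans (ler_normD _ _))// lerD.
Qed.

Lemma bounded_mfunB f g : bounded_mfun f -> bounded_mfun g ->
  bounded_mfun (fun t => f t - g t).
Proof. by move=> bf bg; apply: bounded_mfunD => //; exact: bounded_mfunN. Qed.

Lemma bounded_mfunM f g : bounded_mfun f -> bounded_mfun g ->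
  bounded_mfun (fun t => f t * g t).
Proof.
move=> [mf [M hM]] [mg [K hK]]; split; first exact: measurable_funM.
by exists (M * K) => t; rewrite normrM ler_pM.
Qed.

Lemma bounded_mfunZ (c : R) f : bounded_mfun f -> bounded_mfun (fun t => c * f t).
Proof. by apply: bounded_mfunM; exact: bounded_mfun_cst. Qed.

Lemma bounded_mfunX f k : bounded_mfun f -> bounded_mfun (fun t => f t ^+ k).
Proof.
move=> bf; elim: k => [|k ih]; first exact: (bounded_mfun_cst 1).
rewrite (_ : (fun t => _) = (fun t => f t * f t ^+ k)); first exact: bounded_mfunM.
by apply/funext => t; rewrite exprS.
Qed.

Lemma bounded_mfun_sum (I : Type) (s : seq I) (F : I -> T -> R) :
  (forall i, bounded_mfun (F i)) -> bounded_mfun (fun t => \sum_(i <- s) F i t).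
Proof.
move=> bF; elim: s => [|i s ih].
  rewrite (_ : (fun t => _) = (fun=> 0)); first exact: bounded_mfun_cst.
  by apply/funext => t; rewrite big_nil.
rewrite (_ : (fun t => _) = (fun t => F i t + \sum_(j <- s) F j t)).
  exact: bounded_mfunD.
by apply/funext => t; rewrite big_cons.
Qed.

Lemma bounded_mfun_norm f : bounded_mfun f -> bounded_mfun (fun t => `|f t|).
Proof.
move=> [mf [M hM]]; split.
  by apply: measurableT_comp => //; exact: normr_measurable.
by exists M => t; rewrite normr_id.
Qed.

Lemma bounded_mfun_indic (A : set T) : measurable A -> bounded_mfun (\1_A).
Proof.
move=> mA; split; first exact: measurable_indic.
exists 1 => t; rewrite indicE; case: (t \in A); by rewrite ?normr1 ?normr0 ?ler01.
Qed.

Lemma measurable_cos_comp f : measurable_fun setT f ->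
  measurable_fun setT (fun t => cos (f t)).
Proof.
by move=> mf; apply: (measurableT_comp _ mf); apply: continuous_measurable_fun; exact: continuous_cos.
Qed.

Lemma measurable_sin_comp f : measurable_fun setT f ->
  measurable_fun setT (fun t => sin (f t)).
Proof.
by move=> mf; apply: (measurableT_comp _ mf); apply: continuous_measurable_fun; exact: continuous_sin.
Qed.

Lemma bounded_mfun_cos f : measurable_fun setT f -> bounded_mfun (fun t => cos (f t)).
Proof.
move=> mf; split; first exact: measurable_cos_comp.
by exists 1 => t; rewrite ler_norml cos_geN1 cos_le1.
Qed.

Lemma bounded_mfun_sin f : measurable_fun setT f -> bounded_mfun (fun t => sin (f t)).
Proof.
move=> mf; split; first exact: measurable_sin_comp.
by exists 1 => t; rewrite ler_norml sin_geN1 sin_le1.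
Qed.
End BoundedMeasurable.

Section BoundedExpectation.
Context (R : realType) (d : measure_display) (T : measurableType d).
Variable P : probability T R.
Implicit Types f g : T -> R.

Lemma bounded_mfun_integrable f : bounded_mfun f -> P.-integrable setT (EFin \o f).
Proof.
move=> [mf [M hM]]; apply: measurable_bounded_integrable => //.
  by rewrite (le_lt_trans (probability_le1 P measurableT))// ltry.
exists M; split; first by rewrite num_real.
by move=> K MK t _ /=; rewrite (le_trans (hM t))// ltW.
Qed.

Lemma integrable_RD f g : P.-integrable setT (EFin \o f) ->
  P.-integrable setT (EFin \o g) -> P.-integrable setT (EFin \o (fun t => f t + g t)).
Proof. by move=> fi gi; exact: (integrableD measurableT fi gi). Qed.

Lemma integrable_RZ (k : R) f : P.-integrable setT (EFin \o f) ->
  P.-integrable setT (EFin \o (fun t => k * f t)).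
Proof. by move=> fi; exact: (integrableZl measurableT k fi). Qed.

Lemma integrable_RB f g : P.-integrable setT (EFin \o f) ->
  P.-integrable setT (EFin \o g) -> P.-integrable setT (EFin \o (fun t => f t - g t)).
Proof. by move=> fi gi; exact: (integrableB measurableT fi gi). Qed.

Lemma integrable_Rcst (k : R) : P.-integrable setT (EFin \o (fun=> k)).
Proof. by apply: bounded_mfun_integrable; exact: bounded_mfun_cst. Qed.

Lemma Rexpectation_cst (c : R) : \int[P]_t c = c.
Proof. by rewrite /Rintegral integral_cst// [X in (_ * X)%E](@probability_setT _ _ _ P) mule1. Qed.

Lemma Rexpectation_sum (I : Type) (s : seq I) (F : I -> T -> R) :
  (forall i, bounded_mfun (F i)) ->
  \int[P]_t (\sum_(i <- s) F i t) = \sum_(i <- s) \int[P]_t F i t.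
Proof.
move=> bF; elim: s => [|i s ih].
  by under eq_Rintegral do rewrite big_nil; rewrite Rexpectation_cst big_nil.
under eq_Rintegral do rewrite big_cons.
rewrite RintegralD//; first by rewrite ih big_cons.
  exact: bounded_mfun_integrable.
by apply: bounded_mfun_integrable; exact: bounded_mfun_sum.
Qed.

Lemma RexpectationD f g : bounded_mfun f -> bounded_mfun g ->
  \int[P]_t (f t + g t) = \int[P]_t f t + \int[P]_t g t.
Proof. by move=> bf bg; rewrite RintegralD//; exact: bounded_mfun_integrable. Qed.

Lemma RexpectationB f g : bounded_mfun f -> bounded_mfun g ->
  \int[P]_t (f t - g t) = \int[P]_t f t - \int[P]_t g t.
Proof. by move=> bf bg; rewrite RintegralB//; exact: bounded_mfun_integrable. Qed.

Lemma RexpectationZ (c : R) f : bounded_mfun f ->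
  \int[P]_t (c * f t) = c * \int[P]_t f t.
Proof. by move=> bf; rewrite RintegralZl//; exact: bounded_mfun_integrable. Qed.

Lemma le_Rexpectation f g : bounded_mfun f -> bounded_mfun g ->
  (forall t, f t <= g t) -> \int[P]_t f t <= \int[P]_t g t.
Proof.
move=> bf bg fg; apply: le_Rintegral => //; exact: bounded_mfun_integrable.
Qed.

Lemma normr_Rexpectation_le f g : bounded_mfun f -> bounded_mfun g ->
  (forall t, `|f t| <= g t) -> `|\int[P]_t f t| <= \int[P]_t g t.
Proof.
move=> bf bg fg; rewrite (le_trans (le_normr_Rintegral _ _))//.
  exact: bounded_mfun_integrable.
by apply: le_Rexpectation => //; exact: bounded_mfun_norm.
Qed.

Lemma normr_Rexpectation_le_cst f M : bounded_mfun f ->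
  (forall t, `|f t| <= M) -> `|\int[P]_t f t| <= M.
Proof.
move=> bf fM; rewrite -[leRHS]Rexpectation_cst.
by apply: normr_Rexpectation_le => //; exact: bounded_mfun_cst.
Qed.

Lemma Rexpectation_indic (A : set T) : measurable A -> \int[P]_t \1_A t = fine (P A).
Proof. by move=> mA; rewrite /Rintegral integral_indic// setIT. Qed.

Lemma expectation_bounded_mfun f : bounded_mfun f ->
  ('E_P[f] = (\int[P]_t f t)%:E)%E.
Proof.
move=> bf; rewrite unlock /Rintegral fineK//.
by apply: integrable_fin_num => //; exact: bounded_mfun_integrable.
Qed.
End BoundedExpectation.

(** * Independence *)

Section Independence.
Context (R : realType) (d d' : measure_display).
Context (T : measurableType d) (S : measurableType d').
Variables (P : probability T R) (mu : probability S R).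
Variable X : nat -> {RV P >-> S}.
Hypothesis iidX : iid X mu.
Implicit Types (W : T -> R) (phi psi : S -> R).

Lemma bounded_mfun_RV j phi : bounded_mfun phi -> bounded_mfun (fun t => phi (X j t)).
Proof.
move=> [mphi [M hM]]; split; first exact: (measurableT_comp mphi).
by exists M.
Qed.

Lemma Rexpectation_RV j phi : bounded_mfun phi ->
  \int[P]_t phi (X j t) = \int[mu]_x phi x.
Proof.
move=> bphi; rewrite /Rintegral; congr fine.
have mphi : measurable_fun setT (EFin \o phi) by apply/measurable_EFinP; exact: bphi.1.
rewrite -[LHS](@integral_distribution _ _ _ _ _ P (X j) (EFin \o phi))//.
  by apply: eq_measure_integral => A mA _; exact: (iidX.1 j A mA).
exact: (bounded_mfun_integrable P (bounded_mfun_RV j bphi)).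
Qed.

Definition cylinder (A : nat -> set S) (J : seq nat) : set T :=
  \big[setI/setT]_(j <- J) (X j @^-1` A j).

Lemma measurable_cylinder A J : (forall j, measurable (A j)) ->
  measurable (cylinder A J).
Proof.
move=> mA; rewrite /cylinder; elim: J => [|j J ih]; first by rewrite big_nil.
rewrite big_cons; apply: measurableI => //.
by rewrite -[X in measurable X]setTI; exact: (measurable_funPT (X j)).
Qed.

(** Independence of [W] from the coordinates of index at least [k], tested on cylinder sets instead
    of generated sigma-algebras. In this form it follows from [iid] for constants and passes from
    [k] to [k.+1] when [W] is multiplied by a function of [X k]. *)
Definition indep_from k W := bounded_mfun W /\
  forall (J : seq nat) (A : nat -> set S), uniq J -> (forall j, j \in J -> (k <= j)%N) ->
    (forall j, measurable (A j)) ->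
    \int[P]_t (W t * \1_(cylinder A J) t) =
    (\int[P]_t W t) * \prod_(j <- J) fine (mu (A j)).

Lemma indep_from_cst (c : R) : indep_from 0 (fun=> c).
Proof.
split=> [|J A uJ _ mA]; first exact: bounded_mfun_cst.
have mC := measurable_cylinder J mA.
rewrite RexpectationZ; last exact: bounded_mfun_indic.
rewrite Rexpectation_indic// Rexpectation_cst; congr (_ * _).
rewrite (iidX.2 J A uJ mA); elim: J {uJ mC} => [|j J ih]; first by rewrite !big_nil.
have fP i : P (X i @^-1` A i) = mu (A i) by exact: (iidX.1 i _ (mA i)).
rewrite !big_cons fineM; first by rewrite ih fP.
  by rewrite fP; exact: fin_num_measure.
elim: J {ih} => [|i J ih]; first by rewrite big_nil.
by rewrite big_cons fin_numM// fP; exact: fin_num_measure.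
Qed.

Lemma indep_fromD k W V : indep_from k W -> indep_from k V ->
  indep_from k (fun t => W t + V t).
Proof.
move=> [bW hW] [bV hV]; split=> [|J A uJ kJ mA]; first exact: bounded_mfunD.
have b1 := bounded_mfun_indic R (measurable_cylinder J mA).
under eq_Rintegral do rewrite mulrDl.
by rewrite !RexpectationD ?hW ?hV ?mulrDl//; exact: bounded_mfunM.
Qed.

Lemma indep_fromZ k W (c : R) : indep_from k W -> indep_from k (fun t => c * W t).
Proof.
move=> [bW hW]; split=> [|J A uJ kJ mA]; first exact: bounded_mfunZ.
have b1 := bounded_mfun_indic R (measurable_cylinder J mA).
under eq_Rintegral do rewrite -mulrA.
by rewrite !RexpectationZ ?hW ?mulrA//; exact: bounded_mfunM.
Qed.

Lemma indep_fromS k W : indep_from k W -> indep_from k.+1 W.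
Proof.
move=> [bW hW]; split=> // J A uJ kJ mA; apply: hW => // j jJ.
by rewrite ltnW// kJ.
Qed.

(** For [phi] between 0 and 1 this is the integer part of (m + 1) phi divided by m + 1, written as a
    sum of indicators so that linearity reaches it. *)
Definition staircase phi (m : nat) (x : S) : R :=
  m.+1%:R^-1 * \sum_(i < m.+1) \1_[set x | i.+1%:R <= m.+1%:R * phi x] x.

Lemma staircase_dist phi m x : 0 <= phi x <= 1 ->
  `|phi x - staircase phi m x| <= m.+1%:R^-1.
Proof.
move=> /andP[p0 p1].
have m0 : (0 : R) < m.+1%:R by rewrite ltr0n.
rewrite /staircase; set y := m.+1%:R * phi x.
have y0 : 0 <= y by rewrite mulr_ge0// ltW.
have ym : y <= m.+1%:R by rewrite ler_piMr// ltW.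
pose c k : R := \sum_(i < k) \1_[set x | i.+1%:R <= m.+1%:R * phi x] x.
have cS k : c k.+1 = c k + ((k.+1%:R : R) <= y)%R%:R.
  rewrite /c big_ord_recr/= indicE; congr (_ + _%:R).
  by congr nat_of_bool; apply/idP/idP => [/set_mem//|h]; exact: mem_set.
(* Either the count has stopped within 1 of [y], or every threshold up to [k] was passed. *)
have cP k : c k <= y /\ (y <= c k + 1 /\ c k <= k%:R \/ c k = k%:R).
  elim: k => [|k [cy ih]]; first by rewrite /c big_ord0; split => //; right.
  rewrite cS; case: (lerP (k.+1%:R : R) y) => ky; rewrite ?addr0.
    have ck : c k = k%:R.
      case: ih => // -[h1 h2]; move: ky; rewrite -[k.+1%:R]natr1 => ky.
      by apply/eqP; rewrite eq_le h2/=; lra.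
    by rewrite ck natr1; split => //; right.
  split => //; left; move: ky; rewrite -[k.+1%:R]natr1 => ky.
  by case: ih => [[? ?]|->]; split => //; lra.
have [cy ch] := cP m.+1.
have {}ch : y <= c m.+1 + 1 by case: ch => [[]//|->]; lra.
have -> : phi x - m.+1%:R^-1 * c m.+1 = m.+1%:R^-1 * (y - c m.+1).
  by rewrite mulrBr /y mulKf// gt_eqF.
rewrite normrM gtr0_norm ?invr_gt0// ler_piMr ?invr_ge0 ?(ltW m0)//.
by rewrite ger0_norm; lra.
Qed.

Lemma bounded_mfun_staircase phi m : measurable_fun setT phi ->
  bounded_mfun (staircase phi m).
Proof.
move=> mphi; apply: bounded_mfunZ; apply: bounded_mfun_sum => i.
apply: bounded_mfun_indic; rewrite -[X in measurable X]setTI.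
exact: (measurable_fun_ler (measurable_cst _) (measurable_funM (measurable_cst _) mphi)).
Qed.

Section MulStep.
Variables (k : nat) (W : T -> R).
Hypothesis hW : indep_from k W.

(** The product rule for one more factor [phi (X k)], extended from indicators to their
    combinations, to [0, 1]-valued functions by uniform approximation, and to bounded functions by
    an affine change. The cylinder of later coordinates is kept so that the outcome is again of the
    form [indep_from]. *)
Let mul_ok phi := bounded_mfun phi /\
  forall (J : seq nat) (A : nat -> set S), uniq J ->
    (forall j, j \in J -> (k < j)%N) -> (forall j, measurable (A j)) ->
    \int[P]_t (W t * phi (X k t) * \1_(cylinder A J) t) =
    (\int[P]_t W t) * (\int[mu]_x phi x) * \prod_(j <- J) fine (mu (A j)).

Let mul_ok_indic B : measurable B -> mul_ok (\1_B).
Proof.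
move=> mB; split=> [|J A uJ kJ mA]; first exact: bounded_mfun_indic.
have kJ' : k \notin J by apply/negP => /kJ; rewrite ltnn.
(* Placing [B] at the fresh index [k] turns the indicator in [X k] into one more factor of the
   cylinder. *)
pose A' j := if j == k then B else A j.
have mA' j : measurable (A' j) by rewrite /A'; case: ifP.
have eA' j : j \in J -> A' j = A j.
  by rewrite /A'; case: eqP => // -> kJ''; rewrite kJ'' in kJ'.
have h1 : cylinder A' (k :: J) = X k @^-1` B `&` cylinder A J.
  rewrite /cylinder big_cons {1}/A' eqxx; congr (_ `&` _).
  by apply: eq_big_seq => j /eA' ->.
have -> : \int[P]_t (W t * \1_B (X k t) * \1_(cylinder A J) t) =
    \int[P]_t (W t * \1_(cylinder A' (k :: J)) t).
  apply: eq_Rintegral => t _; rewrite h1 -mulrA; congr (_ * _).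
  by rewrite indicI.
rewrite hW.2//=.
- rewrite big_cons {1}/A' eqxx mulrA; congr (_ * _ * _).
    by rewrite Rexpectation_indic.
  by apply: eq_big_seq => j /eA' ->.
- by rewrite kJ'.
- by move=> j; rewrite inE => /predU1P[->//|/kJ/ltnW].
Qed.

Let mul_ok_sum (I : Type) (s : seq I) (F : I -> S -> R) :
  (forall i, mul_ok (F i)) -> mul_ok (fun x => \sum_(i <- s) F i x).
Proof.
move=> hF; split=> [|J A uJ kJ mA]; first by apply: bounded_mfun_sum => i; exact: (hF i).1.
have bC := bounded_mfun_indic R (measurable_cylinder J mA).
under eq_Rintegral do rewrite mulr_sumr mulr_suml.
rewrite !Rexpectation_sum => [|i|i]; last 2 first.
- by apply: bounded_mfunM => //; apply: bounded_mfunM; [exact: hW.1|apply: bounded_mfun_RV; exact: (hF i).1].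
- exact: (hF i).1.
rewrite mulr_sumr mulr_suml; apply: eq_bigr => i _.
by rewrite (hF i).2.
Qed.

Let mul_okZ (c : R) phi : mul_ok phi -> mul_ok (fun x => c * phi x).
Proof.
move=> [bphi h]; split=> [|J A uJ kJ mA]; first exact: bounded_mfunZ.
have bC := bounded_mfun_indic R (measurable_cylinder J mA).
have -> : \int[P]_t (W t * (c * phi (X k t)) * \1_(cylinder A J) t) =
    \int[P]_t (c * (W t * phi (X k t) * \1_(cylinder A J) t)).
  by apply: eq_Rintegral => t _; rewrite mulrCA !mulrA.
rewrite RexpectationZ; last first.
  by apply: bounded_mfunM => //; apply: bounded_mfunM; [exact: hW.1|exact: bounded_mfun_RV].
by rewrite RexpectationZ// h//; ring.
Qed.

Let mul_ok_staircase phi m : measurable_fun setT phi -> mul_ok (staircase phi m).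
Proof.
move=> mphi; apply: mul_okZ; apply: mul_ok_sum => i; apply: mul_ok_indic.
rewrite -[X in measurable X]setTI.
exact: (measurable_fun_ler (measurable_cst _) (measurable_funM (measurable_cst _) mphi)).
Qed.

Let mul_ok01 phi : measurable_fun setT phi -> (forall x, 0 <= phi x <= 1) -> mul_ok phi.
Proof.
move=> mphi phi01.
have bphi : bounded_mfun phi.
  split=> //; exists 1 => x; have /andP[? ?] := phi01 x.
  by rewrite ger0_norm.
split=> // J A uJ kJ mA.
have bC := bounded_mfun_indic R (measurable_cylinder J mA).
have [bW _] := hW; have [mW [M hM]] := bW.
have M0 : 0 <= M by apply: le_trans (hM point).
set p := \prod_(j <- J) _.
have /andP[p0 p1] : 0 <= p <= 1.
  rewrite /p; elim: (J) => [|j J' /andP[ih1 ih2]]; first by rewrite big_nil ler01 lexx.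
  rewrite big_cons; have f0 : 0 <= fine (mu (A j)) by exact: fine_ge0.
  have f1 : fine (mu (A j)) <= 1.
    by rewrite -[leRHS]/(fine 1) fine_le ?fin_num_measure//; exact: probability_le1.
  by rewrite mulr_ge0// mulr_ile1.
apply/eqP; rewrite -subr_eq0 -normr_le0; apply/ler_addgt0Pr => e e0; rewrite add0r.
(* Two replacement errors of at most M / (m + 1) each must add up to at most [e]. *)
pose m := Num.truncn ((2 * M + 1) / e).
have me : (2 * M) * m.+1%:R^-1 <= e.
  rewrite ler_pdivrMr ?ltr0n// [leRHS]mulrC -ler_pdivrMr//.
  rewrite (le_trans _ (ltW (truncnS_gt _)))//.
  by rewrite ler_pM2r ?invr_gt0//; lra.
apply: le_trans me.
have bs := bounded_mfun_staircase m mphi.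
have [_ /(_ J A uJ kJ mA)] := mul_ok_staircase m mphi.
rewrite -/p => hs.
have -> : \int[P]_t (W t * phi (X k t) * \1_(cylinder A J) t) -
    \int[P]_t W t * \int[mu]_x phi x * p =
    \int[P]_t (W t * (phi (X k t) - staircase phi m (X k t)) * \1_(cylinder A J) t) -
    \int[P]_t W t * \int[mu]_x (phi x - staircase phi m x) * p.
  rewrite RexpectationB//.
  under [X in _ = X - _]eq_Rintegral do rewrite mulrBr mulrBl.
  rewrite RexpectationB; last 2 first.
  - by apply: bounded_mfunM => //; apply: bounded_mfunM => //; exact: bounded_mfun_RV.
  - by apply: bounded_mfunM => //; apply: bounded_mfunM => //; exact: bounded_mfun_RV.
  by rewrite hs; ring.
have -> : 2 * M * m.+1%:R^-1 = M * m.+1%:R^-1 + M * m.+1%:R^-1 by ring.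
rewrite (le_trans (ler_normB _ _))// lerD//.
  apply: normr_Rexpectation_le_cst.
    apply: bounded_mfunM => //; apply: bounded_mfunM => //.
    by apply: bounded_mfunB; exact: bounded_mfun_RV.
  move=> t; rewrite 2!normrM -[leRHS]mulr1; apply: ler_pM => //.
    by apply: ler_pM => //; exact: staircase_dist.
  by rewrite indicE; case: (_ \in _); rewrite ?normr1 ?normr0.
rewrite 2!normrM -[leRHS]mulr1; apply: ler_pM => //.
  apply: ler_pM => //; first exact: normr_Rexpectation_le_cst.
  apply: normr_Rexpectation_le_cst; first exact: bounded_mfunB.
  by move=> x; exact: staircase_dist.
by rewrite ger0_norm.
Qed.

Let mul_ok_bounded phi : bounded_mfun phi -> mul_ok phi.
Proof.
move=> bphi; have [mphi [M hM]] := bphi.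
pose K := `|M| + 1.
have K0 : 0 < K by rewrite /K ltr_wpDl.
have hK x : `|phi x| <= K by rewrite (le_trans (hM x))// /K (le_trans (ler_norm M))// lerDl.
pose psi x := (2 * K)^-1 * (phi x + K).
have ok1 : mul_ok psi.
  apply: mul_ok01.
    by apply: measurable_funM => //; apply: measurable_funD.
  move=> x; have := hK x; rewrite ler_norml => /andP[? ?].
  rewrite /psi mulr_ge0 ?invr_ge0 ?mulr_ge0 ?(ltW K0)//=; last by lra.
  by rewrite mulrC ler_pdivrMr ?mulr_gt0//; lra.
have ok2 : mul_ok (fun=> 1).
  apply: mul_ok01; first exact: measurable_cst.
  by move=> _; rewrite ler01 lexx.
pose F (b : bool) : S -> R := if b then (fun x => (2 * K) * psi x) else (fun x => (- K) * 1).
have okF b : mul_ok (F b) by case: b; exact: mul_okZ.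
have -> : phi = (fun x => \sum_(b <- [:: true; false]) F b x).
  apply/funext => x; rewrite !big_cons big_nil addr0 /F /psi mulVKf ?mulr1 ?addrK//.
  by rewrite mulf_neq0// gt_eqF.
exact: mul_ok_sum.
Qed.

Lemma indep_from_mul phi : bounded_mfun phi ->
  \int[P]_t (W t * phi (X k t)) = (\int[P]_t W t) * \int[mu]_x phi x.
Proof.
move=> bphi; have [_ /(_ [::] (fun=> setT))] := mul_ok_bounded bphi.
rewrite big_nil mulr1 => <- //.
apply: eq_Rintegral => t _; rewrite /cylinder big_nil indicE.
by rewrite mem_set ?mulr1.
Qed.

Lemma indep_fromM phi : bounded_mfun phi ->
  indep_from k.+1 (fun t => W t * phi (X k t)).
Proof.
move=> bphi; split=> [|J A uJ kJ mA].
  by apply: bounded_mfunM; [exact: hW.1|exact: bounded_mfun_RV].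
by rewrite (mul_ok_bounded bphi).2// indep_from_mul.
Qed.
End MulStep.
End Independence.

(** * Critical points near an isolated root *)

Section ContractionAtRoot.
Context (R : realType).
Implicit Types (z w a : R[i]) (A : seq R[i]).
Local Notation N := (@Normc.normc R).

Lemma normc_ge0 z : 0 <= N z.
Proof. by case: z => x y; exact: sqrtr_ge0. Qed.

Lemma normc_real_complex z : `|z| = (N z)%:C.
Proof. by rewrite normc_def; case: z. Qed.

Lemma normc_eq0 z : (N z == 0) = (z == 0).
Proof.
apply/eqP/eqP => [/Normc.eq0_normc//|->].
by rewrite Normc.normc0.
Qed.

Lemma normc_gt0 z : (0 < N z) = (z != 0).
Proof. by rewrite lt_neqAle normc_ge0 andbT eq_sym normc_eq0. Qed.

Lemma normc_le_add z w : N (z + w) <= N z + N w.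
Proof. by rewrite -lecR rmorphD/= -!normc_real_complex ler_normD. Qed.

Lemma normc_opp z : N (- z) = N z.
Proof. by case: z => x y /=; rewrite !sqrrN. Qed.

Lemma normc_distC z w : N (z - w) = N (w - z).
Proof. by rewrite -normc_opp opprB. Qed.

Lemma normc_le_triangle w z a : N (z - a) <= N (z - w) + N (w - a).
Proof. by apply: le_trans (normc_le_add _ _); rewrite addrA subrK. Qed.

Lemma normc_le_sum (I : eqType) (s : seq I) (F : I -> R[i]) (b : I -> R) :
  (forall i, i \in s -> N (F i) <= b i) ->
  N (\sum_(i <- s) F i) <= \sum_(i <- s) b i.
Proof.
elim: s => [|i s ih] h; first by rewrite !big_nil Normc.normc0.
rewrite !big_cons (le_trans (normc_le_add _ _))// lerD//.
  by apply: h; rewrite mem_head.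
by apply: ih => j js; apply: h; rewrite inE js orbT.
Qed.

Lemma Re_le_normc z : `|complex.Re z| <= N z.
Proof. by case: z => x y /=; rewrite -sqrtr_sqr ler_wsqrtr// lerDl sqr_ge0. Qed.

Lemma Im_le_normc z : `|complex.Im z| <= N z.
Proof. by case: z => x y /=; rewrite -sqrtr_sqr ler_wsqrtr// lerDr sqr_ge0. Qed.

Lemma normc_le_ReIm z : N z <= `|complex.Re z| + `|complex.Im z|.
Proof.
rewrite [in N _](complex.complexE z) (le_trans (normc_le_add _ _))//.
rewrite lerD//.
  by rewrite /= expr0n addr0 sqrtr_sqr.
by rewrite Normc.normcM /= expr0n expr1n !addr0 add0r sqrtr1 mul1r sqrtr_sqr.
Qed.

Lemma ReB z w : complex.Re (z - w) = complex.Re z - complex.Re w.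
Proof. by case: z; case: w. Qed.

Lemma ImB z w : complex.Im (z - w) = complex.Im z - complex.Im w.
Proof. by case: z; case: w. Qed.

(** Subtracting the tail 2 c / 2^k from [u k] gives a nondecreasing sequence, since the tail drops
    by exactly c / 2^k at each step. This sequence is bounded above, and the tail tends to 0. *)
Lemma cvg_geometric_increments (u : nat -> R) (c : R) :
  (forall k, `|u k.+1 - u k| <= c / 2 ^+ k) -> cvgn u.
Proof.
move=> uc.
have c0 : 0 <= c by have := uc 0%N; rewrite expr0 divr1; exact/le_trans.
have tail : (fun k => 2 * c / 2 ^+ k) @ \oo --> (0 : R).
  rewrite [X in X @ _ --> _](_ : _ = geometric (2 * c) (2^-1)); last first.
    by apply/funext => k; rewrite /geometric /= exprVn.
  by apply: cvg_geometric; rewrite ger0_norm ?invr_ge0// invf_lt1// ltr1n.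
have tailP k : 2 * c / 2 ^+ k - 2 * c / 2 ^+ k.+1 = c / 2 ^+ k.
  by rewrite exprS; field; rewrite expf_neq0.
have vcvg : cvgn (fun k => u k - 2 * c / 2 ^+ k).
  apply: nondecreasing_is_cvgn.
    apply/nondecreasing_seqP => k; have := uc k; have := tailP k.
    by rewrite ler_norml => h /andP[? _]; lra.
  exists (u 0%N + 2 * c) => _ [k _ <-].
  have ub : u k + 2 * c / 2 ^+ k <= u 0%N + 2 * c.
    elim: k => [|k]; first by rewrite expr0 divr1.
    have := uc k; have := tailP k.
    by rewrite ler_norml => h /andP[_ ?]; lra.
  have : 0 <= 2 * c / 2 ^+ k by rewrite divr_ge0// ?exprn_ge0// mulr_ge0.
  by move=> ?; lra.
rewrite (_ : u = (fun k => u k - 2 * c / 2 ^+ k) \+ (fun k => 2 * c / 2 ^+ k)).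
  by apply: is_cvgD => //; apply/cvg_ex; exists 0.
by apply/funext => k /=; rewrite subrK.
Qed.

Definition log_deriv A z : R[i] := \sum_(a <- A) (z - a)^-1.

Lemma horner_prod_XsubC_deriv A z : z \notin A ->
  (\prod_(a <- A) ('X - a%:P))^`().[z] =
  (\prod_(a <- A) ('X - a%:P)).[z] * log_deriv A z.
Proof.
rewrite /log_deriv; elim: A => [|a A ih].
  by rewrite !big_nil derivC horner0 mulr0.
rewrite inE negb_or => /andP[za zA].
rewrite !big_cons derivM derivXsubC mul1r hornerD !hornerM ih// hornerXsubC.
set q := horner _ _; set l := \sum_(_ <- _) _.
by field; rewrite subr_eq0.
Qed.

(** Away from [A] the product over [A] does not vanish and can be divided out of the derivative. *)
Lemma root_deriv_XsubC_mul xi A z : z \notin A ->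
  root (('X - xi%:P) * \prod_(a <- A) ('X - a%:P))^`() z =
  (1 + (z - xi) * log_deriv A z == 0).
Proof.
move=> zA; rewrite rootE derivM derivXsubC mul1r hornerD hornerM.
rewrite horner_prod_XsubC_deriv// hornerXsubC.
set q := horner _ _.
rewrite (_ : _ + _ = q * (1 + (z - xi) * log_deriv A z)); last by ring.
rewrite mulf_eq0 [q == 0](_ : _ = false)//.
by apply/negbTE; rewrite -rootE root_prod_XsubC.
Qed.

(* Its fixed points are the critical points of (X - xi) * \prod_(a <- A) (X - a),
   where (z - xi)^-1 + log_deriv A z vanishes. *)
Definition crit_step xi A z : R[i] := xi - (log_deriv A z)^-1.

Section Contraction.
Context (xi : R[i]) (A : seq R[i]) (r B : R).
Hypothesis r0 : 0 < r.
Hypothesis Afar : forall a, a \in A -> 2 * r <= N (xi - a).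
Hypothesis AB : \sum_(a <- A) (N (xi - a)) ^- 2 <= B.
Hypothesis Gr : 3 / 2 <= N (log_deriv A xi) * r.
Hypothesis Br : 4 * B * r ^+ 2 <= 1 / 2.
Local Notation G := (log_deriv A).
Local Notation phi := (crit_step xi A).

Let B0 : 0 <= B.
Proof. by apply: le_trans AB; apply: sumr_ge0 => a _; rewrite invr_ge0 exprn_ge0// normc_ge0. Qed.

Let far z a : N (z - xi) <= r -> a \in A ->
  0 < N (xi - a) /\ N (xi - a) / 2 <= N (z - a).
Proof.
move=> zr aA; have := Afar aA; have := normc_le_triangle z xi a.
rewrite (normc_distC xi z) => t f; split.
  by apply: lt_le_trans f; rewrite mulr_gt0.
move: zr t f; move: (N (z - a)) (N (z - xi)) (N (xi - a)) => n1 n2 n3 zr t f.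
lra.
Qed.

Let notin z : N (z - xi) <= r -> z \notin A.
Proof.
move=> zr; apply/negP => zA; have [] := far zr zA.
by rewrite subrr Normc.normc0; lra.
Qed.

(** In the disc, |z - a| and |w - a| are at least half of |xi - a|, which costs a factor 4 in each
    term. *)
Lemma log_deriv_lipschitz z w : N (z - xi) <= r -> N (w - xi) <= r ->
  N (G z - G w) <= N (z - w) * (4 * B).
Proof.
move=> zr wr; rewrite /log_deriv -sumrB.
apply: (@le_trans _ _ (\sum_(a <- A) N (z - w) * 4 * N (xi - a) ^- 2)).
  apply: normc_le_sum => a aA.
  have [a0 za] := far zr aA; have [_ wa] := far wr aA.
  have nz : z - a != 0 by rewrite -normc_gt0; lra.
  have nw : w - a != 0 by rewrite -normc_gt0; lra.
  have -> : (z - a)^-1 - (w - a)^-1 = (w - z) / ((z - a) * (w - a)).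
    by field; rewrite nz nw.
  rewrite Normc.normcM Normc.normcV Normc.normcM (normc_distC w) -mulrA ler_wpM2l ?normc_ge0//.
  have -> : 4 * N (xi - a) ^- 2 = (N (xi - a) / 2 * (N (xi - a) / 2))^-1.
    by field; rewrite gt_eqF.
  rewrite lef_pV2 ?posrE; last 2 first.
  - by rewrite mulr_gt0//; lra.
  - by rewrite mulr_gt0//; lra.
  by apply: ler_pM => //; lra.
rewrite -mulr_sumr -mulrA ler_wpM2l ?normc_ge0// ler_wpM2l//.
Qed.

(** The lower bound 3 / 2 at the centre loses at most 4 B r^2 <= 1 / 2 inside the disc, so that |G
    z| r >= 1. This is what makes [phi] map the disc into itself. *)
Let Gge z : N (z - xi) <= r -> r^-1 <= N (G z).
Proof.
move=> zr; rewrite -[leLHS]mul1r ler_pdivrMr//.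
have xr : N (xi - xi) <= r by rewrite subrr Normc.normc0 ltW.
have := log_deriv_lipschitz xr zr.
have h1 : N (G xi) <= N (G z) + N (G xi - G z).
  by rewrite -{1}(subrK (G z) (G xi)) addrC normc_le_add.
rewrite [X in _ <= X * _]normc_distC => h2.
have h3 : N (z - xi) * (4 * B) <= r * (4 * B) by rewrite ler_wpM2r// mulr_ge0.
have h4 : N (G xi) <= N (G z) + r * (4 * B) by lra.
have : N (G xi) * r <= (N (G z) + r * (4 * B)) * r by rewrite ler_wpM2r// ltW.
move: Br Gr; nra.
Qed.

Let G0 z : N (z - xi) <= r -> 0 < N (G z).
Proof. by move=> /Gge; apply: lt_le_trans; rewrite invr_gt0. Qed.

Let VG z : N (z - xi) <= r -> (N (G z))^-1 <= r.
Proof.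
by move=> zr; rewrite -[leRHS]invrK lef_pV2 ?posrE ?invr_gt0 ?G0// Gge.
Qed.

Let phi_disc z : N (z - xi) <= r -> N (phi z - xi) <= r.
Proof. by move=> zr; rewrite /crit_step addrC addKr normc_opp Normc.normcV VG. Qed.

(** Each 1 / |G| is at most [r], which turns the Lipschitz bound for G into one for its inverse at
    the cost of r^2. *)
Let invG_lip z w : N (z - xi) <= r -> N (w - xi) <= r ->
  N ((G z)^-1 - (G w)^-1) <= N (z - w) * (4 * B * r ^+ 2).
Proof.
move=> zr wr.
have nz : G z != 0 by rewrite -normc_gt0 G0.
have nw : G w != 0 by rewrite -normc_gt0 G0.
have -> : (G z)^-1 - (G w)^-1 = (G w - G z) * ((G z)^-1 * (G w)^-1).
  by field; rewrite nz nw.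
rewrite 2!Normc.normcM !Normc.normcV normc_distC.
rewrite [leRHS]mulrA; apply: ler_pM; rewrite ?mulr_ge0 ?invr_ge0 ?normc_ge0//.
  exact: log_deriv_lipschitz.
rewrite expr2; by apply: ler_pM; rewrite ?invr_ge0 ?normc_ge0// VG.
Qed.

Let phi_contract z w : N (z - xi) <= r -> N (w - xi) <= r ->
  N (phi z - phi w) <= N (z - w) / 2.
Proof.
move=> zr wr.
have -> : phi z - phi w = (G w)^-1 - (G z)^-1 by rewrite /crit_step; ring.
rewrite normc_distC normc_distC (normc_distC z) (le_trans (invG_lip wr zr))// ler_wpM2l ?normc_ge0//.
by rewrite -div1r.
Qed.

Let crit_fix z : N (z - xi) <= r ->
  root (('X - xi%:P) * \prod_(a <- A) ('X - a%:P))^`() z <-> z = phi z.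
Proof.
move=> zr; rewrite root_deriv_XsubC_mul ?notin//.
have nz : G z != 0 by rewrite -normc_gt0 G0.
split=> [/eqP h|h]; last first.
  by apply/eqP; rewrite {1}h /crit_step; field.
apply: (mulIf nz); rewrite /crit_step mulrBl mulVf//.
by apply/eqP; rewrite -subr_eq0 -h; apply/eqP; ring.
Qed.

Local Notation it k := (iter k phi xi).

Let it_disc k : N (it k - xi) <= r.
Proof.
by elim: k => [|k ih] /=; [rewrite subrr Normc.normc0 ltW | exact: phi_disc].
Qed.

Let it_incr k : N (it k.+1 - it k) <= r / 2 ^+ k.
Proof.
elim: k => [|k ih]; first by rewrite expr0 divr1; exact: (it_disc 1).
apply: (le_trans (phi_contract (it_disc k.+1) (it_disc k))).
by rewrite ler_pdivrMr// (le_trans ih)// exprS invfM mulrA mulrAC divfK.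
Qed.

Let Re_incr k : `|complex.Re (it k.+1) - complex.Re (it k)| <= r / 2 ^+ k.
Proof. by rewrite -ReB (le_trans (Re_le_normc _)). Qed.

Let Im_incr k : `|complex.Im (it k.+1) - complex.Im (it k)| <= r / 2 ^+ k.
Proof. by rewrite -ImB (le_trans (Im_le_normc _)). Qed.

(** Banach's fixed point argument, run coordinate by coordinate. The convergence of the iterates is
    part of the conclusion because it later yields measurability in the sample. The last bound
    compares the fixed point with the first iterate xi - 1 / G xi. *)
Theorem crit_step_limit : exists w : R[i],
  [/\ complex.Re (it k) @[k --> \oo] --> complex.Re w,
      complex.Im (it k) @[k --> \oo] --> complex.Im w
    & [/\ N (w - xi) <= r,
          root (('X - xi%:P) * \prod_(a <- A) ('X - a%:P))^`() w,
          (forall z, root (('X - xi%:P) * \prod_(a <- A) ('X - a%:P))^`() z ->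
             N (z - xi) <= r -> z = w)
        & N (w - xi + (G xi)^-1) <= 4 * B * r ^+ 3]].
Proof.
have cRe := cvg_geometric_increments Re_incr.
have cIm := cvg_geometric_increments Im_incr.
set a := limn _ in cRe; set b := limn _ in cIm.
pose w := a +i* b; exists w.
have itw : N (it k - w) @[k --> \oo] --> (0 : R).
  apply: (@squeeze_cvgr _ _ _ _ (cst 0)
    (fun k => `|complex.Re (it k) - a| + `|complex.Im (it k) - b|)).
  - apply: nearW => k; rewrite normc_ge0/= (le_trans (normc_le_ReIm _))//.
    by rewrite ReB ImB.
  - exact: cvg_cst.
  - rewrite -[0]addr0 -(@normr0 _ R); apply: cvgD; apply: cvg_norm;
      by [rewrite -(subrr a); apply: cvgB => //; exact: cvg_cst |
          rewrite -(subrr b); apply: cvgB => //; exact: cvg_cst].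
have le_lim (v : R) (e : nat -> R) :
    e k @[k --> \oo] --> (0 : R) -> (forall k, v <= e k) -> v <= 0.
  by move=> e0 h; apply: (cvgr_to_ge e0); exact: nearW.
have wr : N (w - xi) <= r.
  rewrite -subr_le0; apply: (le_lim _ _ itw) => k.
  have := normc_le_triangle (it k) w xi; have := it_disc k.
  by rewrite (normc_distC w (it k)) => ? ?; lra.
have wphi : w = phi w.
  apply/eqP; rewrite -subr_eq0 -normc_eq0 eq_le normc_ge0 andbT.
  apply: (le_lim _ (fun k => N (it k.+1 - w) + N (it k - w) / 2)).
    rewrite -[0]addr0 -[X in _ + X](mul0r 2^-1); apply: cvgD.
      by rewrite (cvg_shiftS (fun k => N (it k - w))).
    by apply: cvgMl.
  move=> k; apply: (le_trans (normc_le_triangle (it k.+1) w _)).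
  by rewrite (normc_distC w) lerD2l/= phi_contract.
split=> //; split=> //.
- exact/crit_fix.
- move=> z /crit_fix zphi zr; have := phi_contract zr wr.
  rewrite -wphi -zphi// => h; apply/eqP; rewrite -subr_eq0 -normc_eq0.
  by rewrite eq_le normc_ge0 andbT; lra.
- rewrite {1}wphi /crit_step addrAC addrC addrA addrC.
  have xr : N (xi - xi) <= r by rewrite subrr Normc.normc0 ltW.
  have -> : (G xi)^-1 + (- xi + (xi - (G w)^-1)) = (G xi)^-1 - (G w)^-1 by ring.
  have -> : 4 * B * r ^+ 3 = r * (4 * B * r ^+ 2) by rewrite exprS; ring.
  apply: (le_trans (invG_lip xr wr)); rewrite normc_distC.
  by rewrite ler_wpM2r// !mulr_ge0// ltW.
Qed.
End Contraction.
End ContractionAtRoot.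

(** * Gaussian families *)

Section MeasureComparison.
Context (R : realType) (d : measure_display) (T : measurableType d).
Local Open Scope ereal_scope.

(** Both measures are replaced by their restrictions to [D], which satisfy the comparison on all
    measurable sets. *)
Lemma ge0_le_measure_subset_integral (m1 m2 : {measure set T -> \bar R}) (c : R)
    (D : set T) (g : T -> \bar R) :
  measurable D -> (0 <= c)%R ->
  (forall A, measurable A -> A `<=` D -> m1 A <= c%:E * m2 A) ->
  measurable_fun setT g -> (forall x, 0 <= g x) ->
  \int[m1]_(x in D) g x <= c%:E * \int[m2]_(x in D) g x.
Proof.
move=> mD c0 m12 mg g0.
rewrite (_ : \int[m1]_(x in D) g x = \int[mrestr m1 mD]_(x in D) g x); last first.
  by apply: eq_measure_integral => A mA AD; rewrite -[in LHS](setIidl AD).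
rewrite (_ : \int[m2]_(x in D) g x = \int[mrestr m2 mD]_(x in D) g x); last first.
  by apply: eq_measure_integral => A mA AD; rewrite -[in LHS](setIidl AD).
rewrite -(@ge0_integral_mscale _ _ _ (mrestr m2 mD) _ mD (NngNum c0))//.
  apply: ge0_le_measure_integral => // A mA.
  rewrite /mscale /= /mrestr; apply: m12; first exact: measurableI.
  exact: subIsetr.
exact: measurable_funTS.
Qed.

Import HBNNSimple.

(** The hypothesis is the case of indicators; simple functions follow by linearity and the general
    case by monotone convergence. *)
Lemma ge0_integral_density (m1 m2 : {measure set T -> \bar R}) (h : T -> R) (g : T -> \bar R) :
  measurable_fun setT h -> (forall x, 0 <= h x)%R ->
  (forall A, measurable A -> m1 A = \int[m2]_(x in A) (h x)%:E) ->
  measurable_fun setT g -> (forall x, 0 <= g x) ->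
  \int[m1]_x g x = \int[m2]_x (g x * (h x)%:E).
Proof.
move=> /measurable_EFinP mh h0 m1h mg g0.
pose f_ := nnsfun_approx measurableT mg.
have f_h0 n x : 0 <= (f_ n x)%:E * (h x)%:E by rewrite mule_ge0// lee_fin.
have mf_ n : measurable_fun setT (fun x => (f_ n x)%:E) by exact/measurable_EFinP.
transitivity (limn (fun n => \int[m1]_x (f_ n x)%:E)).
  rewrite -monotone_convergence//=.
  - by apply: eq_integral => x _; apply/esym/cvg_lim => //; exact: cvg_nnsfun_approx.
  - by move=> n x _; rewrite lee_fin.
  - by move=> x _ a b ab; rewrite lee_fin; exact/lefP/nd_nnsfun_approx.
transitivity (limn (fun n => \int[m2]_x ((f_ n x)%:E * (h x)%:E))); last first.
  rewrite -monotone_convergence//=; last 2 first.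
  - by move=> n; exact: emeasurable_funM.
  - by move=> x _ a b ab; rewrite lee_wpmul2r ?lee_fin//; exact/lefP/nd_nnsfun_approx.
  apply: eq_integral => x _; apply: cvg_lim => //.
  by apply: cvgeZr => //; exact: cvg_nnsfun_approx.
congr (limn _); apply/funext => n.
under [LHS]eq_integral do rewrite fimfunE -fsumEFin//.
rewrite [LHS]ge0_integral_fsum//; last 2 first.
  - by move=> r; exact/measurable_EFinP/measurableT_comp.
  - by move=> r x _; rewrite EFinM nnfun_muleindic_ge0.
under [RHS]eq_integral.
  move=> x xD; rewrite fimfunE -fsumEFin// ge0_mule_fsuml; last first.
    by move=> r; rewrite EFinM nnfun_muleindic_ge0.
  over.
rewrite [RHS]ge0_integral_fsum//; last 2 first.
  - by move=> r; apply: emeasurable_funM => //; exact/measurable_EFinP/measurableT_comp.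
  - by move=> r x _; rewrite mule_ge0 ?lee_fin// -lee_fin EFinM nnfun_muleindic_ge0.
apply: eq_fsbigr => r rf.
under [RHS]eq_integral do rewrite EFinM -muleA.
have r0 : (0 <= r)%R.
  by move: rf; rewrite inE => -[x _ <-].
rewrite ge0_integralZl//; last 2 first.
- by apply: emeasurable_funM => //; exact/measurable_EFinP/measurable_indic.
- by move=> x _; rewrite mule_ge0 ?lee_fin// indicE.
rewrite integralZl_indic_nnsfun//= integral_indic// setIT m1h//; congr (_ * _).
rewrite [LHS]integral_mkcond; apply: eq_integral => x _.
by rewrite epatch_indic/= muleC.
Qed.
End MeasureComparison.

Definition RV_of (R : realType) (d : measure_display) (T : measurableType d) (P : probability T R)
    (d' : measure_display) (S : measurableType d')
    (f : T -> S) (mf : measurable_fun setT f) : {RV P >-> S} :=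
  HB.pack f (isMeasurableFun.Build _ _ _ _ f mf).

Section IntegralSameLaw.
Context (R : realType) (d1 d2 d' : measure_display).
Context (T1 : measurableType d1) (T2 : measurableType d2) (S : measurableType d').
Variables (m1 : {measure set T1 -> \bar R}) (m2 : {measure set T2 -> \bar R}).
Variables (Y1 : T1 -> S) (Y2 : T2 -> S).
Hypothesis mY1 : measurable_fun setT Y1.
Hypothesis mY2 : measurable_fun setT Y2.
Hypothesis same_law : forall A, measurable A -> m1 (Y1 @^-1` A) = m2 (Y2 @^-1` A).
Local Open Scope ereal_scope.

Lemma ge0_integral_same_law (g : S -> \bar R) :
  measurable_fun setT g -> (forall x, 0 <= g x) ->
  \int[m1]_t g (Y1 t) = \int[m2]_t g (Y2 t).
Proof.
move=> mg g0; transitivity (\int[pushforward m1 Y1]_x g x).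
  by rewrite (ge0_integral_pushforward mY1).
transitivity (\int[pushforward m2 Y2]_x g x).
  by apply: eq_measure_integral => A mA _; exact: same_law.
by rewrite (ge0_integral_pushforward mY2).
Qed.

Lemma integral_same_law (g : S -> \bar R) : measurable_fun setT g ->
  \int[m1]_t g (Y1 t) = \int[m2]_t g (Y2 t).
Proof.
move=> mg; rewrite integralE [RHS]integralE; congr (_ - _).
  have -> : (fun x => g (Y1 x))^\+ = (fun t => g^\+ (Y1 t)) by apply/funext => t; rewrite !funeposE.
  have -> : (fun x => g (Y2 x))^\+ = (fun t => g^\+ (Y2 t)) by apply/funext => t; rewrite !funeposE.
  exact: (ge0_integral_same_law (measurable_funepos mg) (funepos_ge0 g)).
have -> : (fun x => g (Y1 x))^\- = (fun t => g^\- (Y1 t)) by apply/funext => t; rewrite !funenegE.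
have -> : (fun x => g (Y2 x))^\- = (fun t => g^\- (Y2 t)) by apply/funext => t; rewrite !funenegE.
exact: (ge0_integral_same_law (measurable_funeneg mg) (funeneg_ge0 g)).
Qed.

Lemma integrable_same_law (g : S -> \bar R) : measurable_fun setT g ->
  m2.-integrable setT (g \o Y2) -> m1.-integrable setT (g \o Y1).
Proof.
move=> mg /integrableP[_ ig]; apply/integrableP; split; first exact: measurableT_comp.
have mg' : measurable_fun setT (abse \o g) by exact: measurableT_comp.
have -> := ge0_integral_same_law mg' (fun x => abse_ge0 (g x)).
exact: ig.
Qed.
End IntegralSameLaw.

(** * Affine changes of variable on the line *)

Section AffineLebesgue.
Context (R : realType).
Local Notation lam := (@lebesgue_measure R).
Local Open Scope ereal_scope.

Definition affine (y b x : R) : R := (y + b * x)%R.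

Lemma measurable_affine y b : measurable_fun [set: R] (affine y b).
Proof. by apply: measurable_funD => //; apply: measurable_funM. Qed.

HB.instance Definition _ y b :=
  isMeasurableFun.Build _ _ R (measurableTypeR R) (affine y b) (measurable_affine y b).

(** The scaled image measure agrees with Lebesgue measure on the intervals []p, q]]. For b < 0 the
    preimage is closed on the other side, which does not affect its length. *)
Lemma lebesgue_measure_affine (y b : R) (A : set R) : b != 0%R -> measurable A ->
  lam A = `|b|%:E * lam (affine y b @^-1` A).
Proof.
move=> b0 mA.
pose nu : {measure set (measurableTypeR R) -> \bar R} :=
  mscale (NngNum (normr_ge0 b)) (pushforward lam (affine y b : _ -> measurableTypeR R)).
rewrite -[RHS]/(nu (measurable_affine y b) A); apply: lebesgue_measure_unique => // _ [[p q] _ <-].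
rewrite /nu /mscale/= /pushforward.
have pqE : affine y b @^-1` `]p, q]%classic =
  if (0 < b)%R then `]((p - y) / b)%R, ((q - y) / b)%R]%classic
  else `[((q - y) / b)%R, ((p - y) / b)%R[%classic.
  apply/seteqP; split=> x; rewrite /affine/=.
    case: ifPn => b0'; rewrite /= !in_itv/=.
      by rewrite ltr_pdivrMr// ler_pdivlMr// => /andP[? ?]; apply/andP; split; lra.
    have {}b0' : (b < 0)%R by rewrite lt_neqAle b0 leNgt.
    by rewrite ler_ndivrMr// ltr_ndivlMr// => /andP[? ?]; apply/andP; split; lra.
  case: ifPn => b0'; rewrite /= !in_itv/=.
    by rewrite ltr_pdivrMr// ler_pdivlMr// => /andP[? ?]; apply/andP; split; lra.
  have {}b0' : (b < 0)%R by rewrite lt_neqAle b0 leNgt.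
  by rewrite ler_ndivrMr// ltr_ndivlMr// => /andP[? ?]; apply/andP; split; lra.
change (lam `]p, q]%classic = `|b|%:E * lam (affine y b @^-1` `]p, q]%classic)).
rewrite pqE [in LHS]lebesgue_measure_itv/= lte_fin.
case: (ltP 0%R b) => b0'.
  rewrite lebesgue_measure_itv/= lte_fin ltr_pM2r ?invr_gt0// ltrD2r.
  case: ifP => _; last by rewrite mule0.
  rewrite -!EFinB -EFinM; congr EFin; rewrite gtr0_norm//; field; rewrite gt_eqF//.
have {}b0' : (b < 0)%R by rewrite lt_neqAle b0.
rewrite lebesgue_measure_itv/= lte_fin ltr_nM2r ?invr_lt0// ltrD2r.
case: ifP => _; last by rewrite mule0.
rewrite -!EFinB -EFinM; congr EFin; rewrite ltr0_norm//; field; rewrite lt_eqF//.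
Qed.

Lemma ge0_integral_affine (y b : R) (A : set R) (g : R -> \bar R) :
  b != 0%R -> measurable A -> measurable_fun setT g -> (forall x, 0 <= g x) ->
  \int[lam]_(x in A) g x =
  `|b|%:E * \int[lam]_(x in affine y b @^-1` A) g (affine y b x).
Proof.
move=> b0 mA mg g0.
pose nu : {measure set (measurableTypeR R) -> \bar R} :=
  mscale (NngNum (normr_ge0 b)) (pushforward lam (affine y b : _ -> measurableTypeR R)).
transitivity (\int[nu (measurable_affine y b)]_(x in A) g x).
  by apply: eq_measure_integral => B mB _; exact: lebesgue_measure_affine.
rewrite /nu ge0_integral_mscale//; last exact: measurable_funTS.
rewrite ge0_integral_pushforward//; first exact: measurable_affine.
exact: measurable_funTS.
Qed.
End AffineLebesgue.

(** * Sums of independent normal variables *)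

Section NormalConvolution.
Context (R : realType).
Local Notation lam := (@lebesgue_measure R).

Definition std_normal : probability (measurableTypeR R) R := normal_prob (0 : R) 1.

Local Notation nu := std_normal.
Local Open Scope ereal_scope.

Lemma normal_pdf_affine (y b x : R) : b != 0%R ->
  normal_pdf 0 1 x = (`|b| * normal_pdf y `|b| (affine y b x))%R.
Proof.
move=> b0; have b0' : `|b|%R != 0%R by rewrite normr_eq0.
rewrite !normal_pdfE ?oner_neq0// /normal_peak /normal_fun /affine mulrA; congr (_ * expR _)%R.
  rewrite expr1n mul1r real_normK ?num_real// -[in RHS]mulrnAr sqrtrM ?sqr_ge0// sqrtr_sqr.
  by rewrite invfM mulrA divff// mul1r.
rewrite real_normK ?num_real//; field; rewrite b0.
done.
Qed.

Lemma normal_prob_affine (y b : R) (A : set R) : b != 0%R -> measurable A ->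
  nu (affine y b @^-1` A) = normal_prob y `|b| A.
Proof.
move=> b0 mA; rewrite /normal_prob.
have mB : measurable (affine y b @^-1` A).
  by rewrite -[X in measurable X]setTI; exact: measurable_affine.
rewrite [RHS](@ge0_integral_affine _ y b)//; last 2 first.
- by apply/measurable_EFinP; exact: measurable_normal_pdf.
- by move=> x; rewrite lee_fin normal_pdf_ge0.
rewrite -ge0_integralZl//; last 2 first.
- apply/measurable_EFinP; apply: measurable_funTS.
  by apply: (measurableT_comp (measurable_normal_pdf _ _)); exact: measurable_affine.
- by move=> x _; rewrite lee_fin normal_pdf_ge0.
by apply: eq_integral => x _; rewrite (@normal_pdf_affine y b x).
Qed.

(** Completing the square. For Y of law N(0, a^2) and an independent standard Z, the joint density
    of (Y, Y + b Z) is the density of the sum times the conditional density of Y given the sum u,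
    which is normal with mean u a^2 / c^2 and deviation a b / c. *)
Lemma normal_pdf_mul (a b c u y : R) : a != 0%R -> b != 0%R -> c != 0%R ->
  (c ^+ 2 = a ^+ 2 + b ^+ 2)%R ->
  (normal_pdf 0 a y * normal_pdf y b u =
   normal_pdf 0 c u * normal_pdf (u * a ^+ 2 / c ^+ 2) (a * b / c) y)%R.
Proof.
move=> a0 b0 c0 cab.
have abc0 : (a * b / c != 0)%R by rewrite mulf_neq0 ?mulf_neq0 ?invr_neq0.
rewrite !normal_pdfE// /normal_peak /normal_fun.
rewrite [LHS]mulrACA [RHS]mulrACA -!expRD; congr (_ * expR _)%R.
  have sqrtV (x y' : R) : (0 <= x -> (Num.sqrt x)^-1 * (Num.sqrt y')^-1 = (Num.sqrt (x * y'))^-1)%R.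
    by move=> x0; rewrite sqrtrM// invfM.
  have p0 (x : R) : (0 <= x ^+ 2 * pi *+ 2)%R by rewrite mulrn_wge0// mulr_ge0 ?sqr_ge0 ?pi_ge0.
  rewrite !sqrtV//.
  have -> : (a ^+ 2 * pi *+ 2 * (b ^+ 2 * pi *+ 2) =
      c ^+ 2 * pi *+ 2 * ((a * b / c) ^+ 2 * pi *+ 2) :> R)%R by field.
  by [].
rewrite expr_div_n exprMn.
have := sqrf_eq0 a; have := sqrf_eq0 b; have := sqrf_eq0 c.
rewrite (negbTE a0) (negbTE b0) (negbTE c0) !subr0 cab.
move: (a ^+ 2)%R (b ^+ 2)%R => A B /negbT AB0 /negbT B0 /negbT A0.
by field; rewrite A0 B0 AB0.
Qed.

Let h (b y : R) (A : set R) := nu (affine y b @^-1` A).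

Let measurable_h b A : measurable A -> measurable_fun setT (fun y => h b y A).
Proof.
move=> mA; rewrite (_ : (fun y => _) = nu \o xsection [set p : measurableTypeR R * measurableTypeR R | A (p.1 + b * p.2)%R]).
  apply: measurable_fun_xsection; rewrite -[X in measurable X]setTI.
  have mf : measurable_fun setT (fun p : measurableTypeR R * measurableTypeR R => p.1 + b * p.2)%R.
    apply: measurable_funD; first exact: measurable_fst.
    by apply: measurable_funM => //; exact: measurable_snd.
  exact: (mf measurableT A mA).
by apply/funext => y; rewrite /h /= /xsection; congr (nu _); apply/seteqP; split=> x/=; rewrite inE.
Qed.

(** After Tonelli's theorem, the inner integral meets only the conditional density of
    [normal_pdf_mul], whose mass is 1. *)
Let normal_mix0 (a b : R) A : measurable A -> a != 0%R -> b != 0%R ->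
  \int[nu]_x h b (a * x)%R A = normal_prob 0 (Num.sqrt (a ^+ 2 + b ^+ 2)) A.
Proof.
move=> mA a0 b0; set c := Num.sqrt _.
have c2 : (c ^+ 2 = `|a| ^+ 2 + `|b| ^+ 2)%R.
  by rewrite sqr_sqrtr ?addr_ge0 ?sqr_ge0// !real_normK ?num_real.
have c0 : c != 0%R.
  by rewrite sqrtr_eq0 -ltNge ltr_pwDl// ?sqr_ge0// exprn_even_gt0.
have [na nb] : `|a|%R != 0%R /\ `|b|%R != 0%R by rewrite !normr_eq0.
have hE y : h b y A = \int[lam]_(u in A) (normal_pdf y `|b| u)%:E.
  by rewrite /h normal_prob_affine.
pose k (p : measurableTypeR R * measurableTypeR R) := (normal_pdf 0 `|a| p.1 * normal_pdf p.1 `|b| p.2)%R.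
have kE p : k p = (normal_peak `|a| * normal_peak `|b| *
    expR (- p.1 ^+ 2 / (`|a| ^+ 2 *+ 2) - (p.2 - p.1) ^+ 2 / (`|b| ^+ 2 *+ 2)))%R.
  by rewrite /k !normal_pdfE// /normal_fun mulrACA -expRD subr0 [X in (_ + X)%R]mulNr.
have mk : measurable_fun setT k.
  rewrite (_ : k = (fun p => (normal_peak `|a| * normal_peak `|b| *
    expR (- p.1 ^+ 2 / (`|a| ^+ 2 *+ 2) - (p.2 - p.1) ^+ 2 / (`|b| ^+ 2 *+ 2)))%R)); last exact/funext.
  apply: measurable_funM => //; apply: (measurableT_comp (@measurable_expR R)).
  apply: measurable_funB; apply: measurable_funM => //.
    by apply: measurable_funN; apply: measurable_funX; exact: measurable_fst.
  by apply: measurable_funX; apply: measurable_funB; [exact: measurable_snd|exact: measurable_fst].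
have k0 p : (0 <= k p)%R by rewrite mulr_ge0// normal_pdf_ge0.
have mA' : measurable_fun setT (\1_A : R -> R) by exact: measurable_indic.
pose kA (p : measurableTypeR R * measurableTypeR R) := (\1_A p.2 * k p)%:E.
have mkA : measurable_fun setT kA.
  apply/measurable_EFinP; apply: measurable_funM => //.
  by apply: (measurableT_comp mA'); exact: measurable_snd.
have kA0 p : 0 <= kA p by rewrite lee_fin mulr_ge0// indicE.
have h_mul y : h b y A * (normal_pdf 0 `|a| y)%:E = \int[lam]_u kA (y, u).
  rewrite hE integral_mkcond -ge0_integralZr//.
  - apply: eq_integral => u _; rewrite epatch_indic/= /kA/= /k/= -!EFinM; congr EFin.
    by ring.
  - apply/(measurable_restrictT _ mA); apply/measurable_EFinP; apply: measurable_funTS.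
    exact: measurable_normal_pdf.
  - by move=> u _; rewrite erestrict_ge0// => v _; rewrite lee_fin normal_pdf_ge0.
  - by rewrite lee_fin normal_pdf_ge0.
have mh := measurable_h b mA.
have -> : \int[nu]_x h b (a * x)%R A = \int[normal_prob 0 `|a|]_y h b y A.
  transitivity (\int[nu]_x h b (affine 0 a x) A).
    by apply: eq_integral => x _; rewrite /affine add0r.
  apply: (@ge0_integral_same_law R _ _ _ (measurableTypeR R) (measurableTypeR R)
    (measurableTypeR R) nu (normal_prob 0 `|a|) (affine 0 a) id _ _ _ (h b ^~ A)).
  - exact: measurable_affine.
  - exact: measurable_id.
  - by move=> B mB; exact: normal_prob_affine.
  - exact: mh.
  - by move=> y; exact: measure_ge0.
rewrite (@ge0_integral_density _ _ _ _ lam (normal_pdf 0 `|a|))//; last 2 first.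
- exact: measurable_normal_pdf.
- by move=> y; exact: normal_pdf_ge0.
under eq_integral do rewrite h_mul.
rewrite (fubini_tonelli kA)//.
rewrite /normal_prob [RHS]integral_mkcond; apply: eq_integral => u _.
rewrite epatch_indic /=.
under eq_integral => y _.
  rewrite /kA/= /k/= (normal_pdf_mul u y na nb c0 c2) mulrA EFinM.
  over.
rewrite ge0_integralZl//.
- by rewrite integral_normal_pdf mule1 EFinM muleC.
- by apply/measurable_EFinP; exact: measurable_normal_pdf.
- by move=> y _; rewrite lee_fin normal_pdf_ge0.
- by rewrite lee_fin mulr_ge0 ?normal_pdf_ge0// indicE.
Qed.

(* The law N(0, v), as an image of the standard normal law so that v = 0 gives
   the Dirac mass. *)
Definition std_law (d : measure_display) (T : measurableType d) (P : probability T R)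
    (Y : T -> R) (v : R) :=
  forall A, measurable A ->
    P (Y @^-1` A) = nu ((fun x => Num.sqrt v * x)%R @^-1` A).

Lemma std_law_add (d : measure_display) (T : measurableType d) (P : probability T R)
    (Y : T -> R) (v b : R) : (0 <= v)%R -> measurable_fun setT Y -> std_law P Y v ->
  std_law (P \x nu)%E (fun p => Y p.1 + b * p.2)%R (v + b ^+ 2).
Proof.
move=> v0 mY Yv A mA.
have affE (a : R) : (fun x => a * x)%R = affine 0 a by apply/funext => x; rewrite /affine add0r.
have mh := measurable_h b mA.
rewrite [LHS](_ : _ = \int[P]_t h b (Y t) A); last first.
  apply: eq_integral => t _; rewrite /h /=; congr (nu _).
  by rewrite /xsection; apply/seteqP; split=> x/=; rewrite inE.
have -> : \int[P]_t h b (Y t) A = \int[nu]_x h b (Num.sqrt v * x)%R A.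
  transitivity (\int[nu]_x h b (affine 0 (Num.sqrt v) x) A); last first.
    by apply: eq_integral => x _; rewrite /affine add0r.
  apply: (@ge0_integral_same_law R _ _ _ T (measurableTypeR R) (measurableTypeR R)
    P nu Y (affine 0 (Num.sqrt v)) _ _ _ (h b ^~ A)) => //.
  - exact: measurable_affine.
  - by move=> B mB; rewrite -affE; exact: (Yv _ mB).
(* For b = 0 or v = 0 one of the two laws is a Dirac mass without density, so that these cases are
   treated apart. *)
have [->|b0] := eqVneq b 0%R.
  rewrite expr0n addr0.
  rewrite [RHS](_ : _ = \int[nu]_x (\1_(affine 0 (Num.sqrt v) @^-1` A) x)%:E); last first.
    rewrite integral_indic ?setIT ?affE//.
    by rewrite -[X in measurable X]setTI; exact: measurable_affine.
  apply: eq_integral => x _; rewrite /h indicE.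
  case: (pselect (A (Num.sqrt v * x)%R)) => hx.
    rewrite mem_set; last by rewrite /= /affine add0r.
    rewrite (_ : _ @^-1` _ = setT) ?probability_setT//.
    by apply/seteqP; split => // y _; rewrite /= /affine mul0r addr0.
  rewrite memNset; last by rewrite /= /affine add0r.
  rewrite (_ : _ @^-1` _ = set0) ?measure0//.
  by apply/seteqP; split => // y; rewrite /= /affine mul0r addr0.
have [->|v0'] := eqVneq v 0%R.
  rewrite sqrtr0 add0r sqrtr_sqr affE normal_prob_affine ?normr_eq0//.
  under eq_integral do rewrite mul0r /h normal_prob_affine//.
  by rewrite normr_id integral_cst// [X in _ * X]probability_setT mule1.
have sv0 : Num.sqrt v != 0%R by rewrite sqrtr_eq0 -ltNge lt_neqAle eq_sym v0'.
rewrite (normal_mix0 mA sv0 b0) affE normal_prob_affine; last 2 first.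
- by rewrite sqrtr_eq0 -ltNge ltr_wpDl// ?sqr_ge0// exprn_even_gt0.
- by [].
by rewrite (sqr_sqrtr v0) (ger0_norm (sqrtr_ge0 _)).
Qed.

Lemma std_lawE (d : measure_display) (T : measurableType d) (P : probability T R)
    (Y : T -> R) (v : R) : (0 < v)%R -> std_law P Y v ->
  forall A, measurable A -> P (Y @^-1` A) = normal_prob 0 (Num.sqrt v) A.
Proof.
move=> v0 Yv A mA; rewrite (Yv _ mA).
rewrite (_ : (fun x => _)%R = affine 0 (Num.sqrt v)); last first.
  by apply/funext => x; rewrite /affine add0r.
rewrite normal_prob_affine; [|by rewrite sqrtr_eq0 -ltNge|by []].
by rewrite ger0_norm// sqrtr_ge0.
Qed.

(** Induction, taking the product with one more standard normal factor. The law of every linear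
    combination is carried through the induction, which yields joint normality without a joint
    density. *)
Lemma gaussian_family_exists (n : nat) :
  exists (d : measure_display) (T : measurableType d) (P : probability T R)
    (Z : 'I_n -> T -> R), (forall i, measurable_fun setT (Z i)) /\
    forall c : 'I_n -> R,
      std_law P (fun t => \sum_i c i * Z i t)%R (\sum_i c i ^+ 2)%R.
Proof.
elim: n => [|n [d [T [P [Z [mZ hZ]]]]]].
  exists _, (measurableTypeR R), nu, (fun _ _ => 0%R); split => [i|c A mA]; first exact: measurable_cst.
  by congr (nu _); apply/seteqP; split => x /=; rewrite !big_ord0 sqrtr0 mul0r.
pose Z' (i : 'I_n.+1) (p : T * measurableTypeR R) : R := if unlift ord0 i is Some j then Z j p.1 else p.2.
exists _, (T * measurableTypeR R)%type, (P \x nu), Z'; split => [i|c].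
  rewrite /Z'; case: unliftP => [j _|_]; last exact: measurable_snd.
  exact: (measurableT_comp (mZ j) measurable_fst).
rewrite big_ord_recl /= addrC.
rewrite (_ : (fun t => _) = (fun p => \sum_i c (lift ord0 i) * Z i p.1 + c ord0 * p.2)%R).
  apply: (@std_law_add _ _ P (fun t => \sum_i c (lift ord0 i) * Z i t)%R) => //.
    by apply: sumr_ge0 => i _; exact: sqr_ge0.
  have : forall s : seq 'I_n, measurable_fun setT (fun t => \sum_(i <- s) c (lift ord0 i) * Z i t)%R.
    elim=> [|i s ih].
      by under eq_fun do rewrite big_nil; exact: measurable_cst.
    under eq_fun do rewrite big_cons.
    by apply: measurable_funD => //; apply: measurable_funM.
  exact.
apply/funext => p; rewrite big_ord_recl addrC /Z' unlift_none; congr (_ + _)%R.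
by apply: eq_bigr => i _; rewrite liftK.
Qed.
End NormalConvolution.

(** * The characteristic function of the normal law *)

Section TrigBounds.
Context (R : realType).
Implicit Types (f df : R -> R) (x y : R).

(** A consequence of the mean value theorem; it turns the sign of a derivative into the Taylor
    bounds for sine and cosine, and later into those for the hyperbolic functions. *)
Lemma ge0_is_derive_ndecr f df : (forall x, is_derive x 1 f (df x)) ->
  (forall x, 0 <= x -> 0 <= df x) -> forall y, 0 <= y -> f 0 <= f y.
Proof.
move=> fdf df0 y; rewrite le_eqVlt => /predU1P[<-//|y0].
have [c /[!in_itv]/= /andP[c0 _] fE] := @MVT R f df 0 y y0 (fun x _ => fdf x)
  (continuous_subspaceT (fun x => differentiable_continuous
     (proj1 (derivable1_diffP _ _) (@ex_derive _ _ _ _ _ _ _ (fdf x))))).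
by rewrite -subr_ge0 fE mulr_ge0 ?subr0 ?df0 ?ltW.
Qed.

Let sin_le_id y : 0 <= y -> sin y <= y.
Proof.
move=> y0; rewrite -subr_ge0 -[leLHS](_ : 0 - sin 0 = 0); last by rewrite sin0 subr0.
have h x : 0 <= x -> 0 <= 1 - cos x by move=> _; rewrite subr_ge0 cos_le1.
exact: (@ge0_is_derive_ndecr (fun x => x - sin x) (fun x => 1 - cos x) _ h y y0).
Qed.

Lemma abs_sin_le y : `|sin y| <= `|y|.
Proof.
wlog y0 : y / 0 <= y => [h|].
  have [/h//|/ltW y0] := leP 0 y.
  by rewrite -normrN -sinN -(normrN y); apply: h; rewrite oppr_ge0.
rewrite (ger0_norm y0) ler_norml sin_le_id// andbT.
have h x : 0 <= x -> 0 <= 1 + cos x by move=> _; have := cos_geN1 x; lra.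
have : 0 + sin 0 <= y + sin y.
  exact: (@ge0_is_derive_ndecr (fun x => x + sin x) (fun x => 1 + cos x) _ h y y0).
by rewrite sin0 addr0 => ?; lra.
Qed.

Lemma cos_half y : cos y = 1 - 2 * sin (y / 2) ^+ 2.
Proof.
rewrite {1}(_ : y = (y / 2) *+ 2); last by rewrite mulr2n; field.
by rewrite mulr2n cosD -!expr2; have := cos2Dsin2 (y / 2); lra.
Qed.

Lemma cos_ge_taylor2 y : 1 - y ^+ 2 / 2 <= cos y.
Proof.
have := abs_sin_le (y / 2); rewrite -ler_sqr ?nnegrE// !real_normK ?num_real//.
by rewrite cos_half exprMn => h; lra.
Qed.

Let sin_ge_taylor3 y : 0 <= y -> y - y ^+ 3 / 6 <= sin y.
Proof.
move=> y0; rewrite -subr_ge0.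
have -> : 0 = sin 0 - (0 - 0 ^+ 3 / 6) :> R by rewrite sin0 expr0n mul0r !subr0.
apply: (@ge0_is_derive_ndecr (fun x => sin x - (x - x ^+ 3 / 6))
  (fun x => cos x - (1 - x ^+ 2 / 2))) => // x.
  apply: is_derive_eq.
  by rewrite /GRing.scale/=; field.
by move=> _; rewrite subr_ge0 cos_ge_taylor2.
Qed.

Lemma sin_taylor y : `|sin y - y| <= `|y| ^+ 3 / 6.
Proof.
wlog y0 : y / 0 <= y => [h|].
  have [/h//|/ltW y0] := leP 0 y.
  by have := h (- y); rewrite oppr_ge0 sinN -opprD !normrN => ->.
by rewrite (ger0_norm y0) ler_norml; have := sin_le_id y0; have := sin_ge_taylor3 y0;
  have : 0 <= y ^+ 3 by [exact: exprn_ge0]; move=> *; apply/andP; split; lra.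
Qed.

(** By the half-angle formula the error is 2 (z^2 - sin^2 z) with z = y / 2, and the cubic bound on
    z - sin z suffices. *)
Lemma cos_taylor y : `|cos y - (1 - y ^+ 2 / 2)| <= y ^+ 4 / 24.
Proof.
have h1 := cos_ge_taylor2 y; rewrite ger0_norm ?subr_ge0//.
wlog y0 : y h1 / 0 <= y => [h|].
  have [/(h _ h1)//|/ltW y0] := leP 0 y.
  rewrite -cosN -(sqrrN y) (_ : y ^+ 4 = (- y) ^+ 4); last by rewrite exprNn; ring.
  by apply: h; rewrite ?oppr_ge0// cosN sqrrN.
rewrite cos_half; set z := y / 2.
have z0 : 0 <= z by rewrite divr_ge0.
have -> : y = 2 * z by rewrite /z; field.
have sz := sin_le_id z0; have sz3 := sin_ge_taylor3 z0.
have : 0 <= (z ^+ 3 / 6 - (z - sin z)) by lra.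
have : z - sin z <= z ^+ 3 / 6 by lra.
have := abs_sin_le z; rewrite (ger0_norm z0) ler_norml => /andP[sz' _].
have -> : 1 - 2 * sin z ^+ 2 - (1 - (2 * z) ^+ 2 / 2) = 2 * ((z - sin z) * (z + sin z)) by field.
move=> h2 _.
have : (z - sin z) * (z + sin z) <= z ^+ 3 / 6 * (2 * z) by apply: ler_pM; lra.
have -> : (2 * z) ^+ 4 / 24 = 2 * (z ^+ 3 / 6 * (2 * z)) by field.
by lra.
Qed.
End TrigBounds.

(** * Moments and characteristic function of the standard normal law *)

Section StandardNormal.
Context (R : realType).
Local Notation nu := (@std_normal R).
Local Notation lam := (@lebesgue_measure R).

Lemma ge0_integral_std_normal (g : R -> \bar R) :
  measurable_fun setT g -> (forall x, 0 <= g x)%E ->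
  (\int[nu]_x g x = \int[lam]_x (g x * (normal_pdf 0 1 x)%:E))%E.
Proof.
move=> mg g0; apply: ge0_integral_density => //.
- exact: measurable_normal_pdf.
- by move=> x; exact: normal_pdf_ge0.
Qed.

(** Completing the square: exp (t x) times the density of N(0, 1) is exp (t^2 / 2) times the density
    of N(t, 1). *)
Lemma integral_expR_std_normal (t : R) :
  (\int[nu]_x (expR (t * x))%:E = (expR (t ^+ 2 / 2))%:E)%E.
Proof.
rewrite ge0_integral_std_normal; last 2 first.
- by apply/measurable_EFinP; apply: (measurableT_comp (@measurable_expR R)); exact: mulrl_measurable.
- by move=> x; rewrite lee_fin expR_ge0.
transitivity (\int[lam]_x ((expR (t ^+ 2 / 2))%:E * (normal_pdf t 1 x)%:E))%E.
  apply: eq_integral => x _; rewrite -!EFinM; congr EFin.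
  rewrite !normal_pdfE ?oner_neq0// /normal_fun mulrCA [RHS]mulrCA -!expRD; congr (_ * expR _).
  by field.
rewrite ge0_integralZl//.
- by rewrite integral_normal_pdf mule1.
- by apply/measurable_EFinP; exact: measurable_normal_pdf.
- by move=> x _; rewrite lee_fin normal_pdf_ge0.
Qed.

Let measurable_expM (t : R) : measurable_fun [set: measurableTypeR R] (fun x : R => expR (t * x)).
Proof. by apply: (measurableT_comp (@measurable_expR R)); exact: mulrl_measurable. Qed.

Let integrable_expM (t : R) : nu.-integrable setT (EFin \o (fun x : R => expR (t * x))).
Proof.
apply/integrableP; split; first by apply/measurable_EFinP; exact: measurable_expM.
under eq_integral => x _ do rewrite /= ger0_norm ?expR_ge0//.
by rewrite integral_expR_std_normal ltry.
Qed.

(** Twice the hyperbolic cosine. It dominates exp |x| and hence every power of |x|, and its normal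
    integrals are explicit; it is the dominating function for all moments below. *)
Definition cosh2 (x : R) := expR x + expR (- x).

Let integrable_cosh2 (t : R) : nu.-integrable setT (EFin \o (fun x : R => cosh2 (t * x))).
Proof.
rewrite (_ : EFin \o _ = (EFin \o (fun x => expR (t * x))) \+ (EFin \o (fun x => expR ((- t) * x))))%E.
  by apply: integrableD => //; exact: integrable_expM.
by apply/funext => x; rewrite /cosh2 /= -EFinD mulNr.
Qed.

Lemma Rintegral_cosh2 (t : R) : \int[nu]_x cosh2 (t * x) = 2 * expR (t ^+ 2 / 2).
Proof.
have i2 : nu.-integrable setT (EFin \o (fun x : R => expR (- (t * x)))).
  rewrite (_ : (fun x => _) = (fun x => expR ((- t) * x))); first exact: integrable_expM.
  by apply/funext => x; rewrite mulNr.
rewrite /cosh2 (RintegralD measurableT (integrable_expM t) i2).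
have h u : \int[nu]_x expR (u * x) = expR (u ^+ 2 / 2).
  by rewrite /Rintegral integral_expR_std_normal.
under [X in _ + X]eq_Rintegral => x _ do rewrite -mulNr.
by rewrite !h sqrrN; ring.
Qed.

Let expR_norm_le x : expR `|x| <= cosh2 x.
Proof.
rewrite /cosh2; have [x0|x0] := leP 0 x.
  by rewrite ger0_norm// lerDl expR_ge0.
by rewrite ltr0_norm// lerDr expR_ge0.
Qed.

(** The fourth power of the inequality |x| / 4 <= exp (|x| / 4), whence 256 = 4^4. *)
Let pow4_le (x : R) : x ^+ 4 <= 256 * cosh2 x.
Proof.
apply: (@le_trans _ _ (256 * expR `|x|)); last by apply: (ler_wpM2l (ler0n R 256)); exact: expR_norm_le.
have -> : expR `|x| = (expR (`|x| / 4)) ^+ 4.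
  by rewrite -expRM_natr; congr expR; field.
have h : `|x| / 4 <= expR (`|x| / 4) by have := expR_ge1Dx (`|x| / 4); lra.
have : (`|x| / 4) ^+ 4 <= expR (`|x| / 4) ^+ 4.
  by rewrite lerXn2r// nnegrE ?expR_ge0// divr_ge0.
rewrite expr_div_n -normrX (ger0_norm (exprn_even_ge0 _ _))// => h4.
have : x ^+ 4 = 256 * (x ^+ 4 / 4 ^+ 4) by field.
by lra.
Qed.

Let integrable_le_cosh2 (c : R) (f : R -> R) : measurable_fun [set: measurableTypeR R] f ->
  (forall x, `|f x| <= c * cosh2 x) -> nu.-integrable setT (EFin \o f).
Proof.
move=> mf fc.
have h := integrable_cosh2 1.
apply: (@le_integrable _ _ _ nu setT measurableT _ (fun x => c%:E * (EFin \o (fun x : R => cosh2 (1 * x))) x)%E).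
- exact/measurable_EFinP.
- move=> x _; rewrite /= lee_fin mul1r (le_trans (fc x))//.
  by rewrite ler_norm.
- exact: integrableZl.
Qed.

Lemma integrable_std_normal_id : nu.-integrable setT (EFin \o (fun x : R => x)).
Proof.
apply: (@integrable_le_cosh2 1) => // x; rewrite mul1r.
apply: le_trans (expR_norm_le x).
by have := expR_ge1Dx `|x|; lra.
Qed.

Lemma integrable_std_normal_pow4 : nu.-integrable setT (EFin \o (fun x : R => x ^+ 4)).
Proof.
apply: (@integrable_le_cosh2 256) => // x.
by rewrite ger0_norm ?pow4_le// exprn_even_ge0.
Qed.

Lemma integrable_std_normal_sqr : nu.-integrable setT (EFin \o (fun x : R => x ^+ 2)).
Proof.
apply: (@integrable_le_cosh2 257) => // x.
rewrite ger0_norm ?sqr_ge0//.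
have h1 : 1 <= cosh2 x by rewrite (le_trans _ (expR_norm_le x))// -expR0 ler_expR.
have := pow4_le x; have : 0 <= (x ^+ 2 - 1) ^+ 2 by exact: sqr_ge0.
have -> : (x ^+ 2 - 1) ^+ 2 = x ^+ 4 - 2 * x ^+ 2 + 1 by ring.
have : 0 <= x ^+ 4 by rewrite exprn_even_ge0.
by lra.
Qed.

Let reflect_nu (A : set (measurableTypeR R)) : measurable A -> nu ((fun x : R => - x) @^-1` A) = nu (id @^-1` A).
Proof.
move=> mA; have := @normal_prob_affine R 0 (-1) A.
rewrite normrN1 oppr_eq0 oner_neq0 => /(_ isT mA) h.
transitivity (nu (affine 0 (-1) @^-1` A)); last exact: h.
congr (nu _).
by apply/seteqP; split => x; rewrite /= /affine add0r mulN1r.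
Qed.

Let Rintegral_odd (g : R -> R) : measurable_fun [set: measurableTypeR R] g ->
  (forall x, g (- x) = - g x) -> nu.-integrable setT (EFin \o g) -> \int[nu]_x g x = 0.
Proof.
move=> mg godd ig.
have : \int[nu]_x g (- x) = \int[nu]_x g x.
  rewrite /Rintegral; congr fine.
  apply: (@integral_same_law R _ _ _ (measurableTypeR R) (measurableTypeR R) (measurableTypeR R)
    nu nu (fun x : R => - x) id _ _ _ (EFin \o g)).
  - exact: oppr_measurable.
  - exact: measurable_id.
  - exact: reflect_nu.
  - exact/measurable_EFinP.
under eq_Rintegral => x _ do rewrite godd -mulN1r.
by rewrite RintegralZl// => h; lra.
Qed.

Lemma Rintegral_std_normal_id : \int[nu]_x x = 0.
Proof. by apply: Rintegral_odd => //; exact: integrable_std_normal_id. Qed.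

Lemma Rintegral_std_normal_sin (t : R) : \int[nu]_x sin (t * x) = 0.
Proof.
have mt : measurable_fun [set: measurableTypeR R] (fun x : R => t * x) by exact: mulrl_measurable.
apply: Rintegral_odd.
- exact: (bounded_mfun_sin mt).1.
- by move=> x; rewrite mulrN sinN.
- by apply: (bounded_mfun_integrable nu); exact: bounded_mfun_sin.
Qed.

Let cosh2_ge2 (z : R) : 2 <= cosh2 z.
Proof. by have := expR_ge1Dx z; have := expR_ge1Dx (- z); rewrite /cosh2 => ? ?; lra. Qed.

Let sinh2_ge (z : R) : 0 <= z -> 2 * z <= expR z - expR (- z).
Proof.
move=> z0.
have h (x : R) : 0 <= x -> 0 <= expR x + expR (- x) - 2.
  by move=> _; have := cosh2_ge2 x; rewrite /cosh2 => ?; lra.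
have : expR 0 - expR (- 0) - 2 * 0 <= expR z - expR (- z) - 2 * z.
  apply: (@ge0_is_derive_ndecr _ (fun x => expR x - expR (- x) - 2 * x)
    (fun x => expR x + expR (- x) - 2) _ h z z0) => x.
  by apply: is_derive_eq; rewrite /GRing.scale/=; ring.
by rewrite oppr0 subrr mulr0 subrr => ?; lra.
Qed.

Let sinh2_le (z : R) : 0 <= z -> expR z - expR (- z) <= z * cosh2 z.
Proof.
move=> z0.
have h (x : R) : 0 <= x -> 0 <= x * (expR x - expR (- x)).
  by move=> x0; rewrite mulr_ge0//; have := sinh2_ge x0; lra.
have : 0 * cosh2 0 - (expR 0 - expR (- 0)) <= z * cosh2 z - (expR z - expR (- z)).
  apply: (@ge0_is_derive_ndecr _ (fun x => x * cosh2 x - (expR x - expR (- x)))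
    (fun x => x * (expR x - expR (- x))) _ h z z0) => x.
  by rewrite /cosh2; apply: is_derive_eq; rewrite /GRing.scale/=; ring.
by rewrite mul0r oppr0 subrr subr0 => ?; lra.
Qed.

Let cosh2_half (y : R) : cosh2 y = 2 + (expR (y / 2) - expR (- (y / 2))) ^+ 2.
Proof.
rewrite /cosh2 {1 2}(_ : y = y / 2 + y / 2); last by field.
rewrite opprD !expRD; have : expR (y / 2) * expR (- (y / 2)) = 1 by rewrite -expRD subrr expR0.
by move: (expR (y / 2)) (expR (- (y / 2))) => a b ab; ring: ab.
Qed.

Let cosh2N (y : R) : cosh2 (- y) = cosh2 y.
Proof. by rewrite /cosh2 opprK addrC. Qed.

Lemma cosh2_ge (y : R) : 2 + y ^+ 2 <= cosh2 y.
Proof.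
wlog y0 : y / 0 <= y => [h|].
  have [/h//|/ltW y0] := leP 0 y.
  by rewrite -cosh2N -(sqrrN y); apply: h; rewrite oppr_ge0.
rewrite cosh2_half lerD2l lerXn2r ?nnegrE//.
  by have := @sinh2_ge (y / 2); rewrite divr_ge0// => /(_ isT); lra.
by have := @sinh2_ge (y / 2); rewrite divr_ge0// => /(_ isT); lra.
Qed.

(** The bound [sinh2_le] at y / 2 gives cosh2 y - 2 <= (y^2 / 4) (cosh2 y + 2). Inserting this
    estimate into its own right-hand side leaves a remainder of fourth order. *)
Lemma cosh2_le (y : R) : cosh2 y <= 2 + y ^+ 2 + y ^+ 4 / 8 * cosh2 y.
Proof.
wlog y0 : y / 0 <= y => [h|].
  have [/h//|/ltW y0] := leP 0 y.
  rewrite -cosh2N -(sqrrN y) (_ : y ^+ 4 = (- y) ^+ 4); last by ring.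
  by apply: h; rewrite oppr_ge0.
have z0 : 0 <= y / 2 by rewrite divr_ge0.
have h1 : cosh2 y - 2 <= y ^+ 2 / 4 * (cosh2 y + 2).
  have -> : y ^+ 2 / 4 * (cosh2 y + 2) = (y / 2 * cosh2 (y / 2)) ^+ 2.
    rewrite cosh2_half /cosh2.
    have : expR (y / 2) * expR (- (y / 2)) = 1 by rewrite -expRD subrr expR0.
    by move: (expR (y / 2)) (expR (- (y / 2))) => a b ab; field: ab.
  have -> : cosh2 y - 2 = (expR (y / 2) - expR (- (y / 2))) ^+ 2 by rewrite cosh2_half; ring.
  rewrite lerXn2r ?nnegrE ?sinh2_le//.
    by have := sinh2_ge z0; lra.
  by rewrite mulr_ge0// (le_trans _ (cosh2_ge2 _)).
have c2 := cosh2_ge2 y.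
have y2 : 0 <= y ^+ 2 / 4 by rewrite divr_ge0// sqr_ge0.
have h2 : cosh2 y - 2 <= y ^+ 2 / 4 * (2 * cosh2 y).
  by apply: (le_trans h1); rewrite ler_wpM2l//; lra.
have : y ^+ 2 / 4 * (cosh2 y - 2) <= y ^+ 2 / 4 * (y ^+ 2 / 4 * (2 * cosh2 y)).
  by rewrite ler_wpM2l.
have -> : y ^+ 4 / 8 * cosh2 y = y ^+ 2 / 4 * (y ^+ 2 / 4 * (2 * cosh2 y)) by field.
by move: h1 => h1 h3; nra.
Qed.

Lemma eq0_le_mul_sqr (a K : R) : (forall t, 0 < t <= 1 -> `|a| <= K * t ^+ 2) -> a = 0.
Proof.
move=> h; apply/eqP; rewrite -normr_le0; apply/ler_addgt0Pr => e e0; rewrite add0r.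
have K0 : 0 <= K by have := h 1; rewrite ltr01 lexx expr1n mulr1 => /(_ isT); exact: le_trans.
pose t := Num.min 1 (e / (K + 1)).
have K1 : 0 < K + 1 by lra.
have t0 : 0 < t by rewrite lt_min ltr01 divr_gt0.
have t1 : t <= 1 by rewrite ge_min lexx.
apply: (le_trans (h t _)); first by rewrite t0.
have : t ^+ 2 <= t by rewrite expr2 ler_piMl// ltW.
have te : t <= e / (K + 1) by rewrite ge_min lexx orbT.
have : K * (e / (K + 1)) <= e.
  by rewrite mulrA ler_pdivrMr// mulrC ler_wpM2l ?ltW//; lra.
have : K * t <= K * (e / (K + 1)) by rewrite ler_wpM2l.
have : K * t ^+ 2 <= K * t -> K * t <= e -> K * t ^+ 2 <= e by lra.
move=> f1 f2 f3 f4; apply: f1; last by lra.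
by rewrite ler_wpM2l.
Qed.

Let expRm1_le (u : R) : 0 <= u <= 1 / 2 -> expR u - 1 <= u + 2 * u ^+ 2.
Proof.
move=> /andP[u0 u1]; have := expR_ge1Dx (- u); rewrite expRN => h.
have e0 := expR_gt0 u.
have : (1 - u) * expR u <= 1 by rewrite -ler_pdivlMr// div1r.
by move=> ?; nra.
Qed.

(** Here [u] stands for t^2, [m] for the second moment, [E] for exp (u / 2) and [k] for the integral
    that controls the remainder. *)
Let second_moment_squeeze (u m k E : R) : 0 < u -> 0 <= k ->
  2 + u * m <= 2 * E -> 2 * E <= 2 + u * m + u * u / 8 * k ->
  E - 1 <= u / 2 + u * u / 2 -> 1 + u / 2 <= E -> `|m - 1| <= (1 + k / 8) * u.
Proof.
move=> u0 k0 lo hi f2 f1.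
have l1 : u * m <= u * (1 + u) by lra.
have l2 : u * 1 <= u * (m + u / 8 * k) by lra.
rewrite ler_pM2l// in l1; rewrite ler_pM2l// in l2.
have uk : 0 <= u * k by rewrite mulr_ge0// ltW.
by rewrite ler_norml; apply/andP; split; lra.
Qed.

(** The second moment is read off from the integral of [cosh2 (t * x)], known to be 2 exp (t^2 / 2),
    by comparing the terms of order t^2 for small t. *)
Lemma Rintegral_std_normal_sqr : \int[nu]_x (x ^+ 2) = 1.
Proof.
set m2 := Rintegral _ _ _.
(* The integrand dominates x^4 cosh2 (t x) for 0 < t <= 1, since x^4 <= 256 cosh2 x, cosh2 (t x) <=
   2 cosh2 x and (cosh2 x)^2 = cosh2 (2 x) + 2. *)
pose K := \int[nu]_x (512 * cosh2 (2 * x) + 1024).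
have iK : nu.-integrable setT (EFin \o (fun x : R => 512 * cosh2 (2 * x) + 1024)).
  by apply: integrable_RD; [apply: integrable_RZ|exact: integrable_Rcst].
apply/eqP; rewrite -subr_eq0; apply/eqP; apply: (@eq0_le_mul_sqr _ (1 + K / 8)) => t /andP[t0 t1].
have t2 : 0 < t ^+ 2 by rewrite exprn_gt0.
have t21 : t ^+ 2 <= 1 by rewrite exprn_ile1// ltW.
have cE : \int[nu]_x (cosh2 (t * x)) = 2 * expR (t ^+ 2 / 2) by exact: Rintegral_cosh2.
have i2' : nu.-integrable setT (EFin \o (fun x : R => t ^+ 2 * x ^+ 2)).
  by apply: integrable_RZ; exact: integrable_std_normal_sqr.
have i2 : nu.-integrable setT (EFin \o (fun x : R => 2 + t ^+ 2 * x ^+ 2)).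
  by apply: integrable_RD => //; exact: integrable_Rcst.
have i2E : \int[nu]_x (2 + t ^+ 2 * x ^+ 2) = 2 + t ^+ 2 * m2.
  rewrite (RintegralD measurableT (integrable_Rcst nu 2) i2').
  by rewrite Rexpectation_cst (RintegralZl _ measurableT integrable_std_normal_sqr).
have lo : 2 + t ^+ 2 * m2 <= 2 * expR (t ^+ 2 / 2).
  rewrite -cE -i2E; apply: (le_Rintegral measurableT i2 (integrable_cosh2 t)).
  by move=> x _; rewrite -exprMn cosh2_ge.
have hi : 2 * expR (t ^+ 2 / 2) <= 2 + t ^+ 2 * m2 + t ^+ 4 / 8 * K.
  have iK' : nu.-integrable setT (EFin \o (fun x : R => t ^+ 4 / 8 * (512 * cosh2 (2 * x) + 1024))).
    by apply: (integrableZl measurableT (t ^+ 4 / 8) iK).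
  rewrite -cE -i2E -RintegralZl// -RintegralD//.
  apply: (le_Rintegral measurableT (integrable_cosh2 t) (integrable_RD i2 iK')).
  move=> x _; apply: (le_trans (cosh2_le _)); rewrite !exprMn lerD2l//.
  have -> : t ^+ 4 * x ^+ 4 / 8 * cosh2 (t * x) = t ^+ 4 / 8 * (x ^+ 4 * cosh2 (t * x)) by ring.
  apply: ler_wpM2l; first by rewrite divr_ge0// exprn_ge0// ltW.
  have xx : cosh2 (t * x) <= 2 * cosh2 x.
    have h u : expR (t * u) <= expR `|u|.
      rewrite ler_expR (le_trans (ler_norm _))// normrM (gtr0_norm t0) ler_piMl//.
    have := h x; have := h (- x); rewrite normrN mulrN => h1 h2.
    by rewrite /cosh2; have := expR_norm_le x; rewrite /cosh2; lra.
  have c2 := cosh2_ge2 x; have p4 := pow4_le x.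
  have sq : cosh2 (2 * x) = cosh2 x * cosh2 x - 2.
    rewrite /cosh2 (_ : 2 * x = x + x); last by ring.
    rewrite opprD !expRD; have : expR x * expR (- x) = 1 by rewrite -expRD subrr expR0.
    by move: (expR x) (expR (- x)) => a b ab; ring: ab.
  rewrite sq.
  have : x ^+ 4 * cosh2 (t * x) <= (256 * cosh2 x) * (2 * cosh2 x).
    by apply: ler_pM => //; [rewrite exprn_even_ge0|rewrite (le_trans _ (cosh2_ge2 _))].
  by lra.
have u0 : 0 <= t ^+ 2 / 2 <= 1 / 2 by rewrite divr_ge0 ?sqr_ge0// ler_wpM2r// invr_ge0.
have := expRm1_le u0; have := expR_ge1Dx (t ^+ 2 / 2).
have -> : 2 * (t ^+ 2 / 2) ^+ 2 = t ^+ 2 * t ^+ 2 / 2 by field.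
have e4 : t ^+ 4 = t ^+ 2 * t ^+ 2 by rewrite -exprD.
rewrite e4 in hi => f1 f2.
have K0 : 0 <= K.
  by apply: Rintegral_ge0 => x _; have := cosh2_ge2 (2 * x); lra.
exact: (second_moment_squeeze t2 K0 lo hi).
Qed.

Local Notation c t := (\int[nu]_x cos (t * x)).

Let bcos (t : R) : bounded_mfun (fun x : measurableTypeR R => cos (t * x)).
Proof. by apply: bounded_mfun_cos; exact: mulrl_measurable. Qed.

Let bsin (t : R) : bounded_mfun (fun x : measurableTypeR R => sin (t * x)).
Proof. by apply: bounded_mfun_sin; exact: mulrl_measurable. Qed.

(** For independent standard X and Y, a X + b Y has the law of sqrt (a^2 + b^2) X. In the addition
    formula for the cosine, the sine terms integrate to 0 by symmetry. *)
Let std_normal_cos_mul (a b : R) : 0 <= a -> c (Num.sqrt (a ^+ 2 + b ^+ 2)) = c a * c b.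
Proof.
move=> a0.
have ma : measurable_fun [set: measurableTypeR R] (fun x : R => a * x) by exact: mulrl_measurable.
have la : std_law nu (fun x : R => a * x) (a ^+ 2).
  by move=> A mA; rewrite sqrtr_sqr ger0_norm.
have mp : measurable_fun [set: measurableTypeR R * measurableTypeR R] (fun p => a * p.1 + b * p.2).
  by apply: measurable_funD; apply: measurable_funM.
have lab := std_law_add b (sqr_ge0 a) ma la.
have bp := bounded_mfun_cos mp.
transitivity (\int[(nu \x nu)%E]_p cos (a * p.1 + b * p.2)).
  rewrite /Rintegral; congr fine; apply/esym.
  apply: (@integral_same_law R _ _ _ (measurableTypeR R * measurableTypeR R)%type
    (measurableTypeR R) (measurableTypeR R) (nu \x nu)%E nu
    (fun p => a * p.1 + b * p.2) (fun x => Num.sqrt (a ^+ 2 + b ^+ 2) * x) _ _ _ (EFin \o cos)).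
  - exact: mp.
  - exact: mulrl_measurable.
  - exact: lab.
  - by apply/measurable_EFinP; apply: continuous_measurable_fun; exact: continuous_cos.
have ip := bounded_mfun_integrable (nu \x nu)%E bp.
rewrite {1}/Rintegral -(integral12_prod_meas1 ip).
have -> : (\int[nu]_x fubini_F nu (EFin \o (fun p : measurableTypeR R * measurableTypeR R => cos (a * p.1 + b * p.2))) x
    = \int[nu]_x (cos (a * x) * c b)%:E)%E.
  apply: eq_integral => x _; rewrite /fubini_F /=.
  have -> : (\int[nu]_y (cos (a * x + b * y))%:E = (\int[nu]_y (cos (a * x) * cos (b * y) - sin (a * x) * sin (b * y)))%:E)%E.
    rewrite /Rintegral fineK.
      by apply: eq_integral => y _; rewrite cosD.
    apply: integrable_fin_num => //; apply: (bounded_mfun_integrable nu).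
    by apply: bounded_mfunB; apply: bounded_mfunZ.
  rewrite RexpectationB; [|exact: bounded_mfunZ|exact: bounded_mfunZ].
  by rewrite !RexpectationZ// Rintegral_std_normal_sin mulr0 subr0.
rewrite -[LHS]/(Rintegral nu setT (fun x => cos (a * x) * c b)).
by rewrite RintegralZr//; exact: (bounded_mfun_integrable nu).
Qed.

(* [c] and the Gaussian both satisfy h (sqrt 2 * t) = h t ^+ 2, so that iterating
   from t / sqrt 2 ^ k multiplies their distance, initially O(4^-k), by 2^k only. *)
Lemma Rintegral_std_normal_cos (t : R) : c t = expR (- (t ^+ 2 / 2)).
Proof.
wlog t0 : t / 0 <= t => [h|].
  have [/h//|/ltW t0] := leP 0 t.
  rewrite -(sqrrN t) -h ?oppr_ge0//; apply: eq_Rintegral => x _.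
  by rewrite mulNr cosN.
pose D u := `|c u - expR (- (u ^+ 2 / 2))|.
pose m4 := \int[nu]_x (x ^+ 4).
have m40 : 0 <= m4 by apply: Rintegral_ge0 => x _; rewrite exprn_even_ge0.
have D2 u : 0 <= u -> D (Num.sqrt 2 * u) <= 2 * D u.
  move=> u0; rewrite /D.
  have -> : Num.sqrt 2 * u = Num.sqrt (u ^+ 2 + u ^+ 2).
    have -> : u ^+ 2 + u ^+ 2 = 2 * u ^+ 2 by ring.
    by rewrite sqrtrM// sqrtr_sqr ger0_norm.
  rewrite std_normal_cos_mul// sqr_sqrtr ?addr_ge0 ?sqr_ge0//.
  have -> : - ((u ^+ 2 + u ^+ 2) / 2) = - (u ^+ 2 / 2) + - (u ^+ 2 / 2) by field.
  rewrite expRD; set e := expR _.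
  have e1 : `|e| <= 1 by rewrite ger0_norm ?expR_ge0// -expR0 ler_expR oppr_le0 divr_ge0// sqr_ge0.
  have c1 : `|c u| <= 1.
    apply: normr_Rexpectation_le_cst => [|x]; first exact: bcos.
    by rewrite ler_norml cos_geN1 cos_le1.
  have -> : c u * c u - e * e = (c u - e) * (c u + e) by ring.
  rewrite normrM mulrC ler_wpM2r//.
  by apply: (le_trans (ler_normD _ _)); lra.
have Dsmall u : 0 <= u <= 1 -> D u <= (m4 / 24 + 1) * u ^+ 4.
  move=> /andP[u0 u1].
  have i2' : nu.-integrable setT (EFin \o (fun x : R => u ^+ 2 / 2 * x ^+ 2)).
    by apply: integrable_RZ; exact: integrable_std_normal_sqr.
  have i2 : nu.-integrable setT (EFin \o (fun x : R => 1 - u ^+ 2 / 2 * x ^+ 2)).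
    by apply: integrable_RB => //; exact: integrable_Rcst.
  have i2E : \int[nu]_x (1 - u ^+ 2 / 2 * x ^+ 2) = 1 - u ^+ 2 / 2.
    rewrite (RintegralB measurableT (integrable_Rcst nu 1) i2').
    rewrite Rexpectation_cst (RintegralZl _ measurableT integrable_std_normal_sqr).
    by rewrite Rintegral_std_normal_sqr mulr1.
  have ic := bounded_mfun_integrable nu (bcos u).
  have h1 : `|c u - (1 - u ^+ 2 / 2)| <= u ^+ 4 / 24 * m4.
    rewrite -i2E -RintegralB// -RintegralZl//; last exact: integrable_std_normal_pow4.
    have ib := integrableB measurableT ic i2.
    apply: (le_trans (le_normr_Rintegral _ _)) => //.
    apply: le_Rintegral => //.
    - exact: (integrable_norm ib).
    - exact: (integrable_RZ (u ^+ 4 / 24) integrable_std_normal_pow4).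
    - move=> x _; have := cos_taylor (u * x); rewrite !exprMn.
      by rewrite [u ^+ 2 * _ / _]mulrAC [u ^+ 4 * _ / _]mulrAC.
  have h2 : `|expR (- (u ^+ 2 / 2)) - (1 - u ^+ 2 / 2)| <= u ^+ 4.
    set v := u ^+ 2 / 2.
    have v0 : 0 <= v by rewrite divr_ge0// sqr_ge0.
    have lo := expR_ge1Dx (- v).
    have : (1 + v) * expR (- v) <= 1.
      by rewrite expRN ler_pdivrMr ?expR_gt0// mul1r; exact: expR_ge1Dx.
    have e0 := expR_gt0 (- v).
    have -> : u ^+ 4 = (v * 2) ^+ 2 by rewrite /v divfK// -exprM.
    move=> hi; rewrite ler_norml; apply/andP; split; nra.
  rewrite /D.
  have -> : c u - expR (- (u ^+ 2 / 2)) = (c u - (1 - u ^+ 2 / 2)) - (expR (- (u ^+ 2 / 2)) - (1 - u ^+ 2 / 2)) by ring.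
  by apply: (le_trans (ler_normB _ _)); lra.
suff : D t = 0 by move=> /eqP; rewrite normr_eq0 subr_eq0 => /eqP.
have Diter k : D t <= 2 ^+ k * D (t / Num.sqrt 2 ^+ k).
  elim: k => [|k ih]; first by rewrite !expr0 divr1 mul1r.
  apply: (le_trans ih); rewrite exprSr -mulrA ler_wpM2l ?exprn_ge0//.
  have -> : t / Num.sqrt 2 ^+ k = Num.sqrt 2 * (t / Num.sqrt 2 ^+ k.+1).
    by rewrite exprS; field; rewrite expf_neq0 sqrtr_eq0 -ltNge ltr0n.
  by apply: D2; rewrite divr_ge0// exprn_ge0// sqrtr_ge0.
(* From rank [k0] on, t / sqrt 2 ^ k lies in [0, 1], where [Dsmall] applies. *)
have [k0 hk0] : exists k0 : nat, t <= Num.sqrt 2 ^+ k0.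
  have [m mt] : exists m : nat, t ^+ 2 <= m%:R.
    exists (Num.truncn (t ^+ 2)).+1; exact/ltW/truncnS_gt.
  exists m; rewrite -ler_sqr ?nnegrE// ?exprn_ge0 ?sqrtr_ge0//.
  rewrite -exprM mulnC exprM sqr_sqrtr// (le_trans mt)// -natrX ler_nat ltnW// ltn_expl//.
apply/eqP; rewrite eq_le normr_ge0 andbT.
set K := (m4 / 24 + 1) * t ^+ 4.
have bnd k : D t <= K / 2 ^+ (k0 + k).
  apply: (le_trans (Diter (k0 + k)%N)).
  have s2 : 0 < Num.sqrt 2 ^+ (k0 + k) :> R by rewrite exprn_gt0// sqrtr_gt0.
  have h : 0 <= t / Num.sqrt 2 ^+ (k0 + k) <= 1.
    rewrite divr_ge0 ?(ltW s2)//= ler_pdivrMr// mul1r (le_trans hk0)// exprD ler_peMr ?exprn_ge0 ?sqrtr_ge0//.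
    by rewrite exprn_ege1// -[leLHS]sqrtr1 ler_wsqrtr// ler1n.
  have e4 : (Num.sqrt 2 ^+ (k0 + k)) ^+ 4 = 2 ^+ (k0 + k) * 2 ^+ (k0 + k) :> R.
    by rewrite -exprMn -exprM mulnC exprM (_ : 4%N = (2 * 2)%N)// exprM sqr_sqrtr// expr2.
  have := Dsmall _ h; rewrite expr_div_n e4.
  move=> /(ler_wpM2l (exprn_ge0 (k0 + k) (ler0n R 2))) /le_trans; apply.
  rewrite /K le_eqVlt; apply/orP; left; apply/eqP; field.
  by rewrite expf_neq0.
apply/ler_addgt0Pr => e e0; rewrite add0r.
have K0 : 0 <= K by rewrite mulr_ge0 ?addr_ge0 ?divr_ge0 ?exprn_even_ge0.
pose k := Num.truncn (K / e).
apply: (le_trans (bnd k.+1)); rewrite ler_pdivrMr ?exprn_gt0// mulrC -ler_pdivrMr//.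
apply: (le_trans (ltW (truncnS_gt _))); rewrite -natrX ler_nat.
apply: (leq_trans (leq_addl k0 _)); exact/ltnW/ltn_expl.
Qed.
End StandardNormal.

Section GaussianVariableMoments.
Context (R : realType) (d : measure_display) (T : measurableType d).
Variables (P : probability T R) (Y : T -> R) (v : R).
Hypotheses (v0 : 0 <= v) (mY : measurable_fun setT Y) (Yv : std_law P Y v).
Local Notation nu := (@std_normal R).

Let integral_std_law (g : R -> \bar R) : measurable_fun setT g ->
  (\int[P]_t g (Y t) = \int[nu]_x g (Num.sqrt v * x)%R)%E.
Proof.
move=> mg; apply: (@integral_same_law R _ _ _ T (measurableTypeR R) (measurableTypeR R)
  P nu Y (fun x => Num.sqrt v * x) _ _ _ g).
- exact: mY.
- exact: mulrl_measurable.
- exact: Yv.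
- exact: mg.
Qed.

Let integrable_std_law (g : R -> \bar R) : measurable_fun setT g ->
  nu.-integrable setT (fun x : R => g (Num.sqrt v * x)) ->
  P.-integrable setT (fun t => g (Y t)).
Proof.
move=> mg; apply: (@integrable_same_law R _ _ _ T (measurableTypeR R) (measurableTypeR R)
  P nu Y (fun x => Num.sqrt v * x) _ _ _ g).
- exact: mY.
- exact: mulrl_measurable.
- exact: Yv.
- exact: mg.
Qed.

Lemma integrable_gaussian : P.-integrable setT (EFin \o Y).
Proof.
apply: (@integrable_std_law EFin); first exact: EFin_measurable.
exact: (integrable_RZ (Num.sqrt v) (@integrable_std_normal_id R)).
Qed.

Lemma integrable_gaussian_sqr : P.-integrable setT (EFin \o (fun t => Y t ^+ 2)).
Proof.
apply: (@integrable_std_law (fun y => (y ^+ 2)%:E)).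
  by apply/measurable_EFinP; exact: exprn_measurable.
have := integrable_RZ v (@integrable_std_normal_sqr R).
by congr (_.-integrable _ _); apply/funext => x; rewrite /= exprMn sqr_sqrtr.
Qed.

Lemma Rintegral_gaussian : \int[P]_t Y t = 0.
Proof.
rewrite /Rintegral (@integral_std_law EFin); last exact: EFin_measurable.
rewrite -[LHS]/(\int[nu]_x (Num.sqrt v * x)).
by rewrite (RintegralZl _ measurableT (@integrable_std_normal_id R)) Rintegral_std_normal_id mulr0.
Qed.

Lemma Rintegral_gaussian_sqr : \int[P]_t (Y t ^+ 2) = v.
Proof.
rewrite /Rintegral (@integral_std_law (fun y => (y ^+ 2)%:E)); last first.
  by apply/measurable_EFinP; exact: exprn_measurable.
rewrite -[LHS]/(\int[nu]_x ((Num.sqrt v * x) ^+ 2)).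
under eq_Rintegral => x _ do rewrite exprMn sqr_sqrtr//.
by rewrite (RintegralZl _ measurableT (@integrable_std_normal_sqr R)) Rintegral_std_normal_sqr mulr1.
Qed.

Lemma Rintegral_gaussian_cos : \int[P]_t cos (Y t) = expR (- (v / 2)).
Proof.
rewrite /Rintegral (@integral_std_law (EFin \o cos)); last first.
  by apply/measurable_EFinP; apply: continuous_measurable_fun; exact: continuous_cos.
rewrite -[LHS]/(\int[nu]_x cos (Num.sqrt v * x)).
by rewrite Rintegral_std_normal_cos sqr_sqrtr.
Qed.

Lemma Rintegral_gaussian_sin : \int[P]_t sin (Y t) = 0.
Proof.
rewrite /Rintegral (@integral_std_law (EFin \o sin)); last first.
  by apply/measurable_EFinP; apply: continuous_measurable_fun; exact: continuous_sin.
rewrite -[LHS]/(\int[nu]_x sin (Num.sqrt v * x)).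
exact: Rintegral_std_normal_sin.
Qed.
End GaussianVariableMoments.

(** * Levy's continuity theorem *)

Section BernsteinCoins.
Context (R : realType) (I : finType).
Variable u : I -> R.
Hypothesis u01 : forall l, 0 <= u l <= 1.

(** The weights of multivariate Bernstein polynomials, read as probabilities of outcomes of
    independent biased coin flips. *)
Definition coin l (b : bool) : R := if b then u l else 1 - u l.
Definition coins (w : {ffun I -> bool}) : R := \prod_l coin l (w l).

Lemma coins_ge0 w : 0 <= coins w.
Proof.
apply: prodr_ge0 => l _; rewrite /coin; have /andP[? ?] := u01 l.
by case: (w l) => //; rewrite subr_ge0.
Qed.

Lemma sum_coins_prod (F : I -> bool -> R) :
  \sum_(w : {ffun I -> bool}) \prod_l F l (w l) = \prod_l (F l true + F l false).
Proof.
rewrite -(bigA_distr_bigA (fun l b => F l b)); apply: eq_bigr => l _.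
by rewrite big_bool.
Qed.

Lemma sum_coins : \sum_w coins w = 1.
Proof.
rewrite (sum_coins_prod coin) big1// => l _.
by rewrite /coin addrC subrK.
Qed.

(** Distinct flips are uncorrelated: the sum factorizes over the coins, and the factor at [a] is the
    mean of a centered variable. *)
Lemma sum_coins_cross a b : a != b ->
  \sum_w coins w * (((w a)%:R - u a) * ((w b)%:R - u b)) = 0.
Proof.
move=> ab.
pose F l x := coin l x * (if l == a then x%:R - u a else 1) * (if l == b then x%:R - u b else 1).
transitivity (\sum_(w : {ffun I -> bool}) \prod_l F l (w l)).
  apply: eq_bigr => w _; rewrite /F !big_split/= -mulrA; congr (_ * (_ * _)).
    by rewrite (bigD1 a)//= eqxx big1 ?mulr1// => l /negbTE ->.
  by rewrite (bigD1 b)//= eqxx big1 ?mulr1// => l /negbTE ->.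
rewrite (sum_coins_prod F) (bigD1 a)//= /F eqxx (negbTE ab) /coin.
apply/eqP; rewrite mulf_eq0; apply/orP; left; apply/eqP.
by rewrite /=; ring.
Qed.

(** The variance u (1 - u) of a flip is largest at u = 1 / 2. *)
Lemma sum_coins_sqr a : \sum_w coins w * (((w a)%:R - u a) * ((w a)%:R - u a)) <= 1 / 4.
Proof.
pose F l x := coin l x * (if l == a then (x%:R - u a) * (x%:R - u a) else 1).
have -> : \sum_w coins w * (((w a)%:R - u a) * ((w a)%:R - u a)) =
    \sum_(w : {ffun I -> bool}) \prod_l F l (w l).
  apply: eq_bigr => w _; rewrite /F !big_split/=; congr (_ * _).
  by rewrite (bigD1 a)//= eqxx big1 ?mulr1// => l /negbTE ->.
rewrite (sum_coins_prod F) (bigD1 a)//= /F eqxx /coin big1 => [|l /negbTE ->]; last first.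
  by rewrite !mulr1 addrC subrK.
have : 0 <= (2 * u a - 1) ^+ 2 by exact: sqr_ge0.
by rewrite [nat_of_bool true]/= [nat_of_bool false]/= mulr1 => ?; nra.
Qed.
End BernsteinCoins.

(** * Trigonometric approximation of bounded continuous functions *)

Section TrigApprox.
Context (R : realType) (D : nat).
Implicit Types (x c : 'I_D -> R) (h : ('I_D -> R) -> R).

Definition lin c x : R := \sum_i c i * x i.

Lemma linD c c' x : lin (fun i => c i + c' i) x = lin c x + lin c' x.
Proof. by rewrite /lin -big_split/=; apply: eq_bigr => i _; rewrite mulrDl. Qed.

Lemma linB c c' x : lin (fun i => c i - c' i) x = lin c x - lin c' x.
Proof. by rewrite /lin -sumrB; apply: eq_bigr => i _; rewrite mulrBl. Qed.

Lemma measurable_lin d (T : measurableType d) c (Y : T -> 'I_D -> R) :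
  (forall i, measurable_fun setT (fun t => Y t i)) ->
  measurable_fun setT (fun t => lin c (Y t)).
Proof.
move=> mY; rewrite /lin.
have : forall s : seq 'I_D, measurable_fun setT (fun t => \sum_(i <- s) c i * Y t i).
  elim=> [|i s ih]; first by under eq_fun do rewrite big_nil; exact: measurable_cst.
  under eq_fun do rewrite big_cons.
  by apply: measurable_funD => //; apply: measurable_funM.
exact.
Qed.

Section TrigConvergence.
Context d (T : measurableType d) (P : probability T R) (V : nat -> T -> 'I_D -> R).
Context d' (T' : measurableType d') (P' : probability T' R) (W : T' -> 'I_D -> R).
Hypothesis mV : forall n i, measurable_fun setT (fun t => V n t i).
Hypothesis mW : forall i, measurable_fun setT (fun t => W t i).
Hypothesis cvg_cos : forall c,
  \int[P]_t cos (lin c (V n t)) @[n --> \oo] --> \int[P']_t cos (lin c (W t)).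
Hypothesis cvg_sin : forall c,
  \int[P]_t sin (lin c (V n t)) @[n --> \oo] --> \int[P']_t sin (lin c (W t)).

(** Test functions whose expectations converge even after multiplication by the cosine or sine of a
    linear form. Carrying this factor makes the class stable under products with sines, by the
    product-to-sum formulas. *)
Definition trig_cvg h := [/\ forall n, bounded_mfun (fun t => h (V n t)),
  bounded_mfun (fun t => h (W t)),
  forall c, \int[P]_t (h (V n t) * cos (lin c (V n t))) @[n --> \oo] -->
    \int[P']_t (h (W t) * cos (lin c (W t))) &
  forall c, \int[P]_t (h (V n t) * sin (lin c (V n t))) @[n --> \oo] -->
    \int[P']_t (h (W t) * sin (lin c (W t)))].

Let bcosV c n : bounded_mfun (fun t => cos (lin c (V n t))).
Proof. by apply: bounded_mfun_cos; exact: measurable_lin. Qed.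
Let bsinV c n : bounded_mfun (fun t => sin (lin c (V n t))).
Proof. by apply: bounded_mfun_sin; exact: measurable_lin. Qed.
Let bcosW c : bounded_mfun (fun t => cos (lin c (W t))).
Proof. by apply: bounded_mfun_cos; exact: measurable_lin. Qed.
Let bsinW c : bounded_mfun (fun t => sin (lin c (W t))).
Proof. by apply: bounded_mfun_sin; exact: measurable_lin. Qed.

Lemma trig_cvg1 : trig_cvg (fun=> 1).
Proof.
split; [by move=> n; exact: bounded_mfun_cst|exact: bounded_mfun_cst| |] => c.
  under eq_fun do under eq_Rintegral do rewrite mul1r.
  by under eq_Rintegral do rewrite mul1r; exact: cvg_cos.
under eq_fun do under eq_Rintegral do rewrite mul1r.
by under eq_Rintegral do rewrite mul1r; exact: cvg_sin.
Qed.

Lemma trig_cvg_limit h : trig_cvg h ->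
  \int[P]_t h (V n t) @[n --> \oo] --> \int[P']_t h (W t).
Proof.
move=> [_ _ + _] => /(_ (fun=> 0)).
have lin0 x : lin (fun=> 0) x = 0 by rewrite /lin big1// => i _; rewrite mul0r.
under eq_fun do under eq_Rintegral do rewrite lin0 cos0 mulr1.
by under eq_Rintegral do rewrite lin0 cos0 mulr1.
Qed.

Lemma trig_cvgZ (k : R) h : trig_cvg h -> trig_cvg (fun x => k * h x).
Proof.
move=> [bV bW hc hs]; split=> [n|| c | c].
- exact: bounded_mfunZ.
- exact: bounded_mfunZ.
- have -> : \int[P']_t (k * h (W t) * cos (lin c (W t))) = k * \int[P']_t (h (W t) * cos (lin c (W t))).
    rewrite -RexpectationZ; last by apply: bounded_mfunM.
    by apply: eq_Rintegral => t _; rewrite mulrA.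
  rewrite (_ : (fun n => _) = (fun n => k * \int[P]_t (h (V n t) * cos (lin c (V n t))))); last first.
    apply/funext => n; rewrite -RexpectationZ; last by apply: bounded_mfunM.
    by apply: eq_Rintegral => t _; rewrite mulrA.
  by apply: cvgMr; exact: hc.
- have -> : \int[P']_t (k * h (W t) * sin (lin c (W t))) = k * \int[P']_t (h (W t) * sin (lin c (W t))).
    rewrite -RexpectationZ; last by apply: bounded_mfunM.
    by apply: eq_Rintegral => t _; rewrite mulrA.
  rewrite (_ : (fun n => _) = (fun n => k * \int[P]_t (h (V n t) * sin (lin c (V n t))))); last first.
    apply/funext => n; rewrite -RexpectationZ; last by apply: bounded_mfunM.
    by apply: eq_Rintegral => t _; rewrite mulrA.
  by apply: cvgMr; exact: hs.
Qed.

Lemma trig_cvgD h k : trig_cvg h -> trig_cvg k -> trig_cvg (fun x => h x + k x).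
Proof.
move=> [bV bW hc hs] [bV' bW' hc' hs']; split=> [n|| c | c].
- exact: bounded_mfunD.
- exact: bounded_mfunD.
- under eq_fun do under eq_Rintegral do rewrite mulrDl.
  under eq_Rintegral do rewrite mulrDl.
  rewrite RexpectationD; [|exact: bounded_mfunM|exact: bounded_mfunM].
  rewrite (_ : (fun n => _) = (fun n => \int[P]_t (h (V n t) * cos (lin c (V n t))) +
      \int[P]_t (k (V n t) * cos (lin c (V n t))))); first exact: (cvgD (hc c) (hc' c)).
  by apply/funext => n; rewrite RexpectationD//; exact: bounded_mfunM.
- under eq_fun do under eq_Rintegral do rewrite mulrDl.
  under eq_Rintegral do rewrite mulrDl.
  rewrite RexpectationD; [|exact: bounded_mfunM|exact: bounded_mfunM].
  rewrite (_ : (fun n => _) = (fun n => \int[P]_t (h (V n t) * sin (lin c (V n t))) +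
      \int[P]_t (k (V n t) * sin (lin c (V n t))))); first exact: (cvgD (hs c) (hs' c)).
  by apply/funext => n; rewrite RexpectationD//; exact: bounded_mfunM.
Qed.

Lemma trig_cvg_sum (J : Type) (s : seq J) (F : J -> ('I_D -> R) -> R) :
  (forall j, trig_cvg (F j)) -> trig_cvg (fun x => \sum_(j <- s) F j x).
Proof.
move=> hF; elim: s => [|j s ih].
  rewrite (_ : (fun x => _) = (fun x => 0 * 1)); first exact: trig_cvgZ trig_cvg1.
  by apply/funext => x; rewrite big_nil mul0r.
rewrite (_ : (fun x => _) = (fun x => F j x + \sum_(i <- s) F i x)); first exact: trig_cvgD.
by apply/funext => x; rewrite big_cons.
Qed.

Lemma trig_cvg_sin_mul h a : trig_cvg h -> trig_cvg (fun x => sin (lin a x) * h x).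
Proof.
move=> hh; have [bV bW hc hs] := hh; split=> [n|| c | c].
- exact: bounded_mfunM.
- exact: bounded_mfunM.
- pose k x := 2^-1 * (h x * sin (lin (fun i => a i + c i) x) + h x * sin (lin (fun i => a i - c i) x)).
  have kE x : sin (lin a x) * h x * cos (lin c x) = k x.
    by rewrite /k linB linD sinD sinB; field.
  under eq_fun do under eq_Rintegral do rewrite kE.
  under eq_Rintegral do rewrite kE.
  rewrite /k RexpectationZ; last by apply: bounded_mfunD; exact: bounded_mfunM.
  rewrite RexpectationD; [|exact: bounded_mfunM|exact: bounded_mfunM].
  rewrite (_ : (fun n => _) = (fun n => 2^-1 * (\int[P]_t (h (V n t) * sin (lin (fun i => a i + c i) (V n t))) +
      \int[P]_t (h (V n t) * sin (lin (fun i => a i - c i) (V n t)))))).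
    by apply: cvgMr; apply: cvgD; exact: hs.
  apply/funext => n; rewrite RexpectationZ; last by apply: bounded_mfunD; exact: bounded_mfunM.
  by rewrite RexpectationD//; exact: bounded_mfunM.
- pose k x := 2^-1 * (h x * cos (lin (fun i => a i - c i) x) - h x * cos (lin (fun i => a i + c i) x)).
  have kE x : sin (lin a x) * h x * sin (lin c x) = k x.
    by rewrite /k (linB a c) (linD a c) cosB cosD; field.
  under eq_fun do under eq_Rintegral do rewrite kE.
  under eq_Rintegral do rewrite kE.
  rewrite /k RexpectationZ; last by apply: bounded_mfunB; exact: bounded_mfunM.
  rewrite RexpectationB; [|exact: bounded_mfunM|exact: bounded_mfunM].
  rewrite (_ : (fun n => _) = (fun n => 2^-1 * (\int[P]_t (h (V n t) * cos (lin (fun i => a i - c i) (V n t))) -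
      \int[P]_t (h (V n t) * cos (lin (fun i => a i + c i) (V n t)))))).
    by apply: cvgMr; apply: cvgB; exact: hc.
  apply/funext => n; rewrite RexpectationZ; last by apply: bounded_mfunB; exact: bounded_mfunM.
  by rewrite RexpectationB//; exact: bounded_mfunM.
Qed.

Section Levy.
Variable g : 'rV[R]_D -> R.
Hypothesis cg : continuous g.
Variable M : R.
Hypothesis gM : forall y, `|g y| <= M.

Let toV x : 'rV[R]_D := \row_i x i.

Let M0 : 0 <= M.
Proof. exact: le_trans (gM 0). Qed.

Let one_le_pihalf : (1 : R) <= pi / 2.
Proof. by have := @pi_ge2 R; lra. Qed.

Let in_pihalf (y : R) : -1 <= y <= 1 -> y \in `[- (pi / 2), pi / 2].
Proof.
by have := one_le_pihalf => ? /andP[? ?]; rewrite in_itv/=; apply/andP; split; lra.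
Qed.

Let sin_mono_le (y z : R) : -1 <= y <= 1 -> -1 <= z <= 1 -> (sin y <= sin z) = (y <= z).
Proof.
move=> /in_pihalf hy /in_pihalf hz.
by rewrite !leNgt; congr negb; exact: ltr_sin.
Qed.

Let sin1_gt0 : 0 < sin 1 :> R.
Proof.
rewrite -sin0 ltNge sin_mono_le ?ler10//; apply/andP; split; lra.
Qed.

Let sin1_lt1 : sin 1 < 1 :> R.
Proof.
have := cos2Dsin2 (1 : R); have := @cos1_gt0 R; have := sin_le1 (1 : R).
by nra.
Qed.

Let cos_ge_cos1 (y : R) : -1 <= y <= 1 -> cos 1 <= cos y.
Proof.
have pos z : 0 <= z <= 1 -> cos 1 <= cos z :> R.
  move=> /andP[z0]; rewrite le_eqVlt => /predU1P[->//|z1].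
  apply: ltW; rewrite ltr_cos ?in_itv/=//; have := @pi_ge2 R => *; apply/andP; split; lra.
move=> /andP[y1 y2]; have [y0|/ltW y0] := leP 0 y; first by apply: pos; rewrite y0.
by rewrite -[cos y]cosN; apply: pos; apply/andP; split; lra.
Qed.

(** Mean value theorem: the derivative of the sine is at least cos 1 on [-1, 1]. *)
Let sin_expand (y z : R) : -1 <= y <= 1 -> -1 <= z <= 1 -> cos 1 * `|y - z| <= `|sin y - sin z|.
Proof.
wlog yz : y z / y < z => [h|] hy hz.
  have [yz|zy|->] := ltgtP y z; first exact: h.
    by rewrite distrC (distrC (sin y)); exact: h.
  by rewrite !subrr normr0 mulr0.
have [c /[!in_itv]/= /andP[c0 c1] fE] := @MVT R sin cos y z yz (fun (x : R) _ => is_derive_sin x)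
  (continuous_subspaceT (@continuous_sin R)).
rewrite distrC (distrC (sin y)) fE normrM ler_wpM2r//.
have hc : -1 <= c <= 1 by move: hy hz => /andP[? ?] /andP[? ?]; apply/andP; split; lra.
have := cos_ge_cos1 hc; have := @cos1_gt0 R => ? ?.
by rewrite ger0_norm//; lra.
Qed.

Let clamp (y : R) : R := Num.max (- sin 1) (Num.min (sin 1) y).

Let clamp_bounds y : - sin 1 <= clamp y <= sin 1.
Proof.
rewrite /clamp le_max lexx/= ge_max ge_min lexx/= andbT.
by have := sin1_gt0; lra.
Qed.

Let clamp_dist y z : - sin 1 <= z <= sin 1 -> `|clamp y - z| <= `|y - z|.
Proof.
move=> /andP[z1 z2]; rewrite /clamp minEle maxEle; have s0 := sin1_gt0.
have n1 := ler_norm (y - z); have n2 := ler_norm (- (y - z)); rewrite normrN in n2.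
rewrite ler_norml; move: n1 n2; set nn := `|_|; move: s0 z1 z2; set c := sin 1 => s0 z1 z2 n1 n2.
by case: (lerP c y) => h1; [case: (lerP (- c) c) => h2|case: (lerP (- c) y) => h2];
  apply/andP; split; lra.
Qed.

(* [back L] inverts x |-> (1 + sin (x / L)) / 2, coordinate by coordinate,
   for x in [-L, L]; clamping keeps it Lipschitz. *)
Let back1 (L v : R) : R := L * asin (clamp (2 * v - 1)).
Let back (L : R) (v : 'I_D -> R) : 'rV[R]_D := \row_i back1 L (v i).

Let fwd (L : R) x (i : 'I_D) : R := (1 + sin (x i / L)) / 2.

(** Put y = x i / L. Clamping brings 2 v - 1 no farther from sin y, and by [sin_expand] the inverse
    of the sine stretches distances by at most 1 / cos 1 there. *)
Let back1_dist L x i (v : R) : 0 < L -> `|x i| <= L ->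
  `|back1 L v - x i| <= 2 * L / cos 1 * `|v - fwd L x i|.
Proof.
move=> L0 xL; set y := x i / L.
have xE : x i = L * y by rewrite /y mulrC divfK// gt_eqF.
have hy : -1 <= y <= 1 by rewrite -ler_norml /y normrM normfV (gtr0_norm L0) ler_pdivrMr// mul1r.
rewrite /back1 xE -mulrBr normrM (gtr0_norm L0) -!mulrA mulrCA ler_wpM2l ?(ltW L0)//.
set a := asin _; have c1 := @cos1_gt0 R.
have /andP[cl1 cl2] := clamp_bounds (2 * v - 1).
have s1 := sin1_lt1.
have cli : -1 <= clamp (2 * v - 1) <= 1 by apply/andP; split; lra.
have sa : sin a = clamp (2 * v - 1) by rewrite /a asinK// in_itv.
have [a1 a2] := (asin_geNpi2 cli, asin_lepi2 cli).
have ai : a \in `[- (pi / 2), pi / 2] by rewrite in_itv/= a1 a2.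
have h1 : 1 \in `[- (pi / 2) : R, pi / 2] by apply: in_pihalf; apply/andP; split; lra.
have h2 : -1 \in `[- (pi / 2) : R, pi / 2] by apply: in_pihalf; apply/andP; split; lra.
have ha : -1 <= a <= 1.
  apply/andP; split; rewrite leNgt; apply/negP.
    by rewrite -ltr_sin// sa sinN; lra.
  by rewrite -ltr_sin// sa; lra.
have hsy : - sin 1 <= sin y <= sin 1.
  have n1 : -1 <= (-1 : R) <= 1.
    apply/andP; split; first exact: lexx.
    lra.
  have p1 : -1 <= (1 : R) <= 1.
    by apply/andP; split; lra.
  by rewrite -sinN !sin_mono_le.
have := sin_expand ha hy; rewrite sa => h.
have := clamp_dist (2 * v - 1) hsy => h'.
have e : `|2 * v - 1 - sin y| = 2 * `|v - fwd L x i|.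
  have -> : 2 * v - 1 - sin y = 2 * (v - fwd L x i) by rewrite /fwd -/y; field.
  by rewrite normrM ger0_norm.
rewrite e in h'.
rewrite mulrA -ler_pdivrMl ?invr_gt0// ?divr_gt0// invf_div.
by rewrite mulrAC ler_pdivrMr//; lra.
Qed.

Let fwd01 L x i : 0 <= fwd L x i <= 1.
Proof.
by rewrite /fwd; have := sin_geN1 (x i / L); have := sin_le1 (x i / L) => ? ?; apply/andP; split; lra.
Qed.

(** Uniform continuity near a cube, with only [u] confined to it; compactness in its covering form
    provides the common radius. *)
Let unif_g L (e : R) : 0 < e -> exists2 r : R, 0 < r &
  forall u v : 'rV[R]_D, (forall i, `|u ord0 i| <= L) ->
    (forall i, `|u ord0 i - v ord0 i| < r) -> `|g u - g v| <= e.
Proof.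
move=> e0; pose K : set 'rV[R]_D := [set u | forall i, `[- L, L]%classic (u ord0 i)].
have cK : compact K.
  exact: (@rV_compact R D (fun=> `[- L, L]%classic) (fun _ => @segment_compact _ _ _)).
have : near_covering K by exact/compact_near_coveringP.
move=> /(_ R (0^'+) (fun r u => forall v : 'rV[R]_D,
  (forall i, `|u ord0 i - v ord0 i| < r) -> `|g u - g v| <= e)) [].
  move=> u _; have e2 : 0 < e / 2 by lra.
  have cgu : continuous_at u g := @cg u.
  move/cvgrPdist_lt: cgu => /(_ _ e2).
  rewrite -nbhs_ballE => -[r/= r0 hr].
  exists (ball u (r / 2), [set q : R | q < r / 2]).
    split; first by apply: nbhsx_ballx; rewrite divr_gt0.
    by apply: nbhs_right_lt; rewrite divr_gt0.
  move=> [w q] /= [uw qr] v wv.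
  have uw' : ball u r w by apply: le_ball uw; lra.
  have uv : ball u r v.
    split=> // i j; have := uw.2 i j; rewrite /ball/= => uwij.
    have := wv j; rewrite (ord1 i) in uwij *; move=> wvj.
    have := ler_distD (w ord0 j) (u ord0 j) (v ord0 j); lra.
  have h1 := hr _ uw'; have h2 := hr _ uv.
  apply: (le_trans (ler_distD (g u) (g w) (g v))); rewrite (distrC (g w)) (splitr e).
  by apply: ltW; apply: ltrD.
move=> r /= r0 hr; exists (r / 2); first by rewrite divr_gt0.
move=> u v uL uv; apply: (hr (r / 2)) => //=.
- by rewrite sub0r normrN gtr0_norm ?divr_gt0//; lra.
- by rewrite divr_gt0.
- by move=> i; rewrite /= in_itv/= -ler_norml.
Qed.

Let avg N (w : {ffun 'I_D * 'I_N -> bool}) (i : 'I_D) : R :=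
  N%:R^-1 * \sum_(j < N) (w (i, j))%:R.

(** The input of Chebyshev's inequality: the square of the mean deviation has N^2 terms, but only
    the N diagonal ones survive, each at most 1 / 4. *)
Let sum_avg N (f : 'I_D -> R) i : (0 < N)%N -> (forall i, 0 <= f i <= 1) ->
  \sum_w coins (fun l : 'I_D * 'I_N => f l.1) w * (avg w i - f i) ^+ 2 <= N%:R^-1.
Proof.
move=> N0 f01; have N0' : (0 : R) < N%:R by rewrite ltr0n.
set u := fun l : 'I_D * 'I_N => f l.1.
have u01 l : 0 <= u l <= 1 by exact: f01.
have -> : \sum_w coins u w * (avg w i - f i) ^+ 2 =
   N%:R ^- 2 * \sum_(j < N) \sum_(k < N) \sum_w coins u w *
     (((w (i, j))%:R - u (i, j)) * ((w (i, k))%:R - u (i, k))).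
  rewrite (eq_bigr (fun j => \sum_w \sum_(k < N) coins u w *
     (((w (i, j))%:R - u (i, j)) * ((w (i, k))%:R - u (i, k))))); last first.
    by move=> j _; rewrite exchange_big.
  rewrite exchange_big/= mulr_sumr; apply: eq_bigr => w _.
  have -> : avg w i - f i = N%:R^-1 * \sum_(j < N) ((w (i, j))%:R - u (i, j)).
    rewrite sumrB mulrBr; congr (_ - _).
    by rewrite /u/= sumr_const card_ord -[f i *+ N]mulr_natl mulKf// gt_eqF.
  rewrite exprMn exprVn mulrCA; congr (_ * _).
  rewrite expr2 big_distrlr/= mulr_sumr; apply: eq_bigr => j _.
  by rewrite mulr_sumr.
have h : \sum_(j < N) \sum_(k < N) \sum_w coins u w *
     (((w (i, j))%:R - u (i, j)) * ((w (i, k))%:R - u (i, k))) <= \sum_(j < N) 1.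
  apply: ler_sum => j _; pose F (k : 'I_N) := \sum_w coins u w *
     (((w (i, j))%:R - u (i, j)) * ((w (i, k))%:R - u (i, k))).
  rewrite [leLHS](_ : _ = F j); last first.
    rewrite -[LHS]/(\sum_(k < N) F k) (bigD1 j)//= big1 ?addr0// => k kj.
    by apply: sum_coins_cross; apply: contra kj => /eqP[->].
  by apply: (le_trans (sum_coins_sqr _ _)); lra.
rewrite sumr_const card_ord in h.
rewrite -exprVn expr2 -mulrA ler_piMr ?invr_ge0 ?(ltW N0')//.
by rewrite mulrC ler_pdivrMr// mul1r.
Qed.

Definition trig_poly (N : nat) (L : R) x : R :=
  \sum_(w : {ffun 'I_D * 'I_N -> bool})
     coins (fun l => fwd L x l.1) w * g (back L (avg w)).

(* The Bernstein polynomial of [g \o back L] at [fwd L x] is a polynomial in the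
   sin (x i / L), so that its expectations converge. *)
Lemma trig_poly_cvg N L : trig_cvg (trig_poly N L).
Proof.
apply: trig_cvg_sum => w.
under eq_fun do rewrite mulrC.
apply: trig_cvgZ; rewrite /coins.
elim: (index_enum _) => [|l s ih].
  by under eq_fun do rewrite big_nil; exact: trig_cvg1.
pose a (i : 'I_D) : R := if i == l.1 then L^-1 else 0.
have linE x : lin a x = x l.1 / L.
  rewrite /lin (bigD1 l.1)//= /a eqxx big1 ?addr0 1?mulrC// => i /negbTE ->.
  by rewrite mul0r.
pose b : R := if w l then 1 / 2 else - (1 / 2).
rewrite (_ : (fun x => _) = (fun x => 2^-1 * \prod_(l <- s) coin (fun l0 => fwd L x l0.1) l (w l)
    + b * (sin (lin a x) * \prod_(l <- s) coin (fun l0 => fwd L x l0.1) l (w l)))).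
  by apply: trig_cvgD; [exact: trig_cvgZ|apply: trig_cvgZ; exact: trig_cvg_sin_mul].
apply/funext => x; rewrite big_cons linE /coin /fwd /b; set p := \prod_(_ <- _) _.
by case: (w l); field.
Qed.

Lemma bounded_mfun_trig_poly N L d1 (T1 : measurableType d1) (Y : T1 -> 'I_D -> R) :
  (forall i, measurable_fun setT (fun t => Y t i)) ->
  bounded_mfun (fun t => trig_poly N L (Y t)).
Proof.
move=> mY; apply: bounded_mfun_sum => w.
apply: bounded_mfunM; last exact: bounded_mfun_cst.
rewrite /coins; elim: (index_enum _) => [|l s ih].
  by under eq_fun do rewrite big_nil; exact: bounded_mfun_cst.
under eq_fun do rewrite big_cons.
apply: bounded_mfunM => //.
have bs : bounded_mfun (fun t => fwd L (Y t) l.1).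
  under eq_fun do rewrite /fwd mulrC.
  apply: bounded_mfunZ; apply: bounded_mfunD; first exact: bounded_mfun_cst.
  by apply: bounded_mfun_sin; apply: measurable_funM.
rewrite /coin; case: (w l) => //.
by apply: bounded_mfunB => //; exact: bounded_mfun_cst.
Qed.

Lemma trig_poly_le N L x : `|trig_poly N L x| <= M.
Proof.
have c0 := @coins_ge0 R _ (fun l : 'I_D * 'I_N => fwd L x l.1) (fun l => fwd01 L x l.1).
apply: (le_trans (ler_norm_sum _ _ _)).
apply: (@le_trans _ _ (\sum_w coins (fun l : 'I_D * 'I_N => fwd L x l.1) w * M)).
  by apply: ler_sum => w _; rewrite normrM (ger0_norm (c0 w)) ler_wpM2l.
by rewrite -mulr_suml sum_coins// mul1r.
Qed.

(** Bernstein's proof of the Weierstrass theorem. Outcomes whose averages are all within [dl] of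
    their means contribute at most e / 2 by continuity; the others contribute at most 2 M times a
    probability bounded by Chebyshev's inequality. *)
Lemma trig_poly_approx L e : 0 < L -> 0 < e -> exists N, forall x,
  (forall i, `|x i| <= L) -> `|trig_poly N L x - g (toV x)| <= e.
Proof.
move=> L0 e0; have e2 : 0 < e / 2 by lra.
have [r r0 hr] := unif_g L e2.
have c1 := @cos1_gt0 R.
(* The Lipschitz constant 2 L / cos 1 of [back1_dist] turns [dl] into [r]. *)
pose dl := r * cos 1 / (2 * L).
have dl0 : 0 < dl by rewrite divr_gt0 ?mulr_gt0.
(* Chebyshev's inequality summed over the D coordinates bounds the second contribution by B / N. *)
pose B := 2 * M * dl ^- 2 * D%:R.
have B0 : 0 <= B by rewrite !mulr_ge0// invr_ge0 sqr_ge0.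
pose N := (Num.truncn (B / (e / 2))).+1.
exists N => x xL.
set p := coins (fun l : 'I_D * 'I_N => fwd L x l.1).
have p0 w : 0 <= p w := @coins_ge0 R _ (fun l : 'I_D * 'I_N => fwd L x l.1) (fun l => fwd01 L x l.1) w.
have -> : trig_poly N L x - g (toV x) = \sum_w p w * (g (back L (avg w)) - g (toV x)).
  under [RHS]eq_bigr do rewrite mulrBr.
  by rewrite sumrB -mulr_suml sum_coins// mul1r.
have bnd (w : {ffun 'I_D * 'I_N -> bool}) : `|g (back L (avg w)) - g (toV x)| <=
    e / 2 + 2 * M * dl ^- 2 * \sum_i (avg w i - fwd L x i) ^+ 2.
  have s0 : 0 <= \sum_i (avg w i - fwd L x i) ^+ 2 by apply: sumr_ge0 => i _; exact: sqr_ge0.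
  have [h|/existsNP[i /negP]] := pselect (forall i, `|avg w i - fwd L x i| < dl).
    apply: (@le_trans _ _ (e / 2)); last by rewrite lerDl !mulr_ge0// invr_ge0 sqr_ge0.
    rewrite distrC; apply: hr => i; rewrite !mxE// distrC.
    apply: (le_lt_trans (back1_dist _ L0 (xL i))).
    rewrite -ltr_pdivlMl ?divr_gt0 ?mulr_gt0// invf_div mulrC mulrA.
    exact: h.
  rewrite -leNgt => h.
  apply: (@le_trans _ _ (2 * M)).
    by rewrite mulr_natl mulr2n (le_trans (ler_normB _ _))// lerD.
  apply: (@le_trans _ _ (2 * M * dl ^- 2 * \sum_i (avg w i - fwd L x i) ^+ 2)); last by rewrite lerDr ltW.
  rewrite -mulrA ler_peMr ?mulr_ge0// mulrC ler_pdivlMr ?exprn_gt0// mul1r.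
  rewrite (bigD1 i)//= -[leLHS]addr0 lerD//.
    by rewrite -[leRHS]real_normK ?num_real// lerXn2r// nnegrE ltW.
  by apply: sumr_ge0 => k _; exact: sqr_ge0.
apply: (le_trans (ler_norm_sum _ _ _)).
apply: (@le_trans _ _ (\sum_w p w * (e / 2 + 2 * M * dl ^- 2 * \sum_i (avg w i - fwd L x i) ^+ 2))).
  by apply: ler_sum => w _; rewrite normrM (ger0_norm (p0 w)) ler_wpM2l.
under eq_bigr do rewrite mulrDr.
rewrite big_split/= -mulr_suml sum_coins// mul1r.
suff h : \sum_w p w * (2 * M * dl ^- 2 * \sum_i (avg w i - fwd L x i) ^+ 2) <= e / 2 by lra.
have -> : \sum_w p w * (2 * M * dl ^- 2 * \sum_i (avg w i - fwd L x i) ^+ 2) =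
    2 * M * dl ^- 2 * \sum_i \sum_w p w * (avg w i - fwd L x i) ^+ 2.
  rewrite exchange_big/= mulr_sumr; apply: eq_bigr => w _.
  by rewrite mulrCA; congr (_ * _); rewrite mulr_sumr.
apply: (@le_trans _ _ (2 * M * dl ^- 2 * \sum_(i < D) N%:R^-1)).
  apply: ler_wpM2l; first by rewrite !mulr_ge0// invr_ge0 sqr_ge0.
  by apply: ler_sum => i _; apply: sum_avg => // j; exact: fwd01.
rewrite sumr_const card_ord -[_ *+ D]mulr_natr mulrA mulrAC -/B.
rewrite ler_pdivrMr ?ltr0n// mulrC -ler_pdivrMr//.
exact/ltW/truncnS_gt.
Qed.

(** Measurability holds because g is a pointwise limit of trigonometric polynomials on growing
    cubes, and these are measurable functions of the coordinates. *)
Lemma bounded_mfun_row_comp d1 (T1 : measurableType d1) (Y : T1 -> 'I_D -> R) :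
  (forall i, measurable_fun setT (fun t => Y t i)) ->
  bounded_mfun (fun t => g (toV (Y t))).
Proof.
move=> mY; split; last by exists M => t.
have /choice[N hN] : forall k : nat, exists N, forall x, (forall i, `|x i| <= k.+1%:R) ->
    `|trig_poly N k.+1%:R x - g (toV x)| <= k.+1%:R^-1.
  by move=> k; apply: trig_poly_approx; rewrite ?invr_gt0 ltr0n.
apply: (@measurable_fun_cvg _ _ _ _ (fun k t => trig_poly (N k) k.+1%:R (Y t))).
  by move=> k; exact: (bounded_mfun_trig_poly _ _ mY).1.
move=> t _; apply/cvgrPdist_le => e e0.
pose K := (Num.truncn (\sum_i `|Y t i|)).+1.
have hK i : `|Y t i| <= K%:R.
  apply: (le_trans _ (ltW (truncnS_gt _))).
  by rewrite (bigD1 i)//= lerDl sumr_ge0.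
near=> k; rewrite distrC; apply: (le_trans (hN k _ _)).
  move=> i; apply: (le_trans (hK i)); rewrite ler_nat.
  by near: k; exists K => // k /= /leqW.
rewrite -[leRHS]invrK lef_pV2 ?posrE ?invr_gt0// ?ltr0n//.
apply: (le_trans (ltW (truncnS_gt _))); rewrite ler_nat ltnS.
by near: k; exists (Num.truncn e^-1).
Unshelve. all: by end_near. Qed.

Hypothesis tightV : forall e : R, 0 < e -> exists2 L : R, 0 < L &
  \forall n \near \oo, fine (P [set t | exists i, L < `|V n t i|]) <= e.
Hypothesis tightW : forall e : R, 0 < e -> exists2 L : R, 0 < L &
  fine (P' [set t | exists i, L < `|W t i|]) <= e.

Let measurable_out d1 (T1 : measurableType d1) (Y : T1 -> 'I_D -> R) (L : R) :
  (forall i, measurable_fun setT (fun t => Y t i)) ->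
  measurable [set t | exists i, L < `|Y t i|].
Proof.
move=> mY; rewrite (_ : [set t | _] = \bigcup_(i in [set: 'I_D]) [set t | L < `|Y t i|]).
  apply: fin_bigcup_measurable => // i _.
  rewrite -[X in measurable X]setTI.
  have mi : measurable_fun setT (fun t => `|Y t i|).
    by apply: measurableT_comp => //; exact: normr_measurable.
  exact: (measurable_fun_ltr (measurable_cst _) mi).
by apply/seteqP; split => t /=; [move=> [i hi]; exists i|move=> [i _ hi]; exists i].
Qed.

Let approx_bound d1 (T1 : measurableType d1) (Q : probability T1 R) (Y : T1 -> 'I_D -> R)
    N (L e : R) : (forall i, measurable_fun setT (fun t => Y t i)) ->
  (forall x, (forall i, `|x i| <= L) -> `|trig_poly N L x - g (toV x)| <= e) -> 0 <= e ->
  `|\int[Q]_t trig_poly N L (Y t) - \int[Q]_t g (toV (Y t))| <=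
  e + 2 * M * fine (Q [set t | exists i, L < `|Y t i|]).
Proof.
move=> mY he e0; have bt := bounded_mfun_trig_poly N L mY.
have bg := bounded_mfun_row_comp mY.
have mo := measurable_out L mY.
rewrite -RexpectationB//.
have -> : e + 2 * M * fine (Q [set t | exists i, L < `|Y t i|]) =
    \int[Q]_t (e + 2 * M * \1_[set t | exists i, L < `|Y t i|] t).
  rewrite RexpectationD; [|exact: bounded_mfun_cst|apply: bounded_mfunZ; exact: bounded_mfun_indic].
  rewrite Rexpectation_cst RexpectationZ; last exact: bounded_mfun_indic.
  by rewrite Rexpectation_indic.
apply: normr_Rexpectation_le; first exact: bounded_mfunB.
  apply: bounded_mfunD; first exact: bounded_mfun_cst.
  by apply: bounded_mfunZ; exact: bounded_mfun_indic.
move=> t; rewrite indicE; case: (pselect (exists i, L < `|Y t i|)) => h.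
  rewrite mem_set// mulr1 (le_trans (ler_normB _ _))//.
  have := trig_poly_le N L (Y t); have := gM (toV (Y t)) => *; lra.
rewrite memNset// mulr0 addr0; apply: he => i.
by rewrite leNgt; apply/negP => h'; apply: h; exists i.
Qed.

(** The error e is shared out as e / 4 for each of the two replacements of g by a trigonometric
    polynomial and e / 2 for the convergence of its expectations. Tightness controls the
    replacements outside a cube. *)
Lemma levy_cvg :
  \int[P]_t g (toV (V n t)) @[n --> \oo] --> \int[P']_t g (toV (W t)).
Proof.
apply/cvgrPdist_le => e e0.
(* Outside the cube the error is at most 2 M per unit of probability, and probability [q] costs at
   most e / 8. The summand 1 keeps the denominator positive when M = 0. *)
pose q := e / (16 * (M + 1)).
have M1 : 0 < M + 1 by have := M0; lra.
have q0 : 0 < q by rewrite divr_gt0// mulr_gt0.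
have q2 : 2 * M * q <= e / 8.
  rewrite /q mulrA ler_pdivrMr ?mulr_gt0//.
  have -> : e / 8 * (16 * (M + 1)) = 2 * M * e + 2 * e by field.
  by lra.
have [L1 L10 hL1] := tightV q0; have [L2 L20 hL2] := tightW q0.
pose L := Num.max L1 L2.
have L0 : 0 < L by rewrite lt_max L10.
have e8 : 0 < e / 8 by lra.
have [N hN] := trig_poly_approx L0 e8.
have hW : `|\int[P']_t trig_poly N L (W t) - \int[P']_t g (toV (W t))| <= e / 4.
  apply: (le_trans (approx_bound P' mW hN (ltW e8))).
  have : fine (P' [set t | exists i, L < `|W t i|]) <= q.
    apply: le_trans hL2; apply: fine_le; rewrite ?fin_num_measure//; [exact: measurable_out|exact: measurable_out|].
    apply: le_measure; rewrite ?inE; [exact: measurable_out|exact: measurable_out|].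
    by move=> t [i hi]; exists i; apply: le_lt_trans hi; rewrite le_max lexx orbT.
  move=> h; have : 2 * M * fine (P' [set t | exists i, L < `|W t i|]) <= 2 * M * q.
    by rewrite ler_wpM2l// mulr_ge0.
  by lra.
have /cvgrPdist_le /(_ _ (divr_gt0 e0 (ltr0n _ 2))) hB := trig_cvg_limit (trig_poly_cvg N L).
near=> n.
have hV : `|\int[P]_t trig_poly N L (V n t) - \int[P]_t g (toV (V n t))| <= e / 4.
  apply: (le_trans (approx_bound P (mV n) hN (ltW e8))).
  have : fine (P [set t | exists i, L < `|V n t i|]) <= q.
    apply: (@le_trans _ _ (fine (P [set t | exists i, L1 < `|V n t i|]))); last by near: n.
    apply: fine_le; rewrite ?fin_num_measure//; [exact: measurable_out|exact: measurable_out|].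
    apply: le_measure; rewrite ?inE; [exact: measurable_out|exact: measurable_out|].
    by move=> t [i hi]; exists i; apply: le_lt_trans hi; rewrite le_max lexx.
  move=> h; have : 2 * M * fine (P [set t | exists i, L < `|V n t i|]) <= 2 * M * q.
    by rewrite ler_wpM2l// mulr_ge0.
  by lra.
have hn : `|\int[P']_t trig_poly N L (W t) - \int[P]_t trig_poly N L (V n t)| <= e / 2 by near: n.
move: hW hV hn; move: (\int[P']_t trig_poly _ _ _) (\int[P']_t g _) (\int[P]_t trig_poly _ _ _) (\int[P]_t g _) => a b c f.
rewrite !ler_norml => /andP[? ?] /andP[? ?] /andP[? ?]; apply/andP; split; lra.
Unshelve. all: by end_near. Qed.
End Levy.
End TrigConvergence.
End TrigApprox.

(** * Plane integrals of homogeneous kernels *)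

Section PlaneIntegral.
Context (R : realType).
Local Notation lam := (@lebesgue_measure R).
Local Notation RR := (measurableTypeR R * measurableTypeR R)%type.
Local Open Scope ereal_scope.

(** Tonelli's theorem and the reflections x -> a - x and y -> b - y, which preserve Lebesgue
    measure. *)
Lemma lebesgue_measureC_integral (a b : R) (G : R -> R -> \bar R) :
  measurable_fun setT (fun p : RR => G p.1 p.2) ->
  (forall x y, 0 <= G x y) ->
  \int[@lebesgue_measureC R]_z G (a - complex.Re z)%R (b - complex.Im z)%R =
  \int[lam \x lam]_p G p.1 p.2.
Proof.
move=> mG G0.
have mG2 (c e : R) : measurable_fun setT (fun p : RR => G (c - p.1) (e - p.2))%R.
  have mc : measurable_fun setT (fun p : RR => ((c - p.1, e - p.2) : RR))%R.
    by apply/measurable_fun_pairP; split => /=; apply: measurable_funB => //.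
  exact: (measurableT_comp mG mc).
have mG1 x : measurable_fun setT (G x).
  exact: (measurableT_comp mG (@pair1_measurable _ _ (measurableTypeR R) (measurableTypeR R) x)).
transitivity (\int[lam \x lam]_(p in setT) (G (a - p.1)%R (b - p.2)%R)).
  rewrite /lebesgue_measureC ge0_integral_pushforward//.
  - exact: measurable_complex_of_pair.
  - have mc : measurable_fun setT (fun z : R[i] => ((a - complex.Re z, b - complex.Im z) : RR))%R.
      apply/measurable_fun_pairP; split => /=; apply: measurable_funB => //.
        exact: measurable_Re.
      exact: measurable_Im.
    exact: (measurableT_comp mG mc).
rewrite (@fubini_tonelli1 _ _ _ _ _ lam lam (fun p => G (a - p.1)%R (b - p.2)%R))//.
rewrite (@fubini_tonelli1 _ _ _ _ _ lam lam (fun p => G p.1 p.2) mG (fun p => G0 p.1 p.2)).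
rewrite /fubini_F/=.
have mF : measurable_fun setT (fun x => \int[lam]_y G x y).
  exact: (@measurable_fun_fubini_tonelli_F _ _ _ _ R lam (fun p => G p.1 p.2)).

have n1 : (-1 : R)%R != 0%R by rewrite oppr_eq0 oner_neq0.
rewrite [RHS](@ge0_integral_affine R a (-1) setT)//; last first.
  by move=> x; apply: integral_ge0.
rewrite normrN1 mul1e preimage_setT; apply: eq_integral => x _.
rewrite [RHS](@ge0_integral_affine R b (-1) setT)//.
rewrite normrN1 mul1e preimage_setT /affine !mulN1r.
by apply: eq_integral => y _; rewrite mulN1r.
Qed.

(** The square annulus e < max (|x|, |y|) <= rho, cut along the diagonals because each of the two
    parts has its own substitution. *)
Definition sup_annulus (e rho x y : R) : bool :=
  ((`|y| <= `|x|) && (e < `|x| <= rho) || (`|x| < `|y|) && (e < `|y| <= rho))%R.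

Lemma measurable_natb d (T : measurableType d) (b : T -> bool) :
  measurable_fun setT b -> measurable_fun setT (fun t => (b t)%:R : R)%R.
Proof.
move=> mb; rewrite (_ : (fun t => _) = (fun t => if b t then 1 else 0)%R).
  exact: measurable_fun_ifT.
by apply/funext => t; case: (b t).
Qed.

(* On each half of a square annulus, |y| <= |x| or |x| < |y|, the substitution
   y = x * u (or x = y * u) separates a homogeneous kernel. *)
Section Homogeneous.
Variables (h : R -> R) (phi : R -> R -> R) (e rho : R).
Hypothesis e0 : (0 <= e)%R.
Hypothesis mphi : measurable_fun setT (fun p : RR => phi p.1 p.2).
Hypothesis mh : measurable_fun setT h.
Hypothesis phi0 : (forall x y, 0 <= phi x y)%R.
Hypothesis phi_hom : (forall r x y, r != 0 -> phi (r * x) (r * y) = h `|r| * phi x y)%R.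

Let shell (x : R) : bool := (e < `|x| <= rho)%R.

Let mshell d (T : measurableType d) (f : T -> R) : measurable_fun setT f ->
  measurable_fun setT (fun t => shell (f t)).
Proof.
move=> mf; have mn : measurable_fun setT (fun t => `|f t|%R) by exact: measurableT_comp.
by apply: measurable_and; [exact: measurable_fun_ltr|exact: measurable_fun_ler].
Qed.

Let inner_shell (b : R -> R -> bool) (c : R -> bool) (psi : R -> R -> R) x :
  (forall r y, r != 0 -> b r (r * y) = c y)%R ->
  measurable_fun setT (b x) -> measurable_fun setT (psi x) ->
  (forall x y, 0 <= psi x y)%R ->
  (forall r y, r != 0 -> psi r (r * y) = h `|r| * psi 1%R y)%R ->
  measurable_fun setT c -> measurable_fun setT (psi 1%R) -> (h `|x| >= 0)%R ->
  \int[lam]_y (psi x y * (b x y && shell x)%:R)%:E =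
  \int[lam]_y (psi 1%R y * (c y)%:R)%:E * ((shell x)%:R * (h `|x| * `|x|))%:E.
Proof.
move=> bc mb mpsi psi0 psi_hom mc mpsi1 h0.
have [sx|sx] := boolP (shell x); last first.
  rewrite mul0r mule0; apply: integral0_eq => y _.
  by rewrite andbF mulr0.
have x0 : x != 0%R.
  by apply: contraTneq sx => ->; rewrite /shell normr0 ltNge e0.
rewrite (@ge0_integral_affine R 0 x setT)//; last 2 first.
- apply/measurable_EFinP; apply: measurable_funM => //.
  apply: measurable_natb; rewrite (_ : (fun t => _) = b x)//.
  by apply/funext => y; rewrite andbT.
- by move=> y; rewrite lee_fin mulr_ge0.
rewrite preimage_setT.
rewrite (_ : (fun y => _) = (fun y => (h `|x|)%:E * (psi 1%R y * (c y)%:R)%:E)).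
  rewrite ge0_integralZl_EFin//.
  - by rewrite mul1r muleA -EFinM muleC mulrC.
  - by move=> y _; rewrite lee_fin mulr_ge0.
  - by apply/measurable_EFinP; apply: measurable_funM => //; exact: measurable_natb.
apply/funext => y; rewrite /affine add0r psi_hom// bc// andbT -EFinM.
by rewrite mulrA.
Qed.

Let mphi1 x : measurable_fun setT (phi x).
Proof. exact: (measurableT_comp mphi (@pair1_measurable _ _ (measurableTypeR R) (measurableTypeR R) x)). Qed.
Let mphi2 y : measurable_fun setT (phi ^~ y).
Proof. exact: (measurableT_comp mphi (@pair2_measurable _ _ (measurableTypeR R) (measurableTypeR R) y)). Qed.

(** The endpoints form a null set. One part of the annulus contains the diagonals and the other does
    not, so that both the closed and the open interval occur. *)
Let itv_indic (b : bool) (f : R -> R) : measurable_fun setT f -> (forall y, 0 <= f y)%R ->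
  \int[lam]_y (f y * (if b then `|y| < 1 else `|y| <= 1)%R%:R)%:E =
  \int[lam]_(y in `[(-1)%R, 1%R]) (f y)%:E.
Proof.
move=> mf f0; transitivity (\int[lam]_(y in [set` Interval (BSide (~~ b) (-1)%R) (BSide b 1%R)]) (f y)%:E).
  rewrite [RHS]integral_mkcond; apply: eq_integral => y _; rewrite patchE mem_setE in_itv/=.
  case: b; rewrite /= ?lteif ?ltr_norml ?ler_norml; case: ifP => _; by rewrite ?mulr1 ?mulr0.
have mE : measurable_fun (`](-1)%R, 1%R[%classic : set (measurableTypeR R)) (EFin \o f).
  by apply: measurable_funTS; exact/measurable_EFinP.
have oo b0 b1 := @integral_itv_bndoo R (-1)%R 1%R (EFin \o f) b0 b1 mE.
exact: (etrans (oo _ _) (esym (oo _ _))).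
Qed.

Lemma homogeneous_plane_integral : (forall r, 0 <= h r)%R ->
  \int[lam \x lam]_p (phi p.1 p.2 * (sup_annulus e rho p.1 p.2)%:R)%:E =
  (\int[lam]_(t in `[(-1)%R, 1%R]) (phi 1 t)%:E + \int[lam]_(t in `[(-1)%R, 1%R]) (phi t 1)%:E) *
  \int[lam]_x ((e < `|x| <= rho)%R%:R * (h `|x| * `|x|))%:E.
Proof.
move=> h0.
have m1 : measurable_fun setT (fun p : RR => p.1) by exact: measurable_fst.
have m2 : measurable_fun setT (fun p : RR => p.2) by exact: measurable_snd.
have mn1 : measurable_fun setT (fun p : RR => `|p.1|%R) by exact: measurableT_comp.
have mn2 : measurable_fun setT (fun p : RR => `|p.2|%R) by exact: measurableT_comp.
pose f1 (p : RR) := (phi p.1 p.2 * ((`|p.2| <= `|p.1|)%R && shell p.1)%:R)%:E.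
pose f2 (p : RR) := (phi p.1 p.2 * ((`|p.1| < `|p.2|)%R && shell p.2)%:R)%:E.
have mf1 : measurable_fun setT f1.
  apply/measurable_EFinP; apply: measurable_funM => //; apply: measurable_natb.
  by apply: measurable_and; [exact: measurable_fun_ler|exact: mshell].
have mf2 : measurable_fun setT f2.
  apply/measurable_EFinP; apply: measurable_funM => //; apply: measurable_natb.
  by apply: measurable_and; [exact: measurable_fun_ltr|exact: mshell].
have f10 p : 0 <= f1 p by rewrite lee_fin mulr_ge0.
have f20 p : 0 <= f2 p by rewrite lee_fin mulr_ge0.
transitivity (\int[lam \x lam]_p (f1 p + f2 p)).
  apply: eq_integral => -[x y] _; rewrite /f1 /f2/= -EFinD -mulrDr; congr (_ * _)%:E.
  rewrite /sup_annulus -/(shell x) -/(shell y) ltNge.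
  by case: (_ <= _)%R; rewrite /= ?orbF ?addr0 ?add0r.
rewrite ge0_integralD//.
rewrite (@fubini_tonelli1 _ _ _ _ _ lam lam f1)// (@fubini_tonelli2 _ _ _ _ _ lam lam f2)//.
rewrite /fubini_F /fubini_G /f1 /f2/=.
have mH : measurable_fun setT (fun x => ((shell x)%:R * (h `|x| * `|x|))%:E).
  apply/measurable_EFinP; apply: measurable_funM; first exact/measurable_natb/mshell.
  have mn0 : measurable_fun setT (fun x : R => `|x|%R) by exact: normr_measurable.
  by apply: measurable_funM => //; exact: measurableT_comp.
have I1 x : \int[lam]_y (phi x y * ((`|y| <= `|x|)%R && shell x)%:R)%:E =
    \int[lam]_y (phi 1 y * (`|y| <= 1)%R%:R)%:E * ((shell x)%:R * (h `|x| * `|x|))%:E.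
  apply: (@inner_shell (fun x y => `|y| <= `|x|)%R (fun y => `|y| <= 1)%R phi) => //.
  - by move=> r y r0; rewrite normrM ger_pMr ?normr_gt0.
  - by apply: measurable_fun_ler => //; exact: measurableT_comp.
  - by move=> r y r0; rewrite -{1}[r]mulr1 phi_hom.
  - by apply: measurable_fun_ler => //; exact: measurableT_comp.
have I2 x : \int[lam]_y (phi y x * ((`|y| < `|x|)%R && shell x)%:R)%:E =
    \int[lam]_y (phi y 1 * (`|y| < 1)%R%:R)%:E * ((shell x)%:R * (h `|x| * `|x|))%:E.
  apply: (@inner_shell (fun x y => `|y| < `|x|)%R (fun y => `|y| < 1)%R (fun x y => phi y x)) => //.
  - by move=> r y r0; rewrite normrM gtr_pMr ?normr_gt0.
  - by apply: measurable_fun_ltr => //; exact: measurableT_comp.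
  - by move=> r y r0; rewrite -{2}[r]mulr1 phi_hom.
  - by apply: measurable_fun_ltr => //; exact: measurableT_comp.
under eq_integral => x _ do rewrite I1.
under [X in _ + X]eq_integral => x _ do rewrite I2.
rewrite (itv_indic false)// (itv_indic true)//.
have mHk k : 0 <= k -> \int[lam]_x (k * ((shell x)%:R * (h `|x| * `|x|))%:E) = k * \int[lam]_x ((shell x)%:R * (h `|x| * `|x|))%:E.
  move=> k0; rewrite ge0_integralZl// => x _; by rewrite lee_fin !mulr_ge0.
rewrite !mHk ?integral_ge0//; last 2 first.
  by move=> ? _; rewrite lee_fin.
  by move=> ? _; rewrite lee_fin.
have k1 : 0 <= \int[lam]_(y in `[(-1)%R, 1%R]) (phi 1 y)%:E by apply: integral_ge0 => ? _; rewrite lee_fin.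
have k2 : 0 <= \int[lam]_(y in `[(-1)%R, 1%R]) (phi y 1)%:E by apply: integral_ge0 => ? _; rewrite lee_fin.
exact/esym/ge0_muleDl.
Qed.
End Homogeneous.
End PlaneIntegral.


(** * Explicit integrals on the line *)

Section KernelIntegrals.
Context (R : realType).
Local Notation lam := (@lebesgue_measure R).


Lemma integral_is_derive (f F : R -> R) (a b : R) : a < b ->
  (forall x, a <= x <= b -> is_derive x (1 : R) F (f x)) ->
  (forall x, a <= x <= b -> {for x, continuous f}) ->
  (\int[lam]_(x in `[a, b]) (f x)%:E = (F b - F a)%:E)%E.
Proof.
move=> ab dF cf.
have cF x : a <= x <= b -> {for x, continuous F}.
  by move=> xab; apply: differentiable_continuous; apply/derivable1_diffP; have [] := dF x xab.
rewrite (@continuous_FTC2 R f F)//.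
- by apply: continuous_in_subspaceT => x; rewrite inE/= in_itv/=; exact: cf.
- split.
  + by move=> x; rewrite in_itv/= => /andP[xa xb]; have [] := dF x _; rewrite ?ltW.
  + by apply: cvg_at_right_filter; apply: cF; rewrite lexx ltW.
  + by apply: cvg_at_left_filter; apply: cF; rewrite lexx ltW.
- move=> x; rewrite in_itv/= => /andP[xa xb]; rewrite derive1E.
  by have h := dF x _; apply: derive_val; apply: h; rewrite !ltW.
Qed.

Lemma integral_shell_inv (e rho : R) : 0 < e -> e < rho ->
  (\int[lam]_x (((e < `|x|) && (`|x| <= rho))%:R * `|x|^-1)%:E = (2 * ln (rho / e))%:E)%E.
Proof.
move=> e0 er.
pose A : set (measurableTypeR R) := `]e, rho]%classic.
pose B : set (measurableTypeR R) := `[- rho, - e[%classic.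
have mA : measurable A by exact: measurable_itv.
have mB : measurable B by exact: measurable_itv.
have mn0 : measurable_fun setT (fun x : R => `|x|) by exact: normr_measurable.
have minv : measurable_fun setT (fun x : R => (`|x|^-1)%:E).
  by apply/measurable_EFinP; exact: measurable_fun_invr_ge0.
transitivity (\int[lam]_(x in A `|` B) (`|x|^-1)%:E)%E.
  rewrite [RHS]integral_mkcond; apply: eq_integral => x _; rewrite patchE.
  have -> : (x \in A `|` B) = (e < `|x|) && (`|x| <= rho).
    apply/idP/idP; rewrite inE /A /B /= !in_itv/=.
      case=> /andP[h1 h2].
        by rewrite gtr0_norm ?h1 ?h2//; lra.
      by rewrite ltr0_norm; [apply/andP; split; lra|lra].
    move=> /andP[h1 h2]; have [x0|x0] := lerP 0 x.
      by left; rewrite ger0_norm// in h1 h2; rewrite h1.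
    by right; rewrite ltr0_norm// in h1 h2; apply/andP; split; lra.
  by case: ifP => _; rewrite ?mul1r ?mul0r.
rewrite ge0_integral_setU//; first last.
- apply/disj_setPS => x [] /=; rewrite /A /B /= !in_itv/= => /andP[? ?] /andP[? ?]; lra.
- exact: measurable_funTS.
have toc u v b0 b1 : (\int[lam]_(x in [set` Interval (BSide b0 u) (BSide b1 v)]) (`|x|^-1)%:E =
    \int[lam]_(x in `[u, v]) (`|x|^-1)%:E)%E.
  have mE : measurable_fun (`]u, v[%classic : set (measurableTypeR R)) (fun x : R => (`|x|^-1)%:E).
    exact: measurable_funTS.
  have oo c0 c1 := @integral_itv_bndoo R u v (fun x => (`|x|^-1)%:E) c0 c1 mE.
  exact: (etrans (oo _ _) (esym (oo _ _))).
rewrite /A /B !toc.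
have -> : (\int[lam]_(x in `[e, rho]) (`|x|^-1)%:E = (ln rho - ln e)%:E)%E.
  transitivity (\int[lam]_(x in `[e, rho]) (x^-1)%:E)%E; last apply: integral_is_derive => //.
  - apply: eq_integral => x; rewrite inE/= in_itv/= => /andP[ex _].
    by rewrite gtr0_norm//; lra.
  - by move=> x /andP[ex _]; apply: is_derive1_ln; lra.
  - move=> x /andP[ex _]; apply: cvgV; last exact: cvg_id.
    by rewrite gt_eqF//; lra.
have -> : (\int[lam]_(x in `[(- rho)%R, (- e)%R]) (`|x|^-1)%:E = (ln rho - ln e)%:E)%E.
  rewrite (_ : ln rho - ln e = - ln (- - e) - - ln (- - rho)); last by rewrite !opprK; ring.
  transitivity (\int[lam]_(x in `[(- rho)%R, (- e)%R]) ((- x)^-1)%:E)%E;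
    last apply: (@integral_is_derive (fun x => (- x)^-1) (fun x => - ln (- x))).
  - apply: eq_integral => x; rewrite inE/= in_itv/= => /andP[_ ex].
    by rewrite ltr0_norm//; lra.
  - by lra.
  - move=> x /andP[_ ex].
    have x0 : 0 < - x by lra.
    have dl := is_derive1_ln x0.
    have dn := @is_derive1_comp R (@ln R) -%R x _ _ dl (is_deriveNid x 1).
    by apply: is_derive_eq; rewrite mulrN1 opprK.
  - move=> x /andP[_ ex]; apply: cvgV; last by apply: cvgN; exact: cvg_id.
    by rewrite gt_eqF//; lra.
by rewrite -EFinD ln_div ?posrE//; [congr (_%:E); ring|lra].
Qed.

Lemma integral_shell_le (rho : R) : 0 <= rho ->
  (\int[lam]_x (((0 < `|x|) && (`|x| <= rho))%:R * 1)%:E <= (2 * rho)%:E)%E.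
Proof.
move=> r0.
pose D : set (measurableTypeR R) := `[- rho, rho]%classic.
have mD : measurable D by exact: measurable_itv.
apply: (@le_trans _ _ (\int[lam]_x (\1_D x)%:E)%E).
  apply: ge0_le_integral => //.
  - apply/measurable_EFinP; apply: measurable_funM => //; apply: measurable_natb.
    have mn0 : measurable_fun setT (fun x : R => `|x|) by exact: normr_measurable.
    by apply: measurable_and; [exact: measurable_fun_ltr|exact: measurable_fun_ler].
  - by apply/measurable_EFinP; exact: measurable_indic.
  - move=> x _; rewrite lee_fin mulr1 indicE /D mem_setE in_itv/= -ler_norml.
    by case: (0 < `|x|) => //=; exact: ler0n.
rewrite integral_indic// setIT.
rewrite [leLHS](_ : _ = (if (- rho)%:E < rho%:E then rho%:E - (- rho)%:E else 0)%E); last first.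
  exact: (@lebesgue_measure_itv R `[- rho, rho]).
rewrite lte_fin.
case: ifP => _; last by rewrite lee_fin mulr_ge0.
by rewrite -EFinB lee_fin opprK; lra.
Qed.

(** For z = x + i y this is the square of a Re (1 / z) + b Im (1 / z), a kernel homogeneous of
    degree -2. *)
Definition inv_form (a b x y : R) : R := (a * x - b * y) ^+ 2 / (x ^+ 2 + y ^+ 2) ^+ 2.

(** Added to the same integral with [a] and [b] exchanged, this gives (a^2 + b^2) pi / 2. Together
    with the factor 2 of the shell integral it is the origin of the pi in the variance. *)
Lemma integral_inv_form (a b : R) :
  (\int[lam]_(t in `[(-1)%R, 1%R]) (inv_form a b 1 t)%:E =
   (a ^+ 2 * (1 / 2 + pi / 4) + b ^+ 2 * (pi / 4 - 1 / 2))%:E)%E.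
Proof.
pose F (t : R) := a ^+ 2 * (t / (2 * (1 + t ^+ 2)) + atan t / 2) +
  b ^+ 2 * (atan t / 2 - t / (2 * (1 + t ^+ 2))) + a * b / (1 + t ^+ 2).
have h0 (t : R) : 1 + t ^+ 2 != 0 by rewrite gt_eqF// ltr_pwDl// sqr_ge0.
have dF (t : R) : is_derive t (1 : R) F (inv_form a b 1 t).
  have d1 : is_derive t (1 : R) (fun t : R => 1 + t ^+ 2) (2 * t).
    by apply: is_derive_eq; rewrite /= add0r -[_ *: _]/(_ * _)/= ; ring.
  have d2 : is_derive t (1 : R) (fun t : R => (1 + t ^+ 2)^-1) (- (1 + t ^+ 2) ^- 2 *: (2 * t)).
    exact: is_deriveV.
  rewrite /F.
  have -> : (fun t => a ^+ 2 * (t / (2 * (1 + t ^+ 2)) + atan t / 2) +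
  b ^+ 2 * (atan t / 2 - t / (2 * (1 + t ^+ 2))) + a * b / (1 + t ^+ 2)) =
    (fun t => (a ^+ 2 + b ^+ 2) / 2 * atan t + ((a ^+ 2 - b ^+ 2) / 2 * t + a * b) * (1 + t ^+ 2)^-1).
    by apply/funext => u; field.
  apply: is_derive_eq.
  rewrite /= -![_ *: _]/(_ * _) /inv_form; field.
  exact: h0.
have cf : continuous (fun t => inv_form a b 1 t).
  have c1 : continuous (fun t : R => a * 1 - b * t).
    by move=> t; apply: cvgB; [exact: cvg_cst|apply: cvgMr; exact: cvg_id].
  have c2 : continuous (fun t : R => 1 ^+ 2 + t ^+ 2).
    by move=> t; apply: cvgD; [exact: cvg_cst|exact: exprn_continuous].
  move=> t; rewrite /inv_form; apply: cvgM.
    by rewrite expr2; apply: cvgM; exact: c1.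
  apply: cvgV; first by rewrite expf_neq0// expr1n.
  by rewrite expr2; apply: cvgM; exact: c2.
have n11 : (-1 : R) < 1 by lra.
rewrite (@integral_is_derive (fun t => inv_form a b 1 t) F (-1) 1 n11)//; last by move=> x _; exact: cf.
by rewrite /F atanN atan1 sqrrN expr1n; congr (_%:E); field.
Qed.
End KernelIntegrals.

(** * The truncated Cauchy kernel *)

Section SupNorm.
Context (R : realType).
Local Notation N := (@Normc.normc R).
Implicit Types z xi : R[i].

(** Its balls are squares, on which Tonelli's theorem applies directly; it is equivalent to the
    modulus up to the factor 2. *)
Definition supnorm z : R := Num.max `|complex.Re z| `|complex.Im z|.

Lemma supnorm_ge0 z : 0 <= supnorm z.
Proof. by rewrite le_max normr_ge0. Qed.

Lemma sup_annulusE e rho z :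
  sup_annulus e rho (complex.Re z) (complex.Im z) = (e < supnorm z) && (supnorm z <= rho).
Proof.
rewrite /sup_annulus /supnorm; set x := `|complex.Re z|; set y := `|complex.Im z|.
by case: (ltgtP x y) => [h|h|->]; rewrite ?orbF ?andbF.
Qed.

Lemma supnorm_le_normc z : supnorm z <= N z.
Proof. by rewrite ge_max Re_le_normc Im_le_normc. Qed.

Lemma normc_le_supnorm z : N z <= 2 * supnorm z.
Proof.
rewrite (le_trans (normc_le_ReIm z))// mulr_natl mulr2n.
by rewrite lerD// /supnorm le_max lexx ?orbT.
Qed.

Lemma measurable_supnorm d (T : measurableType d) (f : T -> R[i]) :
  measurable_fun setT f -> measurable_fun setT (fun t => supnorm (f t)).
Proof.
move=> /measurable_complexP[fr fi].
have nr : measurable_fun setT (fun t => `|complex.Re (f t)|) by exact: measurableT_comp.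
have ni : measurable_fun setT (fun t => `|complex.Im (f t)|) by exact: measurableT_comp.
exact: measurable_maxr.
Qed.

Definition trunc_inv xi (e : R) x : R[i] :=
  if e < supnorm (xi - x) then (xi - x)^-1 else 0.

Lemma normc_trunc_inv xi e x : 0 < e -> N (trunc_inv xi e x) <= e^-1.
Proof.
move=> e0; rewrite /trunc_inv; case: ifPn => h; last by rewrite Normc.normc0 invr_ge0 ltW.
have hN : e < N (xi - x) by apply: lt_le_trans (supnorm_le_normc _).
by rewrite Normc.normcV lef_pV2 ?posrE ?ltW// (lt_trans e0).
Qed.

Lemma measurable_trunc_inv xi e : measurable_fun setT (trunc_inv xi e).
Proof.
have ms : measurable_fun setT (fun x : R[i] => xi - x).
  by apply: measurable_complexB; [exact: measurable_cst|exact: measurable_id].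
apply: measurable_fun_ifT.
- by apply: measurable_fun_ltr => //; exact: measurable_supnorm.
- exact: measurable_complexV.
- exact: measurable_cst.
Qed.

Lemma bounded_mfun_Re_trunc_inv xi e : 0 < e ->
  bounded_mfun (fun x => complex.Re (trunc_inv xi e x)).
Proof.
move=> e0; have /measurable_complexP[mr mi] := measurable_trunc_inv xi e.
by split=> //; exists e^-1 => x; rewrite (le_trans (Re_le_normc _))// normc_trunc_inv.
Qed.

Lemma bounded_mfun_Im_trunc_inv xi e : 0 < e ->
  bounded_mfun (fun x => complex.Im (trunc_inv xi e x)).
Proof.
move=> e0; have /measurable_complexP[mr mi] := measurable_trunc_inv xi e.
by split=> //; exists e^-1 => x; rewrite (le_trans (Im_le_normc _))// normc_trunc_inv.
Qed.

Lemma inv_formE (a b : R) z :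
  (a * complex.Re z^-1 + b * complex.Im z^-1) ^+ 2 = inv_form a b (complex.Re z) (complex.Im z).
Proof.
case: z => x y; rewrite /inv_form.
have -> : (x +i* y)^-1 = (x / (x ^+ 2 + y ^+ 2)) +i* - (y / (x ^+ 2 + y ^+ 2)) by [].
by rewrite /= mulrN !mulrA -mulrBl expr_div_n.
Qed.

Lemma inv_form_le (a b : R) z :
  inv_form a b (complex.Re z) (complex.Im z) <= (a ^+ 2 + b ^+ 2) * (N z) ^- 2.
Proof.
have -> : N z ^+ 2 = complex.Re z ^+ 2 + complex.Im z ^+ 2.
  by case: z => x y /=; rewrite sqr_sqrtr// addr_ge0 ?sqr_ge0.
rewrite /inv_form; set x := complex.Re z; set y := complex.Im z.
have s0 : 0 <= x ^+ 2 + y ^+ 2 by rewrite addr_ge0 ?sqr_ge0.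
have [->|sn0] := eqVneq (x ^+ 2 + y ^+ 2) 0; first by rewrite expr0n/= invr0 !mulr0.
rewrite [X in _ / X]expr2 invfM mulrA ler_wpM2r ?invr_ge0// ler_pdivrMr ?lt_def ?sn0//.
rewrite -subr_ge0; have -> : (a ^+ 2 + b ^+ 2) * (x ^+ 2 + y ^+ 2) - (a * x - b * y) ^+ 2 = (a * y + b * x) ^+ 2 by ring.
exact: sqr_ge0.
Qed.

Lemma inv_form_ge0 (a b x y : R) : 0 <= inv_form a b x y.
Proof. by rewrite mulr_ge0 ?invr_ge0 ?sqr_ge0. Qed.

End SupNorm.

(** * Integrals of the Cauchy kernel over squares and square annuli *)

Section PlaneKernels.
Context (R : realType).
Local Notation lam := (@lebesgue_measure R).
Local Notation lamC := (@lebesgue_measureC R).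
Local Notation RR := (measurableTypeR R * measurableTypeR R)%type.
Local Notation N := (@Normc.normc R).
Variable xi : R[i].

Lemma lebesgue_measureC_square (e : R) : 0 <= e ->
  lamC [set z | supnorm (xi - z) <= e] = (4 * e ^+ 2)%:E.
Proof.
move=> e0; rewrite /lebesgue_measureC /pushforward.
have itvE (c : R) : lam `[c - e, c + e] = (2 * e)%:E.
  rewrite lebesgue_measure_itv/= lte_fin; case: ifPn => h.
    by rewrite -EFinB; congr (_%:E); ring.
  by congr (_%:E); lra.
have -> : @complex_of_pair R @^-1` [set z | supnorm (xi - z) <= e] =
   `[complex.Re xi - e, complex.Re xi + e] `*` `[complex.Im xi - e, complex.Im xi + e].
  apply/seteqP; split => -[x y]; rewrite /= /complex_of_pair/= !in_itv/= /supnorm ReB ImB/=.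
    rewrite ge_max !ler_norml => /andP[/andP[? ?] /andP[? ?]].
    by split; apply/andP; split; lra.
  move=> [/andP[? ?] /andP[? ?]]; rewrite ge_max !ler_norml.
  by apply/andP; split; apply/andP; split; lra.
transitivity (lam `[(complex.Re xi - e)%R, (complex.Re xi + e)%R] *
  lam `[(complex.Im xi - e)%R, (complex.Im xi + e)%R])%E.
  by apply: product_measure1E; exact: measurable_itv.
by rewrite !itvE -EFinM; congr (_%:E); ring.
Qed.

Let measurable_inv_form (a b : R) : measurable_fun setT (fun p : RR => inv_form a b p.1 p.2).
Proof.
have m1 : measurable_fun setT (fun p : RR => p.1) by exact: measurable_fst.
have m2 : measurable_fun setT (fun p : RR => p.2) by exact: measurable_snd.
apply: measurable_funM.
  by apply: measurable_funX; apply: measurable_funB; apply: measurable_funM.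
apply: measurable_fun_invr_ge0; first by move=> p; exact: sqr_ge0.
by apply: measurable_funX; apply: measurable_funD; apply: measurable_funX.
Qed.

Let measurable_sup_annulus (e rho : R) :
  measurable_fun setT (fun p : RR => (sup_annulus e rho p.1 p.2)%:R : R).
Proof.
have m1 : measurable_fun setT (fun p : RR => `|p.1|) by apply: measurableT_comp => //; exact: measurable_fst.
have m2 : measurable_fun setT (fun p : RR => `|p.2|) by apply: measurableT_comp => //; exact: measurable_snd.
apply: measurable_natb; apply: measurable_or; apply: measurable_and.
- exact: measurable_fun_ler.
- by apply: measurable_and; [exact: measurable_fun_ltr|exact: measurable_fun_ler].
- exact: measurable_fun_ltr.
- by apply: measurable_and; [exact: measurable_fun_ltr|exact: measurable_fun_ler].
Qed.

Lemma integral_annulus_inv_form (a b e rho : R) : 0 < e -> e < rho ->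
  (\int[lamC]_z (inv_form a b (complex.Re (xi - z)) (complex.Im (xi - z)) *
     ((e < supnorm (xi - z)) && (supnorm (xi - z) <= rho))%:R)%:E =
   (pi * (a ^+ 2 + b ^+ 2) * ln (rho / e))%:E)%E.
Proof.
move=> e0 er.
under eq_integral => z _ do rewrite -sup_annulusE ReB ImB.
rewrite (@lebesgue_measureC_integral R (complex.Re xi) (complex.Im xi)
  (fun x y => (inv_form a b x y * (sup_annulus e rho x y)%:R)%:E)); last 2 first.
- by apply/measurable_EFinP; exact: measurable_funM.
- by move=> x y; rewrite lee_fin mulr_ge0// inv_form_ge0.
rewrite (@homogeneous_plane_integral R (fun r => r ^- 2))//.
- rewrite integral_inv_form.
  under [X in (_ + X)%E]eq_integral => t _.
    rewrite (_ : inv_form a b t 1 = inv_form b a 1 t); last first.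
      by rewrite /inv_form; congr (_ / _ ^+ 2); ring.
    over.
  rewrite integral_inv_form.
  under eq_integral => x _.
    rewrite (_ : `|x| ^- 2 * `|x| = `|x|^-1); last first.
      have [->|x0] := eqVneq `|x| 0; first by rewrite mulr0 invr0.
      by rewrite expr2 invfM -mulrA mulVf// mulr1.
    over.
  by rewrite integral_shell_inv// -EFinD -EFinM; congr (_%:E); field.
- exact: ltW.
- apply: measurable_fun_invr_ge0; first by move=> p; exact: sqr_ge0.
  exact: measurable_funX.
- by move=> x y; exact: inv_form_ge0.
- move=> r x y r0; rewrite /inv_form.
  rewrite real_normK ?num_real// !exprMn.
  have [h|h] := eqVneq (x ^+ 2 + y ^+ 2) 0.
    by rewrite h -mulrDr h mulr0 expr0n/= invr0 !mulr0.
  field.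
  by rewrite h r0 !exprMn -mulrDr mulf_neq0// sqrf_eq0.
- by move=> r; rewrite invr_ge0 sqr_ge0.
Qed.

(** The kernel 1 / |z| is homogeneous of degree -1 and at most 1 on the lines x = 1 and y = 1. Each
    side contributes at most 2 and the shell at most 2 rho. *)
Lemma integral_square_inv_normc (rho : R) : 0 <= rho ->
  (\int[lamC]_z ((N (xi - z))^-1 * ((0 < supnorm (xi - z)) && (supnorm (xi - z) <= rho))%:R)%:E
   <= (8 * rho)%:E)%E.
Proof.
move=> r0; pose phi (x y : R) := (N (x +i* y))^-1.
have phi0 x y : 0 <= phi x y by rewrite invr_ge0 normc_ge0.
have mphi : measurable_fun setT (fun p : RR => phi p.1 p.2).
  apply: measurable_fun_invr_ge0; first by move=> p; exact: normc_ge0.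
  exact: (measurable_normc (@measurable_complex_of_pair R)).
have mphi1 x : measurable_fun setT (phi x).
  exact: (measurableT_comp mphi (@pair1_measurable _ _ (measurableTypeR R) (measurableTypeR R) x)).
have mphi2 y : measurable_fun setT (phi ^~ y).
  exact: (measurableT_comp mphi (@pair2_measurable _ _ (measurableTypeR R) (measurableTypeR R) y)).
have phi1 x y : x = 1 \/ y = 1 -> phi x y <= 1.
  move=> xy; rewrite /phi invf_le1//.
    have := Re_le_normc (x +i* y); have := Im_le_normc (x +i* y); rewrite /=.
    by case: xy => ->; rewrite normr1.
  rewrite normc_gt0; apply/eqP => -[x0 y0]; case: xy; rewrite ?x0 ?y0 => /eqP;
    by rewrite eq_sym oner_eq0.
have mn0 : measurable_fun setT (fun x : R => `|x|) by exact: normr_measurable.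
have mninv : measurable_fun setT (fun r : R => `|r|^-1) by exact: measurable_fun_invr_ge0.
have Nphi z : (N z)^-1 = phi (complex.Re z) (complex.Im z) by case: z.
under eq_integral => z _ do rewrite -sup_annulusE Nphi ReB ImB.
rewrite (@lebesgue_measureC_integral R (complex.Re xi) (complex.Im xi)
  (fun x y => (phi x y * (sup_annulus 0 rho x y)%:R)%:E)); last 2 first.
- by apply/measurable_EFinP; exact: measurable_funM.
- by move=> x y; rewrite lee_fin mulr_ge0.
rewrite (@homogeneous_plane_integral R (fun r => `|r|^-1))//.
- have K (psi : R -> R) : measurable_fun setT psi -> (forall t, 0 <= psi t <= 1) ->
     (\int[lam]_(t in `[(-1)%R, 1%R]) (psi t)%:E <= 2%:E)%E.
    move=> mpsi psi1.
    apply: (@le_trans _ _ (\int[lam]_(t in `[(-1)%R, 1%R]) (cst 1 t))%E).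
      apply: ge0_le_integral => //.
      + by move=> t _; rewrite lee_fin; have /andP[] := psi1 t.
      + by apply: measurable_funTS; exact/measurable_EFinP.
      + by move=> t _; rewrite lee_fin; have /andP[] := psi1 t.
    rewrite integral_cst//= mul1e lebesgue_measure_itv/= lte_fin.
    by case: ifP => _; rewrite -?EFinD lee_fin; lra.
  apply: (@le_trans _ _ ((2%:E + 2%:E) * (2 * rho)%:E)%E); last first.
    by rewrite -EFinD -EFinM lee_fin; lra.
  apply: lee_pmul.
  + by apply: adde_ge0; apply: integral_ge0 => ? _; rewrite lee_fin.
  + by apply: integral_ge0 => ? _; rewrite lee_fin !mulr_ge0// invr_ge0.
  + apply: leeD; apply: K.
    * exact: mphi1.
    * by move=> t; rewrite phi0 phi1//; left.
    * exact: mphi2.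
    * by move=> t; rewrite phi0 phi1//; right.
  + apply: le_trans (integral_shell_le r0).
    apply: ge0_le_integral => //.
    * apply/measurable_EFinP; apply: measurable_funM => //.
        apply: measurable_natb.
        by apply: measurable_and; [exact: measurable_fun_ltr|exact: measurable_fun_ler].
      by apply: measurable_funM => //; exact: (measurableT_comp mninv mn0).
    * apply/measurable_EFinP; apply: measurable_funM => //; apply: measurable_natb.
      by apply: measurable_and; [exact: measurable_fun_ltr|exact: measurable_fun_ler].
    * move=> x _; rewrite lee_fin; case: ltP => x0 //=; last by rewrite !mul0r.
      by rewrite normr_id mulVf// gt_eqF.
- move=> r x y _; rewrite /phi.
  have -> : (r * x) +i* (r * y) = r%:C * (x +i* y) by apply/eqP; rewrite eq_complex/= !mul0r subr0 addr0 !eqxx.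
  by rewrite Normc.normcM invfM normr_id; congr (_^-1 * _); rewrite /= expr0n addr0 sqrtr_sqr.
Qed.

End PlaneKernels.


(** * Moments of the truncated kernel under a measure comparable with Lebesgue measure *)

Section MomentBounds.
Context (R : realType) (mu : probability R[i] R) (xi : R[i]).
Local Notation lamC := (@lebesgue_measureC R).
Local Notation N := (@Normc.normc R).
Local Notation sq e := [set z | supnorm (xi - z) <= e].

Let mxi : measurable_fun setT (fun z : R[i] => xi - z).
Proof. by apply: measurable_complexB; [exact: measurable_cst|exact: measurable_id]. Qed.
Let msup : measurable_fun setT (fun z : R[i] => supnorm (xi - z)).
Proof. exact: measurable_supnorm. Qed.
Let msq e : measurable (sq e).
Proof.
rewrite -[sq e]setTI; have /(_ measurableT) h := measurable_fun_ler msup (@measurable_cst _ _ _ _ setT e).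
by apply: (h [set true]).
Qed.
Let minv_form (a b : R) : measurable_fun setT (fun z : R[i] =>
  inv_form a b (complex.Re (xi - z)) (complex.Im (xi - z))).
Proof.
under eq_fun do rewrite -inv_formE; apply: measurable_funX.
have /measurable_complexP[mr mi] := measurable_complexV mxi.
by apply: measurable_funD; apply: measurable_funM.
Qed.
Let mannulus e rho : measurable_fun setT (fun z : R[i] =>
  (((e < supnorm (xi - z)) && (supnorm (xi - z) <= rho))%:R : R)).
Proof.
by apply: measurable_natb; apply: measurable_and; [exact: measurable_fun_ltr|exact: measurable_fun_ler].
Qed.

Let annulus_le (m1 m2 : {measure set R[i] -> \bar R}) (c e rho : R) (g : R[i] -> R) :
  0 <= c -> measurable_fun setT g -> (forall z, 0 <= g z) ->
  (forall A, measurable A -> A `<=` sq rho -> (m1 A <= c%:E * m2 A)%E) ->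
  (\int[m1]_z (g z * ((e < supnorm (xi - z)) && (supnorm (xi - z) <= rho))%:R)%:E <=
   c%:E * \int[m2]_z (g z * ((e < supnorm (xi - z)) && (supnorm (xi - z) <= rho))%:R)%:E)%E.
Proof.
move=> c0 mg g0 m12.
have restr (m : {measure set R[i] -> \bar R}) :
    (\int[m]_z (g z * ((e < supnorm (xi - z)) && (supnorm (xi - z) <= rho))%:R)%:E =
     \int[m]_(z in sq rho) (g z * ((e < supnorm (xi - z)) && (supnorm (xi - z) <= rho))%:R)%:E)%E.
  rewrite [RHS]integral_mkcond; apply: eq_integral => z _; rewrite patchE.
  by case: ifPn => //; rewrite notin_setE /= => /negP/negbTE ->; rewrite andbF mulr0.
rewrite !restr; apply: ge0_le_measure_subset_integral => //.
  by apply/measurable_EFinP; exact: measurable_funM.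
by move=> z; rewrite lee_fin mulr_ge0.
Qed.

Let trunc_sqr a b e x := (a * complex.Re (trunc_inv xi e x) + b * complex.Im (trunc_inv xi e x)) ^+ 2.

Let bounded_trunc_sqr a b e : 0 < e -> bounded_mfun (trunc_sqr a b e).
Proof.
move=> e0; apply: bounded_mfunX; apply: bounded_mfunD; apply: bounded_mfunZ.
  exact: bounded_mfun_Re_trunc_inv.
exact: bounded_mfun_Im_trunc_inv.
Qed.

Let EFin_Rexpectation (f : R[i] -> R) : bounded_mfun f ->
  ((\int[mu]_z f z)%:E = \int[mu]_z (f z)%:E)%E.
Proof. by move=> bf; rewrite -expectation_bounded_mfun// unlock. Qed.

Let trunc_sqrE a b e x : trunc_sqr a b e x =
  inv_form a b (complex.Re (xi - x)) (complex.Im (xi - x)) * (e < supnorm (xi - x))%R%:R.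
Proof.
rewrite /trunc_sqr /trunc_inv; case: ifP => h; first by rewrite inv_formE mulr1.
by rewrite !mulr0 addr0 expr0n.
Qed.

(** Inside the square of half-side [rho] the density bound applies; outside it the squared form is
    at most (a^2 + b^2) / rho^2. *)
Lemma trunc_inv_sqr_le (a b e rho M : R) : 0 < e -> e < rho -> 0 <= M ->
  (forall A, measurable A -> A `<=` sq rho -> (mu A <= M%:E * lamC A)%E) ->
  \int[mu]_x (a * complex.Re (trunc_inv xi e x) + b * complex.Im (trunc_inv xi e x)) ^+ 2
  <= M * (pi * (a ^+ 2 + b ^+ 2) * ln (rho / e)) + (a ^+ 2 + b ^+ 2) / rho ^+ 2.
Proof.
move=> e0 er M0 muM; have r0 : 0 < rho by apply: lt_trans er.
have bq := bounded_trunc_sqr a b e0.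
rewrite -lee_fin EFin_Rexpectation//.
pose ann (z : R[i]) : R := ((e < supnorm (xi - z)) && (supnorm (xi - z) <= rho))%:R.
pose K : R := (a ^+ 2 + b ^+ 2) / rho ^+ 2.
have K0 : 0 <= K by rewrite divr_ge0 ?addr_ge0 ?sqr_ge0.
pose I (z : R[i]) := inv_form a b (complex.Re (xi - z)) (complex.Im (xi - z)).
have I0 z : 0 <= I z by exact: inv_form_ge0.
have mI : measurable_fun setT (fun z => (I z * ann z)%:E).
  by apply/measurable_EFinP; apply: measurable_funM => //; [exact: minv_form|exact: mannulus].
apply: (@le_trans _ _ (\int[mu]_z ((I z * ann z)%:E + K%:E))%E).
  apply: ge0_le_integral => //.
  - by move=> z _; rewrite lee_fin; exact: sqr_ge0.
  - by case: bq => mq _; apply/measurable_EFinP.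
  - by apply: emeasurable_funD => //; exact: measurable_cst.
  - move=> z _; rewrite -EFinD lee_fin -/(trunc_sqr a b e z) trunc_sqrE -/(I z) /ann.
    case: ltP => h1 /=; last by rewrite !mulr0 add0r.
    case: (leP (supnorm (xi - z)) rho) => h2 /=; first by rewrite lerDl.
    rewrite mulr0 add0r mulr1; apply: (le_trans (inv_form_le _ _ _)).
    rewrite ler_wpM2l ?addr_ge0 ?sqr_ge0//.
    have h3 := le_trans (ltW h2) (supnorm_le_normc _).
    by rewrite lef_pV2 ?posrE ?exprn_gt0 ?(lt_le_trans r0 h3)// lerXn2r// nnegrE ltW// (lt_le_trans r0 h3).
rewrite ge0_integralD//; last by move=> z _; rewrite lee_fin mulr_ge0.
rewrite integral_cst// [X in (_ * X)%E](@probability_setT _ _ _ mu) mule1 EFinD leeD//.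
apply: (le_trans (annulus_le e M0 (minv_form a b) I0 muM)).
by rewrite integral_annulus_inv_form// EFinM.
Qed.

Lemma trunc_inv_sqr_ge (a b e rho c : R) : 0 < e -> e < rho -> 0 <= c ->
  (forall A, measurable A -> A `<=` sq rho -> (c%:E * lamC A <= mu A)%E) ->
  c * (pi * (a ^+ 2 + b ^+ 2) * ln (rho / e)) <=
  \int[mu]_x (a * complex.Re (trunc_inv xi e x) + b * complex.Im (trunc_inv xi e x)) ^+ 2.
Proof.
move=> e0 er c0 muc; have r0 : 0 < rho by apply: lt_trans er.
have bq := bounded_trunc_sqr a b e0.
(* The lower bound is used below in the form lamC <= c^-1 mu, which excludes c = 0. *)
have [->|cn0] := eqVneq c 0.
  by rewrite mul0r -(Rexpectation_cst mu 0) le_Rexpectation//; [exact: bounded_mfun_cst|move=> x; exact: sqr_ge0].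
have cp : 0 < c by rewrite lt_neqAle eq_sym cn0.
rewrite -lee_fin EFin_Rexpectation// EFinM -(integral_annulus_inv_form xi a b e0 er).
pose I (z : R[i]) := inv_form a b (complex.Re (xi - z)) (complex.Im (xi - z)).
have I0 z : 0 <= I z by exact: inv_form_ge0.
have cV0 : 0 <= c^-1 by rewrite invr_ge0.
have := @annulus_le lamC mu c^-1 e rho I cV0 (minv_form a b) I0.
have h : forall A, measurable A -> A `<=` sq rho -> (lamC A <= c^-1%:E * mu A)%E.
  by move=> A mA Ar; rewrite -lee_pdivrMl ?invr_gt0// invrK; exact: muc.
move=> /(_ h); rewrite -lee_pdivrMl ?invr_gt0// invrK => {}h; apply: (le_trans h).
apply: ge0_le_integral => //.
- by move=> z _; rewrite lee_fin mulr_ge0.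
- by apply/measurable_EFinP; apply: measurable_funM => //; exact: minv_form.
- by case: bq => mq _; apply/measurable_EFinP.
- move=> z _; rewrite lee_fin -/(trunc_sqr a b e z) trunc_sqrE -/(I z).
  by case: (e < _) => //=; case: (supnorm _ <= _) => //=; rewrite ?mulr1 ?mulr0.
Qed.

Variables (rho M : R).
Hypothesis r0 : 0 < rho.
Hypothesis M0 : 0 <= M.
Hypothesis muM : forall A, measurable A -> A `<=` sq rho -> (mu A <= M%:E * lamC A)%E.

Lemma measure_square_le (e : R) : 0 <= e -> e <= rho -> (mu (sq e) <= (4 * M * e ^+ 2)%:E)%E.
Proof.
move=> e0 er; apply: (le_trans (muM (msq e) _)); first by move=> z /= h; apply: le_trans er.
by rewrite lebesgue_measureC_square// -EFinM (_ : M * (4 * e ^+ 2) = 4 * M * e ^+ 2)//; ring.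
Qed.

Let supnorm_eq0 (z : R[i]) : (supnorm z == 0) = (z == 0).
Proof.
apply/idP/idP => [/eqP h|/eqP ->]; last by rewrite /supnorm /= normr0 maxxx.
by rewrite -normc_eq0 eq_le normc_ge0 andbT (le_trans (normc_le_supnorm _))// h mulr0.
Qed.

Let mN : measurable_fun setT (fun z : R[i] => (N (xi - z))^-1).
Proof. by apply: measurable_fun_invr_ge0; [move=> z; exact: normc_ge0|exact: measurable_normc]. Qed.
Let N0 (z : R[i]) : 0 <= (N (xi - z))^-1.
Proof. by rewrite invr_ge0 normc_ge0. Qed.

Lemma integral_square_inv_normc_le (e : R) : 0 <= e -> e <= rho ->
  (\int[mu]_z ((N (xi - z))^-1 * (supnorm (xi - z) <= e)%R%:R)%:E <= (8 * M * e)%:E)%E.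
Proof.
move=> e0 er.
(* At z = xi the convention 0^-1 = 0 makes the integrand vanish, so that this point may be removed
   from the square. *)
rewrite (_ : (fun z => _) = (fun z => ((N (xi - z))^-1 *
   ((0 < supnorm (xi - z)) && (supnorm (xi - z) <= e))%:R)%:E)); last first.
  apply/funext => z; rewrite [0 < _]lt_neqAle supnorm_ge0 andbT eq_sym supnorm_eq0.
  have [->|//] := eqVneq (xi - z) 0; by rewrite Normc.normc0 invr0 !mul0r.
apply: (le_trans (annulus_le 0 M0 mN N0 _)).
  move=> A mA Ae; apply: muM => // z Az /=; apply: le_trans er; exact: Ae.
apply: (@le_trans _ _ (M%:E * (8 * e)%:E)%E).
  by rewrite lee_wpmul2l ?lee_fin// integral_square_inv_normc.
by rewrite -EFinM (_ : M * (8 * e) = 8 * M * e)//; ring.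
Qed.

Lemma integral_inv_normc_lty : (\int[mu]_z ((N (xi - z))^-1)%:E < +oo)%E.
Proof.
apply: (@le_lt_trans _ _ (\int[mu]_z (((N (xi - z))^-1 * (supnorm (xi - z) <= rho)%R%:R)%:E + (rho^-1)%:E))%E).
  apply: ge0_le_integral => //.
  - by move=> z _; rewrite lee_fin.
  - exact/measurable_EFinP.
  - apply: emeasurable_funD; last exact: measurable_cst.
    by apply/measurable_EFinP; apply: measurable_funM => //; apply: measurable_natb; exact: measurable_fun_ler.
  - move=> z _; rewrite -EFinD lee_fin; case: (leP (supnorm (xi - z)) rho) => h /=.
      by rewrite mulr1 lerDl invr_ge0 ltW.
    have h3 := lt_le_trans h (supnorm_le_normc _).
    by rewrite mulr0 add0r lef_pV2 ?posrE ?ltW// (lt_trans r0).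
rewrite ge0_integralD//.
- rewrite integral_cst// [X in (_ * X)%E](@probability_setT _ _ _ mu) mule1.
  apply: (le_lt_trans (leeD2r _ (integral_square_inv_normc_le (ltW r0) (lexx _)))).
  by rewrite -EFinD ltry.
- by move=> z _; rewrite lee_fin mulr_ge0.
- by apply/measurable_EFinP; apply: measurable_funM => //; apply: measurable_natb; exact: measurable_fun_ler.
- by move=> z _; rewrite lee_fin invr_ge0 ltW.
Qed.

(** Existence is stated with the inverse of the extended reals, which is infinite at [xi]. That
    point has measure 0, by [measure_square_le] at e = 0, so that the real inverse agrees with it
    almost everywhere. *)
Lemma cauchy_stieltjes_exists_bounded_density : cauchy_stieltjes_exists mu xi.
Proof.
rewrite /cauchy_stieltjes_exists.
have mxi0 : measurable [set z : R[i] | supnorm (xi - z) <= 0] by exact: msq.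
have invE (z : R[i]) : ((N (xi - z))%:E^-1 = if (supnorm (xi - z) <= 0)%R then +oo else ((N (xi - z))^-1)%:E)%E.
  by rewrite inver normc_eq0 -supnorm_eq0 eq_le supnorm_ge0 andbT.
rewrite (@ge0_ae_eq_integral _ _ _ mu setT _ (fun z => ((N (xi - z))^-1)%:E))//.
- exact: integral_inv_normc_lty.
- rewrite (_ : (fun z => _) = (fun z => if (supnorm (xi - z) <= 0)%R then +oo else ((N (xi - z))^-1)%:E)%E).
    apply: measurable_fun_ifT; [exact: measurable_fun_ler|exact: measurable_cst|exact/measurable_EFinP].
  by apply/funext => z; exact: invE.
- exact/measurable_EFinP.
- by move=> z _; rewrite invE; case: ifP => // _; rewrite lee_fin.
- by move=> z _; rewrite lee_fin.
- exists [set z : R[i] | supnorm (xi - z) <= 0]; split => //.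
    apply/eqP; rewrite eq_le measure_ge0 andbT.
    by apply: (le_trans (measure_square_le (lexx 0) (ltW r0))); rewrite expr0n/= mulr0.
  move=> z /=; apply: contra_notP => /negP h _; rewrite invE.
  by rewrite (negbTE h).
Qed.

(** The two kernels differ only in the square of half-side [e], where the truncated one is 0 and 1 /
    |xi - x| has integral at most 8 M e. *)
Lemma trunc_inv_bias (e : R) : 0 < e -> e <= rho ->
  `|complex.Re (cauchy_stieltjes mu xi) - \int[mu]_x complex.Re (trunc_inv xi e x)| <= 8 * M * e /\
  `|complex.Im (cauchy_stieltjes mu xi) - \int[mu]_x complex.Im (trunc_inv xi e x)| <= 8 * M * e.
Proof.
move=> e0 er.
have /measurable_complexP[mr mi] := measurable_complexV mxi.
have gen (h : R[i] -> R) : measurable_fun setT (fun x : R[i] => h (xi - x)^-1) ->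
    bounded_mfun (fun x => h (trunc_inv xi e x)) -> h 0 = 0 ->
    (forall z, `|h z| <= N z) ->
    `|\int[mu]_x h (xi - x)^-1 - \int[mu]_x h (trunc_inv xi e x)| <= 8 * M * e.
  move=> mh bh h0 hN.
  have ih : mu.-integrable setT (EFin \o (fun x : R[i] => h (xi - x)^-1)).
    apply/integrableP; split; first exact/measurable_EFinP.
    apply: le_lt_trans integral_inv_normc_lty; apply: ge0_le_integral => //.
    - by apply: measurableT_comp => //; exact/measurable_EFinP.
    - exact/measurable_EFinP.
    - by move=> x _; rewrite /= lee_fin (le_trans (hN _))// Normc.normcV.
  rewrite -RintegralB//; last exact: bounded_mfun_integrable.
  have iD : mu.-integrable setT (EFin \o (fun x : R[i] => h (xi - x)^-1 - h (trunc_inv xi e x))).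
    by apply: integrable_RB => //; exact: bounded_mfun_integrable.
  apply: (le_trans (le_normr_Rintegral _ _)) => //.
  rewrite -lee_fin.
  rewrite [X in (X <= _)%E](_ : _ = (\int[mu]_x `|(h (xi - x)^-1 - h (trunc_inv xi e x))%:E|)%E); last first.
    rewrite /Rintegral fineK//.
    by apply: integrable_fin_num => //; exact: integrable_norm iD.
  apply: le_trans (integral_square_inv_normc_le (ltW e0) er).
  apply: ge0_le_integral => //.
  - by apply: measurableT_comp => //; case/integrableP : iD.
  - by apply/measurable_EFinP; apply: measurable_funM => //; apply: measurable_natb; exact: measurable_fun_ler.
  - move=> x _; rewrite /= lee_fin /trunc_inv; case: ltP => hx; first by rewrite subrr normr0 mulr0.
    by rewrite h0 subr0 mulr1 (le_trans (hN _))// Normc.normcV.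
split; apply: gen => //.
- exact: bounded_mfun_Re_trunc_inv.
- exact: Re_le_normc.
- exact: bounded_mfun_Im_trunc_inv.
- exact: Im_le_normc.
Qed.

End MomentBounds.

(** * From a density near a point to comparison with Lebesgue measure on a square *)

Section DensityBounds.
Context (R : realType) (mu : probability R[i] R) (f : R[i] -> R) (xi : R[i]).
Local Notation lamC := (@lebesgue_measureC R).
Local Notation N := (@Normc.normc R).
Local Notation sq e := [set z | supnorm (xi - z) <= e].

Lemma ballCE (z : R[i]) (r : R) (w : R[i]) : ball z r%:C w = (N (z - w) < r) :> Prop.
Proof. by rewrite /ball/= normc_real_complex ltcR. Qed.

(** The modulus is at most twice [supnorm]; a third of the radius keeps the inequality strict. *)
Lemma supnorm_le_ball (r : R) z : 0 < r -> supnorm (xi - z) <= r / 3 -> N (xi - z) < r.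
Proof. by move=> r0 h; apply: (le_lt_trans (normc_le_supnorm _)); lra. Qed.

Lemma measurable_ballC (rho : R) : measurable (ball xi rho%:C).
Proof.
have mN : measurable_fun setT (fun z : R[i] => N (xi - z)).
  by apply: measurable_normc; apply: measurable_complexB; [exact: measurable_cst|exact: measurable_id].
rewrite (_ : ball xi rho%:C = [set z : R[i] | N (xi - z) < rho]).
  have /(_ measurableT) h := measurable_fun_ltr mN (@measurable_cst _ _ R[i] _ setT rho).
  by rewrite -[X in measurable X]setTI; apply: (h [set true]).
by apply/funext => z; rewrite ballCE.
Qed.

Let density_measure_bounds (B A : set R[i]) (c M : R) : measurable B -> measurable_fun B f ->
  measurable A -> A `<=` B -> 0 <= c -> (forall z, A z -> c <= f z <= M) ->
  mu A = (\int[lamC]_(z in A) (f z)%:E)%E ->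
  (c%:E * lamC A <= mu A)%E /\ (mu A <= M%:E * lamC A)%E.
Proof.
move=> mB mf mA AB c0 hf ->.
have mfA : measurable_fun A (EFin \o f) by apply/measurable_EFinP; exact: measurable_funS mf.
split.
  rewrite -(@integral_cst _ _ _ lamC A)//; apply: ge0_le_integral => //.
  - by move=> z /hf /andP[? _]; rewrite lee_fin.
rewrite -(@integral_cst _ _ _ lamC A)//; apply: ge0_le_integral => //.
- by move=> z /hf /andP[? _]; rewrite lee_fin (le_trans c0).
- by move=> z /hf /andP[_ ?]; rewrite lee_fin.
Qed.

Lemma bounded_density_square : bounded_density_near mu f xi ->
  0 <= f xi /\ exists rho M : R, [/\ 0 < rho, 0 <= M &
    forall A, measurable A -> A `<=` sq rho -> (mu A <= M%:E * lamC A)%E].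
Proof.
move=> [rho r0 [mf [M hM] muE]].
have BB z : supnorm (xi - z) <= rho / 3 -> ball xi rho%:C z.
  by move=> h; rewrite ballCE; exact: supnorm_le_ball.
have Bxi : ball xi rho%:C xi by rewrite ballCE subrr Normc.normc0.
have /andP[f0 fM] := hM _ Bxi; split => //.
exists (rho / 3), M; split; [by rewrite divr_gt0|exact: le_trans fM|].
move=> A mA Ar; have AB : A `<=` ball xi rho%:C by move=> z /Ar; exact: BB.
apply: (@density_measure_bounds (ball xi rho%:C) A 0 M _ mf _ AB _ _ (muE _ mA AB)).2 => //.
- exact: measurable_ballC.
- by move=> z /AB /hM.
Qed.

Lemma continuous_density_square (eta : R) : bounded_density_near mu f xi ->
  {for xi, continuous f} -> 0 < eta ->
  exists rho c : R, [/\ 0 < rho, 0 <= c, f xi - eta <= c <= f xi &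
    forall A, measurable A -> A `<=` sq rho ->
      (c%:E * lamC A <= mu A)%E /\ (mu A <= (f xi + eta)%:E * lamC A)%E].
Proof.
move=> [rho r0 [mf [M hM] muE]] cf eta0.
have Bxi : ball xi rho%:C xi by rewrite ballCE subrr Normc.normc0.
have /andP[f0 fM] := hM _ Bxi.
move/cvgrPdist_lt: cf => /(_ _ eta0).
rewrite -nbhs_ballE => -[del /= del0 hdel].
(* Radii of balls in the complex plane are complex numbers; a positive one is real. *)
have delE : del = (complex.Re del)%:C.
  by move: del0; case: (del) => u v; rewrite ltcE/= => /andP[/eqP -> _].
have d0 : 0 < complex.Re del by move: del0; rewrite [in X in X -> _]delE ltcR.
rewrite delE in hdel.
pose r := Num.min rho (complex.Re del).
have rp : 0 < r by rewrite lt_min r0.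
(* The value f xi - eta may be negative, whereas the lower bound has to be nonnegative. *)
exists (r / 3), (Num.max 0 (f xi - eta)); split.
- by rewrite divr_gt0.
- by rewrite le_max lexx.
- by rewrite le_max lexx orbT ge_max f0/= gerBl ltW.
move=> A mA Ar.
have AN z : A z -> N (xi - z) < r by move=> /Ar /= h; exact: supnorm_le_ball.
have AB : A `<=` ball xi rho%:C.
  by move=> z /AN; rewrite ballCE /r lt_min => /andP[].
apply: (@density_measure_bounds (ball xi rho%:C) A _ _ _ mf _ AB _ _ (muE _ mA AB)) => //.
- exact: measurable_ballC.
- by rewrite le_max lexx.
- move=> z Az; have /andP[fz0 _] := hM _ (AB _ Az).
  have /hdel : ball xi (complex.Re del)%:C z.
    by rewrite ballCE; have := AN _ Az; rewrite /r lt_min => /andP[].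
  rewrite ltr_norml => /andP[? ?]; rewrite ge_max fz0/=.
  by apply/andP; split; lra.
Qed.
End DensityBounds.

(** * Truncated moments at one point and at two points *)

Section TruncatedMoments.
Context (R : realType) (mu : probability R[i] R) (f : R[i] -> R).
Local Notation N := (@Normc.normc R).

Lemma normc_trunc_inv_sqr xi (e : R) x :
  N (trunc_inv xi e x) ^+ 2 = (1 * complex.Re (trunc_inv xi e x) + 0 * complex.Im (trunc_inv xi e x)) ^+ 2 +
   (0 * complex.Re (trunc_inv xi e x) + 1 * complex.Im (trunc_inv xi e x)) ^+ 2.
Proof.
case: trunc_inv => u v /=; rewrite sqr_sqrtr ?addr_ge0 ?sqr_ge0//.
by rewrite !mul1r !mul0r addr0 add0r.
Qed.

Lemma bounded_mfun_normc_trunc_inv xi (e : R) : 0 < e -> bounded_mfun (fun x => N (trunc_inv xi e x)).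
Proof.
move=> e0; split; first by apply: measurable_normc; exact: measurable_trunc_inv.
by exists e^-1 => x; rewrite ger0_norm ?normc_ge0// normc_trunc_inv.
Qed.

Definition trunc_mean xi (e : R) : R[i] :=
  (\int[mu]_x complex.Re (trunc_inv xi e x)) +i* (\int[mu]_x complex.Im (trunc_inv xi e x)).

(** What the construction of the critical points uses of mu near [xi], with a single constant: the
    mass of a small square, the bias of truncation and two moments. *)
Definition trunc_moments (xi : R[i]) (K : R) := forall e, 0 < e -> e <= K^-1 ->
  [/\ (mu [set z | (supnorm (xi - z) <= e)%R] <= (K * e ^+ 2)%:E)%E,
      N (cauchy_stieltjes mu xi - trunc_mean xi e) <= K * e,
      \int[mu]_x N (trunc_inv xi e x) <= K &
      \int[mu]_x N (trunc_inv xi e x) ^+ 2 <= K * (1 + ln e^-1)].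

(** The bounds are given for every larger constant too, so that finitely many points can share
    one. *)
Lemma trunc_moments_exists xi : bounded_density_near mu f xi ->
  cauchy_stieltjes_exists mu xi /\ exists2 K, 1 <= K & forall K', K <= K' -> trunc_moments xi K'.
Proof.
move=> /bounded_density_square[_ [rho [M [r0 M0 muM]]]].
split; first exact: (cauchy_stieltjes_exists_bounded_density r0 M0 muM).
have I0 := integral_inv_normc_lty r0 M0 muM.
have Ip : (0 <= \int[mu]_z ((N (xi - z))^-1)%:E)%E.
  by apply: integral_ge0 => z _; rewrite lee_fin invr_ge0 normc_ge0.
set I1 := fine (\int[mu]_z ((N (xi - z))^-1)%:E).
have I1p : 0 <= I1 by exact: fine_ge0.
have pi0 : 0 <= (pi : R) by exact: pi_ge0.
(* The summands 1 and 2 / rho force e <= 1 and e < rho; the others serve the four bounds. *)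
pose K := 1 + 16 * M + I1 + 2 * (M * pi) + 2 * (M * pi * `|ln rho|) + 2 / rho ^+ 2 + 2 * rho^-1.
have Mpi : 0 <= M * pi by exact: mulr_ge0.
have Mpil : 0 <= M * pi * `|ln rho| by exact: mulr_ge0.
have r2 : 0 <= 1 / rho ^+ 2 by rewrite divr_ge0 ?sqr_ge0.
have r1 : 0 <= rho^-1 by rewrite invr_ge0 ltW.
exists K; first by rewrite /K; lra.
move=> K' KK' e e0 eK.
have K'0 : 0 < K' by apply: lt_le_trans KK'; rewrite /K; lra.
have e1 : e <= 1.
  by apply: (le_trans eK); rewrite invf_le1//; apply: le_trans KK'; rewrite /K; lra.
have er : e < rho.
  apply: (le_lt_trans eK); rewrite -[ltRHS]invrK ltf_pV2 ?posrE ?invr_gt0//.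
  have rip : 0 < rho^-1 by rewrite invr_gt0.
  by apply: lt_le_trans KK'; rewrite /K; lra.
have L0 : 0 <= ln e^-1 by rewrite ln_ge0// invf_ge1.
have bN := bounded_mfun_normc_trunc_inv xi e0.
split.
- apply: (le_trans (measure_square_le muM (ltW e0) (ltW er))).
  rewrite lee_fin ler_wpM2r ?sqr_ge0// (le_trans _ KK')// /K; lra.
- have [h1 h2] := trunc_inv_bias r0 M0 muM e0 (ltW er).
  apply: (le_trans (normc_le_ReIm _)); rewrite ReB ImB.
  apply: (le_trans (lerD h1 h2)); apply: (@le_trans _ _ (16 * M * e)); first by lra.
  by rewrite ler_wpM2r ?(ltW e0)// (le_trans _ KK')// /K; lra.
- apply: (@le_trans _ _ I1); last by rewrite (le_trans _ KK')// /K; lra.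
  have I1E : (I1%:E = \int[mu]_z ((N (xi - z))^-1)%:E)%E by rewrite /I1 fineK// ge0_fin_numE.
  rewrite -lee_fin I1E.
  rewrite -expectation_bounded_mfun// unlock; apply: ge0_le_integral => //.
  + by move=> x _; rewrite lee_fin normc_ge0.
  + by apply/measurable_EFinP; exact: bN.1.
  + apply/measurable_EFinP; apply: measurable_fun_invr_ge0; first by move=> x; exact: normc_ge0.
    by apply: measurable_normc; apply: measurable_complexB; [exact: measurable_cst|exact: measurable_id].
  + move=> x _; rewrite lee_fin /trunc_inv; case: ifP => _; first by rewrite Normc.normcV.
    by rewrite Normc.normc0 invr_ge0 normc_ge0.
- have bR := bounded_mfun_Re_trunc_inv xi e0; have bI := bounded_mfun_Im_trunc_inv xi e0.
  under eq_Rintegral => x _ do rewrite normc_trunc_inv_sqr.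
  rewrite RexpectationD; last 2 first.
  + by apply: bounded_mfunX; apply: bounded_mfunD; exact: bounded_mfunZ.
  + by apply: bounded_mfunX; apply: bounded_mfunD; exact: bounded_mfunZ.
  have h1 := trunc_inv_sqr_le 1 0 e0 er M0 muM; have h2 := trunc_inv_sqr_le 0 1 e0 er M0 muM.
  apply: (le_trans (lerD h1 h2)); rewrite expr1n expr0n/= addr0 add0r mulr1.
  rewrite ln_div ?posrE// lnV ?posrE// in L0 *.
  have l1 := ler_norm (ln rho).
  have KL : K * (1 - ln e) <= K' * (1 - ln e) by rewrite ler_wpM2r//; lra.
  apply: le_trans KL.
  have hl : M * pi * (ln rho - ln e) <= M * pi * `|ln rho| + M * pi * - ln e.
    by rewrite -mulrDr ler_wpM2l// lerD2r.
  have := mulr_ge0 Mpil L0; have := mulr_ge0 M0 L0; have := mulr_ge0 I1p L0;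
    have := mulr_ge0 r2 L0; have := mulr_ge0 r1 L0.
  rewrite /K mulrA; nra.
Qed.

(** On a small square the density is within eta / pi of f xi, which encloses the moment between two
    multiples of the logarithm. The terms in ln rho and the part outside the square do not depend on
    [e] and go into [K]. *)
Lemma trunc_second_moment_asympt xi (eta : R) : bounded_density_near mu f xi ->
  {for xi, continuous f} -> 0 < eta ->
  exists2 K, 1 <= K & forall a b e, 0 < e -> e <= K^-1 ->
  `|\int[mu]_x (a * complex.Re (trunc_inv xi e x) + b * complex.Im (trunc_inv xi e x)) ^+ 2
    - f xi * pi * (a ^+ 2 + b ^+ 2) * ln e^-1| <= (a ^+ 2 + b ^+ 2) * (eta * ln e^-1 + K).
Proof.
move=> hd cf eta0.
have pi0 : 0 < (pi : R) by exact: pi_gt0.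
have ep : 0 < eta / pi by rewrite divr_gt0.
have [f0 _] := bounded_density_square hd.
have [rho [c [r0 c0 /andP[c1 c2] hA]]] := continuous_density_square hd cf ep.
set eta' := eta / pi in ep c1 hA.
have etaE : eta = eta' * pi by rewrite /eta' divfK ?gt_eqF.
have r2 : 0 <= 1 / rho ^+ 2 by rewrite divr_ge0 ?sqr_ge0.
have ri : 0 < rho^-1 by rewrite invr_gt0.
pose B := (f xi + eta') * pi * `|ln rho|.
have fe0 : 0 <= f xi + eta' by rewrite addr_ge0// ltW.
have B0 : 0 <= B by rewrite !mulr_ge0// ltW.
pose K := 1 + rho^-1 + 1 / rho ^+ 2 + B.
have K0 : 0 < K by rewrite /K; lra.
exists K; first by rewrite /K; lra.
move=> a b e e0 eK.
have er : e < rho.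
  apply: (le_lt_trans eK); rewrite -[ltRHS]invrK ltf_pV2 ?posrE//.
  by rewrite /K; lra.
have e1 : e <= 1 by apply: (le_trans eK); rewrite invf_le1// /K; lra.
have L0 : 0 <= ln e^-1 by rewrite ln_ge0// invf_ge1.
have h1 := trunc_inv_sqr_le a b e0 er _ (fun A mA Ar => (hA A mA Ar).2).
have h2 := trunc_inv_sqr_ge a b e0 er c0 (fun A mA Ar => (hA A mA Ar).1).
have {}h1 := h1 (addr_ge0 f0 (ltW ep)).
set I := \int[mu]_x _ in h1 h2 *.
set q := a ^+ 2 + b ^+ 2 in h1 h2 *.
have q0 : 0 <= q by rewrite addr_ge0 ?sqr_ge0.
move: h1 h2; rewrite ln_div ?posrE// lnV ?posrE// in L0 *; set L := - ln e in L0 *.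
move=> h1 h2.
have -> : I - f xi * pi * q * L = (I - (f xi * pi * L) * q) by ring.
have l1 := ler_norm (ln rho); have l2 := ler_norm (- ln rho); rewrite normrN in l2.
have cB : c * pi * `|ln rho| <= B by rewrite /B !ler_wpM2r// ?ltW// (le_lt_trans c2)// ltrDl.
have h3 : (f xi + eta') * (pi * q * (ln rho - ln e)) + q / rho ^+ 2 - f xi * pi * L * q
    = q * ((f xi + eta') * pi * ln rho + eta' * pi * L + 1 / rho ^+ 2) by rewrite /L; field; rewrite gt_eqF.
have h4 : f xi * pi * L * q - c * (pi * q * (ln rho - ln e)) = q * ((f xi - c) * pi * L - c * pi * ln rho).
  by rewrite /L; ring.
have b1 : (f xi + eta') * pi * ln rho <= B by rewrite /B ler_wpM2l// mulr_ge0 ?ltW// ltr_wpDl.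
have b2 : - (c * pi * ln rho) <= c * pi * `|ln rho|.
  by rewrite -mulrN ler_wpM2l// mulr_ge0// ltW.
have b3 : (f xi - c) * pi * L <= eta' * pi * L.
  by apply: ler_wpM2r => //; apply: ler_wpM2r; [exact: ltW|lra].
rewrite ler_norml; apply/andP; split.
  rewrite lerNl opprB; apply: (@le_trans _ _ (f xi * pi * L * q - c * (pi * q * (ln rho - ln e)))); first by lra.
  rewrite h4 ler_wpM2l// etaE /K; lra.
apply: (@le_trans _ _ ((f xi + eta') * (pi * q * (ln rho - ln e)) + q / rho ^+ 2 - f xi * pi * L * q)).
  by rewrite lerB.
by rewrite h3 ler_wpM2l// etaE /K; lra.
Qed.

(** A point cannot be closer to both [xi] and [xi'] than half their distance, so that one factor is
    at most 2 / |xi - xi'|. Mixed second moments are thereby controlled by first moments. *)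
Lemma normc_trunc_inv_mul_le xi xi' (e : R) x : xi != xi' ->
  N (trunc_inv xi e x) * N (trunc_inv xi' e x) <=
  2 / N (xi - xi') * (N (trunc_inv xi e x) + N (trunc_inv xi' e x)).
Proof.
move=> xx; set del := N (xi - xi').
have d0 : 0 < del by rewrite normc_gt0 subr_eq0.
have tri : del <= N (xi - x) + N (xi' - x).
  by rewrite (normc_distC xi') normc_le_triangle.
have bnd y : del / 2 <= N (y - x) -> N (trunc_inv y e x) <= 2 / del.
  move=> h; rewrite /trunc_inv; case: ifP => _; last by rewrite Normc.normc0 divr_ge0// ltW.
  rewrite Normc.normcV -[leRHS]invf_div lef_pV2 ?posrE ?divr_gt0//.
  by apply: lt_le_trans h; rewrite divr_gt0.
have n1 := normc_ge0 (trunc_inv xi e x); have n2 := normc_ge0 (trunc_inv xi' e x).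
have d2 : 0 <= 2 / del by rewrite divr_ge0// ltW.
have [h|h] := lerP (del / 2) (N (xi - x)).
  apply: (le_trans (ler_wpM2r n2 (bnd _ h))).
  by rewrite ler_wpM2l// lerDr.
have h' : del / 2 <= N (xi' - x) by lra.
rewrite mulrC; apply: (le_trans (ler_wpM2r n1 (bnd _ h'))).
by rewrite ler_wpM2l// lerDl.
Qed.

End TruncatedMoments.

(** * Characteristic functions of iid sums *)

Section PowerDistance.
Context (R : realType).
Local Notation N := (@Normc.normc R).

Lemma normcX (z : R[i]) k : N (z ^+ k) = N z ^+ k.
Proof.
elim: k => [|k ih]; first by rewrite !expr0 Normc.normc1.
by rewrite !exprS Normc.normcM ih.
Qed.

Lemma normc_subX_le (z w : R[i]) k : N z <= 1 -> N w <= 1 ->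
  N (z ^+ k - w ^+ k) <= k%:R * N (z - w).
Proof.
move=> z1 w1; elim: k => [|k ih]; first by rewrite !expr0 subrr Normc.normc0 mul0r.
have -> : z ^+ k.+1 - w ^+ k.+1 = z * (z ^+ k - w ^+ k) + (z - w) * w ^+ k.
  by rewrite !exprS; ring.
rewrite (le_trans (normc_le_add _ _))// -natr1 [leRHS]mulrDl mul1r lerD//.
  by rewrite Normc.normcM (le_trans _ ih)// ler_piMl// normc_ge0.
rewrite Normc.normcM normcX ler_piMr ?normc_ge0//.
by rewrite exprn_ile1// normc_ge0.
Qed.

Lemma expRN_dist_le (x : R) : 0 <= x -> `|expR (- x) - (1 - x)| <= x ^+ 2.
Proof.
move=> x0; have h1 := expR_ge1Dx (- x).
have h2 : expR (- x) * (1 + x) <= 1.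
  rewrite expRN mulrC ler_pdivrMr ?expR_gt0// mul1r; exact: expR_ge1Dx.
have h3 : expR (- x) <= 1 by rewrite -[leRHS]expR0 ler_expR; lra.
rewrite ger0_norm; last by lra.
have h0 := expR_gt0 (- x); nra.
Qed.

End PowerDistance.

Section CharacteristicFunction.
Context (R : realType) (d d' : measure_display).
Context (T : measurableType d) (S : measurableType d').
Variables (P : probability T R) (mu : probability S R).
Variable X : nat -> {RV P >-> S}.
Hypothesis iidX : iid X mu.
Variable y : S -> R.
Hypothesis by_ : bounded_mfun y.
Local Notation N := (@Normc.normc R).

Definition iid_sum (k : nat) (t : T) : R := \sum_(j < k) y (X j t).

Lemma iid_sumS k t : iid_sum k.+1 t = iid_sum k t + y (X k t).
Proof. by rewrite /iid_sum big_ord_recr. Qed.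

Lemma bounded_mfun_iid_sum k : bounded_mfun (iid_sum k).
Proof. by apply: bounded_mfun_sum => j; exact: (bounded_mfun_RV X j by_). Qed.

Lemma indep_from_iid_sum k : indep_from mu X k (iid_sum k).
Proof.
elim: k => [|k ih].
  rewrite (_ : iid_sum 0 = (fun=> 0)); first exact: indep_from_cst.
  by apply/funext => t; rewrite /iid_sum big_ord0.
rewrite (_ : iid_sum k.+1 = (fun t => iid_sum k t + 1 * y (X k t))).
  apply: indep_fromD; first exact: indep_fromS.
  apply: indep_fromM => //.
  have : indep_from mu X 0 (fun=> 1) by exact: indep_from_cst.
  by elim: {ih} k => // k ih h; apply: indep_fromS; exact: ih.
by apply/funext => t; rewrite iid_sumS mul1r.
Qed.

Lemma Rexpectation_iid_sum_sqr k : \int[mu]_x y x = 0 ->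
  \int[P]_t iid_sum k t ^+ 2 = k%:R * \int[mu]_x y x ^+ 2.
Proof.
move=> y0; elim: k => [|k ih].
  rewrite mul0r -[RHS](Rexpectation_cst P); apply: eq_Rintegral => t _.
  by rewrite /iid_sum big_ord0 expr0n.
have bs := bounded_mfun_iid_sum k; have by1 := bounded_mfun_RV X k by_.
under eq_Rintegral => t _.
  rewrite iid_sumS (_ : (_ + _) ^+ 2 = iid_sum k t ^+ 2 +
    (2 * (iid_sum k t * y (X k t)) + y (X k t) ^+ 2)); last by ring.
  over.
rewrite RexpectationD; last 2 first.
- exact: bounded_mfunX.
- by apply: bounded_mfunD; [apply: bounded_mfunZ; exact: bounded_mfunM|exact: bounded_mfunX].
rewrite RexpectationD; last 2 first.
- by apply: bounded_mfunZ; exact: bounded_mfunM.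
- exact: bounded_mfunX.
rewrite RexpectationZ; last exact: bounded_mfunM.
rewrite (indep_from_mul (indep_from_iid_sum k))// y0 !mulr0 add0r ih.
rewrite (Rexpectation_RV iidX k (phi := fun x => y x ^+ 2)); last exact: bounded_mfunX.
by rewrite -natr1 mulrDl mul1r.
Qed.

Variable h : R.

Definition char_re (k : nat) := \int[P]_t cos (h * iid_sum k t).
Definition char_im (k : nat) := \int[P]_t sin (h * iid_sum k t).

Let bcos : bounded_mfun (fun x => cos (h * y x)).
Proof. by apply: bounded_mfun_cos; apply: (bounded_mfunZ h by_).1. Qed.
Let bsin : bounded_mfun (fun x => sin (h * y x)).
Proof. by apply: bounded_mfun_sin; apply: (bounded_mfunZ h by_).1. Qed.

(** Cosine and sine are propagated together, as each addition formula involves both. *)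
Let indep_trig k : indep_from mu X k (fun t => cos (h * iid_sum k t)) /\
  indep_from mu X k (fun t => sin (h * iid_sum k t)).
Proof.
elim: k => [|k [ihc ihs]].
  split.
    rewrite (_ : (fun _ => _) = (fun=> 1)); first exact: indep_from_cst.
    by apply/funext => t; rewrite /iid_sum big_ord0 mulr0 cos0.
  rewrite (_ : (fun _ => _) = (fun=> 0)); first exact: indep_from_cst.
  by apply/funext => t; rewrite /iid_sum big_ord0 mulr0 sin0.
split.
  rewrite (_ : (fun _ => _) = (fun t => cos (h * iid_sum k t) * cos (h * y (X k t)) +
      (-1) * (sin (h * iid_sum k t) * sin (h * y (X k t))))).
    apply: indep_fromD; first exact: (indep_fromM ihc bcos).
    apply: indep_fromZ; exact: (indep_fromM ihs bsin).
  by apply/funext => t; rewrite iid_sumS mulrDr cosD mulN1r.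
rewrite (_ : (fun _ => _) = (fun t => sin (h * iid_sum k t) * cos (h * y (X k t)) +
    cos (h * iid_sum k t) * sin (h * y (X k t)))).
  apply: indep_fromD; first exact: (indep_fromM ihs bcos).
  exact: (indep_fromM ihc bsin).
by apply/funext => t; rewrite iid_sumS mulrDr sinD.
Qed.

Let a := \int[mu]_x cos (h * y x).
Let b := \int[mu]_x sin (h * y x).

Lemma char_iid_sum k : char_re k +i* char_im k = (a +i* b) ^+ k.
Proof.
elim: k => [|k ih].
  rewrite expr0 /char_re /char_im; apply/eqP; rewrite eq_complex /=; apply/andP; split; apply/eqP.
    rewrite -[RHS](Rexpectation_cst P); apply: eq_Rintegral => t _.
    by rewrite /iid_sum big_ord0 mulr0 cos0.
  rewrite -[RHS](Rexpectation_cst P); apply: eq_Rintegral => t _.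
  by rewrite /iid_sum big_ord0 mulr0 sin0.
have [ic is_] := indep_trig k.
have bc1 := bounded_mfun_RV X k bcos; have bs1 := bounded_mfun_RV X k bsin.
rewrite exprSr -ih; apply/eqP; rewrite eq_complex /=; apply/andP; split; apply/eqP.
  rewrite /char_re; under eq_Rintegral => t _ do rewrite iid_sumS mulrDr cosD.
  rewrite RexpectationB; [|exact: (bounded_mfunM ic.1 bc1)|exact: (bounded_mfunM is_.1 bs1)].
  by rewrite (indep_from_mul ic bcos) (indep_from_mul is_ bsin).
rewrite /char_im; under eq_Rintegral => t _ do rewrite iid_sumS mulrDr sinD.
rewrite RexpectationD; [|exact: (bounded_mfunM is_.1 bc1)|exact: (bounded_mfunM ic.1 bs1)].
by rewrite (indep_from_mul is_ bcos) (indep_from_mul ic bsin) addrC.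
Qed.

(** The square of a mean is at most the mean of the square, and the squares of cosine and sine add
    up to 1. *)
Let normc_char_le1 : N (a +i* b) <= 1.
Proof.
rewrite /= -[leRHS]sqrtr1 ler_wsqrtr//.
have v (f : S -> R) : bounded_mfun f -> (\int[mu]_x f x) ^+ 2 <= \int[mu]_x f x ^+ 2.
  move=> bf; set m := \int[mu]_x f x.
  have : 0 <= \int[mu]_x (f x - m) ^+ 2.
    rewrite -(Rexpectation_cst mu 0); apply: le_Rexpectation => //.
    - exact: bounded_mfun_cst.
    - by apply: bounded_mfunX; apply: bounded_mfunB => //; exact: bounded_mfun_cst.
    - by move=> x; exact: sqr_ge0.
  under eq_Rintegral => x _.
    rewrite (_ : _ ^+ 2 = f x ^+ 2 - (2 * m * f x - m ^+ 2)); last by ring.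
    over.
  have b1 : bounded_mfun (fun x => 2 * m * f x) by exact: bounded_mfunZ.
  have b2 := bounded_mfun_cst S (m ^+ 2).
  rewrite RexpectationB; [|exact: bounded_mfunX|exact: bounded_mfunB].
  rewrite RexpectationB// RexpectationZ// Rexpectation_cst -/m.
  by rewrite -[X in _ - (X - _)]mulrA; lra.
apply: (le_trans (lerD (v _ bcos) (v _ bsin))).
rewrite -RexpectationD; [|exact: bounded_mfunX|exact: bounded_mfunX].
under eq_Rintegral => x _ do rewrite cos2Dsin2.
by rewrite Rexpectation_cst.
Qed.

(** The characteristic function of one summand and exp (- h^2 v / 2) have modulus at most 1, so that
    their k-th powers differ by at most k times their distance. The uniform bound [K] lets the
    higher Taylor terms be estimated by the variance. *)
Lemma char_iid_sum_dist (k : nat) (K : R) : \int[mu]_x y x = 0 ->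
  (forall x, `|y x| <= K) -> let v := \int[mu]_x y x ^+ 2 in
  let err := k%:R * (h ^+ 2 * v * ((`|h| * K) ^+ 2 + `|h| * K + h ^+ 2 * v)) in
  `|char_re k - expR (- (k%:R * (h ^+ 2 * v / 2)))| <= err /\ `|char_im k| <= err.
Proof.
move=> y0 yK v.
have v0 : 0 <= v.
  rewrite -(Rexpectation_cst mu 0); apply: le_Rexpectation => //.
  - exact: bounded_mfun_cst.
  - exact: bounded_mfunX.
  - by move=> x; exact: sqr_ge0.
have by2 := bounded_mfunX 2 by_.
pose x := h ^+ 2 * v / 2; pose w : R[i] := (expR (- x))%:C.
have x0 : 0 <= x by rewrite divr_ge0// mulr_ge0// sqr_ge0.
set e1 := h ^+ 2 * v * ((`|h| * K) ^+ 2 + `|h| * K + h ^+ 2 * v).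
have hyK t : `|h * y t| <= `|h| * K by rewrite normrM ler_wpM2l.
have K0 : 0 <= `|h| * K.
  by have := hyK point; apply: le_trans.
have ha : `|a - (1 - x)| <= (`|h| * K) ^+ 2 * (h ^+ 2 * v).
  have -> : a - (1 - x) = \int[mu]_t (cos (h * y t) - (1 - (h ^+ 2 / 2) * y t ^+ 2)).
    have b3 : bounded_mfun (fun t => h ^+ 2 / 2 * y t ^+ 2) by exact: bounded_mfunZ.
    have b1 := bounded_mfun_cst S (1 : R).
    rewrite RexpectationB//; last exact: bounded_mfunB.
    rewrite RexpectationB// Rexpectation_cst RexpectationZ// -/v /x -/a.
    by congr (_ - (_ - _)); ring.
  rewrite -[h ^+ 2 * v]RexpectationZ// -RexpectationZ; last exact: bounded_mfunZ.
  apply: normr_Rexpectation_le.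
  - apply: bounded_mfunB => //; apply: bounded_mfunB; [exact: bounded_mfun_cst|exact: bounded_mfunZ].
  - by apply: bounded_mfunZ; exact: bounded_mfunZ.
  - move=> t; have -> : h ^+ 2 / 2 * y t ^+ 2 = (h * y t) ^+ 2 / 2 by ring.
    apply: (le_trans (cos_taylor _)).
    have h1 : (h * y t) ^+ 2 <= (`|h| * K) ^+ 2.
      by rewrite -[leLHS]real_normK ?num_real// lerXn2r ?nnegrE.
    have h2 := sqr_ge0 (h * y t).
    have -> : h ^+ 2 * y t ^+ 2 = (h * y t) ^+ 2 by ring.
    have -> : (h * y t) ^+ 4 = (h * y t) ^+ 2 * (h * y t) ^+ 2 by ring.
    nra.
have hb : `|b| <= `|h| * K * (h ^+ 2 * v).
  have -> : b = \int[mu]_t (sin (h * y t) - h * y t).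
    have b1 := bounded_mfunZ h by_.
    by rewrite RexpectationB// RexpectationZ// y0 mulr0 subr0.
  rewrite -[h ^+ 2 * v]RexpectationZ// -RexpectationZ; last exact: bounded_mfunZ.
  apply: normr_Rexpectation_le.
  - by apply: bounded_mfunB => //; exact: bounded_mfunZ.
  - by apply: bounded_mfunZ; exact: bounded_mfunZ.
  - move=> t; apply: (le_trans (sin_taylor _)).
    have -> : h ^+ 2 * y t ^+ 2 = `|h * y t| ^+ 2 by rewrite real_normK ?num_real// exprMn.
    have := hyK t; have := normr_ge0 (h * y t).
    set q := `|_| => q0 qK.
    have -> : q ^+ 3 = q * q ^+ 2 by ring.
    have := sqr_ge0 q; nra.
have hw : N ((a +i* b) - w) <= e1.
  apply: (le_trans (normc_le_ReIm _)).
  rewrite /= oppr0 addr0.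
  have h1 := expRN_dist_le x0.
  have h2 : `|a - expR (- x)| <= `|a - (1 - x)| + `|expR (- x) - (1 - x)|.
    by rewrite (distrC (expR _)); exact: ler_distD.
  have h3 : x ^+ 2 <= (h ^+ 2 * v) * (h ^+ 2 * v).
    have : 0 <= h ^+ 2 * v by rewrite mulr_ge0// sqr_ge0.
    rewrite /x; nra.
  rewrite /e1; nra.
have w1 : N w <= 1.
  rewrite /= expr0n addr0 sqrtr_sqr ger0_norm ?expR_ge0//.
  by rewrite -[leRHS]expR0 ler_expR oppr_le0.
have := normc_subX_le k normc_char_le1 w1.
rewrite -char_iid_sum => hk.
have hk2 := le_trans hk (ler_wpM2l (ler0n R k) hw).
have wk : w ^+ k = (expR (- (k%:R * x)))%:C.
  by rewrite /w -rmorphXn/= -expRM_natl mulrN.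
rewrite wk in hk2; split.
  by have := Re_le_normc ((char_re k +i* char_im k) - (expR (- (k%:R * x)))%:C) => /= /le_trans; apply.
apply: le_trans hk2; apply: le_trans (Im_le_normc _).
by rewrite /= oppr0 addr0.
Qed.

End CharacteristicFunction.

(** * Pairing of a root and a critical point *)

Section PairingStep.
Context (R : realType).
Local Notation N := (@Normc.normc R).

Lemma normcR (x : R) : N x%:C = `|x|.
Proof. by rewrite /= expr0n/= addr0 sqrtr_sqr. Qed.

Lemma natc (n : nat) : n%:R = (n%:R : R)%:C :> R[i].
Proof. by rewrite rmorph_nat. Qed.

(* q, lam and L stand for the square roots of n and log n and for log n; m is the
   transform at xi and mean its truncation at level e. *)
Variables (xi m mean : R[i]) (A1 Xs : seq R[i]) (n : nat) (K q L lam e : R).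
Hypothesis K1 : 1 <= K.
Hypothesis Km : K^-1 <= N m.
Hypothesis mK : N m <= K.
Hypothesis A1far : forall a, a \in A1 -> K^-1 <= N (xi - a).
Hypothesis cK : N (log_deriv A1 xi) <= K.
Hypothesis A1K : \sum_(a <- A1) N (xi - a) ^- 2 <= K.
Hypothesis q0 : 0 < q.
Hypothesis nq : n%:R = q ^+ 2.
Hypothesis lam1 : 1 <= lam.
Hypothesis Llam : L = lam ^+ 2.
Hypothesis qL : 144 * K ^+ 4 * L ^+ 4 <= q.
Hypothesis kn : `|(size Xs)%:R - n%:R| <= K.
Hypothesis eq_ : e <= q^-1.
Hypothesis eqL : (q * L)^-1 <= e.
Hypothesis mean_e : N (m - mean) <= K * e.
Hypothesis Xfar : forall x, x \in Xs -> e < supnorm (xi - x).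
Hypothesis Xsqr : \sum_(x <- Xs) N (xi - x) ^- 2 <= n%:R * L ^+ 2.
Let W : R[i] := \sum_(x <- Xs) (xi - x)^-1 - (size Xs)%:R * mean.
Hypothesis WL : N W <= q * lam * L.

Let A := A1 ++ Xs.
Let r : R := 3 / (N m * n%:R).
Let B : R := 2 * n%:R * L ^+ 2.
Let G := log_deriv A xi.

Let K0 : 0 < K. Proof. by apply: lt_le_trans K1. Qed.
Let L1 : 1 <= L. Proof. by rewrite Llam exprn_ege1. Qed.
Let L0 : 0 < L. Proof. by apply: lt_le_trans L1. Qed.
Let lam0 : 0 < lam. Proof. by apply: lt_le_trans lam1. Qed.
Let nu0 : 0 < N m. Proof. by apply: lt_le_trans Km; rewrite invr_gt0. Qed.
Let n0 : 0 < n%:R :> R. Proof. by rewrite nq exprn_gt0. Qed.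
Let KX k : 1 <= K ^+ k. Proof. by rewrite exprn_ege1. Qed.
Let LX k : 1 <= L ^+ k. Proof. by rewrite exprn_ege1. Qed.

(** The largeness hypothesis [qL] implies every comparison of [q] with lower powers of [K] and [L],
    as both are at least 1. *)
Let mono i j : (i <= 4)%N -> (j <= 4)%N -> 144 * K ^+ i * L ^+ j <= q.
Proof.
move=> i4 j4; apply: le_trans qL; rewrite -[leLHS]mulrA -[leRHS]mulrA ler_wpM2l//.
by apply: ler_pM; rewrite ?exprn_ge0 ?(ltW K0) ?(ltW L0)// ler_weXn2l.
Qed.

Let q1 : 1 <= q. Proof. by have := mono (leq0n 4) (leq0n 4); rewrite !expr0; lra. Qed.

Let GE : G = log_deriv A1 xi + (W + (size Xs)%:R * mean).
Proof. by rewrite /G /log_deriv big_cat /W subrK. Qed.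

Let sizeK : (size Xs)%:R <= 2 * n%:R :> R.
Proof.
move: kn; rewrite ler_norml => /andP[_ h].
have : K <= n%:R.
  have h1 := mono (isT : 1 <= 4)%N (leq0n 4); rewrite expr1 expr0 mulr1 in h1.
  rewrite nq expr2; have := q1; nra.
lra.
Qed.

Let qe : n%:R * e <= q.
Proof.
rewrite nq expr2 -mulrA ler_piMr ?(ltW q0)//.
by rewrite -ler_pdivlMl// mulr1.
Qed.

Let WL2 : N W <= q * L ^+ 2.
Proof.
apply: (le_trans WL); rewrite expr2 mulrA ler_wpM2r ?(ltW L0)// ler_wpM2l ?(ltW q0)//.
by rewrite Llam expr2 ler_peMr// ltW.
Qed.

(** The nonrandom part of G minus j m. It is used with j = n to bound G from below, and with j =
    n.+1 for the fluctuation. *)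
Let bias_le (j : nat) (C : R) : `|(size Xs)%:R - j%:R| <= C ->
  N (log_deriv A1 xi + (size Xs)%:R * mean - j%:R * m) <= K + 2 * K * q + C * K.
Proof.
move=> jC.
have -> : log_deriv A1 xi + (size Xs)%:R * mean - j%:R * m =
  log_deriv A1 xi + ((size Xs)%:R * (mean - m) + ((size Xs)%:R - j%:R) * m) by ring.
apply: (le_trans (normc_le_add _ _)); rewrite -addrA lerD//.
apply: (le_trans (normc_le_add _ _)); rewrite !Normc.normcM lerD//.
  rewrite normc_distC natc normcR ger0_norm//.
  apply: (@le_trans _ _ (2 * n%:R * (K * e))).
    by apply: ler_pM => //; exact: normc_ge0.
  rewrite (_ : 2 * n%:R * (K * e) = 2 * K * (n%:R * e)); last by ring.
  by rewrite ler_wpM2l// mulr_ge0// ltW.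
rewrite !natc -rmorphB normcR; apply: ler_pM => //.
exact: normc_ge0.
Qed.

Let Gdist : N (G - n%:R * m) <= 5 * K ^+ 2 * q * L ^+ 2.
Proof.
have -> : G - n%:R * m = W + (log_deriv A1 xi + (size Xs)%:R * mean - n%:R * m) by rewrite GE; ring.
apply: (le_trans (normc_le_add _ _)).
apply: (le_trans (lerD WL2 (bias_le kn))).
have := LX 2; set L2 := L ^+ 2 => hL.
have := K1; have := q1 => hq hK.
have h1 : q * L2 >= q by rewrite ler_peMr// ltW.
have h2 : K ^+ 2 >= K by rewrite expr2 ler_peMr// ltW.
have -> : 5 * K ^+ 2 * q * L2 = 5 * (K ^+ 2 * (q * L2)) by ring.
rewrite -expr2; set Q := q * L2 in h1 *; set KK := K ^+ 2 in h2 *.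
have h3 : K * q <= KK * Q by apply: ler_pM; rewrite // ltW.
have h4 : 1 * Q <= KK * Q by apply: ler_wpM2r; lra.
have h5 : KK * 1 <= KK * Q by apply: ler_wpM2l; lra.
lra.
Qed.

(** The error of [Gdist] is at most half of n |m|, because [q] dominates K^3 L^2. *)
Let Gge : N m * n%:R / 2 <= N G.
Proof.
have h : N (n%:R * m) <= N G + N (G - n%:R * m).
  have := normc_le_add G (n%:R * m - G); rewrite addrC subrK.
  by rewrite (normc_distC (n%:R * m)).
have hn : N (n%:R * m) = n%:R * N m by rewrite Normc.normcM natc normcR ger0_norm.
rewrite hn in h.
suff : 5 * K ^+ 2 * q * L ^+ 2 <= N m * n%:R / 2.
  have := Gdist; lra.
have h1 := mono (isT : 3 <= 4)%N (isT : 2 <= 4)%N.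
have h2 : K^-1 * (10 * K ^+ 3 * q * L ^+ 2) <= N m * n%:R.
  apply: ler_pM => //.
  - by rewrite invr_ge0 ltW.
  - by rewrite !mulr_ge0 ?exprn_ge0 ?(ltW K0) ?(ltW L0) ?(ltW q0).
  - rewrite nq expr2 -[X in X <= _]mulrA [q * L ^+ 2]mulrC mulrA ler_wpM2r ?(ltW q0)//.
    apply: le_trans h1; rewrite -!mulrA ler_wpM2r//; last by lra.
    by rewrite -?mulrA !mulr_ge0 ?exprn_ge0// ltW.
have h3 : K^-1 * (10 * K ^+ 3 * q * L ^+ 2) = 10 * K ^+ 2 * q * L ^+ 2 by field; rewrite gt_eqF.
by rewrite h3 in h2; lra.
Qed.

Let G0 : G != 0.
Proof.
rewrite -normc_gt0; apply: lt_le_trans Gge.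
by rewrite !mulr_gt0.
Qed.

Let r0 : 0 < r. Proof. by rewrite divr_gt0// mulr_gt0. Qed.

Let rle : r <= 3 * K / q ^+ 2.
Proof.
rewrite /r nq invfM mulrA ler_wpM2r ?invr_ge0 ?sqr_ge0// ler_wpM2l//.
by rewrite -[leRHS]invrK lef_pV2// ?posrE ?invr_gt0.
Qed.

(** The constant is 4 B r^3 = 4 (2 n L^2) (3 / (|m| n))^3 = 216 L^2 / (|m|^3 n^2), with 1 / |m| <=
    K. *)
Lemma pairing_step : exists w : R[i],
  [/\ complex.Re (iter k (crit_step xi A) xi) @[k --> \oo] --> complex.Re w,
      complex.Im (iter k (crit_step xi A) xi) @[k --> \oo] --> complex.Im w
    & [/\ N (w - xi) <= r,
          root (('X - xi%:P) * \prod_(a <- A) ('X - a%:P))^`() w,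
          (forall z, root (('X - xi%:P) * \prod_(a <- A) ('X - a%:P))^`() z ->
             N (z - xi) <= r -> z = w)
        & N (w - xi + G^-1) <= 216 * K ^+ 3 * L ^+ 2 / n%:R ^+ 2]].
Proof.
have q2 : 0 < q ^+ 2 by exact: exprn_gt0.
(* The radius is of order 1 / n, far below the fixed distances to [A1] and below the level [e], of
   order at least 1 / (q L). *)
have far a : a \in A -> 2 * r <= N (xi - a).
  rewrite mem_cat => /orP[/A1far|/Xfar] h.
    apply: le_trans h; apply: (@le_trans _ _ (2 * (3 * K / q ^+ 2))); first by rewrite ler_wpM2l.
    rewrite -[leRHS]mul1r -[leLHS]/(2 * (3 * K / q ^+ 2)) ler_pdivlMr// mulrA.
    rewrite mulrAC ler_pdivrMr// mul1r.
    have h1 := mono (isT : 2 <= 4)%N (leq0n 4); rewrite expr0 mulr1 in h1.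
    have := q1; have := KX 2; rewrite !expr2 in h1 *; nra.
  apply: le_trans (supnorm_le_normc _); apply: le_trans (ltW h); apply: le_trans eqL.
  apply: (@le_trans _ _ (2 * (3 * K / q ^+ 2))); first by rewrite ler_wpM2l.
  rewrite -[leRHS]mul1r ler_pdivlMr ?mulr_gt0//.
  rewrite (_ : _ * (q * L) = 6 * K * L / q); last by field; rewrite gt_eqF.
  rewrite ler_pdivrMr// mul1r.
  have h1 := mono (isT : 1 <= 4)%N (isT : 1 <= 4)%N; rewrite !expr1 in h1.
  have := mulr_gt0 K0 L0; nra.
have AB : \sum_(a <- A) (N (xi - a)) ^- 2 <= B.
  rewrite big_cat /B /=; apply: (le_trans (lerD A1K Xsqr)).
  have : K <= n%:R * L ^+ 2.
    have h1 := mono (isT : 1 <= 4)%N (leq0n 4); rewrite expr1 expr0 mulr1 in h1.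
    have := LX 2; rewrite nq (expr2 q); have := q1; set L2 := L ^+ 2 => ? ?.
    apply: (@le_trans _ _ (q * q)); first by nra.
    by rewrite ler_peMr// mulr_ge0// ltW.
  rewrite (_ : 2 * n%:R * L ^+ 2 = n%:R * L ^+ 2 + n%:R * L ^+ 2); last by ring.
  lra.
have Gr : 3 / 2 <= N (log_deriv A xi) * r.
  rewrite -/G /r mulrA ler_pdivlMr ?mulr_gt0//.
  by have := Gge; lra.
have nu2 : (N m)^-1 <= K by rewrite -[leRHS]invrK lef_pV2 ?posrE ?invr_gt0.
have Br : 4 * B * r ^+ 2 <= 1 / 2.
  apply: (@le_trans _ _ (4 * B * (3 * K / q ^+ 2) ^+ 2)).
    have B0 : 0 <= B by rewrite /B !mulr_ge0// ltW.
    apply: ler_wpM2l; first exact: mulr_ge0.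
    by rewrite lerXn2r// nnegrE ltW// ?divr_gt0// mulr_gt0.
  rewrite /B nq (_ : 4 * _ * _ = 72 * K ^+ 2 * L ^+ 2 / (q * q)); last by field; rewrite gt_eqF.
  rewrite ler_pdivrMr ?mulr_gt0//.
  have h1 := mono (isT : 2 <= 4)%N (isT : 2 <= 4)%N.
  have := q1; nra.
have [w [h1 h2 [h3 h4 h5 h6]]] := crit_step_limit r0 far AB Gr Br.
exists w; split => //; split => //.
apply: (le_trans h6).
rewrite /B /r (_ : 4 * _ * _ = 216 * (N m)^-1 ^+ 3 * L ^+ 2 / n%:R ^+ 2); last first.
  by field; rewrite (gt_eqF n0) gt_eqF.
rewrite ler_wpM2r ?invr_ge0 ?sqr_ge0// ler_wpM2r ?sqr_ge0// (ler_wpM2l (ler0n R 216))//.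
by rewrite lerXn2r// nnegrE ?invr_ge0// ltW.
Qed.

(** Replacing w - xi by - 1 / G leaves m (G - (n + 1) m) / ((n + 1) G), where G - (n + 1) m = W + D
    with D not random. Moreover m / ((n + 1) G) is 1 / n^2 up to Q, and (q^3 / lam) / n^2 = 1 / (q
    lam). The constant 288 is 216 for the fixed point error plus 72 for Q; the term in 1 / lam comes
    from D. *)
Lemma pairing_fluctuation w : N (w - xi + G^-1) <= 216 * K ^+ 3 * L ^+ 2 / n%:R ^+ 2 ->
  N ((q ^+ 3 / lam)%:C * m ^+ 2 * (w - xi + 1 / n.+1%:R * (1 / m)) - W * ((q * lam)^-1)%:C) <=
  288 * K ^+ 5 * (L ^+ 4 / q) + 5 * K ^+ 2 / lam.
Proof.
move=> hw.
pose D : R[i] := log_deriv A1 xi + (size Xs)%:R * mean - n.+1%:R * m.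
pose Q : R[i] := m / (n.+1%:R * G) - (n%:R ^+ 2)^-1.
have m0 : m != 0 by rewrite -normc_gt0.
have n10 : (n.+1%:R : R[i]) != 0 by rewrite pnatr_eq0.
have nC0 : (n%:R : R[i]) != 0 by rewrite natc -normc_gt0 normcR normr_gt0 gt_eqF.
have nCq : (n%:R : R[i]) = q%:C ^+ 2 by rewrite natc nq rmorphXn.
have qC0 : q%:C != 0 :> R[i] by rewrite -normc_gt0 normcR normr_gt0 gt_eqF.
have lC0 : lam%:C != 0 :> R[i] by rewrite -normc_gt0 normcR normr_gt0 gt_eqF.
have GD : G - n.+1%:R * m = W + D by rewrite GE /D; ring.
have VU : (q ^+ 3 / lam)%:C * m ^+ 2 * (w - xi + 1 / n.+1%:R * (1 / m)) - W * ((q * lam)^-1)%:C =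
    (q ^+ 3 / lam)%:C * m ^+ 2 * (w - xi + G^-1) +
    ((q ^+ 3 / lam)%:C * ((W + D) * Q) + D * ((q * lam)^-1)%:C).
  rewrite -GD /D /Q -/D.
  have DE : D = G - n.+1%:R * m - W by rewrite GD; ring.
  have cE : (q ^+ 3 / lam)%:C = q%:C ^+ 3 / lam%:C :> R[i] by rewrite rmorphM rmorphXn fmorphV.
  have cE2 : ((q * lam)^-1)%:C = (q%:C * lam%:C)^-1 :> R[i] by rewrite fmorphV rmorphM.
  rewrite DE nCq cE cE2; move: n10; set z := n.+1%:R; clearbody z; move=> z0.
  by field; rewrite qC0 G0 lC0 z0 m0.
have K0' := ltW K0; have L0' := ltW L0; have q0' := ltW q0; have l0' := ltW lam0.
have c0 : 0 <= q ^+ 3 / lam by rewrite divr_ge0// exprn_ge0.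
have c1 : q ^+ 3 / lam <= q ^+ 3 by rewrite ler_pdivrMr// ler_peMr// exprn_ge0.
have n1K : `|(size Xs)%:R - n.+1%:R| <= K + 1 :> R.
  rewrite -natr1 opprD addrA (le_trans (ler_normB _ _))// normr1 lerD2r//.
have ND := bias_le n1K; rewrite -/D in ND.
have hK2 : K <= K ^+ 2 by rewrite expr2 ler_peMr.
have ND1 : N D <= 5 * K ^+ 2 * q.
  apply: (le_trans ND); have := q1; have := K1; rewrite expr2 in hK2 *; nra.
have ND2 : N D <= 5 * K ^+ 2 * q * L ^+ 2 by apply: (le_trans ND1); rewrite ler_peMr// !mulr_ge0// exprn_ge0.
have NWD : N (W + D) <= 6 * K ^+ 2 * (q * L ^+ 2).
  apply: (le_trans (normc_le_add _ _)); apply: (le_trans (lerD WL2 ND2)).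
  have : 1 * (q * L ^+ 2) <= K ^+ 2 * (q * L ^+ 2) by rewrite ler_wpM2r// mulr_ge0// exprn_ge0.
  lra.
have NQ : N Q <= 12 * K ^+ 3 * (L ^+ 2 / q ^+ 5).
  have -> : Q = ((n.+1%:R * (n%:R * m - G) - n%:R * m) / n.+1%:R) * (n%:R ^+ 2 * G)^-1.
    have -> : (n.+1%:R : R[i]) = n%:R + 1 by rewrite -natr1.
    by rewrite /Q -natr1; field; rewrite G0 nC0 natr1 n10.
  rewrite Normc.normcM.
  have h1 : N ((n.+1%:R * (n%:R * m - G) - n%:R * m) / n.+1%:R) <= 6 * K ^+ 2 * (q * L ^+ 2).
    rewrite mulrBl mulrAC divff// mul1r mulrAC.
    apply: (le_trans (normc_le_add _ _)); rewrite normc_opp normc_distC.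
    have h2 : N (n%:R / n.+1%:R * m) <= K.
      rewrite Normc.normcM; apply: le_trans mK; rewrite ler_piMl ?normc_ge0//.
      rewrite Normc.normcM Normc.normcV !natc !normcR !ger0_norm//.
      by rewrite ler_pdivrMr ?ltr0n// mul1r ler_nat.
    apply: (le_trans (lerD Gdist h2)).
    have h3 : K <= K ^+ 2 * (q * L ^+ 2).
      rewrite -[leLHS]mulr1; apply: ler_pM => //.
      by rewrite -[leLHS]mulr1; apply: ler_pM => //; exact: LX.
    lra.
  have h2 : N (n%:R ^+ 2 * G)^-1 <= 2 * K / q ^+ 6.
    rewrite Normc.normcV Normc.normcM normcX natc normcR ger0_norm ?(ltW n0)//.
    rewrite -[leRHS]invrK lef_pV2 ?posrE ?invr_gt0 ?divr_gt0 ?mulr_gt0 ?exprn_gt0 ?normc_gt0//.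
    rewrite invf_div.
    have -> : q ^+ 6 / (2 * K) = n%:R ^+ 2 * (K^-1 * n%:R / 2) by rewrite nq; field; rewrite gt_eqF.
    rewrite ler_wpM2l ?sqr_ge0//; apply: le_trans Gge.
    by rewrite ler_wpM2r// ler_wpM2r// ltW.
  apply: (@le_trans _ _ (6 * K ^+ 2 * (q * L ^+ 2) * (2 * K / q ^+ 6))).
    by apply: ler_pM => //; exact: normc_ge0.
  rewrite (_ : _ * (2 * K / q ^+ 6) = 12 * K ^+ 3 * (L ^+ 2 / q ^+ 5))//.
  by field; rewrite gt_eqF.
rewrite VU; apply: (le_trans (normc_le_add _ _)).
have t1 : N ((q ^+ 3 / lam)%:C * m ^+ 2 * (w - xi + G^-1)) <= 216 * K ^+ 5 * (L ^+ 4 / q).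
  rewrite Normc.normcM Normc.normcM normcR (ger0_norm c0) normcX.
  apply: (@le_trans _ _ (q ^+ 3 * K ^+ 2 * (216 * K ^+ 3 * L ^+ 2 / n%:R ^+ 2))).
    apply: ler_pM => //; first by rewrite mulr_ge0// exprn_ge0// normc_ge0.
      exact: normc_ge0.
    apply: ler_pM => //; first by rewrite exprn_ge0// normc_ge0.
    by rewrite lerXn2r// nnegrE// normc_ge0.
  rewrite nq (_ : _ * (216 * K ^+ 3 * L ^+ 2 / _) = 216 * K ^+ 5 * (L ^+ 2 / q)); last by field; rewrite gt_eqF.
  rewrite (ler_wpM2l (mulr_ge0 (ler0n R 216) _)) ?exprn_ge0//.
  by rewrite ler_wpM2r ?invr_ge0// ler_weXn2l.
have t2 : N ((q ^+ 3 / lam)%:C * ((W + D) * Q)) <= 72 * K ^+ 5 * (L ^+ 4 / q).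
  rewrite !Normc.normcM normcR (ger0_norm c0).
  apply: (@le_trans _ _ (q ^+ 3 * ((6 * K ^+ 2 * (q * L ^+ 2)) * (12 * K ^+ 3 * (L ^+ 2 / q ^+ 5))))).
    apply: ler_pM => //; first by rewrite mulr_ge0 ?normc_ge0.
    by apply: ler_pM => //; exact: normc_ge0.
  by rewrite (_ : _ * (_ * (12 * _ * _)) = 72 * K ^+ 5 * (L ^+ 4 / q))//; field; rewrite gt_eqF.
have t3 : N (D * ((q * lam)^-1)%:C) <= 5 * K ^+ 2 / lam.
  rewrite Normc.normcM normcR ger0_norm ?invr_ge0 ?mulr_ge0//.
  apply: (@le_trans _ _ (5 * K ^+ 2 * q * (q * lam)^-1)).
    by rewrite ler_wpM2r// invr_ge0 mulr_ge0.
  by rewrite invfM mulrA mulfK ?gt_eqF.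
have := normc_le_add ((q ^+ 3 / lam)%:C * ((W + D) * Q)) (D * ((q * lam)^-1)%:C).
lra.
Qed.

(** n / ((n + 1) G) differs from 1 / G by 1 / ((n + 1) G), at most 2 K / n^2; hence 218 = 216 +
    2. *)
Lemma pairing_linearization w : N (w - xi + G^-1) <= 216 * K ^+ 3 * L ^+ 2 / n%:R ^+ 2 ->
  N (w - xi + 1 / n.+1%:R * (n%:R / G)) <= 218 * K ^+ 3 * (L / n%:R) ^+ 2.
Proof.
move=> hw; have K0' := ltW K0.
have n10 : (n.+1%:R : R[i]) != 0 by rewrite pnatr_eq0.
have -> : w - xi + 1 / n.+1%:R * (n%:R / G) = (w - xi + G^-1) - n.+1%:R^-1 * G^-1.
  have -> : (n%:R : R[i]) = n.+1%:R - 1 by rewrite -natr1 addrK.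
  by move: n10; set z := n.+1%:R; clearbody z; move=> z0; field; rewrite z0 G0.
apply: (le_trans (normc_le_add _ _)); rewrite normc_opp.
have h : N (n.+1%:R^-1 * G^-1) <= 2 * K ^+ 3 * (L / n%:R) ^+ 2.
  rewrite Normc.normcM !Normc.normcV natc normcR ger0_norm//.
  apply: (@le_trans _ _ (n%:R^-1 * (2 * K / n%:R))).
    apply: ler_pM; rewrite ?invr_ge0 ?normc_ge0//.
      by have hn : n%:R <= n.+1%:R :> R by [rewrite ler_nat]; rewrite lef_pV2// posrE ltr0n.
    rewrite -[leRHS]invrK lef_pV2 ?posrE ?invr_gt0 ?divr_gt0 ?mulr_gt0 ?normc_gt0//.
    rewrite invf_div; apply: le_trans Gge.
    rewrite invfM mulrA mulrAC ler_wpM2r// mulrC ler_wpM2r// ltW.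
  have -> : n%:R^-1 * (2 * K / n%:R) = 2 * (K * n%:R^-1 ^+ 2) by rewrite expr2; ring.
  have -> : 2 * K ^+ 3 * (L / n%:R) ^+ 2 = 2 * (K ^+ 3 * L ^+ 2 * n%:R^-1 ^+ 2) by ring.
  rewrite ler_wpM2l// ler_wpM2r ?exprn_ge0 ?invr_ge0// -[leLHS]mulr1.
  apply: ler_pM => //.
  by rewrite -[leLHS]expr1 ler_weXn2l.
apply: (le_trans (lerD hw h)).
by rewrite expr_div_n (_ : _ + _ = 218 * K ^+ 3 * (L ^+ 2 / n%:R ^+ 2))//; ring.
Qed.

End PairingStep.

(** * Typical samples *)

Section Scales.
Context (R : realType).

Definition nlog (n : nat) : R := ln n%:R.
Definition rootn (n : nat) : R := Num.sqrt n%:R.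
Definition rootlog (n : nat) : R := Num.sqrt (nlog n).
(** With this fourth root of log n, n e^2 = (log n)^(-1/2) tends to 0 while e sqrt (n log n) = (log
    n)^(1/4) tends to infinity. *)
Definition trunc_level (n : nat) : R := (rootn n * Num.sqrt (rootlog n))^-1.

Lemma nlog_unbounded (M : R) : \forall n \near \oo, M <= nlog n.
Proof.
near=> n; rewrite -[leLHS]expRK /nlog ler_ln ?posrE ?expR_gt0//.
  by near: n; exact: nbhs_infty_ger.
by rewrite ltr0n; near: n; exact: nbhs_infty_gt.
Unshelve. all: by end_near. Qed.

Lemma rootlogV_small (del : R) : 0 < del -> \forall n \near \oo, 1 <= rootlog n /\ (rootlog n)^-1 <= del.
Proof.
move=> d0; near=> n.
have h : (1 + del^-1) ^+ 2 <= nlog n by near: n; exact: nlog_unbounded.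
have d1 : 0 < del^-1 by rewrite invr_gt0.
have h2 : 1 + del^-1 <= rootlog n.
  by rewrite -[leLHS]ger0_norm -?sqrtr_sqr ?ler_wsqrtr//; lra.
split; first by lra.
by rewrite -[leRHS]invrK lef_pV2 ?posrE//; lra.
Unshelve. all: by end_near. Qed.

(** The inequality ln x <= x at x = n^(1/16). This root makes (log n)^4 at most of order n^(1/4),
    well below sqrt n. *)
Lemma nlog_le_sqrt4 n : (0 < n)%N -> nlog n <= 16 * Num.sqrt (Num.sqrt (Num.sqrt (rootn n))).
Proof.
move=> n0; set x := Num.sqrt _.
have n0' : (0 : R) < n%:R by rewrite ltr0n.
have x0 : 0 < x by rewrite !sqrtr_gt0.
have -> : nlog n = ln (x ^+ 16).
  rewrite /nlog; congr ln.
  rewrite (_ : 16 = 2 * (2 * (2 * 2)))%N// !exprM.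
  by rewrite !sqr_sqrtr// ?sqrtr_ge0// ltW.
rewrite lnXn// -[ln x *+ 16]mulr_natl; apply: ler_wpM2l => //.
have := le_ln1Dx (x := x - 1); rewrite addrCA subrr addr0 => h.
by apply: le_trans (h _) _; lra.
Qed.

Lemma nlog_rootn_small (del : R) : 0 < del -> \forall n \near \oo, nlog n ^+ 4 <= del * rootn n.
Proof.
move=> d0; near=> n.
have n0 : (0 < n)%N by near: n; exact: nbhs_infty_gt.
have n0' : (0 : R) < n%:R by rewrite ltr0n.
have l0 : 0 <= nlog n by near: n; exact: nlog_unbounded.
apply: (@le_trans _ _ ((16 * Num.sqrt (Num.sqrt (Num.sqrt (rootn n)))) ^+ 4)).
  by rewrite lerXn2r ?nnegrE ?mulr_ge0 ?sqrtr_ge0//; exact: nlog_le_sqrt4.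
rewrite exprMn; set z := Num.sqrt _.
have -> : z ^+ 4 = Num.sqrt (rootn n).
  by rewrite (_ : 4 = 2 * 2)%N// exprM !sqr_sqrtr ?sqrtr_ge0.
set y := Num.sqrt (rootn n).
have y0 : 0 < y by rewrite !sqrtr_gt0.
have -> : rootn n = y * y by rewrite -expr2 sqr_sqrtr// sqrtr_ge0.
rewrite mulrA ler_wpM2r ?(ltW y0)// -ler_pdivrMl//.
have h : ((del^-1 * 16 ^+ 4) ^+ 2) ^+ 2 <= n%:R by near: n; exact: nbhs_infty_ger.
have c0 : 0 <= del^-1 * 16 ^+ 4 by rewrite mulr_ge0 ?invr_ge0 ?exprn_ge0// ltW.
rewrite -[leLHS]ger0_norm// -sqrtr_sqr ler_wsqrtr//.
by rewrite -[leLHS]ger0_norm ?sqr_ge0// -sqrtr_sqr ler_wsqrtr.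
Unshelve. all: by end_near. Qed.

Section Fixed.
Variable n : nat.
Hypothesis lam1 : 1 <= rootlog n.
Hypothesis Lq : nlog n ^+ 4 <= rootn n.

Lemma nlogE : nlog n = rootlog n ^+ 2.
Proof.
rewrite /rootlog sqr_sqrtr//; case: (lerP 0 (nlog n)) => // h.
by move: lam1; rewrite /rootlog ler0_sqrtr ?(ltW h)// => ?; lra.
Qed.

Lemma nlog_ge1 : 1 <= nlog n. Proof. by rewrite nlogE exprn_ege1. Qed.

Lemma rootn_gt0 : 0 < rootn n.
Proof. by apply: lt_le_trans Lq; rewrite exprn_gt0// (lt_le_trans _ nlog_ge1). Qed.

Lemma natrE_rootn : n%:R = rootn n ^+ 2. Proof. by rewrite sqr_sqrtr. Qed.

Let sl := Num.sqrt (rootlog n).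
Let sl2 : sl ^+ 2 = rootlog n. Proof. by rewrite sqr_sqrtr// (le_trans _ lam1). Qed.
Let sl1 : 1 <= sl. Proof. by rewrite -[leLHS]sqrtr1 ler_wsqrtr. Qed.

Lemma trunc_level_gt0 : 0 < trunc_level n.
Proof. by rewrite invr_gt0 mulr_gt0 ?rootn_gt0// (lt_le_trans _ sl1). Qed.

Lemma trunc_level_le : trunc_level n <= (rootn n)^-1.
Proof.
have q0 := rootn_gt0.
rewrite lef_pV2 ?posrE ?mulr_gt0 ?(lt_le_trans ltr01 sl1)// ler_peMr// ltW//.
Qed.

Lemma trunc_level_ge : (rootn n * nlog n)^-1 <= trunc_level n.
Proof.
have q0 := rootn_gt0; have L1 := nlog_ge1.
rewrite lef_pV2 ?posrE ?mulr_gt0 ?(lt_le_trans ltr01 sl1) ?(lt_le_trans ltr01 L1)//.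
apply: ler_wpM2l; first exact: ltW.
by rewrite nlogE -[in leRHS]sl2 -/sl -exprM -[leLHS]expr1; apply: ler_weXn2l.
Qed.

Lemma trunc_level_sqr : n%:R * trunc_level n ^+ 2 = (rootlog n)^-1.
Proof.
have q0 := rootn_gt0.
rewrite /trunc_level exprVn exprMn -natrE_rootn sl2 invfM mulrA divff ?mul1r//.
by rewrite natrE_rootn expf_neq0// gt_eqF.
Qed.

Lemma ln_trunc_level : ln (trunc_level n)^-1 = nlog n / 2 + ln (rootlog n) / 2.
Proof.
have q0 := rootn_gt0; have l0 : 0 < rootlog n by apply: lt_le_trans lam1.
have s0 : 0 < sl by apply: lt_le_trans sl1.
rewrite /trunc_level invrK -/sl lnM ?posrE// /nlog natrE_rootn lnXn//.
have -> : ln (rootlog n) = ln sl *+ 2 by rewrite -sl2 lnXn.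
by rewrite -[ln (rootn n) *+ 2]mulr_natr -[ln sl *+ 2]mulr_natr !mulfK// pnatr_eq0.
Qed.

Lemma ln_trunc_level_le : ln (trunc_level n)^-1 <= nlog n.
Proof.
have l0 : 0 < rootlog n by apply: lt_le_trans lam1.
have := le_ln1Dx (x := rootlog n - 1); rewrite addrCA subrr addr0 => h.
have h1 : ln (rootlog n) <= rootlog n - 1 by apply: h; lra.
have h2 : rootlog n <= nlog n by rewrite nlogE expr2 ler_peMr// ltW.
rewrite ln_trunc_level; lra.
Qed.

End Fixed.
End Scales.


(** * Probability of a typical sample *)

Section Events.
Context (R : realType) (mu : probability R[i] R) (s : nat) (xi : 'I_s -> R[i]).
Context (d : measure_display) (T : measurableType d) (P : probability T R).
Variable X : nat -> {RV P >-> R[i]}.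
Hypothesis iidX : iid X mu.
Variable n : nat.
Local Notation N := (@Normc.normc R).
Local Notation e := (trunc_level R n).
Local Notation k := (n.+1 - s)%N.
Local Notation L := (nlog R n).
Local Notation lam := (rootlog R n).
Local Notation q := (rootn R n).
Hypothesis lam1 : 1 <= lam.
Hypothesis Lq : L ^+ 4 <= q.

Let e0 : 0 < e. Proof. exact: trunc_level_gt0. Qed.
Let L1 : 1 <= L. Proof. exact: nlog_ge1. Qed.
Let q0 : 0 < q. Proof. exact: rootn_gt0. Qed.
Let n0 : (0 : R) < n%:R. Proof. by rewrite natrE_rootn exprn_gt0. Qed.

Definition trunc_fluct l t : R[i] :=
  \sum_(j < k) trunc_inv (xi l) e (X j t) - k%:R * trunc_mean mu (xi l) e.

Definition trunc_energy l t : R := \sum_(j < k) N (trunc_inv (xi l) e (X j t)) ^+ 2.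

Definition close_points l t : R :=
  \sum_(j < k) \1_[set z : R[i] | supnorm (xi l - z) <= e] (X j t).

(* A typical sample makes every summand less than 1: no sample point is within
   [e] of [xi l], and the energy and the fluctuation are below their
   denominators. *)
Definition atypicality t : R := \sum_l (close_points l t +
  trunc_energy l t / (n%:R * L ^+ 2) + N (trunc_fluct l t) ^+ 2 / (n%:R * L ^+ 3)).

Definition typical : set T := [set t | atypicality t < 1].

Let measurable_square l : measurable [set z : R[i] | supnorm (xi l - z) <= e].
Proof.
have ms : measurable_fun setT (fun z : R[i] => supnorm (xi l - z)).
  by apply: measurable_supnorm; apply: measurable_complexB; [exact: measurable_cst|exact: measurable_id].
have /(_ measurableT) h := measurable_fun_ler ms (@measurable_cst _ _ R[i] _ setT e).
by rewrite -[X in measurable X]setTI; apply: (h [set true]).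
Qed.

Let bclose l : bounded_mfun (close_points l).
Proof.
apply: bounded_mfun_sum => j; apply: (bounded_mfun_RV X j (phi := \1_[set z : R[i] | supnorm (xi l - z) <= e])).
exact: bounded_mfun_indic.
Qed.

Let bsqr l : bounded_mfun (fun x => N (trunc_inv (xi l) e x) ^+ 2).
Proof. by apply: bounded_mfunX; exact: bounded_mfun_normc_trunc_inv. Qed.

Let benergy l : bounded_mfun (trunc_energy l).
Proof. by apply: bounded_mfun_sum => j; exact: (bounded_mfun_RV X j (bsqr l)). Qed.

Let cRe l x := complex.Re (trunc_inv (xi l) e x) - complex.Re (trunc_mean mu (xi l) e).
Let cIm l x := complex.Im (trunc_inv (xi l) e x) - complex.Im (trunc_mean mu (xi l) e).

Lemma bounded_mfun_centered_Re l : bounded_mfun (cRe l).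
Proof. by apply: bounded_mfunB; [exact: bounded_mfun_Re_trunc_inv|exact: bounded_mfun_cst]. Qed.
Lemma bounded_mfun_centered_Im l : bounded_mfun (cIm l).
Proof. by apply: bounded_mfunB; [exact: bounded_mfun_Im_trunc_inv|exact: bounded_mfun_cst]. Qed.

Lemma trunc_fluctE l t : trunc_fluct l t = iid_sum X (cRe l) k t +i* iid_sum X (cIm l) k t.
Proof.
have Re_sum (F : 'I_k -> R[i]) : complex.Re (\sum_j F j) = \sum_j complex.Re (F j).
  by apply: big_morph => // -[a b] [a' b'].
have Im_sum (F : 'I_k -> R[i]) : complex.Im (\sum_j F j) = \sum_j complex.Im (F j).
  by apply: big_morph => // -[a b] [a' b'].
have ReZ (z : R[i]) : complex.Re (k%:R * z) = k%:R * complex.Re z.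
  by rewrite natc; case: z => a b; rewrite /= mul0r subr0.
have ImZ (z : R[i]) : complex.Im (k%:R * z) = k%:R * complex.Im z.
  by rewrite natc; case: z => a b; rewrite /= mul0r addr0.
rewrite /trunc_fluct /iid_sum /cRe /cIm !sumrB !sumr_const card_ord.
rewrite -[complex.Re _ *+ k]mulr_natl -[complex.Im _ *+ k]mulr_natl.
by apply/eqP; rewrite eq_complex ReB ImB Re_sum Im_sum ReZ ImZ /= !eqxx.
Qed.

Lemma bounded_mfun_trunc_fluct_sqr l : bounded_mfun (fun t => N (trunc_fluct l t) ^+ 2).
Proof.
rewrite (_ : (fun t => _) = (fun t => iid_sum X (cRe l) k t ^+ 2 + iid_sum X (cIm l) k t ^+ 2)).
  have bR := bounded_mfun_iid_sum X (bounded_mfun_centered_Re l) k.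
  have bI := bounded_mfun_iid_sum X (bounded_mfun_centered_Im l) k.
  by apply: bounded_mfunD; exact: bounded_mfunX.
by apply/funext => t; rewrite trunc_fluctE /= sqr_sqrtr// addr_ge0 ?sqr_ge0.
Qed.

Let bfluct := bounded_mfun_trunc_fluct_sqr.

Let batyp : bounded_mfun atypicality.
Proof.
apply: bounded_mfun_sum => l; apply: bounded_mfunD; first apply: bounded_mfunD.
- exact: bclose.
- by under eq_fun do rewrite mulrC; exact: bounded_mfunZ.
- by under eq_fun do rewrite mulrC; exact: bounded_mfunZ.
Qed.

Lemma measurable_typical : measurable typical.
Proof.
have [ma _] := batyp.
have /(_ measurableT) h := measurable_fun_ltr ma (@measurable_cst _ _ T _ setT (1 : R)).
by rewrite /typical -[X in measurable X]setTI; apply: (h [set true]).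
Qed.

Let close0 l t : 0 <= close_points l t.
Proof. by apply: sumr_ge0 => j _; rewrite indicE ler0n. Qed.
Let energy0 l t : 0 <= trunc_energy l t.
Proof. by apply: sumr_ge0 => j _; exact: sqr_ge0. Qed.
Let nL0 i : 0 < n%:R * L ^+ i.
Proof. by rewrite mulr_gt0// exprn_gt0// (lt_le_trans ltr01 L1). Qed.

Let atyp0 t : 0 <= atypicality t.
Proof.
apply: sumr_ge0 => l _; rewrite addr_ge0// ?divr_ge0 ?sqr_ge0 ?(ltW (nL0 _))//.
by rewrite addr_ge0 ?divr_ge0 ?(ltW (nL0 _)).
Qed.

Lemma typicalP t : typical t -> forall l,
  [/\ forall j : 'I_k, e < supnorm (xi l - X j t),
      trunc_energy l t <= n%:R * L ^+ 2 &
      N (trunc_fluct l t) <= q * lam * L].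
Proof.
move=> ht l.
have h : close_points l t + trunc_energy l t / (n%:R * L ^+ 2) +
    N (trunc_fluct l t) ^+ 2 / (n%:R * L ^+ 3) < 1.
  apply: le_lt_trans ht; rewrite /atypicality (bigD1 l)//= lerDl.
  apply: sumr_ge0 => i _; rewrite addr_ge0// ?divr_ge0 ?sqr_ge0 ?(ltW (nL0 _))//.
  by rewrite addr_ge0 ?divr_ge0 ?(ltW (nL0 _)).
have h1 := close0 l t.
have h2 : 0 <= trunc_energy l t / (n%:R * L ^+ 2) by rewrite divr_ge0// ltW.
have h3 : 0 <= N (trunc_fluct l t) ^+ 2 / (n%:R * L ^+ 3) by rewrite divr_ge0 ?sqr_ge0// ltW.
split.
- move=> j; rewrite ltNge; apply/negP => hj.
  have : close_points l t < 1 by lra.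
  rewrite /close_points (bigD1 j)//= indicE mem_set//= => hh.
  have : 0 <= \sum_(i < k | i != j) (\1_[set z : R[i] | supnorm (xi l - z) <= e] (X i t) : R).
    by apply: sumr_ge0 => i _; rewrite indicE ler0n.
  by lra.
- by rewrite -[leRHS]mul1r -ler_pdivrMr//; lra.
- have h4 : N (trunc_fluct l t) ^+ 2 <= n%:R * L ^+ 3 by rewrite -[leRHS]mul1r -ler_pdivrMr//; lra.
  have q3 : n%:R * L ^+ 3 = (q * lam * L) ^+ 2.
    by rewrite natrE_rootn !exprMn -(nlogE lam1) -[in RHS]mulrA -exprS.
  rewrite q3 in h4.
  rewrite -(ler_pXn2r (n := 2))// nnegrE ?normc_ge0// !mulr_ge0 ?(ltW q0)//.
    by rewrite (le_trans _ lam1).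
  by rewrite (le_trans _ L1).
Qed.

Variable K : R.
Hypothesis K1 : 1 <= K.
Hypothesis tmK : forall l, trunc_moments mu (xi l) K.
Hypothesis eK : e <= K^-1.
Hypothesis k2n : k%:R <= 2 * n%:R :> R.

Let K0 : 0 <= K. Proof. by apply: le_trans K1. Qed.

Let sqr_bound l : \int[mu]_x N (trunc_inv (xi l) e x) ^+ 2 <= 2 * K * L.
Proof.
have [_ _ _ h] := tmK l e0 eK; apply: (le_trans h).
rewrite (mulrC 2) -mulrA ler_wpM2l//.
by have := ln_trunc_level_le lam1 Lq; have := L1; lra.
Qed.

Let centered (F : R[i] -> R) : bounded_mfun F -> let c := \int[mu]_x F x in
  \int[mu]_x (F x - c) = 0 /\ \int[mu]_x (F x - c) ^+ 2 <= \int[mu]_x F x ^+ 2.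
Proof.
move=> bF c; have bc := bounded_mfun_cst R[i] c; split.
  by rewrite RexpectationB// Rexpectation_cst subrr.
under eq_Rintegral => x _.
  rewrite (_ : _ ^+ 2 = F x ^+ 2 - (2 * c * F x - c ^+ 2)); last by ring.
  over.
have b1 : bounded_mfun (fun x => 2 * c * F x) by exact: bounded_mfunZ.
have b2 := bounded_mfun_cst R[i] (c ^+ 2).
rewrite RexpectationB; [|exact: bounded_mfunX|exact: bounded_mfunB].
rewrite RexpectationB// RexpectationZ// Rexpectation_cst -/c.
by have := sqr_ge0 c; lra.
Qed.

Lemma trunc_fluct_second_moment l :
  \int[P]_t N (trunc_fluct l t) ^+ 2 <= 2 * n%:R * (2 * K * L).
Proof.
have bR := bounded_mfun_centered_Re l; have bI := bounded_mfun_centered_Im l.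
have -> : \int[P]_t N (trunc_fluct l t) ^+ 2 = k%:R * (\int[mu]_x cRe l x ^+ 2 + \int[mu]_x cIm l x ^+ 2).
  under eq_Rintegral => t _.
    rewrite trunc_fluctE /= sqr_sqrtr; last by rewrite addr_ge0 ?sqr_ge0.
    over.
  rewrite RexpectationD; last 2 first.
  - by apply: bounded_mfunX; exact: bounded_mfun_iid_sum.
  - by apply: bounded_mfunX; exact: bounded_mfun_iid_sum.
  rewrite (Rexpectation_iid_sum_sqr iidX bR); last first.
    exact: (centered (bounded_mfun_Re_trunc_inv (xi l) e0)).1.
  rewrite (Rexpectation_iid_sum_sqr iidX bI); last first.
    exact: (centered (bounded_mfun_Im_trunc_inv (xi l) e0)).1.
  by rewrite mulrDr.
have h : \int[mu]_x cRe l x ^+ 2 + \int[mu]_x cIm l x ^+ 2 <= 2 * K * L.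
  apply: le_trans (sqr_bound l).
  have bR2 := bounded_mfun_Re_trunc_inv (xi l) e0; have bI2 := bounded_mfun_Im_trunc_inv (xi l) e0.
  apply: (le_trans (lerD (centered bR2).2 (centered bI2).2)).
  rewrite -RexpectationD; [|exact: bounded_mfunX|exact: bounded_mfunX].
  apply: le_Rexpectation => //.
    by apply: bounded_mfunD; exact: bounded_mfunX.
  by move=> x; case: trunc_inv => u v; rewrite /= sqr_sqrtr// addr_ge0 ?sqr_ge0.
apply: ler_pM => //; rewrite addr_ge0// -(Rexpectation_cst mu 0); apply: le_Rexpectation => //;
    rewrite ?bounded_mfun_cst//; try (by apply: bounded_mfunX); try (by move=> x; exact: sqr_ge0).
    exact: bounded_mfun_cst.
  exact: bounded_mfun_cst.
Qed.

(** The three expectations are of order n e^2 = 1 / lam, n L / (n L^2) and n L / (n L^3), each at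
    most of order 1 / lam. The coefficients add up to 10 = 2 + 4 + 4. *)
Lemma atypicality_expectation : \int[P]_t atypicality t <= s%:R * (10 * K / lam).
Proof.
rewrite /atypicality Rexpectation_sum; last first.
  move=> l; apply: bounded_mfunD; first apply: bounded_mfunD.
  - exact: bclose.
  - by under eq_fun do rewrite mulrC; exact: bounded_mfunZ.
  - by under eq_fun do rewrite mulrC; exact: bounded_mfunZ.
have -> : s%:R * (10 * K / lam) = \sum_(l < s) (10 * K / lam).
  by rewrite sumr_const card_ord mulr_natl.
apply: ler_sum => l _.
have b2 : bounded_mfun (fun t => trunc_energy l t / (n%:R * L ^+ 2)).
  by under eq_fun do rewrite mulrC; exact: bounded_mfunZ.
have b3 : bounded_mfun (fun t => N (trunc_fluct l t) ^+ 2 / (n%:R * L ^+ 3)).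
  by under eq_fun do rewrite mulrC; exact: bounded_mfunZ.
rewrite RexpectationD//; last exact: bounded_mfunD.
rewrite RexpectationD//.
have lam0 : 0 < lam by apply: lt_le_trans lam1.
have Llam : L^-1 <= lam^-1.
  by rewrite lef_pV2 ?posrE ?(lt_le_trans ltr01 L1)// (nlogE lam1) expr2 ler_peMr// ltW.
have E1 : \int[P]_t close_points l t <= 2 * K / lam.
  rewrite /close_points Rexpectation_sum; last first.
    move=> j; apply: (bounded_mfun_RV X j (phi := \1_[set z : R[i] | supnorm (xi l - z) <= e])).
    exact: bounded_mfun_indic.
  rewrite (eq_bigr (fun=> fine (mu [set z : R[i] | supnorm (xi l - z) <= e]))); last first.
    move=> j _; rewrite (Rexpectation_RV iidX j (phi := \1_[set z : R[i] | supnorm (xi l - z) <= e])).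
      by rewrite Rexpectation_indic.
    exact: bounded_mfun_indic.
  rewrite sumr_const card_ord -[_ *+ _]mulr_natl.
  have [h _ _ _] := tmK l e0 eK.
  have h' : fine (mu [set z : R[i] | supnorm (xi l - z) <= e]) <= K * e ^+ 2.
    by rewrite -lee_fin fineK// fin_num_measure.
  apply: (@le_trans _ _ (2 * n%:R * (K * e ^+ 2))).
    by apply: ler_pM => //; rewrite fine_ge0.
  rewrite -(trunc_level_sqr lam1 Lq).
  by rewrite (_ : 2 * n%:R * (K * e ^+ 2) = 2 * K * (n%:R * e ^+ 2))//; ring.
have E2 : \int[P]_t (trunc_energy l t / (n%:R * L ^+ 2)) <= 4 * K / lam.
  under eq_Rintegral do rewrite mulrC.
  rewrite RexpectationZ// /trunc_energy Rexpectation_sum; last by move=> j; exact: (bounded_mfun_RV X j (bsqr l)).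
  rewrite (eq_bigr (fun=> \int[mu]_x N (trunc_inv (xi l) e x) ^+ 2)); last first.
    by move=> j _; rewrite (Rexpectation_RV iidX j (bsqr l)).
  rewrite sumr_const card_ord -[(\int[mu]_x _) *+ k]mulr_natl mulrC ler_pdivrMr//.
  apply: (@le_trans _ _ (2 * n%:R * (2 * K * L))).
    apply: ler_pM => //; rewrite -(Rexpectation_cst mu 0); apply: le_Rexpectation => //.
      exact: bounded_mfun_cst.
    by move=> x; exact: sqr_ge0.
  apply: (@le_trans _ _ (4 * K * L^-1 * (n%:R * L ^+ 2))).
    by rewrite le_eqVlt; apply/orP; left; apply/eqP; field; rewrite gt_eqF// (lt_le_trans ltr01 L1).
  by rewrite ler_wpM2r ?(ltW (nL0 _))// ler_wpM2l// mulr_ge0.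
have E3 : \int[P]_t (N (trunc_fluct l t) ^+ 2 / (n%:R * L ^+ 3)) <= 4 * K / lam.
  under eq_Rintegral do rewrite mulrC.
  rewrite RexpectationZ//.
  rewrite mulrC ler_pdivrMr//; apply: (le_trans (trunc_fluct_second_moment l)).
  apply: (@le_trans _ _ (4 * K * L^-1 * (n%:R * L ^+ 2))).
    by rewrite le_eqVlt; apply/orP; left; apply/eqP; field; rewrite gt_eqF// (lt_le_trans ltr01 L1).
  apply: ler_pM.
  - by rewrite !mulr_ge0// invr_ge0 (le_trans _ L1).
  - exact: ltW.
  - by rewrite ler_wpM2l// mulr_ge0.
  - by rewrite ler_wpM2l ?(ltW n0)// ler_weXn2l.
have -> : 10 * K / lam = 2 * K / lam + 4 * K / lam + 4 * K / lam by ring.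
by rewrite !lerD.
Qed.

Lemma typical_probability : 1 - s%:R * (10 * K / lam) <= fine (P typical).
Proof.
have mt := measurable_typical.
have h : 1 - \int[P]_t atypicality t <= fine (P typical).
  rewrite -Rexpectation_indic// -{1}(Rexpectation_cst P 1) -RexpectationB//; last exact: bounded_mfun_cst.
  apply: le_Rexpectation.
  - by apply: bounded_mfunB => //; exact: bounded_mfun_cst.
  - exact: bounded_mfun_indic.
  - move=> t; rewrite indicE; have [h|h] := boolP (t \in typical).
      by rewrite gerBl.
    by move: h; rewrite notin_setE /typical /= => /negP; rewrite -leNgt => h; rewrite subr_le0.
by apply: le_trans h; rewrite lerB// atypicality_expectation.
Qed.

End Events.

(** * The central limit theorem for truncated sums *)

Section LinearCombination.
Context (R : realType) (mu : probability R[i] R) (s : nat) (xi : 'I_s -> R[i]).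
Variables (a b : 'I_s -> R).
Local Notation N := (@Normc.normc R).

(** The Cramer-Wold device: a real linear combination of the kernels at all points makes the
    fluctuations at the s points a single real iid sum, with summand [centered_lin]. *)
Definition lin_trunc (e : R) l x : R :=
  a l * complex.Re (trunc_inv (xi l) e x) + b l * complex.Im (trunc_inv (xi l) e x).

Definition centered_lin (e : R) x : R :=
  \sum_l lin_trunc e l x - \sum_l \int[mu]_x lin_trunc e l x.

Let al l : R := `|a l| + `|b l|.
Let al0 l : 0 <= al l. Proof. exact: addr_ge0. Qed.

Lemma lin_trunc_le e l x : `|lin_trunc e l x| <= al l * N (trunc_inv (xi l) e x).
Proof.
rewrite (le_trans (ler_normD _ _))// !normrM mulrDl lerD// ler_wpM2l//.
  exact: Re_le_normc.
exact: Im_le_normc.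
Qed.

Section Level.
Variables (e K : R).
Hypothesis e0 : 0 < e.

Lemma bounded_mfun_lin_trunc l : bounded_mfun (lin_trunc e l).
Proof.
apply: bounded_mfunD; apply: bounded_mfunZ.
  exact: bounded_mfun_Re_trunc_inv.
exact: bounded_mfun_Im_trunc_inv.
Qed.
Let bp := bounded_mfun_lin_trunc.

Lemma bounded_mfun_centered_lin : bounded_mfun (centered_lin e).
Proof. by apply: bounded_mfunB; [exact: bounded_mfun_sum|exact: bounded_mfun_cst]. Qed.

Lemma Rexpectation_centered_lin : \int[mu]_x centered_lin e x = 0.
Proof.
rewrite RexpectationB; [|exact: bounded_mfun_sum|exact: bounded_mfun_cst].
by rewrite Rexpectation_cst Rexpectation_sum// subrr.
Qed.

Lemma centered_lin_le x : `|centered_lin e x| <= 2 * (\sum_l al l) / e.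
Proof.
have h l x' : `|lin_trunc e l x'| <= al l / e.
  rewrite (le_trans (lin_trunc_le _ _ _))// ler_wpM2l//; exact: normc_trunc_inv.
rewrite (le_trans (ler_normB _ _))//.
rewrite (_ : 2 * _ / e = \sum_l al l / e + \sum_l al l / e); last by rewrite -mulr_suml; ring.
rewrite lerD// (le_trans (ler_norm_sum _ _ _))//; apply: ler_sum => l _ //.
exact: normr_Rexpectation_le_cst.
Qed.

Hypothesis K1 : 1 <= K.
Hypothesis Kint : forall l, \int[mu]_x N (trunc_inv (xi l) e x) <= K.
Hypothesis Kxi : forall l l', l != l' -> K^-1 <= N (xi l - xi l').

Let K0 : 0 <= K. Proof. by apply: le_trans K1. Qed.
Let bN l := bounded_mfun_normc_trunc_inv (xi l) e0.

(** Products of kernels at distinct points have bounded integrals by [normc_trunc_inv_mul_le], and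
    the mean is bounded as well. The error therefore does not depend on [e], while the diagonal
    terms may grow logarithmically. *)
Lemma variance_centered_lin :
  `|\int[mu]_x centered_lin e x ^+ 2 - \sum_l \int[mu]_x lin_trunc e l x ^+ 2| <=
  \sum_l \sum_l' al l * al l' * (4 * K ^+ 2) + (\sum_l al l * K) ^+ 2.
Proof.
pose c := \sum_l \int[mu]_x lin_trunc e l x.
have bS : bounded_mfun (fun x => \sum_l lin_trunc e l x) by exact: bounded_mfun_sum.
have h1 : \int[mu]_x centered_lin e x ^+ 2 = \int[mu]_x (\sum_l lin_trunc e l x) ^+ 2 - c ^+ 2.
  under eq_Rintegral => x _.
    rewrite (_ : _ ^+ 2 = (\sum_l lin_trunc e l x) ^+ 2 -
       (2 * c * (\sum_l lin_trunc e l x) - c ^+ 2)); last by rewrite /centered_lin -/c; ring.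
    over.
  have b1 := bounded_mfunZ (2 * c) bS.
  have b2 := bounded_mfun_cst R[i] (c ^+ 2).
  rewrite RexpectationB; [|exact: bounded_mfunX|exact: bounded_mfunB].
  rewrite RexpectationB// RexpectationZ// Rexpectation_cst Rexpectation_sum// -/c.
  by ring.
have h2 : \int[mu]_x (\sum_l lin_trunc e l x) ^+ 2 =
    \sum_l \int[mu]_x lin_trunc e l x ^+ 2 +
    \sum_l \sum_(l' | l' != l) \int[mu]_x (lin_trunc e l x * lin_trunc e l' x).
  rewrite -big_split/=.
  under eq_Rintegral => x _ do rewrite expr2 big_distrlr/=.
  rewrite Rexpectation_sum; last first.
    by move=> l; apply: bounded_mfun_sum => l'; exact: bounded_mfunM.
  apply: eq_bigr => l _; rewrite Rexpectation_sum; last by move=> l'; exact: bounded_mfunM.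
  by rewrite (bigD1 l)//=.
have cross l l' : l' != l -> `|\int[mu]_x (lin_trunc e l x * lin_trunc e l' x)| <= al l * al l' * (4 * K ^+ 2).
  move=> ll'; have xx : xi l != xi l'.
    have := Kxi ll'; apply: contraTneq => ->; rewrite subrr Normc.normc0 -ltNge invr_gt0.
    exact: lt_le_trans K1.
  have bb : bounded_mfun (fun x => al l * al l' * (2 / N (xi l - xi l') *
     (N (trunc_inv (xi l) e x) + N (trunc_inv (xi l') e x)))).
    by apply: bounded_mfunZ; apply: bounded_mfunZ; exact: bounded_mfunD.
  apply: (le_trans (normr_Rexpectation_le _ _ bb _)).
  - exact: bounded_mfunM.
  - move=> x; rewrite normrM.
    apply: (le_trans (ler_pM (normr_ge0 _) (normr_ge0 _) (lin_trunc_le _ _ _) (lin_trunc_le _ _ _))).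
    rewrite mulrACA; apply: ler_wpM2l; first exact: mulr_ge0.
    exact: normc_trunc_inv_mul_le.
  rewrite RexpectationZ; last by apply: bounded_mfunZ; exact: bounded_mfunD.
  rewrite ler_wpM2l ?mulr_ge0// RexpectationZ; last exact: bounded_mfunD.
  rewrite RexpectationD//.
  have h3 : 2 / N (xi l - xi l') <= 2 * K.
    rewrite ler_wpM2l// -[leRHS]invrK lef_pV2 ?posrE ?invr_gt0 ?normc_gt0 ?subr_eq0// ?(lt_le_trans ltr01 K1)//.
    by apply: Kxi; rewrite eq_sym.
  rewrite (_ : 4 * K ^+ 2 = 2 * K * (K + K)); last by ring.
  apply: ler_pM => //.
  - by rewrite divr_ge0// normc_ge0.
  - by apply: addr_ge0; rewrite -(Rexpectation_cst mu 0); apply: le_Rexpectation => //;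
      [exact: bounded_mfun_cst|move=> x; exact: normc_ge0|exact: bounded_mfun_cst|move=> x; exact: normc_ge0].
  - exact: lerD.
rewrite h1 h2 [X in `|X|](_ : _ = \sum_l \sum_(l' | l' != l) \int[mu]_x (lin_trunc e l x * lin_trunc e l' x) - c ^+ 2); last by ring.
rewrite (le_trans (ler_normB _ _))// lerD//.
  rewrite (le_trans (ler_norm_sum _ _ _))//; apply: ler_sum => l _.
  rewrite (le_trans (ler_norm_sum _ _ _))//.
  rewrite [leRHS](bigD1 l)//= -[leLHS]add0r lerD//.
    by rewrite !mulr_ge0// ?exprn_ge0.
  by apply: ler_sum => l' ll'; exact: cross.
rewrite normrX lerXn2r// ?nnegrE//.
  by apply: sumr_ge0 => l _; exact: mulr_ge0.
rewrite (le_trans (ler_norm_sum _ _ _))//; apply: ler_sum => l _.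
apply: (le_trans (normr_Rexpectation_le _ _ (bounded_mfunZ (al l) (bN l)) _)) => //.
  by move=> x; exact: lin_trunc_le.
by rewrite RexpectationZ// ler_wpM2l.
Qed.

End Level.

Lemma lin_trunc_fluct d (T : measurableType d) (P : probability T R) (X : nat -> {RV P >-> R[i]}) n t :
  1 <= rootlog R n -> nlog R n ^+ 4 <= rootn R n ->
  \sum_l (a l * complex.Re (trunc_fluct mu xi X n l t) + b l * complex.Im (trunc_fluct mu xi X n l t)) =
  iid_sum X (centered_lin (trunc_level R n)) (n.+1 - s) t.
Proof.
move=> lam1 Lq; have e0 := trunc_level_gt0 lam1 Lq.
rewrite (eq_bigr _ (fun l _ => congr2 (fun u v => a l * u + b l * v)
   (congr1 (@complex.Re R) (trunc_fluctE mu xi X n l t)) (congr1 (@complex.Im R) (trunc_fluctE mu xi X n l t)))).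
rewrite /= /iid_sum /centered_lin /lin_trunc.
under eq_bigr => l _ do rewrite !mulr_sumr -big_split/=.
rewrite exchange_big/=; apply: eq_bigr => j _.
rewrite -sumrB; apply: eq_bigr => l _.
rewrite RexpectationD; [|apply: bounded_mfunZ; exact: bounded_mfun_Re_trunc_inv|apply: bounded_mfunZ; exact: bounded_mfun_Im_trunc_inv].
rewrite !RexpectationZ; [|exact: bounded_mfun_Im_trunc_inv|exact: bounded_mfun_Re_trunc_inv].
by ring.
Qed.

End LinearCombination.


(** * Limits of the scales *)

Section ScaleLimits.
Context (R : realType).

Lemma trunc_level_le_rootlogV n : 1 <= rootlog R n -> nlog R n ^+ 4 <= rootn R n ->
  trunc_level R n <= (rootlog R n)^-1.
Proof.
move=> lam1 Lq; apply: (le_trans (trunc_level_le lam1 Lq)).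
have lam0 : 0 < rootlog R n by apply: lt_le_trans lam1.
rewrite lef_pV2 ?posrE//; last exact: rootn_gt0.
apply: le_trans Lq; rewrite (nlogE lam1) -exprM -[leLHS]expr1; exact: ler_weXn2l.
Qed.

Lemma near_scales (del : R) : 0 < del -> \forall n \near \oo,
  [/\ 1 <= rootlog R n, (rootlog R n)^-1 <= del, nlog R n ^+ 4 <= del * rootn R n,
      nlog R n ^+ 4 <= rootn R n & (0 < n)%N].
Proof.
move=> d0; near=> n.
have [h1 h2] : 1 <= rootlog R n /\ (rootlog R n)^-1 <= del by near: n; exact: rootlogV_small.
split => //.
- by near: n; exact: nlog_rootn_small.
- by rewrite -[leRHS]mul1r; near: n; exact: nlog_rootn_small.
- by near: n; exact: nbhs_infty_gt.
Unshelve. all: by end_near. Qed.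

Lemma cvg_rootlogV : (rootlog R n)^-1 @[n --> \oo] --> (0 : R).
Proof.
apply/cvgrPdist_le => del d0; near=> n.
have [h1 h2 _ _ _] : [/\ 1 <= rootlog R n, (rootlog R n)^-1 <= del, nlog R n ^+ 4 <= del * rootn R n,
      nlog R n ^+ 4 <= rootn R n & (0 < n)%N] by near: n; exact: near_scales.
by rewrite sub0r normrN ger0_norm// invr_ge0 (le_trans _ h1).
Unshelve. all: by end_near. Qed.

Lemma cvg_sqrt_rootlogV : (Num.sqrt (rootlog R n))^-1 @[n --> \oo] --> (0 : R).
Proof.
under eq_fun do rewrite -sqrtrV ?sqrtr_ge0//.
have := cvg_comp _ _ cvg_rootlogV (@sqrt_continuous R 0).
by rewrite sqrtr0.
Qed.

Lemma cvg_natV : (n%:R^-1 : R) @[n --> \oo] --> (0 : R).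
Proof.
apply: (squeeze_cvgr _ (cvg_cst _) cvg_rootlogV); near=> n.
have [h1 _ _ h3 h4] : [/\ 1 <= rootlog R n, (rootlog R n)^-1 <= 1, nlog R n ^+ 4 <= 1 * rootn R n,
      nlog R n ^+ 4 <= rootn R n & (0 < n)%N] by near: n; exact: near_scales.
have lam0 : 0 < rootlog R n by apply: lt_le_trans h1.
have q0 := rootn_gt0 h1 h3.
rewrite invr_ge0 ler0n/= lef_pV2 ?posrE ?ltr0n//.
have hq : rootlog R n <= rootn R n.
  by apply: le_trans h3; rewrite (nlogE h1) -exprM -[leLHS]expr1; exact: ler_weXn2l.
have q1 := le_trans h1 hq.
by rewrite natrE_rootn (le_trans hq)// expr2 ler_peMr// ltW.
Unshelve. all: by end_near. Qed.

Lemma cvg_subn_ratio s : ((n.+1 - s)%N%:R / n%:R : R) @[n --> \oo] --> (1 : R).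
Proof.
have h : (1 + (1 - s%:R) * n%:R^-1 : R) @[n --> \oo] --> (1 : R).
  rewrite -[X in _ --> X]addr0; apply: cvgD; first exact: cvg_cst.
  rewrite -[X in _ --> X](mulr0 (1 - s%:R)); apply: cvgM; first exact: cvg_cst.
  exact: cvg_natV.
apply: cvg_trans h; apply: near_eq_cvg; near=> n.
have n0 : (0 < n)%N by near: n; exact: nbhs_infty_gt.
have sn : (s <= n)%N by near: n; exact: nbhs_infty_ge.
rewrite natrB ?leqW// -natr1; field.
by rewrite pnatr_eq0 -lt0n.
Unshelve. all: by end_near. Qed.

End ScaleLimits.

(** * Variance and characteristic function of the rescaled sum *)

Section CentralLimit.
Context (R : realType) (mu : probability R[i] R) (f : R[i] -> R) (s : nat) (xi : 'I_s -> R[i]).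
Local Notation N := (@Normc.normc R).
Hypothesis hd : forall l, bounded_density_near mu f (xi l).
Hypothesis cf : forall l, {for xi l, continuous f}.
Variable K : R.
Hypothesis K1 : 1 <= K.
Hypothesis tmK : forall l, trunc_moments mu (xi l) K.
Hypothesis Kxi : forall l l', l != l' -> K^-1 <= N (xi l - xi l').
Variables (a b : 'I_s -> R).

Let p l n x := lin_trunc xi a b (trunc_level R n) l x.
Let v n := \int[mu]_x centered_lin mu xi a b (trunc_level R n) x ^+ 2.

Definition limit_variance : R := \sum_l (a l ^+ 2 + b l ^+ 2) * (pi * f (xi l) / 2).

(** This is [trunc_second_moment_asympt] at the truncation level, where log (1 / e) = (L + log lam)
    / 2. *)
Let cvg_second_moment l : (\int[mu]_x p l n x ^+ 2) / nlog R n @[n --> \oo] -->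
  (a l ^+ 2 + b l ^+ 2) * (pi * f (xi l) / 2).
Proof.
apply/cvgrPdist_le => del d0.
set al2 := a l ^+ 2 + b l ^+ 2.
have al0 : 0 <= al2 by rewrite addr_ge0 ?sqr_ge0.
have eta0 : 0 < del / (2 * (1 + al2)) by rewrite divr_gt0// mulr_gt0// ltr_pwDl.
set eta := del / _ in eta0.
have [Ke Ke1 hKe] := trunc_second_moment_asympt (hd l) (@cf l) eta0.
have [f0 _] := bounded_density_square (hd l).
have pi0 : 0 <= (pi : R) by exact: pi_ge0.
have fp0 : 0 <= f (xi l) * pi * al2 by rewrite !mulr_ge0.
(* All errors except the one proportional to [eta] add up to at most C lam, which is negligible
   against L = lam^2. *)
pose C := 1 + Ke + al2 * Ke + f (xi l) * pi * al2.
have aK0 : 0 <= al2 * Ke by rewrite mulr_ge0// (le_trans _ Ke1).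
have C0 : 0 < C by rewrite /C; lra.
near=> n.
have [h1 h2 _ h3 h4] : [/\ 1 <= rootlog R n, (rootlog R n)^-1 <= Num.min C^-1 (del / (2 * C)),
    nlog R n ^+ 4 <= Num.min C^-1 (del / (2 * C)) * rootn R n,
    nlog R n ^+ 4 <= rootn R n & (0 < n)%N].
  by near: n; apply: near_scales; rewrite lt_min invr_gt0 C0 divr_gt0// mulr_gt0.
move: h2; rewrite le_min => /andP[h2 h5].
have e0 := trunc_level_gt0 h1 h3.
have eKe : trunc_level R n <= Ke^-1.
  apply: (le_trans (trunc_level_le_rootlogV h1 h3)); apply: (le_trans h2).
  by rewrite lef_pV2 ?posrE//; [rewrite /C; lra|lra].
have := hKe (a l) (b l) _ e0 eKe.
rewrite -/al2; set I := \int[mu]_x _ => hI.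
have L1 := nlog_ge1 h1; have L0 : 0 < nlog R n by apply: lt_le_trans L1.
have lam0 : 0 < rootlog R n by apply: lt_le_trans h1.
have ell := ln_trunc_level h1 h3; have ellL := ln_trunc_level_le h1 h3.
have lnlam0 := ln_ge0 h1.
have lnlam : ln (rootlog R n) <= rootlog R n.
  have := @le_ln1Dx R (rootlog R n - 1); rewrite addrCA subrr addr0 => h; by rewrite (le_trans (h _)) ?gerBl// ltrBrDr addNr.
set el := ln _^-1 in hI ell ellL.
have LE := nlogE h1.
set L := nlog R n in L1 L0 ell ellL LE *; set lam := rootlog R n in h1 h2 h5 lam0 ell lnlam lnlam0 LE.
have hI2 : `|I - f (xi l) * pi * al2 * (L / 2)| <= al2 * (eta * L + Ke) + f (xi l) * pi * al2 * (lam / 2).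
  have -> : I - f (xi l) * pi * al2 * (L / 2) = (I - f (xi l) * pi * al2 * el) + f (xi l) * pi * al2 * (ln lam / 2).
    by rewrite ell; ring.
  rewrite (le_trans (ler_normD _ _))// lerD//.
    by apply: (le_trans hI); rewrite ler_wpM2l// lerD2r ler_wpM2l// ltW.
  by rewrite ger0_norm ?mulr_ge0// ?ler_wpM2l//; lra.
rewrite distrC.
have -> : I / L - al2 * (pi * f (xi l) / 2) = (I - f (xi l) * pi * al2 * (L / 2)) / L.
  by field; rewrite gt_eqF.
rewrite normrM normfV (gtr0_norm L0) ler_pdivrMr//.
apply: (le_trans hI2).
have lamL : lam <= L by rewrite LE expr2 ler_peMr// ltW.
have e1 : al2 * eta <= del / 2.
  rewrite /eta; rewrite mulrA ler_pdivrMr ?mulr_gt0// ?ltr_pwDl//.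
  by rewrite (_ : del / 2 * (2 * (1 + al2)) = del + al2 * del); [lra|field].
have e2 : C * lam <= del / 2 * L.
  rewrite LE expr2 mulrA ler_wpM2r ?(ltW lam0)//.
  have : C * lam^-1 <= del / 2.
    by rewrite mulrC -ler_pdivlMr// (le_trans h5)// invfM mulrA.
  by rewrite ler_pdivrMr.
have e3 : al2 * eta * L <= del / 2 * L by rewrite ler_wpM2r// ltW.
have e4 : al2 * Ke * 1 <= al2 * Ke * lam by rewrite ler_wpM2l.
have e5 : 0 <= f (xi l) * pi * al2 * lam by rewrite mulr_ge0// ltW.
have e6 : 0 <= (1 + Ke) * lam by rewrite mulr_ge0 ?(ltW lam0)// addr_ge0// (le_trans _ Ke1).
have CE : C * lam = (1 + Ke) * lam + al2 * Ke * lam + f (xi l) * pi * al2 * lam by rewrite /C; ring.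
have -> : al2 * (eta * L + Ke) + f (xi l) * pi * al2 * (lam / 2) =
  al2 * eta * L + al2 * Ke * 1 + f (xi l) * pi * al2 * lam / 2 by ring.
by lra.
Unshelve. all: by end_near. Qed.

(** Only the diagonal terms grow like log n; the error of [variance_centered_lin] is bounded and
    disappears after division. *)
Lemma cvg_variance : v n / nlog R n @[n --> \oo] --> limit_variance.
Proof.
pose S n := \sum_l \int[mu]_x p l n x ^+ 2.
have hS : S n / nlog R n @[n --> \oo] --> limit_variance.
  rewrite /S /limit_variance.
  under eq_fun do rewrite mulr_suml.
  apply: cvg_big => [|l _]; [exact: add_continuous|exact: cvg_second_moment].
have hr : (v n - S n) / nlog R n @[n --> \oo] --> (0 : R).
  set C := \sum_l \sum_l' (`|a l| + `|b l|) * (`|a l'| + `|b l'|) * (4 * K ^+ 2) + (\sum_l (`|a l| + `|b l|) * K) ^+ 2.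
  apply: (@squeeze_cvgr _ _ _ _ (fun n => - (C * (rootlog R n)^-1)) (fun n => C * (rootlog R n)^-1)).
  - near=> n.
    have [h1 h2 _ h3 h4] : [/\ 1 <= rootlog R n, (rootlog R n)^-1 <= K^-1,
        nlog R n ^+ 4 <= K^-1 * rootn R n, nlog R n ^+ 4 <= rootn R n & (0 < n)%N].
      by near: n; apply: near_scales; rewrite invr_gt0 (lt_le_trans ltr01 K1).
    have e0 := trunc_level_gt0 h1 h3.
    have eK := le_trans (trunc_level_le_rootlogV h1 h3) h2.
    have L1 := nlog_ge1 h1; have L0 : 0 < nlog R n by apply: lt_le_trans L1.
    have lam0 : 0 < rootlog R n by apply: lt_le_trans h1.
    have hint l : \int[mu]_x N (trunc_inv (xi l) (trunc_level R n) x) <= K.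
      by have [] := tmK l e0 eK.
    have hv := @variance_centered_lin R mu s xi a b _ K e0 K1 hint Kxi.
    rewrite -ler_norml normrM normfV (gtr0_norm L0).
    have C0 : 0 <= C := le_trans (normr_ge0 _) hv.
    apply: ler_pM => //; first by rewrite invr_ge0 ltW.
    by rewrite lef_pV2 ?posrE// (nlogE h1) expr2 ler_peMr// ltW.
  - rewrite -oppr0; apply: cvgN; rewrite -[X in _ --> X](mulr0 C).
    by apply: cvgM; [exact: cvg_cst|exact: cvg_rootlogV].
  - rewrite -[X in _ --> X](mulr0 C).
    by apply: cvgM; [exact: cvg_cst|exact: cvg_rootlogV].
have -> : (fun n => v n / nlog R n) = (fun n => S n / nlog R n + (v n - S n) / nlog R n).
  by apply/funext => n; rewrite -mulrDl addrC subrK.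
rewrite -[X in _ --> X]addr0; exact: cvgD.
Unshelve. all: by end_near. Qed.

Context (d : measure_display) (T : measurableType d) (P : probability T R).
Variable X : nat -> {RV P >-> R[i]}.
Hypothesis iidX : iid X mu.

Let y n := centered_lin mu xi a b (trunc_level R n).
Let h n : R := (rootn R n * rootlog R n)^-1.

(** A summand is at most a constant over e; multiplied by [h n] this is [kap n], which tends to 0.
    As the variance of the rescaled sum converges, the error of [char_iid_sum_dist] tends to 0. *)
Lemma cvg_char_centered_lin :
  char_re X (y n) (h n) (n.+1 - s) @[n --> \oo] --> expR (- (limit_variance / 2)) /\
  char_im X (y n) (h n) (n.+1 - s) @[n --> \oo] --> (0 : R).
Proof.
pose rat n : R := (n.+1 - s)%N%:R / n%:R.
pose u n := v n / nlog R n.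
pose al := 2 * \sum_l (`|a l| + `|b l|).
pose kap n := al * (Num.sqrt (rootlog R n))^-1.
pose err n := rat n * u n * (kap n ^+ 2 + kap n + u n * n%:R^-1).
have crat : rat n @[n --> \oo] --> (1 : R) by exact: cvg_subn_ratio.
have cu : u n @[n --> \oo] --> limit_variance by exact: cvg_variance.
have ckap : kap n @[n --> \oo] --> (0 : R).
  rewrite -[X in _ --> X](mulr0 al); apply: cvgM; [exact: cvg_cst|exact: cvg_sqrt_rootlogV].
have cerr : err n @[n --> \oo] --> (0 : R).
  have -> : (0 : R) = 1 * limit_variance * (0 ^+ 2 + 0 + limit_variance * 0) by rewrite expr0n/= mulr0 !addr0 mulr0.
  apply: cvgM; first exact: cvgM.
  apply: cvgD; last by apply: cvgM => //; exact: cvg_natV.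
  apply: cvgD => //; rewrite expr2; under eq_fun do rewrite expr2; exact: cvgM.
have cexp : expR (- (rat n * u n / 2)) @[n --> \oo] --> expR (- (limit_variance / 2)).
  have h1 : - (rat n * u n / 2) @[n --> \oo] --> - (limit_variance / 2).
    apply: cvgN; apply: cvgM; last exact: cvg_cst.
    by rewrite -[X in _ --> X]mul1r; exact: cvgM.
  exact: (cvg_comp _ _ h1 (@continuous_expR R _)).
have bound : \forall n \near \oo,
    `|char_re X (y n) (h n) (n.+1 - s) - expR (- (rat n * u n / 2))| <= err n /\
    `|char_im X (y n) (h n) (n.+1 - s)| <= err n.
  near=> n.
  have [h1 h2 _ h3 h4] : [/\ 1 <= rootlog R n, (rootlog R n)^-1 <= 1,
      nlog R n ^+ 4 <= 1 * rootn R n, nlog R n ^+ 4 <= rootn R n & (0 < n)%N].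
    by near: n; exact: near_scales.
  have e0 := trunc_level_gt0 h1 h3.
  have lam0 : 0 < rootlog R n by apply: lt_le_trans h1.
  have q0 := rootn_gt0 h1 h3.
  have n0 : (0 : R) < n%:R by rewrite ltr0n.
  have := char_iid_sum_dist iidX (bounded_mfun_centered_lin mu xi a b e0) (h n) (n.+1 - s)
    (Rexpectation_centered_lin mu xi a b e0) (centered_lin_le mu xi a b e0).
  rewrite /= -/(v n).
  have hv : h n ^+ 2 * v n = u n * n%:R^-1.
    rewrite /h /u natrE_rootn (nlogE h1); field.
    by rewrite !gt_eqF.
  have hk : `|h n| * (2 * (\sum_l (`|a l| + `|b l|)) / trunc_level R n) = kap n.
    have s0 : 0 < Num.sqrt (rootlog R n) by rewrite sqrtr_gt0.
    rewrite ger0_norm; last by rewrite invr_ge0 mulr_ge0// ltW.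
    rewrite /h /trunc_level invrK /kap /al.
    have -> : rootlog R n = Num.sqrt (rootlog R n) ^+ 2 by rewrite sqr_sqrtr// ltW.
    rewrite sqrtr_sqr (ger0_norm (ltW s0)).
    by field; rewrite !gt_eqF.
  rewrite hk hv.
  have -> : (n.+1 - s)%N%:R * (u n * n%:R^-1 / 2) = rat n * u n / 2 by rewrite /rat; ring.
  have -> : (n.+1 - s)%N%:R * (u n * n%:R^-1 * (kap n ^+ 2 + kap n + u n * n%:R^-1)) = err n.
    by rewrite /err /rat; ring.
  by [].
split.
  have hdiff : char_re X (y n) (h n) (n.+1 - s) - expR (- (rat n * u n / 2)) @[n --> \oo] --> (0 : R).
    apply: (@squeeze_cvgr _ _ _ _ (fun n => - err n) err).
    - by near=> n; rewrite -ler_norml; near: n; apply: filterS bound => n [].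
    - by rewrite -oppr0; exact: cvgN.
    - exact: cerr.
  have -> : (fun n => char_re X (y n) (h n) (n.+1 - s)) = (fun n =>
     (char_re X (y n) (h n) (n.+1 - s) - expR (- (rat n * u n / 2))) + expR (- (rat n * u n / 2))).
    by apply/funext => n; rewrite subrK.
  by rewrite -[X in _ --> X]add0r; exact: cvgD.
apply: (@squeeze_cvgr _ _ _ _ (fun n => - err n) err).
- by near=> n; rewrite -ler_norml; near: n; apply: filterS bound => n [].
- by rewrite -oppr0; exact: cvgN.
- exact: cerr.
Unshelve. all: by end_near. Qed.

End CentralLimit.

(** * Critical points of the random polynomial *)

Section Constants.
Context (R : realType) (mu : probability R[i] R) (f : R[i] -> R) (s : nat) (xi : 'I_s -> R[i]).
Local Notation N := (@Normc.normc R).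
Local Notation m := (cauchy_stieltjes mu).

Definition other_roots (l : 'I_s) : seq R[i] := [seq xi j | j <- enum 'I_s & j != l].

Lemma big_other_roots (V : nmodType) l (F : R[i] -> V) :
  \sum_(a <- other_roots l) F a = \sum_(j < s | j != l) F (xi j).
Proof. by rewrite /other_roots big_map big_filter big_enum_cond. Qed.

(** One constant for all points and all estimates, depending on mu and the points only and hence
    available before the sample space. *)
Record uniform_constant (K : R) : Prop := UniformConstant {
  uniform_ge1 : 1 <= K;
  uniform_size : s%:R + 1 <= K;
  uniform_moments : forall l, trunc_moments mu (xi l) K;
  uniform_transform_ge : forall l, K^-1 <= N (m (xi l));
  uniform_transform_le : forall l, N (m (xi l)) <= K;
  uniform_separation : forall l l', l != l' -> K^-1 <= N (xi l - xi l');
  uniform_deriv : forall l, N (log_deriv (other_roots l) (xi l)) <= K;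
  uniform_sqr : forall l, \sum_(a <- other_roots l) N (xi l - a) ^- 2 <= K }.

Lemma uniform_constant_exists : injective xi ->
  (forall l, ~ cauchy_stieltjes_zeros mu (xi l)) ->
  (forall l, bounded_density_near mu f (xi l)) -> exists K, uniform_constant K.
Proof.
move=> xi_inj nz hd.
(* Membership in [cauchy_stieltjes_zeros] includes existence of the integral; since the bounded
   density provides existence, the transform cannot vanish. *)
have m0 l : 0 < N (m (xi l)).
  have [ex _] := trunc_moments_exists (hd l).
  by rewrite normc_gt0; apply/eqP => ml0; apply: (nz l); split.
have /choice[Kl hKl] : forall l, exists K, 1 <= K /\ forall K', K <= K' -> trunc_moments mu (xi l) K'.
  by move=> l; have [_ [K K1 hK]] := trunc_moments_exists (hd l); exists K.
pose c l := N (log_deriv (other_roots l) (xi l)).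
pose sq l := \sum_(a <- other_roots l) N (xi l - a) ^- 2.
pose sep l := \sum_l' (N (xi l - xi l'))^-1.
pose S l := Kl l + N (m (xi l)) + (N (m (xi l)))^-1 + c l + sq l + sep l.
have Kl1 l : 1 <= Kl l by have [] := hKl l.
have c0 l : 0 <= c l by exact: normc_ge0.
have sq0 l : 0 <= sq l by apply: sumr_ge0 => a _; rewrite invr_ge0 sqr_ge0.
have sep0 l : 0 <= sep l by apply: sumr_ge0 => a _; rewrite invr_ge0 normc_ge0.
have mV0 l : 0 < (N (m (xi l)))^-1 by rewrite invr_gt0.
have S0 l : 0 <= S l.
  rewrite /S; have := Kl1 l; have := c0 l; have := sq0 l; have := sep0 l; have := mV0 l; have := m0 l; lra.
pose K := 1 + s%:R + \sum_l S l.
have KS l : S l + 1 <= K.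
  have : S l <= \sum_l S l by rewrite (bigD1 l)//= lerDl; apply: sumr_ge0.
  have := ler0n R s; rewrite /K; lra.
have K0 : 1 + s%:R <= K by rewrite /K lerDl; apply: sumr_ge0.
have Kp : 0 < K by have := ler0n R s; lra.
exists K; split.
- by have := ler0n R s; lra.
- by lra.
- move=> l; apply: (hKl l).2; apply: le_trans (KS l); rewrite /S.
  have := c0 l; have := sq0 l; have := sep0 l; have := mV0 l; have := m0 l; lra.
- move=> l; rewrite -[leRHS]invrK lef_pV2 ?posrE//; apply: le_trans (KS l); rewrite /S.
  have := Kl1 l; have := c0 l; have := sq0 l; have := sep0 l; have := mV0 l; have := m0 l; lra.
- move=> l; apply: le_trans (KS l); rewrite /S.
  have := Kl1 l; have := c0 l; have := sq0 l; have := sep0 l; have := mV0 l; have := m0 l; lra.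
- move=> l l' ll'; have d0 : 0 < N (xi l - xi l').
    by rewrite normc_gt0 subr_eq0; apply: contra ll' => /eqP/xi_inj ->.
  rewrite -[leRHS]invrK lef_pV2 ?posrE ?invr_gt0//; apply: le_trans (KS l).
  have : (N (xi l - xi l'))^-1 <= sep l.
    by rewrite /sep (bigD1 l')//= lerDl; apply: sumr_ge0 => j _; rewrite invr_ge0 normc_ge0.
  rewrite /S; have := Kl1 l; have := c0 l; have := sq0 l; have := mV0 l; have := m0 l; lra.
- move=> l; apply: le_trans (KS l); rewrite /S -/(c l).
  have := Kl1 l; have := sq0 l; have := sep0 l; have := mV0 l; have := m0 l; lra.
- move=> l; apply: le_trans (KS l); rewrite /S -/(sq l).
  have := Kl1 l; have := c0 l; have := sep0 l; have := mV0 l; have := m0 l; lra.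
Qed.

End Constants.

(** * Critical points on typical samples, and their measurability *)

Section CriticalPoints.
Context (R : realType) (mu : probability R[i] R) (s : nat) (xi : 'I_s -> R[i]).
Local Notation N := (@Normc.normc R).
Local Notation m := (cauchy_stieltjes mu).
Variable K : R.
Hypothesis uK : uniform_constant mu xi K.

Definition large_scale n := [/\ 1 <= rootlog R n, (rootlog R n)^-1 <= K^-1,
  144 * K ^+ 4 * nlog R n ^+ 4 <= rootn R n & (s <= n)%N /\ nlog R n ^+ 4 <= rootn R n].

Lemma near_large_scale : \forall n \near \oo, large_scale n.
Proof.
have K1 := uniform_ge1 uK; have K0 : 0 < K by apply: lt_le_trans K1.
have c0 : 0 < 144 * K ^+ 4 by rewrite mulr_gt0// exprn_gt0.
near=> n.
have h1 : 1 <= rootlog R n /\ (rootlog R n)^-1 <= K^-1.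
  by near: n; apply: rootlogV_small; rewrite invr_gt0.
split; [exact: h1.1|exact: h1.2| |split].
- by rewrite -ler_pdivlMl//; near: n; apply: nlog_rootn_small; rewrite invr_gt0.
- by near: n; exact: nbhs_infty_ge.
- by rewrite -[leRHS]mul1r; near: n; exact: nlog_rootn_small.
Unshelve. all: by end_near. Qed.

Context (d : measure_display) (T : measurableType d) (P : probability T R).
Variable X : nat -> {RV P >-> R[i]}.
Hypothesis iidX : iid X mu.

Definition sample_roots n t : seq R[i] := [seq X j t | j <- iota 0 (n.+1 - s)].
Definition all_other_roots n l t := other_roots xi l ++ sample_roots n t.

Lemma big_sample_roots (V : nmodType) n t (F : R[i] -> V) :
  \sum_(a <- sample_roots n t) F a = \sum_(j < n.+1 - s) F (X j t).
Proof. by rewrite /sample_roots big_map -(big_mkord xpredT (fun j => F (X j t))) /index_iota subn0. Qed.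

Lemma rooted_polyE n l t : rooted_poly xi (fun j => X j t) n =
  ('X - (xi l)%:P) * \prod_(a <- all_other_roots n l t) ('X - a%:P).
Proof.
rewrite /rooted_poly /all_other_roots big_cat/= mulrA; congr (_ * _).
  rewrite (bigD1 l)//=; congr (_ * _).
  by rewrite /other_roots big_map big_filter big_enum_cond.
by rewrite /sample_roots big_map -(big_mkord xpredT (fun j => 'X - (X j t)%:P)) /index_iota subn0.
Qed.

Lemma log_deriv_all_other_roots n l t z : log_deriv (all_other_roots n l t) z =
  \sum_(j < s | j != l) (z - xi j)^-1 + \sum_(j < n.+1 - s) (z - X j t)^-1.
Proof. by rewrite /log_deriv big_cat/= big_other_roots big_sample_roots. Qed.

Definition crit_iter n l k t := iter k (crit_step (xi l) (all_other_roots n l t)) (xi l).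

(** Every iterate is a rational expression in the sample. This is the source of measurability for
    the critical point itself. *)
Lemma measurable_crit_iter n l k : measurable_fun setT (crit_iter n l k).
Proof.
elim: k => [|k ih]; first exact: measurable_cst.
rewrite (_ : crit_iter n l k.+1 = (fun t => xi l -
   (\sum_(j < s | j != l) (crit_iter n l k t - xi j)^-1 +
    \sum_(j < n.+1 - s) (crit_iter n l k t - X j t)^-1)^-1)).
  apply: measurable_complexB; first exact: measurable_cst.
  apply: measurable_complexV; apply: measurable_complexD.
    under eq_fun do rewrite -big_filter.
    apply: measurable_complex_sum => j; apply: measurable_complexV.
    by apply: measurable_complexB => //; exact: measurable_cst.
  apply: measurable_complex_sum => j; apply: measurable_complexV.
  by apply: measurable_complexB => //; exact: measurable_funPT.
by apply/funext => t; rewrite /crit_iter iterS /crit_step log_deriv_all_other_roots.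
Qed.

(* The difference of these two is asymptotically negligible. *)
Definition lin_stat n l t : R[i] := trunc_fluct mu xi X n l t * ((rootn R n * rootlog R n)^-1)%:C.
Definition crit_fluct n l (w : R[i]) : R[i] :=
  (rootn R n ^+ 3 / rootlog R n)%:C * m (xi l) ^+ 2 * (w - xi l + 1 / n.+1%:R * (1 / m (xi l))).

Definition crit_properties n l t (w : R[i]) :=
  let p := rooted_poly xi (fun j => X j t) n in
  let r := 3 / (N (m (xi l)) * n%:R) in
  [/\ N (w - xi l) <= r,
      root p^`() w /\ forall z, root p^`() z -> N (z - xi l) <= r -> z = w,
      N (w - xi l + 1 / n.+1%:R * (n%:R / log_deriv (all_other_roots n l t) (xi l))) <=
        218 * K ^+ 3 * (nlog R n / n%:R) ^+ 2
    & N (crit_fluct n l w - lin_stat n l t) <=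
        288 * K ^+ 5 * (nlog R n ^+ 4 / rootn R n) + 5 * K ^+ 2 / rootlog R n].

(** On a typical sample no point lies in a truncation square, so that truncated and true sums
    coincide and [pairing_step] applies. *)
Lemma crit_point_exists n l t : large_scale n -> typical mu xi X n t -> exists w,
  [/\ complex.Re (crit_iter n l k t) @[k --> \oo] --> complex.Re w,
      complex.Im (crit_iter n l k t) @[k --> \oo] --> complex.Im w &
      crit_properties n l t w].
Proof.
move=> [h1 h2 h3 [h4 h5]] ht.
have [K1 Ks Km Kge Kle Ksep Kder Ksqr] := uK.
have K0 : 0 < K by apply: lt_le_trans K1.
have [t1 t2 t3] := typicalP h1 h5 ht l.
have e0 := trunc_level_gt0 h1 h5.
have eK := le_trans (trunc_level_le_rootlogV h1 h5) h2.
have [_ mb _ _] := Km l _ e0 eK.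
have q0 := rootn_gt0 h1 h5.
have far x : x \in sample_roots n t -> trunc_level R n < supnorm (xi l - x).
  by move=> /mapP[j]; rewrite mem_iota add0n => /andP[_ jk] ->; exact: (t1 (Ordinal jk)).
have tE j : (j < n.+1 - s)%N -> trunc_inv (xi l) (trunc_level R n) (X j t) = (xi l - X j t)^-1.
  by move=> jk; rewrite /trunc_inv (t1 (Ordinal jk)).
have sz : size (sample_roots n t) = (n.+1 - s)%N by rewrite size_map size_iota.
have A1far a : a \in other_roots xi l -> K^-1 <= N (xi l - a).
  by move=> /mapP[j]; rewrite mem_filter => /andP[jl _] ->; apply: Ksep; rewrite eq_sym.
have kn : `|(size (sample_roots n t))%:R - n%:R| <= K.
  rewrite sz natrB ?leqW// -natr1 ler_norml; have := ler0n R s => s0.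
  by apply/andP; split; lra.
have Xsqr : \sum_(x <- sample_roots n t) N (xi l - x) ^- 2 <= n%:R * nlog R n ^+ 2.
  apply: le_trans t2; rewrite big_sample_roots /trunc_energy.
  by apply: ler_sum => j _; rewrite tE// Normc.normcV exprVn.
have WE : \sum_(x <- sample_roots n t) (xi l - x)^-1 -
    (size (sample_roots n t))%:R * trunc_mean mu (xi l) (trunc_level R n) = trunc_fluct mu xi X n l t.
  rewrite big_sample_roots sz /trunc_fluct; congr (_ - _).
  by apply: eq_bigr => j _; rewrite tE.
have WL : N (\sum_(x <- sample_roots n t) (xi l - x)^-1 -
    (size (sample_roots n t))%:R * trunc_mean mu (xi l) (trunc_level R n)) <=
    rootn R n * rootlog R n * nlog R n by rewrite WE.
have := @pairing_step R (xi l) (m (xi l)) (trunc_mean mu (xi l) (trunc_level R n))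
  (other_roots xi l) (sample_roots n t) n K (rootn R n) (nlog R n) (rootlog R n) (trunc_level R n)
  K1 (Kge l) (Kle l) A1far (Kder l) (Ksqr l) q0 (natrE_rootn R n) h1 (nlogE h1) h3 kn
  (trunc_level_le h1 h5) (trunc_level_ge h1 h5) mb far Xsqr WL.
move=> [w [w1 w2 [w3 w4 w5 w6]]]; exists w; split => //; split => //.
- by rewrite (rooted_polyE n l t); split.
- exact: (@pairing_linearization R (xi l) (m (xi l)) (trunc_mean mu (xi l) (trunc_level R n))
    (other_roots xi l) (sample_roots n t) n K (rootn R n) (nlog R n) (rootlog R n) (trunc_level R n)
    K1 (Kge l) (Kle l) (Kder l) q0 (natrE_rootn R n) h1 (nlogE h1) h3 kn
    (trunc_level_le h1 h5) mb WL w w6).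
- rewrite /lin_stat -WE.
  exact: (@pairing_fluctuation R (xi l) (m (xi l)) (trunc_mean mu (xi l) (trunc_level R n))
    (other_roots xi l) (sample_roots n t) n K (rootn R n) (nlog R n) (rootlog R n) (trunc_level R n)
    K1 (Kge l) (Kle l) (Kder l) q0 (natrE_rootn R n) h1 (nlogE h1) h3 kn
    (trunc_level_le h1 h5) mb WL w w6).
Qed.

Variable n0 : nat.
Hypothesis n0P : forall n, (n0 <= n)%N -> large_scale n.

(** Empty below [n0], so that the properties of the critical points can be asserted for every n
    without changing the limit of the probabilities. *)
Definition good_event n : set T := if (n0 <= n)%N then typical mu xi X n else set0.

Lemma measurable_good_event n : measurable (good_event n).
Proof.
rewrite /good_event; case: ifPn => // h; have [h1 h2 _ [_ h3]] := n0P h.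
exact: measurable_typical.
Qed.

Lemma good_event_probability n : (n0 <= n)%N ->
  1 - s%:R * (10 * K / rootlog R n) <= fine (P (good_event n)).
Proof.
move=> h; rewrite /good_event h; have [h1 h2 h3 [h4 h5]] := n0P h.
apply: typical_probability => //.
- exact: (uniform_ge1 uK).
- exact: (uniform_moments uK).
- exact: (le_trans (trunc_level_le_rootlogV h1 h5) h2).
- have n1 : (0 < n)%N.
    have := rootn_gt0 h1 h5; case: (n) => // hh; have := hh; by rewrite /rootn sqrtr0 ltxx.
  rewrite -natrM ler_nat; apply: (leq_trans (leq_subr _ _)).
  by rewrite mul2n -addnn -addn1 leq_add2l.
Qed.

Lemma good_event_cvg : P (good_event n) @[n --> \oo] --> 1%E.
Proof.
have mE n := measurable_good_event n.
have h : fine (P (good_event n)) @[n --> \oo] --> (1 : R).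
  apply: (@squeeze_cvgr _ _ _ _ (fun n => 1 - s%:R * (10 * K) * (rootlog R n)^-1) (fun=> 1)).
  - near=> n.
    have nn : (n0 <= n)%N by near: n; exact: nbhs_infty_ge.
    apply/andP; split; first by have := good_event_probability nn; rewrite !mulrA.
    by rewrite -lee_fin fineK ?fin_num_measure// probability_le1.
  - rewrite -[X in _ --> X]subr0; apply: cvgB; first exact: cvg_cst.
    rewrite -[X in _ --> X](mulr0 (s%:R * (10 * K))); apply: cvgM; [exact: cvg_cst|exact: cvg_rootlogV].
  - exact: cvg_cst.
by apply: cvg_EFin => //; apply: nearW => n; rewrite fin_num_measure.
Unshelve. all: by end_near. Qed.

(** The point is picked separately for each outcome, yet it is measurable: it is the limit of the
    iterates multiplied by the indicator of the good event, and 0 elsewhere. *)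
Lemma crit_points : exists w : nat -> 'I_s -> {RV P >-> R[i]},
  forall n l t, good_event n t -> crit_properties n l t (w n l t).
Proof.
have /choice[W hW] : forall p : nat * 'I_s * T, exists w : R[i],
    (good_event p.1.1 p.2 ->
     [/\ complex.Re (crit_iter p.1.1 p.1.2 k p.2) @[k --> \oo] --> complex.Re w,
      complex.Im (crit_iter p.1.1 p.1.2 k p.2) @[k --> \oo] --> complex.Im w &
      crit_properties p.1.1 p.1.2 p.2 w]) /\ (~ good_event p.1.1 p.2 -> w = 0).
  move=> [[n l] t] /=; have [h|h] := pselect (good_event n t); last by exists 0.
  have [||w hw] := @crit_point_exists n l t.
  - by move: h; rewrite /good_event; case: ifPn => // h _; exact: n0P.
  - by move: h; rewrite /good_event; case: ifPn.
  by exists w; split.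
have mW n l : measurable_fun setT (fun t => W (n, l, t)).
  have mE := measurable_good_event n.
  have mind : measurable_fun setT (\1_(good_event n) : T -> R) by exact: measurable_indic.
  have mi k : measurable_fun setT (fun t => complex.Re (crit_iter n l k t)) /\
      measurable_fun setT (fun t => complex.Im (crit_iter n l k t)).
    by apply/measurable_complexP; exact: measurable_crit_iter.
  apply/measurable_complexP; split.
    apply: (@measurable_fun_cvg _ _ R setT (fun k t => complex.Re (crit_iter n l k t) * \1_(good_event n) t)).
      by move=> k; apply: measurable_funM => //; exact: (mi k).1.
    move=> t _; have [h1 h2] := hW (n, l, t); rewrite /= in h1 h2.
    rewrite indicE; have [h|h] := boolP (t \in good_event n).
      have [c1 _ _] := h1 (set_mem h).
      by under eq_fun do rewrite mulr1; exact: c1.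
    rewrite notin_setE in h; rewrite (h2 h) /=.
    by under eq_fun do rewrite mulr0; exact: cvg_cst.
  apply: (@measurable_fun_cvg _ _ R setT (fun k t => complex.Im (crit_iter n l k t) * \1_(good_event n) t)).
    by move=> k; apply: measurable_funM => //; exact: (mi k).2.
  move=> t _; have [h1 h2] := hW (n, l, t); rewrite /= in h1 h2.
  rewrite indicE; have [h|h] := boolP (t \in good_event n).
    have [_ c1 _] := h1 (set_mem h).
    by under eq_fun do rewrite mulr1; exact: c1.
  rewrite notin_setE in h; rewrite (h2 h) /=.
  by under eq_fun do rewrite mulr0; exact: cvg_cst.
exists (fun n l => RV_of P (mW n l)) => n l t ht.
by have [h1 _] := hW (n, l, t); have [] := h1 ht.
Qed.

End CriticalPoints.

(** * The limit law of the fluctuations *)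

Section GaussianFamily.
Context (R : realType) (n : nat) (d : measure_display) (T : measurableType d).
Variables (P : probability T R) (Z : 'I_n -> T -> R).
Hypothesis mZ : forall i, measurable_fun setT (Z i).
Hypothesis hZ : forall c : 'I_n -> R,
  std_law P (fun t => \sum_i c i * Z i t) (\sum_i c i ^+ 2).
Implicit Types c : 'I_n -> R.

Let Y c t := \sum_i c i * Z i t.
Let v0 c : 0 <= \sum_i c i ^+ 2. Proof. by apply: sumr_ge0 => i _; exact: sqr_ge0. Qed.

Lemma measurable_gaussian_lin c : measurable_fun setT (fun t => \sum_i c i * Z i t).
Proof. exact: measurable_lin. Qed.
Let mY := measurable_gaussian_lin.

Lemma gaussian_variable_lin c : gaussian_variable P (fun t => \sum_i c i * Z i t).
Proof.
have [v1|v1] := eqVneq (\sum_i c i ^+ 2) 0; last first.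
  have vp : 0 < \sum_i c i ^+ 2 by rewrite lt_neqAle eq_sym v1 v0.
  left; exists 0, (Num.sqrt (\sum_i c i ^+ 2)); split; first by rewrite gt_eqF// sqrtr_gt0.
  exact: (std_lawE vp (hZ c)).
right; exists 0 => A mA; rewrite (hZ c mA) v1 sqrtr0.
rewrite (_ : (fun x : R => 0 * x) = cst 0); last by apply/funext => x; rewrite mul0r.
rewrite preimage_cst diracE; case: ifPn => h; last by rewrite measure0.
by rewrite [LHS](@probability_setT _ _ _ (std_normal R)).
Qed.

(** Polarization reduces the product to squares of two other linear combinations. *)
Lemma Rexpectation_gaussian_lin_mul c c' :
  P.-integrable setT (EFin \o (fun t => Y c t * Y c' t)) /\
  \int[P]_t (Y c t * Y c' t) = \sum_i c i * c' i.
Proof.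
pose p i := c i + c' i; pose q i := c i - c' i.
have YE t : Y c t * Y c' t = 4^-1 * (Y p t ^+ 2 - Y q t ^+ 2).
  have -> : Y p t = Y c t + Y c' t by rewrite /Y -big_split/=; apply: eq_bigr => i _; rewrite mulrDl.
  have -> : Y q t = Y c t - Y c' t by rewrite /Y -sumrB/=; apply: eq_bigr => i _; rewrite mulrBl.
  by field.
have ip := integrable_gaussian_sqr (v0 p) (mY p) (hZ p).
have iq := integrable_gaussian_sqr (v0 q) (mY q) (hZ q).
have ipq := integrable_RB ip iq.
split.
  rewrite (_ : (fun t => _) = (fun t => 4^-1 * (Y p t ^+ 2 - Y q t ^+ 2))); last exact/funext.
  exact: integrable_RZ.
under eq_Rintegral => t _ do rewrite YE.
rewrite (RintegralZl _ measurableT ipq) (RintegralB measurableT ip iq).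
rewrite (Rintegral_gaussian_sqr (v0 p) (mY p) (hZ p)) (Rintegral_gaussian_sqr (v0 q) (mY q) (hZ q)).
by rewrite -sumrB mulr_sumr; apply: eq_bigr => i _; rewrite /p /q; field.
Qed.

Lemma expectation_gaussian_lin c : ('E_P[(fun t => \sum_i c i * Z i t)%R] = 0)%E.
Proof.
have i1 := integrable_gaussian (mY c) (hZ c).
have := Rintegral_gaussian (mY c) (hZ c).
rewrite /Rintegral => h; rewrite unlock.
by rewrite -[LHS]fineK ?h// integrable_fin_num.
Qed.

Lemma covariance_gaussian_lin c c' :
  covariance P (fun t => \sum_i c i * Z i t) (fun t => \sum_i c' i * Z i t) = (\sum_i c i * c' i)%:E.
Proof.
have [i1 h] := Rexpectation_gaussian_lin_mul c c'.
rewrite unlock !expectation_gaussian_lin/= unlock.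
rewrite -h /Rintegral fineK; last exact: integrable_fin_num.
apply: eq_integral => t _; congr (_%:E).
by rewrite -[LHS]/((Y c t - 0) * (Y c' t - 0)) !subr0.
Qed.

Lemma gaussian_lin_tight (sigma : 'I_n -> R) (e : R) : 0 < e -> exists2 L : R, 0 < L &
  fine (P [set t | exists i, L < `|sigma i * Z i t|]) <= e.
Proof.
move=> e0.
pose del (i : 'I_n) (j : 'I_n) : R := if j == i then sigma i else 0.
have YE i t : Y (del i) t = sigma i * Z i t.
  rewrite /Y (bigD1 i)//= /del eqxx big1 ?addr0// => j /negbTE ->; by rewrite mul0r.
pose v := \sum_i sigma i ^+ 2.
have v_0 : 0 <= v := v0 sigma.
(* Chebyshev's inequality gives the bound v / L^2, and v <= e L <= e L^2. *)
pose L := 1 + v / e.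
have L1 : 1 <= L by rewrite /L lerDl divr_ge0// ltW.
have L0 : 0 < L by apply: lt_le_trans L1.
exists L => //.
set A := [set t | _].
have mA : measurable A.
  rewrite (_ : A = \bigcup_(i in [set: 'I_n]) [set t | L < `|sigma i * Z i t|]).
    apply: fin_bigcup_measurable => // i _.
    have mf : measurable_fun setT (fun t => `|sigma i * Z i t|).
      by apply: measurableT_comp => //; exact: measurable_funM.
    have /(_ measurableT) hh := measurable_fun_ltr (@measurable_cst _ _ T _ setT L) mf.
    by rewrite -[X in measurable X]setTI; apply: (hh [set true]).
  by apply/seteqP; split => t /=; [move=> [i hi]; exists i|move=> [i _ hi]; exists i].
have isq i : P.-integrable setT (EFin \o (fun t => (sigma i * Z i t) ^+ 2)).
  have := integrable_gaussian_sqr (v0 (del i)) (mY (del i)) (hZ (del i)).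
  by rewrite (_ : (fun t => _) = (fun t => (sigma i * Z i t) ^+ 2))//; apply/funext => t; rewrite -YE.
have Isq i : \int[P]_t (sigma i * Z i t) ^+ 2 = sigma i ^+ 2.
  under eq_Rintegral => t _ do rewrite -YE.
  rewrite (Rintegral_gaussian_sqr (v0 (del i)) (mY (del i)) (hZ (del i))).
  rewrite (bigD1 i)//= /del eqxx big1 ?addr0// => j /negbTE ->; by rewrite expr0n.
have hs : forall r : seq 'I_n, P.-integrable setT (EFin \o (fun t => \sum_(i <- r) (sigma i * Z i t) ^+ 2)) /\
    \int[P]_t (\sum_(i <- r) (sigma i * Z i t) ^+ 2) = \sum_(i <- r) sigma i ^+ 2.
  elim=> [|i r [ih1 ih2]].
    rewrite big_nil (_ : (fun t => _) = (fun=> 0)); last by apply/funext => t; rewrite big_nil.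
    by split; [exact: integrable_Rcst|exact: Rexpectation_cst].
  rewrite big_cons (_ : (fun t => _) = (fun t => (sigma i * Z i t) ^+ 2 + \sum_(i <- r) (sigma i * Z i t) ^+ 2)).
    by split; [exact: integrable_RD|rewrite RintegralD// Isq ih2].
  by apply/funext => t; rewrite big_cons.
have [i1 h1] := hs (index_enum _).
rewrite -Rexpectation_indic//.
have iA := bounded_mfun_integrable P (bounded_mfun_indic R mA).
have i2 := integrable_RZ (L ^- 2) i1.
apply: (@le_trans _ _ (\int[P]_t (L ^- 2 * \sum_i (sigma i * Z i t) ^+ 2))).
  apply: le_Rintegral => // t _.
  rewrite indicE; have [h|h] := boolP (t \in A); last first.
    by rewrite mulr_ge0 ?invr_ge0 ?sqr_ge0//; apply: sumr_ge0 => i _; exact: sqr_ge0.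
  have [i hi] := set_mem h.
  rewrite mulrC ler_pdivlMr ?exprn_gt0// mul1r (bigD1 i)//= -[leLHS]addr0 lerD//.
    by rewrite -[leRHS]real_normK ?num_real// lerXn2r// ?nnegrE// ltW.
  by apply: sumr_ge0 => j _; exact: sqr_ge0.
rewrite (RintegralZl _ measurableT i1) h1 -/v mulrC ler_pdivrMr ?exprn_gt0//.
have h2 : v <= e * L by rewrite /L mulrDr mulr1 mulrC divfK ?gt_eqF// lerDr ltW.
by apply: (le_trans h2); rewrite ler_wpM2l ?(ltW e0)// expr2 ler_peMr// ltW.
Qed.

End GaussianFamily.

(** * Complex vectors in real coordinates *)

Section Coordinates.
Context (R : realType) (s : nat).
Local Notation N := (@Normc.normc R).

(** Real parts first, then imaginary parts, so that a complex vector becomes a real one to which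
    [levy_cvg] applies. *)
Definition coords (z : 'I_s -> R[i]) (i : 'I_(s + s)) : R :=
  row_mx (\row_l complex.Re (z l)) (\row_l complex.Im (z l)) ord0 i.

Definition uncoords (v : 'rV[R]_(s + s)) : 'rV[R[i]]_s :=
  \row_l (v ord0 (lshift s l) +i* v ord0 (rshift s l)).

Lemma coords_lshift z l : coords z (lshift s l) = complex.Re (z l).
Proof. by rewrite /coords row_mxEl mxE. Qed.

Lemma coords_rshift z l : coords z (rshift s l) = complex.Im (z l).
Proof. by rewrite /coords row_mxEr mxE. Qed.

Lemma coordsK z : uncoords (\row_i coords z i) = \row_l z l.
Proof.
apply/rowP => l; rewrite !mxE coords_lshift coords_rshift.
by case: (z l).
Qed.

Lemma lin_coords c z : lin c (coords z) =
  \sum_l (c (lshift s l) * complex.Re (z l) + c (rshift s l) * complex.Im (z l)).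
Proof.
rewrite /lin big_split_ord/= big_split/=.
by congr (_ + _); apply: eq_bigr => l _; rewrite ?coords_lshift ?coords_rshift.
Qed.

Lemma coords_le z i : exists l, `|coords z i| <= N (z l).
Proof.
rewrite /coords -(splitK i); case: (fintype.split i) => l /=; exists l; rewrite ?row_mxEl ?row_mxEr mxE.
  exact: Re_le_normc.
exact: Im_le_normc.
Qed.

Lemma continuous_uncoords : continuous uncoords.
Proof.
move=> v; apply: (iffRL (cvg_ballP (F := nbhs v) uncoords (uncoords v))) => eps eps0.
(* The radius is a positive element of the complex field, hence real. *)
have epsE : eps = (complex.Re eps)%:C.
  by move: eps0; case: (eps) => a b; rewrite ltcE/= => /andP[/eqP -> _].
have e0 : 0 < complex.Re eps by move: eps0; rewrite [in X in X -> _]epsE ltcR.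
rewrite epsE; near=> u.
have h : ball v (complex.Re eps / 2) u by near: u; apply: nbhsx_ballx; rewrite divr_gt0.
split; first by rewrite ltcR.
move=> i l; rewrite !mxE ballCE.
apply: (le_lt_trans (normc_le_ReIm _)); rewrite /= .
have := h.2 ord0 (lshift s l); have := h.2 ord0 (rshift s l); rewrite /ball/= => h1 h2.
by rewrite (splitr (complex.Re eps)) ltrD.
Unshelve. all: by end_near. Qed.

End Coordinates.

Section Lipschitz.
Context (R : realType).

Lemma cos_lipschitz (x y : R) : `|cos x - cos y| <= `|x - y|.
Proof.
pose u := (x + y) / 2; pose v := (x - y) / 2.
have xE : x = u + v by rewrite /u /v; field.
have yE : y = u - v by rewrite /u /v; field.
have -> : cos x - cos y = - (2 * (sin u * sin v)) by rewrite xE yE cosD cosB; ring.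
rewrite normrN 2!normrM (ger0_norm (ler0n R 2)).
have s1 : `|sin u| <= 1 by rewrite ler_norml sin_geN1 sin_le1.
have -> : x - y = 2 * v by rewrite /v; field.
rewrite normrM (ger0_norm (ler0n R 2)) ler_wpM2l//.
by rewrite -[leRHS]mul1r; apply: ler_pM => //; exact: abs_sin_le.
Qed.

Lemma sin_lipschitz (x y : R) : `|sin x - sin y| <= `|x - y|.
Proof.
pose u := (x + y) / 2; pose v := (x - y) / 2.
have xE : x = u + v by rewrite /u /v; field.
have yE : y = u - v by rewrite /u /v; field.
have -> : sin x - sin y = 2 * (cos u * sin v) by rewrite xE yE sinD sinB; ring.
rewrite 2!normrM (ger0_norm (ler0n R 2)).
have s1 : `|cos u| <= 1 by rewrite ler_norml cos_geN1 cos_le1.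
have -> : x - y = 2 * v by rewrite /v; field.
rewrite normrM (ger0_norm (ler0n R 2)) ler_wpM2l//.
by rewrite -[leRHS]mul1r; apply: ler_pM => //; exact: abs_sin_le.
Qed.

End Lipschitz.

(** * From the linear statistic to the critical points *)

Section FluctuationLimit.
Context (R : realType) (mu : probability R[i] R) (f : R[i] -> R) (s : nat) (xi : 'I_s -> R[i]).
Local Notation N := (@Normc.normc R).
Hypothesis hd : forall l, bounded_density_near mu f (xi l).
Hypothesis cf : forall l, {for xi l, continuous f}.
Variable K : R.
Hypothesis uK : uniform_constant mu xi K.
Context (d : measure_display) (T : measurableType d) (P : probability T R).
Variable X : nat -> {RV P >-> R[i]}.
Hypothesis iidX : iid X mu.
Variable n0 : nat.
Hypothesis n0P : forall n, (n0 <= n)%N -> large_scale s K n.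
Variable w : nat -> 'I_s -> {RV P >-> R[i]}.
Hypothesis hw : forall n l t, good_event mu xi X n0 n t -> crit_properties mu xi K X n l t (w n l t).

Let K1 : 1 <= K. Proof. exact: (uniform_ge1 uK). Qed.
Let K0 : 0 <= K. Proof. by apply: le_trans K1. Qed.

Definition fluct_coords n t := coords (fun l => crit_fluct mu xi n l (w n l t)).
Definition stat_coords n t := coords (fun l => lin_stat mu xi X n l t).
Let V := fluct_coords.
Let U := stat_coords.
Let E n := good_event mu xi X n0 n.

Lemma measurable_complexM_cst d1 (T1 : measurableType d1) (c : R[i]) (g : T1 -> R[i]) :
  measurable_fun setT g -> measurable_fun setT (fun t => c * g t).
Proof.
move=> /measurable_complexP[gr gi]; apply/measurable_complexP.
have ReM t : complex.Re (c * g t) = complex.Re c * complex.Re (g t) - complex.Im c * complex.Im (g t).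
  by case: c (g t) => a b [a' b'].
have ImM t : complex.Im (c * g t) = complex.Re c * complex.Im (g t) + complex.Im c * complex.Re (g t).
  by clear ReM; case: c (g t) => a b [a' b'].
split; [under eq_fun do rewrite ReM|under eq_fun do rewrite ImM].
  by apply: measurable_funB; apply: measurable_funM.
by apply: measurable_funD; apply: measurable_funM.
Qed.

Let measurable_coords (z : T -> 'I_s -> R[i]) i : (forall l, measurable_fun setT (fun t => z t l)) ->
  measurable_fun setT (fun t => coords (z t) i).
Proof.
move=> mz; rewrite -(splitK i); case: (fintype.split i) => l /=.
  under eq_fun do rewrite coords_lshift.
  by have /measurable_complexP[] := mz l.
under eq_fun do rewrite coords_rshift.
by have /measurable_complexP[] := mz l.
Qed.

Lemma measurable_fluct_coords n i : measurable_fun setT (fun t => V n t i).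
Proof.
apply: (measurable_coords (z := fun t l => crit_fluct mu xi n l (w n l t))) => l.
apply: measurable_complexM_cst; apply: measurable_complexD; last exact: measurable_cst.
by apply: measurable_complexB; [exact: measurable_funPT|exact: measurable_cst].
Qed.

Let mU n i : measurable_fun setT (fun t => U n t i).
Proof.
apply: (measurable_coords (z := fun t l => lin_stat mu xi X n l t)) => l.
rewrite /lin_stat; under eq_fun do rewrite mulrC.
apply: measurable_complexM_cst; apply: measurable_complexB; last exact: measurable_cst.
apply: measurable_complex_sum => j.
by apply: (measurableT_comp (measurable_trunc_inv _ _)); exact: measurable_funPT.
Qed.

Definition fluct_error n : R :=
  288 * K ^+ 5 * (nlog R n ^+ 4 / rootn R n) + 5 * K ^+ 2 / rootlog R n.

Let err0 n : 0 <= fluct_error n.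
Proof.
have L4 : 0 <= nlog R n ^+ 4 by rewrite (exprM _ 2 2) sqr_ge0.
have a0 : 0 <= 288 * K ^+ 5 by exact: (mulr_ge0 (ler0n R 288) (exprn_ge0 _ K0)).
have b0 : 0 <= 5 * K ^+ 2 by rewrite mulr_ge0// exprn_ge0.
exact: (addr_ge0 (mulr_ge0 a0 (divr_ge0 L4 (sqrtr_ge0 _))) (divr_ge0 b0 (sqrtr_ge0 _))).
Qed.

Lemma cvg_fluct_error : fluct_error n @[n --> \oo] --> (0 : R).
Proof.
have h : nlog R n ^+ 4 / rootn R n @[n --> \oo] --> (0 : R).
  apply/cvgrPdist_le => del d0; near=> n.
  have [h1 h2 h3 h4 h5] : [/\ 1 <= rootlog R n, (rootlog R n)^-1 <= del, nlog R n ^+ 4 <= del * rootn R n,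
      nlog R n ^+ 4 <= rootn R n & (0 < n)%N] by near: n; exact: near_scales.
  have q0 := rootn_gt0 h1 h4.
  rewrite sub0r normrN ger0_norm ?ler_pdivrMr// divr_ge0 ?(ltW q0)//.
  by rewrite (exprM _ 2 2) sqr_ge0.
rewrite -[X in _ --> X]addr0; apply: cvgD.
  rewrite -[X in _ --> X](mulr0 (288 * K ^+ 5)); apply: cvgM => //; exact: cvg_cst.
rewrite -[X in _ --> X](mulr0 (5 * K ^+ 2)); apply: cvgM; [exact: cvg_cst|exact: cvg_rootlogV].
Unshelve. all: by end_near. Qed.

Let coords_dist n t i : E n t -> `|V n t i - U n t i| <= fluct_error n.
Proof.
move=> ht; pose z l := crit_fluct mu xi n l (w n l t) - lin_stat mu xi X n l t.
have -> : V n t i - U n t i = coords z i.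
  rewrite /V /U /fluct_coords /stat_coords -(splitK i); case: (fintype.split i) => l /=.
    by rewrite !coords_lshift ReB.
  by rewrite !coords_rshift ImB.
have [l hl] := coords_le z i; apply: (le_trans hl).
by have [_ _ _] := hw l ht.
Qed.

Let mE n : measurable (E n). Proof. exact: (measurable_good_event mu xi X n0P). Qed.

Let prob_compl n : 1 - fine (P (E n)) = fine (P (~` E n)).
Proof.
by rewrite probability_setC// fineB ?fin_num_measure.
Qed.

Let cvg_prob_compl : fine (P (~` E n)) @[n --> \oo] --> (0 : R).
Proof.
have h := fine_cvg (good_event_cvg uK iidX n0P).
rewrite (_ : (fun n => _) = (fun n => 1 - fine (P (E n)))); last by apply/funext => n; rewrite prob_compl.
rewrite -(subrr (1 : R)); apply: cvgB; [exact: cvg_cst|exact: h].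
Qed.

(** On the good event the linear forms differ by at most the sum of the |c i| times the error; off
    it, the values of [F] differ by at most 2. Cosine and sine are the two uses. *)
Let transfer (F : R -> R) (c : 'I_(s + s) -> R) n : (forall x y, `|F x - F y| <= `|x - y|) ->
  (forall x, `|F x| <= 1) -> measurable_fun setT F ->
  `|\int[P]_t F (lin c (V n t)) - \int[P]_t F (lin c (U n t))| <=
  (\sum_i `|c i|) * fluct_error n + 2 * fine (P (~` E n)).
Proof.
move=> Flip F1 mF.
have mEc : measurable (~` E n) by exact: measurableC.
have bV : bounded_mfun (fun t => F (lin c (V n t))).
  split; last by exists 1.
  by apply: (measurableT_comp mF); apply: measurable_lin => i; exact: measurable_fluct_coords.
have bU : bounded_mfun (fun t => F (lin c (U n t))).
  split; last by exists 1.
  by apply: (measurableT_comp mF); apply: measurable_lin.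
have b1 : bounded_mfun (\1_(~` E n) : T -> R) by exact: bounded_mfun_indic.
rewrite -RexpectationB// -Rexpectation_indic//.
rewrite -(RexpectationZ P 2 b1) -{1}(Rexpectation_cst P ((\sum_i `|c i|) * fluct_error n)).
have b0 := bounded_mfun_cst T ((\sum_i `|c i|) * fluct_error n).
rewrite -RexpectationD//; last exact: bounded_mfunZ.
apply: normr_Rexpectation_le.
- exact: bounded_mfunB.
- by apply: bounded_mfunD => //; exact: bounded_mfunZ.
move=> t; rewrite indicE; have c0 : 0 <= (\sum_i `|c i|) * fluct_error n by apply: mulr_ge0 => //; exact: sumr_ge0.
have [h|h] := boolP (t \in ~` E n); last first.
  rewrite mulr0 addr0; apply: (le_trans (Flip _ _)).
  have ht : E n t by apply: contrapT => ht; move/negP: h; apply; rewrite inE.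
  rewrite /lin -sumrB mulr_suml (le_trans (ler_norm_sum _ _ _))//; apply: ler_sum => i _.
  by rewrite -mulrBr normrM ler_wpM2l// coords_dist.
rewrite mulr1 (le_trans (ler_normB _ _))//.
have := F1 (lin c (V n t)); have := F1 (lin c (U n t)); lra.
Qed.

Let lin_statE (c : 'I_(s + s) -> R) n t : 1 <= rootlog R n -> nlog R n ^+ 4 <= rootn R n ->
  lin c (U n t) = (rootn R n * rootlog R n)^-1 *
    iid_sum X (centered_lin mu xi (fun l => c (lshift s l)) (fun l => c (rshift s l)) (trunc_level R n)) (n.+1 - s) t.
Proof.
move=> h1 h2; rewrite -lin_trunc_fluct// lin_coords mulr_sumr; apply: eq_bigr => l _.
rewrite /lin_stat; set x := (_ * _)^-1; case: trunc_fluct => u v /=.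
rewrite !mulr0 subr0 add0r; ring.
Qed.

Definition limit_variance_coords (c : 'I_(s + s) -> R) : R :=
  limit_variance f xi (fun l => c (lshift s l)) (fun l => c (rshift s l)).

(** Slutsky's argument: the central limit theorem gives the limits for the linear statistic [U], and
    [transfer] passes them on to [V]. *)
Lemma cvg_trig_fluct_coords (c : 'I_(s + s) -> R) :
  \int[P]_t cos (lin c (V n t)) @[n --> \oo] --> expR (- (limit_variance_coords c / 2)) /\
  \int[P]_t sin (lin c (V n t)) @[n --> \oo] --> (0 : R).
Proof.
have [cc cs] := cvg_char_centered_lin hd cf K1 (uniform_moments uK) (uniform_separation uK)
  (fun l => c (lshift s l)) (fun l => c (rshift s l)) iidX.
have cerr : (\sum_i `|c i|) * fluct_error n + 2 * fine (P (~` E n)) @[n --> \oo] --> (0 : R).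
  rewrite [X in _ --> X](_ : 0 = (\sum_i `|c i|) * 0 + 2 * 0); last by rewrite !mulr0 addr0.
  by apply: cvgD; apply: cvgM; [exact: cvg_cst|exact: cvg_fluct_error|exact: cvg_cst|exact: cvg_prob_compl].
have gen (F : R -> R) (l : R) : (forall x y, `|F x - F y| <= `|x - y|) ->
    (forall x, `|F x| <= 1) -> measurable_fun setT F ->
    \int[P]_t F ((rootn R n * rootlog R n)^-1 *
    iid_sum X (centered_lin mu xi (fun l => c (lshift s l)) (fun l => c (rshift s l)) (trunc_level R n)) (n.+1 - s) t)
      @[n --> \oo] --> l ->
    \int[P]_t F (lin c (V n t)) @[n --> \oo] --> l.
  move=> Flip F1 mF hF.
  have hU : \int[P]_t F (lin c (U n t)) @[n --> \oo] --> l.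
    apply: cvg_trans hF; apply: near_eq_cvg; near=> n.
    have [h1 _ _ h3 _] : [/\ 1 <= rootlog R n, (rootlog R n)^-1 <= 1,
      nlog R n ^+ 4 <= 1 * rootn R n, nlog R n ^+ 4 <= rootn R n & (0 < n)%N].
      by near: n; exact: near_scales.
    by apply: eq_Rintegral => t _; rewrite lin_statE.
  have hD : \int[P]_t F (lin c (V n t)) - \int[P]_t F (lin c (U n t)) @[n --> \oo] --> (0 : R).
    apply: (@squeeze_cvgr _ _ _ _ (fun n => - ((\sum_i `|c i|) * fluct_error n + 2 * fine (P (~` E n))))
      (fun n => (\sum_i `|c i|) * fluct_error n + 2 * fine (P (~` E n)))) => //.
      by apply: nearW => n; rewrite -ler_norml; exact: transfer.
    by have h := cvgN cerr; rewrite (@oppr0 R) in h; exact: h.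
  have -> : (fun n => \int[P]_t F (lin c (V n t))) = (fun n =>
      (\int[P]_t F (lin c (V n t)) - \int[P]_t F (lin c (U n t))) + \int[P]_t F (lin c (U n t))).
    by apply/funext => n; rewrite subrK.
  by rewrite -[X in _ --> X]add0r; exact: cvgD.
split; apply: gen.
- exact: cos_lipschitz.
- by move=> x; rewrite ler_norml cos_geN1 cos_le1.
- by apply: continuous_measurable_fun; exact: continuous_cos.
- exact: cc.
- exact: sin_lipschitz.
- by move=> x; rewrite ler_norml sin_geN1 sin_le1.
- by apply: continuous_measurable_fun; exact: continuous_sin.
- exact: cs.
Unshelve. all: by end_near. Qed.

(** On the good event [V] is eventually within 1 of [U], which accounts for the 1 added to [B], and
    the second moment of [U] is bounded uniformly in n. *)
Lemma fluct_coords_tight (e : R) : 0 < e -> exists2 L : R, 0 < L &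
  \forall n \near \oo, fine (P [set t | exists i, L < `|V n t i|]) <= e.
Proof.
(* Chebyshev's bound 4 s K / B^2 is at most e / 2 for this [B]; the other half of [e] pays for the
   complement of the good event. *)
move=> e0; pose B := 1 + 8 * s%:R * K / e.
have sK0 : 0 <= 8 * s%:R * K / e by rewrite divr_ge0 ?mulr_ge0// ltW.
have B1 : 1 <= B by rewrite /B; lra.
exists (1 + B); first by lra.
have e2 : 0 < e / 2 by rewrite divr_gt0.
have H1 : \forall n \near \oo, `|0 - fluct_error n| <= 1 by have /cvgrPdist_le := cvg_fluct_error; apply.
have H2 : \forall n \near \oo, `|0 - fine (P (~` E n))| <= e / 2 by have /cvgrPdist_le := cvg_prob_compl; apply.
near=> n.
have [h1 h2 _ h3 _] : [/\ 1 <= rootlog R n, (rootlog R n)^-1 <= K^-1,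
  nlog R n ^+ 4 <= K^-1 * rootn R n, nlog R n ^+ 4 <= rootn R n & (0 < n)%N].
  by near: n; apply: near_scales; rewrite invr_gt0 (lt_le_trans ltr01 K1).
have nn : (n0 <= n)%N by near: n; exact: nbhs_infty_ge.
have err1 : fluct_error n <= 1.
  have : `|0 - fluct_error n| <= 1 by near: n; exact: H1.
  by rewrite sub0r normrN ger0_norm.
have hp : fine (P (~` E n)) <= e / 2.
  have : `|0 - fine (P (~` E n))| <= e / 2 by near: n; exact: H2.
  by rewrite sub0r normrN ger0_norm// fine_ge0.
have q0 := rootn_gt0 h1 h3; have lam0 : 0 < rootlog R n by apply: lt_le_trans h1.
have n1 : (0 : R) < n%:R by rewrite natrE_rootn exprn_gt0.
have Ln0 : 0 < nlog R n by rewrite (nlogE h1) exprn_gt0.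
have eK := le_trans (trunc_level_le_rootlogV h1 h3) h2.
have k2n : (n.+1 - s)%N%:R <= 2 * n%:R :> R.
  rewrite -natrM ler_nat; apply: (leq_trans (leq_subr _ _)).
  by rewrite mul2n -addnn -addn1 leq_add2l -(ltr0n R).
set x := (rootn R n * rootlog R n)^-1.
have x0 : 0 <= x by rewrite invr_ge0 mulr_ge0// ltW.
pose S t := \sum_l N (trunc_fluct mu xi X n l t) ^+ 2.
have bl l := bounded_mfun_trunc_fluct_sqr mu xi X h1 h3 l.
have bS : bounded_mfun S by exact: bounded_mfun_sum.
have ES : \int[P]_t S t <= s%:R * (2 * n%:R * (2 * K * nlog R n)).
  rewrite /S Rexpectation_sum//.
  have -> : s%:R * (2 * n%:R * (2 * K * nlog R n)) = \sum_(l < s) (2 * n%:R * (2 * K * nlog R n)).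
    by rewrite sumr_const card_ord mulr_natl.
  apply: ler_sum => l _; apply: (trunc_fluct_second_moment iidX h1 h3 K1 _ eK k2n).
  exact: (uniform_moments uK).
have mEc : measurable (~` E n) by exact: measurableC.
set A := [set t | _].
have mA : measurable A.
  rewrite (_ : A = \bigcup_(i in [set: 'I_(s + s)]) [set t | 1 + B < `|V n t i|]).
    apply: fin_bigcup_measurable => // i _.
    have mf : measurable_fun setT (fun t => `|V n t i|).
      by apply: measurableT_comp => //; exact: measurable_fluct_coords.
    have /(_ measurableT) hh := measurable_fun_ltr (@measurable_cst _ _ T _ setT (1 + B)) mf.
    by rewrite -[X in measurable X]setTI; apply: (hh [set true]).
  by apply/seteqP; split => t /=; [move=> [i hi]; exists i|move=> [i _ hi]; exists i].
have b1 : bounded_mfun (\1_(~` E n) : T -> R) by exact: bounded_mfun_indic.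
have b2 : bounded_mfun (fun t => x ^+ 2 / B ^+ 2 * S t) by exact: bounded_mfunZ.
rewrite -Rexpectation_indic//.
apply: (@le_trans _ _ (\int[P]_t (\1_(~` E n) t + x ^+ 2 / B ^+ 2 * S t))).
  apply: le_Rexpectation.
  - exact: bounded_mfun_indic.
  - exact: bounded_mfunD.
  move=> t; have S0 : 0 <= S t by apply: sumr_ge0 => l _; exact: sqr_ge0.
  have c0 : 0 <= x ^+ 2 / B ^+ 2 by rewrite divr_ge0 ?sqr_ge0.
  rewrite !indicE; have [hA|hA] := boolP (t \in A); last by rewrite addr_ge0// ?ler0n// mulr_ge0.
  have [hE|hE] := boolP (t \in ~` E n); first by rewrite lerDl mulr_ge0.
  have ht : E n t by apply: contrapT => ht; move/negP: hE; apply; rewrite inE.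
  rewrite add0r; have [i hi] := set_mem hA.
  have hU : B < `|U n t i|.
    have := coords_dist i ht; have := ler_normB (V n t i - U n t i) (- U n t i).
    by rewrite opprK subrK normrN; lra.
  have [l hl] := coords_le (fun l => lin_stat mu xi X n l t) i.
  have hN : B <= x * N (trunc_fluct mu xi X n l t).
    apply: ltW; apply: (lt_le_trans hU); apply: (le_trans hl).
    by rewrite /lin_stat Normc.normcM normcR ger0_norm// mulrC.
  have B0 : 0 < B by lra.
  have hl2 : N (trunc_fluct mu xi X n l t) ^+ 2 <= S t.
    by rewrite /S (bigD1 l)//= lerDl; apply: sumr_ge0 => j _; exact: sqr_ge0.
  rewrite mulrAC ler_pdivlMr ?exprn_gt0// mul1r.
  apply: (@le_trans _ _ ((x * N (trunc_fluct mu xi X n l t)) ^+ 2)).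
    by rewrite lerXn2r// nnegrE ?(ltW B0)// mulr_ge0// normc_ge0.
  by rewrite exprMn ler_wpM2l ?sqr_ge0.
rewrite RexpectationD// Rexpectation_indic// RexpectationZ// (splitr e) lerD//.
have B0 : 0 < B by lra.
apply: (@le_trans _ _ (x ^+ 2 / B ^+ 2 * (s%:R * (2 * n%:R * (2 * K * nlog R n))))).
  by rewrite ler_wpM2l// divr_ge0 ?sqr_ge0.
have -> : x ^+ 2 / B ^+ 2 * (s%:R * (2 * n%:R * (2 * K * nlog R n))) = 4 * s%:R * K / B ^+ 2.
  rewrite /x (natrE_rootn R n) (nlogE h1).
  have : rootn R n != 0 by rewrite gt_eqF.
  have : rootlog R n != 0 by rewrite gt_eqF.
  have : B != 0 by rewrite gt_eqF.
  generalize (rootn R n) (rootlog R n) B (s%:R : R) => q lam b s' hb hl hq.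
  by field; rewrite hb hl hq.
rewrite ler_pdivrMr ?exprn_gt0//.
have hB : 4 * s%:R * K <= e / 2 * B.
  rewrite /B mulrDr mulr1 (_ : e / 2 * (8 * s%:R * K / e) = 4 * s%:R * K); last by field; rewrite gt_eqF.
  by rewrite lerDr ltW.
by apply: (le_trans hB); rewrite ler_wpM2l ?(ltW e2)// expr2 ler_peMr// ltW.
Unshelve. all: by end_near. Qed.

End FluctuationLimit.

(** * The limiting complex normal vector *)

Section LimitVector.
Context (R : realType) (s : nat) (v : 'I_s -> R).
Hypothesis v0 : forall l, 0 <= v l.
Context (d : measure_display) (T : measurableType d) (P : probability T R) (Z : 'I_(s + s) -> T -> R).
Hypothesis mZ : forall i, measurable_fun setT (Z i).
Hypothesis hZ : forall c : 'I_(s + s) -> R,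
  std_law P (fun t => \sum_i c i * Z i t) (\sum_i c i ^+ 2).

Definition scales (i : 'I_(s + s)) : R := coords (fun l => Num.sqrt (v l) +i* Num.sqrt (v l)) i.

Definition gaussian_complex (l : 'I_s) (t : T) : R[i] :=
  (Num.sqrt (v l) * Z (lshift s l) t) +i* (Num.sqrt (v l) * Z (rshift s l) t).

Lemma measurable_gaussian_complex l : measurable_fun setT (gaussian_complex l).
Proof. by apply/measurable_complexP; split; apply: measurable_funM. Qed.

Lemma coords_gaussian_complex t : coords (gaussian_complex ^~ t) = fun i => scales i * Z i t.
Proof.
apply/funext => i; rewrite /scales -(splitK i); case: (fintype.split i) => l /=.
  by rewrite !coords_lshift.
by rewrite !coords_rshift.
Qed.

Definition lin_gaussian_coef (c : 'I_s * bool -> R) (i : 'I_(s + s)) : R :=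
  coords (fun l => c (l, false) * Num.sqrt (v l) +i* (c (l, true) * Num.sqrt (v l))) i.

Lemma lin_gaussian_complex c t :
  \sum_k c k * real_coordinates gaussian_complex k t = \sum_i lin_gaussian_coef c i * Z i t.
Proof.
have -> : \sum_k c k * real_coordinates gaussian_complex k t =
    \sum_(k : 'I_s * bool) c (k.1, k.2) * real_coordinates gaussian_complex (k.1, k.2) t.
  by apply: eq_bigr => -[].
rewrite big_split_ord/= -(pair_bigA _ (fun l b => c (l, b) * real_coordinates gaussian_complex (l, b) t))/=.
rewrite -big_split/=; apply: eq_bigr => l _.
rewrite big_bool/= /lin_gaussian_coef coords_lshift coords_rshift /real_coordinates /= !mulrA addrC.
by [].
Qed.

Lemma lin_gaussian_coefM c c' : \sum_i lin_gaussian_coef c i * lin_gaussian_coef c' i =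
  \sum_l (c (l, false) * c' (l, false) + c (l, true) * c' (l, true)) * v l.
Proof.
rewrite big_split_ord/= -big_split/=; apply: eq_bigr => l _.
rewrite /lin_gaussian_coef !coords_lshift !coords_rshift /=.
rewrite -[in RHS](sqr_sqrtr (v0 l)); ring.
Qed.

Lemma gaussian_vector_complex : gaussian_vector P (real_coordinates gaussian_complex).
Proof.
move=> c; rewrite (_ : (fun t => _) = (fun t => \sum_i lin_gaussian_coef c i * Z i t)).
  exact: gaussian_variable_lin.
by apply/funext => t; exact: lin_gaussian_complex.
Qed.

Let del (k : 'I_s * bool) k' : R := (k' == k)%:R.

Let real_coordinatesE k : real_coordinates gaussian_complex k =
  fun t => \sum_i lin_gaussian_coef (del k) i * Z i t.
Proof.
apply/funext => t; rewrite -lin_gaussian_complex (bigD1 k)//= /del eqxx mul1r big1 ?addr0//.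
by move=> k' /negbTE ->; rewrite mul0r.
Qed.

Lemma expectation_gaussian_complex k : ('E_P[real_coordinates gaussian_complex k] = 0)%E.
Proof. by rewrite real_coordinatesE; exact: expectation_gaussian_lin. Qed.

Lemma covariance_gaussian_complex j b l b' :
  covariance P (real_coordinates gaussian_complex (j, b)) (real_coordinates gaussian_complex (l, b')) =
  (if (l == j) && (b == b') then v j else 0)%:E.
Proof.
rewrite !real_coordinatesE covariance_gaussian_lin// lin_gaussian_coefM; congr (_%:E).
rewrite (bigD1 j)//= big1 ?addr0 => [|k /negbTE kj]; last first.
  by rewrite /del !xpair_eqE kj/= !mul0r addr0 mul0r.
rewrite /del !xpair_eqE eqxx/= [j == l]eq_sym.
by case: (l == j); case: b b' => -[]; rewrite /= ?(mulr0, mul0r, addr0, add0r, mul1r).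
Qed.

Lemma char_gaussian_complex (c : 'I_(s + s) -> R) :
  \int[P]_t cos (lin c (coords (gaussian_complex ^~ t))) =
    expR (- ((\sum_l (c (lshift s l) ^+ 2 + c (rshift s l) ^+ 2) * v l) / 2)) /\
  \int[P]_t sin (lin c (coords (gaussian_complex ^~ t))) = 0.
Proof.
pose c' i := c i * scales i.
have cE : (\sum_l (c (lshift s l) ^+ 2 + c (rshift s l) ^+ 2) * v l) = \sum_i c' i ^+ 2.
  rewrite [RHS]big_split_ord/= -big_split/=; apply: eq_bigr => l _.
  rewrite /c' /scales coords_lshift coords_rshift /= -[in LHS](sqr_sqrtr (v0 l)); ring.
have linE t : lin c (coords (gaussian_complex ^~ t)) = \sum_i c' i * Z i t.
  by rewrite coords_gaussian_complex /lin; apply: eq_bigr => i _; rewrite mulrA.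
have mY : measurable_fun setT (fun t => \sum_i c' i * Z i t) by exact: measurable_gaussian_lin.
have p0 : 0 <= \sum_i c' i ^+ 2 by apply: sumr_ge0 => i _; exact: sqr_ge0.
under eq_Rintegral => t _ do rewrite linE.
rewrite cE (Rintegral_gaussian_cos p0 mY)//; split=> //.
under eq_Rintegral => t _ do rewrite linE.
exact: (Rintegral_gaussian_sin mY (hZ c')).
Qed.

End LimitVector.

(** A bounded continuous function of the complex row is one of its real coordinates through
    [uncoords], to which [levy_cvg] applies. *)
Lemma cvg_in_distribution_coords (R : realType) (s : nat)
    (d : measure_display) (T : measurableType d) (P : probability T R) (V : nat -> T -> 'I_s -> R[i])
    (d' : measure_display) (T' : measurableType d') (P' : probability T' R) (W : T' -> 'I_s -> R[i]) :
  (forall n i, measurable_fun setT (fun t => coords (V n t) i)) ->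
  (forall i, measurable_fun setT (fun t => coords (W t) i)) ->
  (forall c, \int[P]_t cos (lin c (coords (V n t))) @[n --> \oo] --> \int[P']_t cos (lin c (coords (W t)))) ->
  (forall c, \int[P]_t sin (lin c (coords (V n t))) @[n --> \oo] --> \int[P']_t sin (lin c (coords (W t)))) ->
  (forall e : R, 0 < e -> exists2 L : R, 0 < L &
    \forall n \near \oo, fine (P [set t | exists i, L < `|coords (V n t) i|]) <= e) ->
  (forall e : R, 0 < e -> exists2 L : R, 0 < L &
    fine (P' [set t | exists i, L < `|coords (W t) i|]) <= e) ->
  cvg_in_distribution P (fun n t => \row_l V n t l) P' (fun t => \row_l W t l).
Proof.
move=> mV mW hc hs tV tW g cg [M gM].
pose h (y : 'rV[R]_(s + s)) := g (uncoords y).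
have ch : continuous h.
  by move=> y; apply: (continuous_comp (f := @uncoords R s)); [exact: continuous_uncoords|exact: cg].
have hM y : `|h y| <= M by exact: gM.
have VE n : (g \o (fun t => \row_l V n t l)) = (fun t => h (\row_i coords (V n t) i)).
  by apply/funext => t; rewrite /h coordsK.
have WE : (g \o (fun t => \row_l W t l)) = (fun t => h (\row_i coords (W t) i)).
  by apply/funext => t; rewrite /h coordsK.
rewrite WE (expectation_bounded_mfun _ (bounded_mfun_row_comp ch hM mW)).
rewrite (_ : (fun n => _) = (fun n => (\int[P]_t h (\row_i coords (V n t) i))%:E)); last first.
  apply/funext => n; rewrite VE.
  by rewrite (expectation_bounded_mfun _ (bounded_mfun_row_comp ch hM (mV n))).
apply: cvg_EFin; first by apply: nearW.
exact: (levy_cvg mV mW hc hs ch hM tV tW).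
Qed.

Lemma powR_three_halves (R : realType) n : (n%:R : R) `^ (3 / 2) = rootn R n ^+ 3.
Proof.
by rewrite [3 / 2]mulrC powRrM powR12_sqrt// -[X in _ `^ X]/(3%:R) powR_mulrn.
Qed.

(** The discs have radius at most 3 K / n around centres at mutual distance at least 1 / K, and n >=
    12 K^2 makes them disjoint. The s critical points are therefore distinct. *)
Lemma crit_points_injective (R : realType) (mu : probability R[i] R) (s : nat) (xi : 'I_s -> R[i])
    (K : R) n (z : 'I_s -> R[i]) : uniform_constant mu xi K -> large_scale s K n ->
  (forall l, Normc.normc (z l - xi l) <= 3 / (Normc.normc (cauchy_stieltjes mu (xi l)) * n%:R)) ->
  injective z.
Proof.
move=> uK [h1 _ h3 [_ h5]] hz l l' zz; apply/eqP; apply: contrapT => /negP ll'.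
have K1 := uniform_ge1 uK; have K0 : 0 < K by apply: lt_le_trans K1.
have q0 := rootn_gt0 h1 h5.
have n0 : (0 : R) < n%:R by rewrite natrE_rootn exprn_gt0.
have small j : Normc.normc (z j - xi j) <= 3 * K / n%:R.
  apply: (le_trans (hz j)); have mj := uniform_transform_ge uK j.
  have mj0 : 0 < Normc.normc (cauchy_stieltjes mu (xi j)) by apply: lt_le_trans mj; rewrite invr_gt0.
  rewrite invfM mulrA ler_wpM2r ?invr_ge0 ?(ltW n0)// ler_wpM2l//.
  by rewrite -[leRHS]invrK lef_pV2 ?posrE ?invr_gt0.
have far := uniform_separation uK ll'.
have tri : Normc.normc (xi l - xi l') <= 6 * K / n%:R.
  have -> : xi l - xi l' = (z l' - xi l') - (z l - xi l) by rewrite zz; ring.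
  apply: (le_trans (normc_le_add _ _)); rewrite normc_opp.
  by have := small l; have := small l'; lra.
have L1 : 1 <= nlog R n ^+ 4 by apply: exprn_ege1; exact: nlog_ge1.
have q1 : 144 * K ^+ 4 <= rootn R n.
  by apply: le_trans h3; rewrite ler_peMr// (mulr_ge0 (ler0n R 144))// exprn_ge0// ltW.
have K4 : 1 <= K ^+ 3 by exact: exprn_ege1.
have K44 : K <= K ^+ 4 by rewrite exprS ler_peMr// ltW.
have qq : 144 * K <= rootn R n by apply: le_trans q1; rewrite (ler_wpM2l (ler0n R 144)).
have big : 12 * K * K <= n%:R.
  by rewrite (natrE_rootn R n) expr2; apply: ler_pM; lra.
have : K^-1 <= 6 * K / n%:R by exact: le_trans tri.
by rewrite ler_pdivlMr// ler_pdivrMl//; nra.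
Qed.

Theorem theorem2p8 (R : realType) (mu : probability R[i] R) (s : nat)
    (xi : 'I_s -> R[i]) (f : R[i] -> R) :
  let m := cauchy_stieltjes mu in
  injective xi ->
  (forall l, ~ cauchy_stieltjes_zeros mu (xi l)) ->
  (forall l, bounded_density_near mu f (xi l)) ->
  exists C : R,
  forall (d : measure_display) (T : measurableType d) (P : probability T R)
    (X : nat -> {RV P >-> R[i]}), iid X mu ->
  exists (E : nat -> set T) (w : nat -> 'I_s -> {RV P >-> R[i]}),
  let p n t := rooted_poly xi (fun j => X j t) n in
  [/\ forall n, measurable (E n),
      P (E n) @[n --> \oo] --> 1%E,
      forall n t, E n t ->
        injective (fun l => w n l t) /\
        forall l : 'I_s,
        [/\ root (p n t)^`() (w n l t),
            `|w n l t - xi l| <= 3 / (`|m (xi l)| * n%:R),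
            forall z, root (p n t)^`() z ->
              `|z - xi l| <= 3 / (`|m (xi l)| * n%:R) -> z = w n l t
          & `|w n l t - xi l + 1 / n.+1%:R *
                (n%:R / (\sum_(j < s | j != l) 1 / (xi l - xi j) +
                         \sum_(j < n.+1 - s) 1 / (xi l - X j t)))|
            <= (C * (ln n%:R / n%:R) ^+ 2)%:C]
    & (forall l, {for xi l, continuous f}) ->
      exists (d' : measure_display) (T' : measurableType d')
        (P' : probability T' R) (N : 'I_s -> {RV P' >-> R[i]}),
      [/\ cvg_in_distribution P
            (fun n t => \row_l ((n%:R `^ (3 / 2) / Num.sqrt (ln n%:R))%:C *
               m (xi l) ^+ 2 *
               (w n l t - xi l + 1 / n.+1%:R * (1 / m (xi l)))))
            P' (fun t => \row_l N l t),
          gaussian_vector P' (real_coordinates (fun l => N l)),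
          forall l, ('E_P'[@complex.Re R \o N l] = 0)%E /\
                    ('E_P'[@complex.Im R \o N l] = 0)%E
        & forall j l : 'I_s,
          [/\ covariance P' (@complex.Re R \o N j) (@complex.Re R \o N l) =
                (if l == j then pi * f (xi j) / 2 else 0)%:E,
              covariance P' (@complex.Im R \o N j) (@complex.Im R \o N l) =
                (if l == j then pi * f (xi j) / 2 else 0)%:E
            & covariance P' (@complex.Re R \o N j) (@complex.Im R \o N l)
                = 0%E]]].
Proof.
move=> m xi_inj nz hd.
have [K uK] := uniform_constant_exists xi_inj nz hd.
have [n0 _ n0P] := near_large_scale uK.
have {}n0P n : (n0 <= n)%N -> large_scale s K n by exact: n0P.
(* The constant of [pairing_linearization], given before the probability space is introduced. *)
exists (218 * K ^+ 3) => d T P X iidX.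
have [w hw] := crit_points uK X n0P.
exists (good_event mu xi X n0), w => p; split.
- by move=> n; exact: (measurable_good_event mu xi X n0P).
- exact: (good_event_cvg uK iidX n0P).
- move=> n t ht; have n0n : (n0 <= n)%N by move: ht; rewrite /good_event; case: ifPn.
  have radE l : 3 / (`|m (xi l)| * n%:R) = (3 / (Normc.normc (m (xi l)) * n%:R))%:C.
    by rewrite normc_real_complex !rmorphM/= fmorphV rmorphM/= !rmorph_nat.
  split.
    apply: (crit_points_injective uK (n0P _ n0n)) => l.
    by have [] := hw n l t ht.
  move=> l; have [h1 [h2 h3] h4 _] := hw n l t ht; rewrite radE; split => //.
  + by rewrite normc_real_complex lecR.
  + by move=> z zr; rewrite normc_real_complex lecR; exact: h3.
  + rewrite normc_real_complex lecR; apply: le_trans h4.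
    rewrite log_deriv_all_other_roots le_eqVlt; apply/orP; left; apply/eqP.
    do 5 congr (_ _ _).
    by congr (_ + _); apply: eq_bigr => j _; rewrite div1r.
move=> cf.
pose v l := pi * f (xi l) / 2.
have v0 l : 0 <= v l.
  have [f0 _] := bounded_density_square (hd l).
  by rewrite /v divr_ge0// mulr_ge0// pi_ge0.
have [d' [T' [P' [Z [mZ hZ]]]]] := gaussian_family_exists R (s + s).
pose G := gaussian_complex v Z.
have mG l : measurable_fun setT (G l) by exact: measurable_gaussian_complex.
exists d', T', P', (fun l => RV_of P' (mG l)); split.
- rewrite (_ : (fun n t => _) = (fun n t => \row_l crit_fluct mu xi n l (w n l t))); last first.
    by apply/funext => n; apply/funext => t; apply/rowP => l; rewrite !mxE powR_three_halves.
  apply: cvg_in_distribution_coords.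
  + by move=> n i; exact: (measurable_fluct_coords mu xi w n i).
  + move=> i; rewrite (_ : (fun t => _) = (fun t => scales v i * Z i t)).
      exact: measurable_funM.
    by apply/funext => t; rewrite coords_gaussian_complex.
  + move=> c; have [-> _] := char_gaussian_complex v0 mZ hZ c.
    exact: (cvg_trig_fluct_coords hd cf uK iidX n0P hw c).1.
  + move=> c; have [_ ->] := char_gaussian_complex v0 mZ hZ c.
    exact: (cvg_trig_fluct_coords hd cf uK iidX n0P hw c).2.
  + exact: (fluct_coords_tight uK iidX n0P hw).
  + move=> e e0; have [L L0 hL] := gaussian_lin_tight mZ hZ (scales v) e0.
    exists L => //; rewrite (_ : [set t | _] = [set t | exists i, L < `|scales v i * Z i t|])//.
    by apply/funext => t /=; rewrite coords_gaussian_complex.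
- exact: gaussian_vector_complex.
- by move=> l; split; [exact: (expectation_gaussian_complex v mZ hZ (l, false))|
    exact: (expectation_gaussian_complex v mZ hZ (l, true))].
- move=> j l; split.
  + by have := covariance_gaussian_complex v0 mZ hZ j false l false; rewrite andbT.
  + by have := covariance_gaussian_complex v0 mZ hZ j true l true; rewrite andbT.
  + by have := covariance_gaussian_complex v0 mZ hZ j false l true; rewrite andbF.
Qed.
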